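(* There exists a numerical constant $C>0$ such that for all $h\in(0,1/2]$ and $\delta\in[0,1]$ $$\frac1C\left(h^2+\delta^{3/2}h^{3/2}\right)\le\min_{\mathcal{A}_\delta}E_h\le C\left(h^2+\delta^{3/2}h^{3/2}\right).$$
   Context: $B_1=\{x\in\mathbb{R}^2:|x|<1\}$ and $\hat x=x/|x|$. To a pair of functions $u,w$ on $[0,1]$ associate $U(x)=\frac12u(|x|)\hat x$ and $W(x)=w(|x|)$ on $B_1$. For $\delta\in[0,1]$, $$\mathcal{A}_\delta=\{(u,w):(U,W)\in W^{1,2}(B_1;\mathbb{R}^2)\times W^{2,2}(B_1),\ w(0)=0,\ w(1)=1-\delta\}.$$ For $h>0$ the energy $E_h:\mathcal{A}_\delta\to\mathbb{R}$ is $$E_h(u,w)=\int_0^1\frac{u^2}{r}+r\left(u'+w'^2-4r^2\right)^2+h^2\left(rw''^2+\frac{w'^2}{r}\right)dr.$$ *)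

(* Defs.v *)
From HB Require Import structures.
From mathcomp Require Import all_boot all_order all_algebra.
From mathcomp Require Import all_classical all_reals all_analysis.
Set Implicit Arguments.
Unset Strict Implicit.
Unset Printing Implicit Defensive.
Import Order.TTheory GRing.Theory Num.Theory.
Import numFieldNormedType.Exports.
Local Open Scope classical_set_scope.
Local Open Scope ring_scope.

Section TestFunctions.
Context {R : realType} {V : normedModType R}.

(* In finite dimension, existence and continuity of all iterated directional
   derivatives of order at most k is the usual class C^k. *)
Fixpoint Ck (k : nat) (f : V -> R^o) : Prop :=
  continuous f /\
  match k with
  | 0%N => True
  | k'.+1 => forall v : V, (forall x, derivable f x v) /\ Ck k' ('D_v f)
  end.

Definition test_function (D : set V) (phi : V -> R^o) : Prop :=
  (forall k, Ck k phi) /\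
  exists K : set V,
    [/\ compact K, K `<=` D & forall x, ~ K x -> phi x = 0].

End TestFunctions.

Section Plane.
Context {R : realType}.

(* The library norm on R * R is the sup norm, hence the explicit Euclidean
   norm; it induces the same topology. *)
Definition enorm (x : R * R) : R := Num.sqrt (x.1 ^+ 2 + x.2 ^+ 2).

Definition B1 : set (R * R) := [set x | enorm x < 1].

Definition lebesgue2 :
    {measure set (measurableTypeR R * measurableTypeR R)%type -> \bar R} :=
  (@lebesgue_measure R \x @lebesgue_measure R)%E.

Definition is_weak_partial (D : set (R * R)) (v : R * R) (f g : R * R -> R) :
    Prop :=
  forall phi : R * R -> R, test_function D phi ->
    (\int[lebesgue2]_(x in D) (f x * 'D_v (phi : R * R -> R^o) x) =
     - \int[lebesgue2]_(x in D) (g x * phi x))%R.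

(* W^{k,2}(D); functions are representatives of their a.e. classes. *)
Fixpoint sobolev2 (k : nat) (D : set (R * R)) (f : R * R -> R) : Prop :=
  f \_ D \in Lfun lebesgue2 2%:E /\
  match k with
  | 0%N => True
  | k'.+1 =>
      (exists g1, is_weak_partial D (1, 0) f g1 /\ sobolev2 k' D g1) /\
      (exists g2, is_weak_partial D (0, 1) f g2 /\ sobolev2 k' D g2)
  end.

End Plane.

Section Energy.
Context {R : realType}.

(* Functions on [0, 1] are total functions whose values outside [0, 1] are
   never used. *)

Definition radial_vector (u : R -> R) (x : R * R) : R * R :=
  (2^-1 * u (enorm x) * (x.1 / enorm x), 2^-1 * u (enorm x) * (x.2 / enorm x)).

Definition radial_scalar (w : R -> R) (x : R * R) : R := w (enorm x).

(* W^{2,2}(B_1) embeds into the continuous functions on the closed disc; the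
   boundary values w(0), w(1) are those of the continuous representative, so w
   is required to be that representative. *)
Definition admissible (delta : R) (uw : (R -> R) * (R -> R)) : Prop :=
  [/\ sobolev2 1 B1 (fst \o radial_vector uw.1),
      sobolev2 1 B1 (snd \o radial_vector uw.1),
      sobolev2 2 B1 (radial_scalar uw.2),
      {within `[0, 1], continuous uw.2}
    & uw.2 0 = 0 /\ uw.2 1 = 1 - delta].

Definition is_weak_deriv (f g : R -> R) : Prop :=
  [/\ locally_integrable `]0, 1[ f, locally_integrable `]0, 1[ g
    & forall phi : R -> R, test_function (`]0, 1[ : set R^o) (phi : R^o -> R^o) ->
      (\int[lebesgue_measure]_(r in `]0%R, 1%R[) (f r * derive1 (phi : R -> R^o) r) =
       - \int[lebesgue_measure]_(r in `]0%R, 1%R[) (g r * phi r))%R].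

(* A weak derivative is unique almost everywhere, so integrals do not depend on
   the one chosen; the default value 0 is only met by functions that have no
   weak derivative on (0, 1). *)
Definition weak_deriv (f : R -> R) : R -> R :=
  xget (fun=> 0) [set g | is_weak_deriv f g].

(* The integrand is nonnegative; the integral is taken in the extended reals
   so that a divergent integral is +oo. *)
Definition energy (h : R) (uw : (R -> R) * (R -> R)) : \bar R :=
  let u := uw.1 in
  let u' := weak_deriv u in
  let w' := weak_deriv uw.2 in
  let w'' := weak_deriv w' in
  (\int[lebesgue_measure]_(r in `]0%R, 1%R[)
     (u r ^+ 2 / r + r * (u' r + w' r ^+ 2 - 4 * r ^+ 2) ^+ 2 +
      h ^+ 2 * (r * w'' r ^+ 2 + w' r ^+ 2 / r))%:E)%E.

Definition is_min_value (h delta m : R) : Prop :=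
  (exists2 uw, admissible delta uw & energy h uw = m%:E) /\
  (forall uw, admissible delta uw -> (m%:E <= energy h uw)%E).

End Energy.

(* Main.v *)
Require Import Defs.
From HB Require Import structures.
From mathcomp Require Import all_boot all_order all_algebra.
From mathcomp Require Import all_classical all_reals all_analysis.
From mathcomp Require Import measurable_realfun ring lra.
Set Implicit Arguments.
Unset Strict Implicit.
Unset Printing Implicit Defensive.
Import Order.TTheory GRing.Theory Num.Theory.
Import numFieldNormedType.Exports.
Local Open Scope classical_set_scope.
Local Open Scope ring_scope.

(* In the radial variables put v = w' and z = u' + v^2 - 4 r^2.

   Lower bound.  If E_h is small, v^2 stays close to 4 r^2 away from the origin, so
   v is close to 2r or to -2r there.  As 2r has integral 1 while v has integral
   1 - delta, v must vanish at some radius r0 of order at least delta^(1/2), and a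
   zero at r0 costs r0^3 h^(3/2): bending keeps v^2 well below 4 r^2 on an interval of
   length h^(1/2) below r0, which is detected by pairing z with a bump.  The term h^2
   is the cost of the origin.  The competitor for the upper bound reverses the sign of
   v once, at a radius of order delta^(1/2).

   Minimiser.  z, v' and v are bounded in weighted L^2, so v is equicontinuous away
   from 0; the parallelogram identity in z, v', v upgrades convergence of minimising
   sequences to strong convergence, and Fatou's lemma concludes.

   Cartesian side.  On almost every horizontal line a Sobolev function is absolutely
   continuous, and r = sqrt (s^2 + t^2) is a monotone change of variable on each half
   line; this transfers local absolute continuity between the profile and the planar
   function in both directions, the axis being negligible. *)

(** With k = h^(1/2) and d = delta^(1/2) the target reads k^4 + d^3 k^3, so fractional powers appear
    only in the last steps.

    The energy gives no L2 bound on u' apart from v^2, so v^2 - 4 r^2 is seen only after an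
    integration by parts. Each test function is made for one purpose: a bump removes the boundary
    values of u, a constant removes the integral of u, and 1 / (2 r + v), available where v > 0,
    turns 4 r^2 - v^2 into 2 r - v.

    The obstacle to existence is the square v^2 inside z: at the midpoint of two states, z lies
    below the mean of the two z by (v1 - v2)^2 / 4. Closeness of the v must therefore come first. It
    holds uniformly away from 0, where v is equicontinuous, and near 0 the weight r makes the error
    small for bounded v.

    The functions u', w', w'' are carried as independent functions p, v, b tied to u and w' by
    absolute continuity; weak derivatives selected by choice enter only when the planar problem is
    attached.

    In the competitor, a profile that overshoots 1 gives 1 - phi^2 mean zero, which confines u to
    the transition layer. *)

Section IntervalIntegral.
Context {R : realType}.
Notation mu := (@lebesgue_measure R).
Implicit Types (a b c x y s t : R) (f g : R -> R).

(** * Integrals over compact intervals *)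

Lemma mitv a b : measurable (`[a, b]%classic : set (measurableTypeR R)).
Proof. exact: measurable_itv. Qed.

Definition L1 a b f := mu.-integrable `[a, b] (EFin \o f).
Definition itg a b f := \int[mu]_(t in `[a, b]) f t.

Lemma L1_sub a b c d f : L1 a b f -> a <= c -> d <= b -> L1 c d f.
Proof.
move=> i ac db; apply: integrableS i => //=.
by move=> t /=; rewrite !in_itv/= => /andP[? ?]; apply/andP; split; lra.
Qed.

Lemma L1D a b f g : L1 a b f -> L1 a b g -> L1 a b (fun t => f t + g t).
Proof. by move=> fi gi; exact: (@integrableD _ _ _ mu _ (mitv a b) _ _ fi gi). Qed.

Lemma L1B a b f g : L1 a b f -> L1 a b g -> L1 a b (fun t => f t - g t).
Proof. by move=> fi gi; exact: (@integrableB _ _ _ mu _ (mitv a b) _ _ fi gi). Qed.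

Lemma L1Z a b k f : L1 a b f -> L1 a b (fun t => k * f t).
Proof. by move=> fi; exact: (@integrableZl _ _ _ mu _ (mitv a b) k _ fi). Qed.

Lemma L1_norm a b f : L1 a b f -> L1 a b (fun t => `|f t|).
Proof. by move=> fi; exact: (@integrable_norm _ _ _ mu _ f fi). Qed.

Lemma L1_cont a b f : {within `[a, b], continuous f} -> L1 a b f.
Proof.
by move=> cf; apply: continuous_compact_integrable => //; exact: segment_compact.
Qed.

Lemma L1_cst a b k : L1 a b (fun=> k).
Proof. by apply: L1_cont; apply: continuous_subspaceT => x; exact: cvg_cst. Qed.

Lemma L1_meas a b f : L1 a b f -> measurable_fun `[a, b] f.
Proof. by move/measurable_int/measurable_EFinP. Qed.

Lemma L1_le a b f g : measurable_fun `[a, b] f ->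
  (forall t, a <= t <= b -> `|f t| <= g t) -> L1 a b g -> L1 a b f.
Proof.
move=> mf fg gi; apply: le_integrable gi => //; first exact/measurable_EFinP.
move=> t; rewrite /= in_itv/= => /fg h; rewrite lee_fin (le_trans h)//.
exact: ler_norm.
Qed.

Lemma L1_eq a b f g : (forall t, a <= t <= b -> f t = g t) -> L1 a b f -> L1 a b g.
Proof.
move=> fg; apply: eq_integrable => // t; rewrite inE/= in_itv/= => /fg/= ->//.
Qed.

Lemma L1N a b f : L1 a b f -> L1 a b (fun t => - f t).
Proof. by move=> fi; apply: L1_eq (L1Z (-1) fi) => t _; rewrite mulN1r. Qed.

Lemma L1M_bounded a b f g M : measurable_fun `[a, b] f ->
  (forall t, a <= t <= b -> `|f t| <= M) -> L1 a b g -> L1 a b (fun t => f t * g t).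
Proof.
move=> mf fM gi; have mg := L1_meas gi.
apply: (@L1_le _ _ _ (fun t => M * `|g t|)).
- exact: measurable_funM.
- by move=> t /fM h; rewrite normrM ler_wpM2r.
- exact/L1Z/L1_norm.
Qed.

Lemma within_bounded a b f : {within `[a, b], continuous f} ->
  exists M : R, forall t, a <= t <= b -> `|f t| <= M.
Proof.
move=> cf.
have /compact_bounded[M [_ mrt]] := continuous_compact cf (@segment_compact _ a b).
exists (`|M| + 1) => t tab; apply: (mrt (`|M| + 1)); last by exists t => //=; rewrite in_itv.
by rewrite ltr_pwDr// ler_norm.
Qed.

Lemma within_meas a b f : {within `[a, b], continuous f} -> measurable_fun `[a, b] f.
Proof. by move=> cf; apply: subspace_continuous_measurable_fun. Qed.

Lemma L1M_cont a b f g : {within `[a, b], continuous f} ->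
  L1 a b g -> L1 a b (fun t => f t * g t).
Proof.
move=> cf; have [M fM] := within_bounded cf.
exact: (L1M_bounded (within_meas cf) fM).
Qed.

Lemma itgD a b f g : L1 a b f -> L1 a b g ->
  itg a b (fun t => f t + g t) = itg a b f + itg a b g.
Proof. by move=> fi gi; rewrite /itg RintegralD. Qed.

Lemma itgB a b f g : L1 a b f -> L1 a b g ->
  itg a b (fun t => f t - g t) = itg a b f - itg a b g.
Proof. by move=> fi gi; rewrite /itg RintegralB. Qed.

Lemma itgZ a b k f : L1 a b f -> itg a b (fun t => k * f t) = k * itg a b f.
Proof. by move=> fi; rewrite /itg RintegralZl. Qed.

Lemma itgN a b f : L1 a b f -> itg a b (fun t => - f t) = - itg a b f.
Proof.
move=> fi; rewrite -mulN1r -itgZ//.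
by apply: eq_Rintegral => t _; rewrite mulN1r.
Qed.

Lemma itg_eq a b f g : (forall t, a <= t <= b -> f t = g t) -> itg a b f = itg a b g.
Proof. by move=> fg; apply: eq_Rintegral => t; rewrite inE/= in_itv/= => /fg. Qed.

Lemma itg_cst a b k : a <= b -> itg a b (fun=> k) = k * (b - a).
Proof.
move=> ab; rewrite /itg Rintegral_cst//= lebesgue_measure_itv/= lte_fin.
by move: ab; rewrite le_eqVlt => /predU1P[->|->]; rewrite ?ltxx ?subrr.
Qed.

Lemma itg_pt a f : itg a a f = 0.
Proof. by rewrite /itg set_itv1 Rintegral_set1. Qed.

Lemma itg_le a b f g : L1 a b f -> L1 a b g ->
  (forall t, a <= t <= b -> f t <= g t) -> itg a b f <= itg a b g.
Proof.
by move=> fi gi fg; apply: le_Rintegral => // t; rewrite /= in_itv/=; exact: fg.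
Qed.

Lemma itg_ge0 a b f : (forall t, a <= t <= b -> 0 <= f t) -> 0 <= itg a b f.
Proof. by move=> f0; apply: Rintegral_ge0 => t; rewrite /= in_itv/=; exact: f0. Qed.

Lemma itg_norm a b f : L1 a b f -> `|itg a b f| <= itg a b (fun t => `|f t|).
Proof. exact: le_normr_Rintegral. Qed.

Lemma itg_norm_le a b f g : L1 a b f -> L1 a b g ->
  (forall t, a <= t <= b -> `|f t| <= g t) -> `|itg a b f| <= itg a b g.
Proof.
move=> fi gi fg; apply: le_trans (itg_norm fi) _.
by apply: itg_le => //; exact: L1_norm.
Qed.

Lemma itg_split a b c f : a <= b -> b <= c -> L1 a c f ->
  itg a c f = itg a b f + itg b c f.
Proof.
move=> ab bc fi; apply/eqP; rewrite -subr_eq addrC eq_sym -subr_eq0 addrC; apply/eqP.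
have := @Rintegral_itvB _ f (BLeft a) (BRight c) b fi.
rewrite !bnd_simp => /(_ ab bc).
rewrite Rintegral_itv_obnd_cbnd//; last first.
  apply: integrableS fi => //= t /=.
  by rewrite !in_itv/= => /andP[? ->]; rewrite andbT; lra.
rewrite /itg => <-; lra.
Qed.

Lemma itg_sub_le a b c d f : a <= c -> c <= d -> d <= b -> L1 a b f ->
  (forall t, a <= t <= b -> 0 <= f t) -> itg c d f <= itg a b f.
Proof.
move=> ac cd db fi f0.
rewrite (@itg_split a c b)//; last exact: le_trans db.
rewrite (@itg_split c d b)//; last exact: (L1_sub fi).
have h1 : 0 <= itg a c f by apply: itg_ge0 => t /andP[? ?]; apply: f0; lra.
have h2 : 0 <= itg d b f by apply: itg_ge0 => t /andP[? ?]; apply: f0; lra.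
lra.
Qed.

Lemma itg_FTC a b f F : a <= b -> (forall t, a <= t <= b -> is_derive t 1 F (f t)) ->
  {within `[a, b], continuous f} -> itg a b f = F b - F a.
Proof.
rewrite le_eqVlt => /predU1P[->|ab] dF cf; first by rewrite itg_pt subrr.
rewrite /itg /Rintegral (continuous_FTC2 ab cf (F := F))//.
- have cF t : a <= t <= b -> F x @[x --> t] --> F t.
    move=> /dF h; apply: differentiable_continuous; apply/derivable1_diffP.
    exact: ex_derive.
  split.
  + by move=> x; rewrite in_itv/= => /andP[? ?]; have h : is_derive x 1 F (f x) by apply: dF; lra.
  + by apply: cvg_at_right_filter; apply: cF; lra.
  + by apply: cvg_at_left_filter; apply: cF; lra.
- move=> x; rewrite in_itv/= => /andP[? ?]; rewrite derive1E.
  have h : is_derive x 1 F (f x) by apply: dF; lra.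
  exact: derive_val.
Qed.

(** The quadratic in t is evaluated at its minimum t = - B / C. Applied to the integral of a square
    this gives Cauchy-Schwarz without square roots. *)
Lemma discriminant_le (A B C : R) : 0 <= C ->
  (forall t : R, 0 <= A + t * (2 * B) + t ^+ 2 * C) -> B ^+ 2 <= A * C.
Proof.
rewrite le_eqVlt => /predU1P[<- h|C0 h]; last first.
  have := h (- (B / C)); rewrite sqrrN expr_div_n.
  have -> : A + - (B / C) * (2 * B) + B ^+ 2 / C ^+ 2 * C = A - B ^+ 2 / C.
    by field; rewrite gt_eqF.
  by rewrite subr_ge0 ler_pdivrMr.
rewrite mulr0; have [->|B0] := eqVneq B 0; first by rewrite expr0n.
(* With C = 0 the polynomial is affine; if B is nonzero, it takes the value -1 at this point. *)
have := h (- (A + 1) / (2 * B)).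
have -> : A + - (A + 1) / (2 * B) * (2 * B) + (- (A + 1) / (2 * B)) ^+ 2 * 0 = -1.
  by field.
lra.
Qed.

(* Subdividing [x, y] finely turns the local estimate into a global one with an
   arbitrarily small constant. *)
Lemma itg_criterion x y (F beta m : R -> R) : x <= y -> L1 x y beta -> L1 x y m ->
  (forall e : R, 0 < e -> exists2 eta : R, 0 < eta & forall s t, x <= s -> s <= t -> t <= y ->
     t - s < eta -> `|F t - F s - itg s t beta| <= e * itg s t m) ->
  F y - F x = itg x y beta.
Proof.
move=> xy bi mi H; apply/eqP; rewrite -subr_eq0 -normr_le0; apply/ler_addgt0Pr => e e0; rewrite add0r.
pose M := itg x y m.
have e'0 : 0 < e / (`|M| + 1) by rewrite divr_gt0// ltr_wpDl.
have [eta eta0 h] := H _ e'0.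
pose N := (Num.bound ((y - x) / eta)).+1.
have N0 : 0 < N%:R :> R by rewrite ltr0n.
have hN : (y - x) / N%:R < eta.
  rewrite ltr_pdivrMr// mulrC -ltr_pdivrMr//.
  apply: lt_trans (archi_boundP _) _; last by rewrite ltr_nat.
  by rewrite divr_ge0 ?subr_ge0// ltW.
pose p i := x + i%:R * ((y - x) / N%:R).
have pN : p N = y by rewrite /p; field; rewrite gt_eqF.
have p0 : p 0%N = x by rewrite /p mul0r addr0.
have st0 : 0 <= (y - x) / N%:R by rewrite divr_ge0 ?subr_ge0// ltW.
have pS i : p i.+1 = p i + (y - x) / N%:R by rewrite /p -natr1; ring.
have pge i : x <= p i by rewrite /p lerDl mulr_ge0.
have ple i : (i <= N)%N -> p i <= y.
  move=> iN; rewrite -pN /p lerD2l ler_wpM2r// ler_nat//.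
have step i : (i <= N)%N -> `|F (p i) - F x - itg x (p i) beta| <= e / (`|M| + 1) * itg x (p i) m.
  elim: i => [|i ih] iN; first by rewrite p0 subrr !itg_pt subrr normr0 mulr0.
  have ii1 : p i <= p i.+1 by rewrite pS lerDl.
  have := ih (ltnW iN); have := h (p i) (p i.+1) (pge _) ii1 (ple _ iN).
  have dp : p i.+1 - p i < eta by rewrite pS addrAC subrr add0r.
  move=> /(_ dp) h1 h2.
  rewrite (@itg_split x (p i) (p i.+1) beta)//; last by apply: (L1_sub bi) => //; exact: ple.
  rewrite (@itg_split x (p i) (p i.+1) m)//; last by apply: (L1_sub mi) => //; exact: ple.
  have -> : F (p i.+1) - F x - (itg x (p i) beta + itg (p i) (p i.+1) beta) =
    (F (p i) - F x - itg x (p i) beta) + (F (p i.+1) - F (p i) - itg (p i) (p i.+1) beta) by ring.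
  apply: le_trans (ler_normD _ _) _; rewrite mulrDr; exact: lerD.
have := step N (leqnn _); rewrite pN => /le_trans; apply.
rewrite mulrAC ler_pdivrMr ?ltr_wpDl// ler_wpM2l ?ltW//.
by rewrite -/M ltr_pwDr// ler_norm.
Qed.

End IntervalIntegral.

(** * Absolutely continuous functions with a given density *)

Section AbsolutelyContinuous.
Context {R : realType}.
Notation mu := (@lebesgue_measure R).
Implicit Types (x y s t : R) (f g b c : R -> R).

(** Heine's theorem. The near-covering form of compactness asks only that small eta work for all s
    close to a given t0, which follows from continuity at t0 and the triangle inequality through f
    t0. *)
Lemma heine x y f : {within `[x, y], continuous f} -> forall e : R, 0 < e ->
  exists2 eta : R, 0 < eta & forall s t, x <= s <= y -> x <= t <= y ->
    `|t - s| < eta -> `|f t - f s| < e.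
Proof.
move=> /subspace_continuousP cf e e0.
pose P (eta s : R) := forall t, x <= s <= y -> x <= t <= y -> `|t - s| < eta -> `|f t - f s| < e.
have /compact_near_coveringP/(_ _ _ P) := @segment_compact _ x y.
move=> /(_ (0^'+) _) H.
have H' : \forall eta \near 0^'+, `[x, y] `<=` P eta.
  apply: H => t0 t0xy; have := cf _ t0xy.
  move=> /cvgrPdist_lt/(_ (e / 2)) H.
  have /H[/= d d0 hd] : 0 < e / 2 by lra.
  exists (ball t0 (d / 2), [set eta | 0 < eta < d / 2]) => /=.
    split; first by apply: nbhsx_ballx; lra.
    by near=> z; apply/andP; split => //; near: z; apply: nbhs_right_lt; lra.
  move=> [s eta]/= [sb /andP[eta0 etad]] t sxy txy ts.
  have h1 : `|f t0 - f t| < e / 2.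
    apply: hd => /=; last by rewrite in_itv.
    have -> : t0 - t = (t0 - s) - (t - s) by ring.
    apply: le_lt_trans (ler_normB _ _) _; move: sb; rewrite /ball/=; lra.
  have h2 : `|f t0 - f s| < e / 2.
    by apply: hd => /=; [move: sb; rewrite /ball/=; lra|rewrite in_itv].
  have -> : f t - f s = (f t0 - f s) - (f t0 - f t) by ring.
  by apply: le_lt_trans (ler_normB _ _) _; lra.
have [/= d d0 hd] := H'; exists (d / 2); first by lra.
move=> s t sxy txy; apply: (hd (d / 2)) => //=; try lra.
by rewrite sub0r normrN gtr0_norm; lra.
Unshelve. all: by end_near. Qed.

(* [f] is absolutely continuous on [x, y] with density [b]. *)
Definition acon x y f b :=
  L1 x y b /\ forall s t, x <= s -> s <= t -> t <= y -> f t - f s = itg s t b.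

Lemma acon_sub x y s t f b : acon x y f b -> x <= s -> t <= y -> acon s t f b.
Proof.
move=> [bi fb] xs ty; split; first exact: (L1_sub bi).
by move=> s' t' ? ? ?; apply: fb => //; lra.
Qed.

Lemma acon_within x y f b : acon x y f b -> {within `[x, y], continuous f}.
Proof.
move=> [bi fb]; have [xy|yx] := leP x y; last first.
  by rewrite set_itv_ge ?bnd_simp -?ltNge//; exact: continuous_subspace0.
have := parameterized_integral_continuous xy bi => /subspace_continuousP cI.
apply/subspace_continuousP => t /[dup] txy; rewrite /= in_itv/= => /andP[xt ty].
change (f z @[z --> within `[x, y] (nbhs t)] --> f t).
have -> : f t = f x + itg x t b by have := fb x t (lexx _) xt ty; lra.
apply: cvg_trans (cvgD (cvg_cst (f x)) (cI t txy)); apply: near_eq_cvg.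
apply: filterS (withinT _ _) => z; rewrite /= in_itv/= => /andP[xz zy].
change (f x + itg x z b = f z).
by have := fb x z (lexx _) xz zy; lra.
Qed.

(** The defect over [s, t] is the integral of (g t - g r) b r + (f s - f r) c r, which uniform
    continuity makes small against the integral of |b| + |c|; [itg_criterion] then sums the
    defects. *)
Lemma aconM x y f b g c : acon x y f b -> acon x y g c ->
  acon x y (fun t => f t * g t) (fun t => b t * g t + f t * c t).
Proof.
move=> fb gc; have wf := acon_within fb; have wg := acon_within gc.
have [bi fE] := fb; have [ci gE] := gc.
have bgi : L1 x y (fun t => b t * g t).
  by apply: L1_eq (L1M_cont wg bi) => t _; rewrite mulrC.
have fci : L1 x y (fun t => f t * c t) := L1M_cont wf ci.
split=> [|x' y' xx' xy' yy']; first exact: L1D.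
have sub' k : L1 x y k -> L1 x' y' k by move=> /L1_sub; apply.
apply: (@itg_criterion _ _ _ (fun t => f t * g t) _ (fun t => `|b t| + `|c t|)) => //.
- by apply: sub'; exact: L1D.
- by apply: sub'; apply: L1D; exact: L1_norm.
move=> e e0.
have [eta1 eta10 h1] := heine wf e0; have [eta2 eta20 h2] := heine wg e0.
exists (Num.min eta1 eta2); first by rewrite lt_min eta10.
move=> s t xs st ty; rewrite lt_min => /andP[d1 d2].
have sub k : L1 x y k -> L1 s t k by move=> /L1_sub; apply; lra.
have xs' : x <= s by lra.
have ty' : t <= y by lra.
have bi' := sub _ bi; have ci' := sub _ ci; have bgi' := sub _ bgi; have fci' := sub _ fci.
have -> : f t * g t - f s * g s - itg s t (fun r => b r * g r + f r * c r) =
  itg s t (fun r => (g t - g r) * b r + (f s - f r) * c r).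
  have -> : f t * g t - f s * g s = g t * (f t - f s) + f s * (g t - g s) by ring.
  rewrite fE// gE// -!itgZ//.
  rewrite -itgD//; try exact: L1Z.
  rewrite -itgB//; try by apply: L1D => //; exact: L1Z.
  by apply: itg_eq => r _; ring.
rewrite -itgZ; last by apply: L1D; exact: L1_norm.
apply: itg_norm_le.
- apply: L1_eq (L1B (L1D (L1Z (g t) bi') (L1Z (f s) ci')) (L1D bgi' fci')) => r _; ring.
- by apply/L1Z/L1D; exact: L1_norm.
move=> r /andP[sr rt].
apply: le_trans (ler_normD _ _) _; rewrite !normrM mulrDr; apply: lerD.
  rewrite ler_wpM2r//; apply/ltW/h2; try lra.
  by rewrite ger0_norm; lra.
rewrite ler_wpM2r//; apply/ltW/h1; try lra.
by rewrite distrC ger0_norm; lra.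
Qed.

(** Same scheme as for products: a bound and a modulus of continuity for the reciprocal control the
    defect by the integral of |b|. *)
Lemma aconV x y f b : acon x y f b -> (forall t, x <= t <= y -> 0 < f t) ->
  acon x y (fun t => (f t)^-1) (fun t => - b t * (f t)^-1 ^+ 2).
Proof.
move=> fb fpos; have wf := acon_within fb; have [bi fE] := fb.
have wV : {within `[x, y], continuous fun t => (f t)^-1}.
  apply/subspace_continuousP => t txy; apply: cvgV; last exact: (subspace_continuousP _ _).1 wf t txy.
  by move: txy; rewrite /= in_itv/= => txy; rewrite gt_eqF// fpos.
have i1 : L1 x y (fun t => - b t * (f t)^-1 ^+ 2).
  by apply: L1_eq (L1M_cont wV (L1M_cont wV (L1N bi))) => t _; ring.
split=> // x' y' xx' xy' yy'.
have sub' k : L1 x y k -> L1 x' y' k by move=> /L1_sub; apply.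
have [M fM] := within_bounded wV.
have M0 : 0 <= M by apply: le_trans (fM x _); [exact: normr_ge0|lra].
apply: (@itg_criterion _ _ _ (fun t => (f t)^-1) _ (fun t => 2 * (M * `|b t|))) => //; first exact: sub'.
  by apply: sub'; exact/L1Z/L1Z/L1_norm.
move=> e e0.
have [eta eta0 h] := heine wV e0; exists eta => // s t xs st ty d.
have sub k : L1 x y k -> L1 s t k by move=> /L1_sub; apply; lra.
have xs' : x <= s by lra.
have ty' : t <= y by lra.
have bi' := sub _ bi; have i1' := sub _ i1.
have fs0 : f s != 0 by rewrite gt_eqF// fpos//; lra.
have ft0 : f t != 0 by rewrite gt_eqF// fpos//; lra.
have -> : (f t)^-1 - (f s)^-1 - itg s t (fun r => - b r * (f r)^-1 ^+ 2) =
  itg s t (fun r => ((f r)^-1 ^+ 2 - (f s)^-1 * (f t)^-1) * b r).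
  have -> : (f t)^-1 - (f s)^-1 = - ((f s)^-1 * (f t)^-1) * (f t - f s) by field; rewrite fs0 ft0.
  rewrite fE// -!itgZ//.
  rewrite -itgB//; try exact: L1Z.
  by apply: itg_eq => r _; ring.
have li : L1 s t (fun r => ((f r)^-1 ^+ 2 - (f s)^-1 * (f t)^-1) * b r).
  by apply: L1_eq (L1B (L1N i1') (L1Z ((f s)^-1 * (f t)^-1) bi')) => r _; ring.
rewrite -itgZ; last exact/L1Z/L1Z/L1_norm.
apply: itg_norm_le => //; first exact/L1Z/L1Z/L1Z/L1_norm.
(* f_r^-2 - f_s^-1 f_t^-1 = f_r^-1 (f_r^-1 - f_s^-1) + f_s^-1 (f_r^-1 - f_t^-1) *)
move=> r /andP[sr rt].
  have -> : ((f r)^-1 ^+ 2 - (f s)^-1 * (f t)^-1) * b r =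
    ((f r)^-1 * ((f r)^-1 - (f s)^-1) + (f s)^-1 * ((f r)^-1 - (f t)^-1)) * b r by ring.
  rewrite normrM !mulrA ler_wpM2r//.
  apply: le_trans (ler_normD _ _) _; rewrite !normrM.
  have e1 : `|(f r)^-1 - (f s)^-1| <= e.
    by apply/ltW/h; [lra|lra|rewrite ger0_norm; lra].
  have e2 : `|(f r)^-1 - (f t)^-1| <= e.
    by apply/ltW/h; [lra|lra|rewrite distrC ger0_norm; lra].
  have m1 : `|(f r)^-1| <= M by apply: fM; lra.
  have m2 : `|(f s)^-1| <= M by apply: fM; lra.
  have := ler_pM (normr_ge0 _) (normr_ge0 _) m1 e1.
  have := ler_pM (normr_ge0 _) (normr_ge0 _) m2 e2.
  lra.
Qed.

Lemma aconD x y f b g c : acon x y f b -> acon x y g c ->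
  acon x y (fun t => f t + g t) (fun t => b t + c t).
Proof.
move=> [bi fE] [ci gE]; split=> [|s t xs st ty]; first exact: L1D.
rewrite itgD; [|exact: (L1_sub bi)|exact: (L1_sub ci)].
by rewrite -fE// -gE//; ring.
Qed.

Lemma aconZ x y k f b : acon x y f b -> acon x y (fun t => k * f t) (fun t => k * b t).
Proof.
move=> [bi fE]; split=> [|s t xs st ty]; first exact: L1Z.
by rewrite itgZ; [rewrite -fE//; ring|exact: (L1_sub bi)].
Qed.

Lemma acon_derive x y f b : (forall t, x <= t <= y -> is_derive t 1 f (b t)) ->
  {within `[x, y], continuous b} -> acon x y f b.
Proof.
move=> fd cb; split=> [|s t xs st ty]; first exact: L1_cont.
apply/esym/itg_FTC => //; first by move=> r ?; apply: fd; lra.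
by apply: continuous_subspaceW cb => r /=; rewrite !in_itv/=; lra.
Qed.

(* [f] is locally absolutely continuous on ]0, 1[ with density [b]. *)
Definition ac f b := forall x y, 0 < x -> y < 1 -> acon x y f b.

Lemma acD f b g c : ac f b -> ac g c -> ac (fun t => f t + g t) (fun t => b t + c t).
Proof. by move=> fb gc x y x0 y1; apply: aconD; [exact: fb|exact: gc]. Qed.

Lemma acZ k f b : ac f b -> ac (fun t => k * f t) (fun t => k * b t).
Proof. by move=> fb x y x0 y1; apply: aconZ; exact: fb. Qed.

End AbsolutelyContinuous.

(** * Lower bound: the energy tested against functions *)

Section LowerBound.
Context {R : realType}.
Notation mu := (@lebesgue_measure R).
Implicit Types (x y s t : R) (f g b c : R -> R).

Lemma within_id x y : {within `[x, y], continuous (fun r : R => r)}.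
Proof. by apply: continuous_subspaceT => r; exact: cvg_id. Qed.

Lemma within_invr x y : 0 < x -> {within `[x, y], continuous (fun r : R => r^-1)}.
Proof.
move=> x0; apply: continuous_in_subspaceT => r.
by rewrite inE/= in_itv/= => /andP[xr _]; apply: cvgV; [rewrite gt_eqF//; lra|exact: cvg_id].
Qed.

(** The quadratic in t is the integral of (om f + t g)^2 / om. The same squares with t = 1 and t =
    -1 dominate f g by the two given integrands and so give its integrability. *)
Lemma itg_weighted_cs x y (om f g : R -> R) : measurable_fun `[x, y] om ->
  measurable_fun `[x, y] f -> measurable_fun `[x, y] g ->
  (forall r, x <= r <= y -> 0 < om r) ->
  L1 x y (fun r => om r * f r ^+ 2) -> L1 x y (fun r => g r ^+ 2 / om r) ->
  L1 x y (fun r => f r * g r) /\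
  itg x y (fun r => f r * g r) ^+ 2 <=
  itg x y (fun r => om r * f r ^+ 2) * itg x y (fun r => g r ^+ 2 / om r).
Proof.
move=> mo mf mg o0 f2 g2.
have fg : L1 x y (fun r => f r * g r).
  apply: (@L1_le _ _ _ _ (fun r => om r * f r ^+ 2 + g r ^+ 2 / om r)) => [|r /o0 or|].
  - exact: measurable_funM.
  - have : 0 <= (om r * f r + g r) ^+ 2 / om r by rewrite divr_ge0 ?sqr_ge0// ltW.
    have : 0 <= (om r * f r - g r) ^+ 2 / om r by rewrite divr_ge0 ?sqr_ge0// ltW.
    have -> : (om r * f r - g r) ^+ 2 / om r = om r * f r ^+ 2 + g r ^+ 2 / om r - 2 * (f r * g r).
      by field; rewrite gt_eqF.
    have -> : (om r * f r + g r) ^+ 2 / om r = om r * f r ^+ 2 + g r ^+ 2 / om r + 2 * (f r * g r).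
      by field; rewrite gt_eqF.
    have h3 : 0 <= om r * f r ^+ 2 + g r ^+ 2 / om r.
      by apply: addr_ge0; [apply: mulr_ge0|apply: divr_ge0]; rewrite ?sqr_ge0 ?ltW.
    by rewrite ler_norml; lra.
  - exact: L1D.
split=> //; apply: discriminant_le => [|t].
  by apply: itg_ge0 => r /o0 or; rewrite divr_ge0 ?sqr_ge0// ltW.
rewrite mulrA -!itgZ// -!itgD//; try apply: L1D => //; try exact: L1Z.
apply: itg_ge0 => r /o0 or.
have -> : om r * f r ^+ 2 + t * 2 * (f r * g r) + t ^+ 2 * (g r ^+ 2 / om r) =
  (om r * f r + t * g r) ^+ 2 / om r by field; rewrite gt_eqF.
by rewrite divr_ge0 ?sqr_ge0// ltW.
Qed.

Lemma acon_by_parts x y f b g c : x <= y -> acon x y f b -> acon x y g c ->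
  itg x y (fun r => b r * g r) = f y * g y - f x * g x - itg x y (fun r => f r * c r).
Proof.
move=> xy fb gc; have [_ /(_ x y)] := aconM fb gc.
have wf := acon_within fb; have wg := acon_within gc.
have [bi _] := fb; have [ci _] := gc.
rewrite itgD.
- by move=> /(_ (lexx _) xy (lexx _)) ->; ring.
- by apply: L1_eq (L1M_cont wg bi) => t _; rewrite mulrC.
- exact: L1M_cont.
Qed.

Lemma acon_lin x y (m q : R) : acon x y (fun r => m * r + q) (fun=> m).
Proof.
apply: acon_derive => [t _|]; last by apply: continuous_subspaceT => r; exact: cvg_cst.
have -> : (fun r : R => m * r + q) = (m \*: (@id R)) + cst q by [].
by apply: is_derive_eq; rewrite addr0 /GRing.scale/= mulr1.
Qed.

Lemma itg_2r x y : x <= y -> itg x y (fun r => 2 * r) = y ^+ 2 - x ^+ 2.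
Proof.
move=> xy; have h := acon_lin x y 1 0.
have [_ /(_ x y (lexx _) xy (lexx _))] := aconM h h.
rewrite (itg_eq (g := fun r => 2 * r)); last by move=> t _; ring.
by move=> <-; ring.
Qed.

(** The form in which the lower bound uses the energy: each of its four terms is at most e on every
    compact subinterval of ]0, 1[. Here p, v, b stand for u', w', w''. *)
Definition ebound (h e : R) (u p v b : R -> R) :=
  [/\ ac u p, ac v b & forall x y, 0 < x -> y < 1 ->
  [/\ L1 x y (fun r => u r ^+ 2 / r) /\ itg x y (fun r => u r ^+ 2 / r) <= e,
      L1 x y (fun r => r * (p r + v r ^+ 2 - 4 * r ^+ 2) ^+ 2) /\
      itg x y (fun r => r * (p r + v r ^+ 2 - 4 * r ^+ 2) ^+ 2) <= e,
      L1 x y (fun r => r * b r ^+ 2) /\ h ^+ 2 * itg x y (fun r => r * b r ^+ 2) <= e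
    & L1 x y (fun r => v r ^+ 2 / r) /\ h ^+ 2 * itg x y (fun r => v r ^+ 2 / r) <= e]].

Section Bounds.
Context (h e : R) (u p v b : R -> R) (H : ebound h e u p v b).

Let up : ac u p. Proof. by case: H. Qed.
Let vb : ac v b. Proof. by case: H. Qed.
Let z r := p r + v r ^+ 2 - 4 * r ^+ 2.

Let mu_u x y : 0 < x -> y < 1 -> measurable_fun `[x, y] u.
Proof. by move=> x0 y1; apply: within_meas; apply: acon_within; exact: up. Qed.

Let mu_v x y : 0 < x -> y < 1 -> measurable_fun `[x, y] v.
Proof. by move=> x0 y1; apply: within_meas; apply: acon_within; exact: vb. Qed.

Let mu_z x y : 0 < x -> y < 1 -> measurable_fun `[x, y] z.
Proof.
move=> x0 y1; have [/L1_meas mp _] := up x0 y1; have mv := mu_v x0 y1.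
apply: measurable_funB; first apply: measurable_funD => //.
  exact: measurable_funX.
apply: measurable_funM; first exact: measurable_cst.
by apply: measurable_funX; exact: measurable_id.
Qed.

Let wv2 x y : 0 < x -> y < 1 -> L1 x y (fun r => v r ^+ 2).
Proof.
move=> x0 y1; have w := acon_within (vb x0 y1).
by apply: L1_eq (L1M_cont w (L1_cont w)) => t _; rewrite expr2.
Qed.

Lemma ebound_u x y g (M : R) : 0 < x -> x <= y -> y < 1 -> {within `[x, y], continuous g} ->
  (forall r, x <= r <= y -> `|g r| <= M) ->
  itg x y (fun r => u r * g r) ^+ 2 <= e * (y * M ^+ 2 * (y - x)).
Proof.
move=> x0 xy y1 cg gM; have [_ _ /(_ x y x0 y1)[[iu ue] _ _ _]] := H.
have i1 : L1 x y (fun r => r^-1 * u r ^+ 2) by apply: L1_eq iu => r _; rewrite mulrC.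
have i2 : L1 x y (fun r => g r ^+ 2 / r^-1).
  have := L1M_cont (@within_id x y) (L1M_cont cg (L1_cont cg)).
  by apply: L1_eq => r _; rewrite invrK; ring.
have [] := itg_weighted_cs (om := fun r => r^-1) _ _ _ _ i1 i2.
- by apply: within_meas; exact: within_invr.
- exact: mu_u.
- exact: within_meas.
- by move=> r ?; rewrite invr_gt0; lra.
move=> _ /le_trans; apply; apply: ler_pM.
- by apply: itg_ge0 => r ?; rewrite mulr_ge0 ?sqr_ge0// invr_ge0; lra.
- by apply: itg_ge0 => r ?; rewrite invrK mulr_ge0 ?sqr_ge0//; lra.
- by apply: le_trans ue; rewrite (itg_eq (g := fun r => u r ^+ 2 / r))// => r _; rewrite mulrC.
rewrite -itg_cst//; apply: itg_le => //; first exact: L1_cst.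
move=> r rxy; rewrite invrK mulrC; apply: ler_pM; rewrite ?sqr_ge0//; try lra.
by rewrite -(ger0_norm (sqr_ge0 (g r))) normrX lerXn2r ?nnegrE//; [exact: le_trans (gM r rxy)|exact: gM].
Qed.

Lemma ebound_z x y g (M : R) : 0 < x -> x <= y -> y < 1 -> {within `[x, y], continuous g} ->
  (forall r, x <= r <= y -> `|g r| <= M) ->
  L1 x y (fun r => z r * g r) /\
  itg x y (fun r => z r * g r) ^+ 2 <= e * (M ^+ 2 / x * (y - x)).
Proof.
move=> x0 xy y1 cg gM; have [_ _ /(_ x y x0 y1)[_ [iz ze] _ _]] := H.
have i2 : L1 x y (fun r => g r ^+ 2 / r).
  have := L1M_cont (@within_invr x y x0) (L1M_cont cg (L1_cont cg)).
  by apply: L1_eq => r _; ring.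
have [] := itg_weighted_cs (om := id) (f := z) _ _ _ _ iz i2.
- by apply: within_meas; exact: within_id.
- exact: mu_z.
- exact: within_meas.
- by move=> r ?; lra.
move=> i3 cs; split=> //; apply: le_trans cs _; apply: ler_pM.
- by apply: itg_ge0 => r ?; rewrite mulr_ge0 ?sqr_ge0//; lra.
- by apply: itg_ge0 => r ?; rewrite divr_ge0 ?sqr_ge0//; lra.
- exact: ze.
rewrite -itg_cst//; apply: itg_le => //; first exact: L1_cst.
move=> r rxy; apply: ler_pM; rewrite ?sqr_ge0//.
- by rewrite invr_ge0; lra.
- by rewrite -(ger0_norm (sqr_ge0 (g r))) normrX lerXn2r ?nnegrE//; [exact: le_trans (gM r rxy)|exact: gM].
- by rewrite lef_pV2 ?posrE; lra.
Qed.

(** Cauchy-Schwarz for the integral of b against 1 with weight r: a Hoelder modulus of exponent 1/2,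
    whose constant degenerates only as x tends to 0. *)
Lemma ebound_v x y : 0 < h -> 0 < x -> x <= y -> y < 1 ->
  (v y - v x) ^+ 2 <= e * ((h ^+ 2 * x)^-1 * (y - x)).
Proof.
move=> h0 x0 xy y1; have [_ _ /(_ x y x0 y1)[_ _ [ib be] _]] := H.
have [bi ->] := vb x0 y1; rewrite ?lexx//.
have i2 : L1 x y (fun r => 1 ^+ 2 / r).
  by apply: L1_eq (L1_cont (@within_invr x y x0)) => r _; rewrite expr1n mul1r.
have [] := itg_weighted_cs (om := id) (f := b) (g := fun=> 1) _ _ _ _ ib i2.
- by apply: within_meas; exact: within_id.
- exact: L1_meas bi.
- exact: measurable_cst.
- by move=> r ?; lra.
move=> _; rewrite (itg_eq (g := b)); last by move=> r _; rewrite mulr1.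
move=> /le_trans; apply.
have -> : e * ((h ^+ 2 * x)^-1 * (y - x)) = (e / h ^+ 2) * (x^-1 * (y - x)).
  by field; rewrite !gt_eqF.
apply: ler_pM.
- by apply: itg_ge0 => r ?; rewrite mulr_ge0 ?sqr_ge0//; lra.
- by apply: itg_ge0 => r ?; rewrite divr_ge0 ?sqr_ge0//; lra.
- by rewrite ler_pdivlMr ?exprn_gt0// mulrC.
rewrite -itg_cst//; apply: itg_le => //; first exact: L1_cst.
by move=> r rxy; rewrite expr1n mul1r lef_pV2 ?posrE; lra.
Qed.

(** Pigeonhole on the integral of u^2 / r. It provides the cut points at which the boundary terms of
    an integration by parts are small. *)
Lemma ebound_pick x y (C : R) : 0 < x -> x < y -> y < 1 -> e * y < C * (y - x) ->
  exists2 r, x <= r <= y & u r ^+ 2 <= C.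
Proof.
move=> x0 xy y1 eC; apply: contrapT => /forall2NP nC.
have [_ _ /(_ x y x0 y1)[[iu ue] _ _ _]] := H.
suff : C / y * (y - x) <= e.
  by apply/negP; rewrite -ltNge mulrAC ltr_pdivlMr//; lra.
apply: le_trans ue; rewrite -itg_cst; last exact: ltW.
apply: itg_le => //; first exact: L1_cst.
move=> r rxy; have [//|/negP] := nC r; rewrite -ltNge => /ltW Cr.
have y0 : 0 < y by lra.
apply: (@le_trans _ _ (u r ^+ 2 / y)); first by rewrite ler_wpM2r// invr_ge0 ltW.
by rewrite ler_wpM2l ?sqr_ge0// lef_pV2 ?posrE; lra.
Qed.

(** Since 4 r^2 - v^2 = u' - z, integration by parts moves the derivative from u to g and leaves
    only u and z, which the energy controls in weighted L2. All knowledge of how close v^2 is to 4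
    r^2 comes from a choice of g here. *)
Lemma ebound_test x y g c : 0 < x -> x <= y -> y < 1 -> acon x y g c -> 
  {within `[x, y], continuous g} ->
  L1 x y (fun r => (4 * r ^+ 2 - v r ^+ 2) * g r) /\
  itg x y (fun r => (4 * r ^+ 2 - v r ^+ 2) * g r) =
  u y * g y - u x * g x - itg x y (fun r => u r * c r) - itg x y (fun r => z r * g r).
Proof.
move=> x0 xy y1 gc wg; rewrite -(acon_by_parts xy (up x0 y1) gc).
have [M gM] := within_bounded wg.
have [zi _] := ebound_z x0 xy y1 wg gM.
have [pi _] := up x0 y1.
have pgi : L1 x y (fun r => p r * g r).
  by apply: L1_eq (L1M_cont wg pi) => r _; rewrite mulrC.
split; first by apply: L1_eq (L1B pgi zi) => r _; rewrite /z; ring.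
by rewrite -itgB//; apply: itg_eq => r _; rewrite /z; ring.
Qed.

End Bounds.
End LowerBound.

(** * Lower bound: the cost h^2 and the cost of a zero of w' *)

Section LowerBound2.
Context {R : realType}.
Notation mu := (@lebesgue_measure R).
Implicit Types (x y s t : R) (f g c : R -> R).

Lemma within_ac_lin x y (m q : R) : {within `[x, y], continuous (fun r => m * r + q)}.
Proof. by apply: acon_within; exact: acon_lin. Qed.

Lemma bump_acon x y : acon x y (fun r => (1 * r - x) * (-1 * r + y))
  (fun r => - 2 * r + (x + y)).
Proof.
have -> : (fun r => - 2 * r + (x + y)) = (fun r => 1 * (-1 * r + y) + (1 * r - x) * -1).
  by apply/funext => r; ring.
by apply: aconM; exact: acon_lin.
Qed.

(** Only the middle half of [x, y] is kept, where the bump is at least 3/16 (y - x)^2; the exact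
    constant would be 1/6. *)
Lemma bump_itg x y : x <= y ->
  3 / 32 * (y - x) ^+ 3 <= itg x y (fun r => (1 * r - x) * (-1 * r + y)).
Proof.
move=> xy; have [bi _] := bump_acon x y.
have b0 r : x <= r <= y -> 0 <= (1 * r - x) * (-1 * r + y).
  by move=> ?; apply: mulr_ge0; lra.
have wb := acon_within (bump_acon x y).
have h1 : x <= x + (y - x) / 4 by lra.
have h2 : x + (y - x) / 4 <= y - (y - x) / 4 by lra.
have h3 : y - (y - x) / 4 <= y by lra.
have := itg_sub_le h1 h2 h3 (L1_cont wb) b0; apply: le_trans.
have -> : 3 / 32 * (y - x) ^+ 3 = (3 / 16 * (y - x) ^+ 2) * ((y - (y - x) / 4) - (x + (y - x) / 4)) by field.
rewrite -itg_cst//; apply: itg_le.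
- exact: L1_cst.
- exact: (L1_sub (L1_cont wb)).
- by move=> r rr; nra.
Qed.

Lemma sqr_small (a m : R) : 0 <= m -> a ^+ 2 <= m ^+ 2 -> - m <= a <= m.
Proof. by move=> m0 am; apply/andP; split; nra. Qed.

(** If e were far below h^2, the bending term v^2 / r would make v^2 negligible on [1/4, 3/4], while
    the membrane terms tested with a bump force v^2 to stay near 4 r^2 in the mean. *)
Lemma ebound_h2 (h e : R) u p v b : 0 < h -> h <= 1 / 2 -> @ebound R h e u p v b ->
  h ^+ 2 <= (32 * 32) ^+ 2 * e.
Proof.
move=> h0 h12 H; rewrite leNgt; apply/negP => eh.
(* The threshold is t = 1/1024. The bump integral is at least 12 t, the errors from u and z are at
   most t each, and the one from v^2 / r is at most t^2, so the test yields 3 t - t^2 <= 2 t. *)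
have [t [t0 t1 t12 t11]] : exists t : R,
    [/\ 0 < t, e <= h ^+ 2 * t ^+ 2, 12 * t = 3 / 32 * (1 / 2) ^+ 3 & t <= 1 / 2].
  exists (32 * 32)^-1; split; first by rewrite invr_gt0 mulr_gt0.
  - by rewrite exprVn ler_pdivlMr ?exprn_gt0 ?mulr_gt0// mulrC ltW.
  - by field.
  - by lra.
clear eh.
pose x : R := 1 / 4; pose y : R := 3 / 4.
have x0 : 0 < x by rewrite /x; lra.
have xy : x <= y by rewrite /x /y; lra.
have y1 : y < 1 by rewrite /y; lra.
have ga := bump_acon x y; have wg := acon_within ga.
have wc := @within_ac_lin x y (- 2) (x + y).
have gM r : x <= r <= y -> `|(1 * r - x) * (-1 * r + y)| <= 1 / 16.
  rewrite /x /y => rxy; have h1 : 0 <= (1 * r - 1 / 4) * (-1 * r + 3 / 4).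
    by apply: mulr_ge0; lra.
  by rewrite ger0_norm//; have := sqr_ge0 (r - 1 / 2); nra.
have cM r : x <= r <= y -> `|- 2 * r + (x + y)| <= 1 / 2.
  by rewrite /x /y => ?; rewrite ler_norml; lra.
have [Ti T] := ebound_test H x0 xy y1 ga wg.
have A := ebound_u H x0 xy y1 wc cM.
have [zi B] := ebound_z H x0 xy y1 wg gM.
have [_ vb /(_ x y x0 y1)[_ _ _ [iv ve]]] := H.
have bI := bump_itg xy.
have wv := acon_within (vb x y x0 y1).
have L : 1 / 4 * itg x y (fun r => (1 * r - x) * (-1 * r + y)) - itg x y (fun r => v r ^+ 2 / r) <=
  itg x y (fun r => (4 * r ^+ 2 - v r ^+ 2) * ((1 * r - x) * (-1 * r + y))).
  rewrite -itgZ -?itgB; try exact: L1_cont; try exact: L1Z; first last.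
  - exact: iv.
  - by apply: L1Z; exact: L1_cont.
  apply: itg_le.
  - by apply: L1B => //; apply: L1Z; exact: L1_cont.
  - exact: Ti.
  - move=> r rr; have g0 := gM r rr; move: g0; rewrite ler_norml => /andP[_ g1].
    have r0 : 0 < r by rewrite /x in rr; lra.
    have g0 : 0 <= (1 * r - x) * (-1 * r + y) by apply: mulr_ge0; lra.
    set g := (1 * r - x) * (-1 * r + y) in g0 g1 *.
    have rx : 1 / 4 <= r <= 3 / 4 by move: rr; rewrite /x /y.
    have v2 : v r ^+ 2 * g <= v r ^+ 2 / r.
      rewrite ler_wpM2l ?sqr_ge0//; apply: (@le_trans _ _ 1); first lra.
      by rewrite -(invr1) lef_pV2 ?posrE//; clear -rx r0; lra.
    have : 1 / 4 * g <= 4 * r ^+ 2 * g by rewrite ler_wpM2r//; clear -rx; nra.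
    move: v2; clear; lra.
have bI' : 12 * t <= itg x y (fun r => (1 * r - x) * (-1 * r + y)).
  by rewrite t12; have <- : y - x = 1 / 2 by rewrite /x /y; field.
have ve' : itg x y (fun r => v r ^+ 2 / r) <= t ^+ 2.
  have h20 : 0 < h ^+ 2 by rewrite exprn_gt0.
  by rewrite -(ler_pM2l h20) (le_trans ve).
have e1 : e <= t ^+ 2 / 4.
  apply: le_trans t1 _; have : h ^+ 2 <= 1 / 4 by nra.
  by move=> /(ler_wpM2r (sqr_ge0 t)); lra.
set IA := itg x y (fun r => u r * _) in A T; set IB := itg x y (fun r => (p r + _ - _) * _) in B T.
have t20 : 0 <= t ^+ 2 by exact: sqr_ge0.
have /andP[A1 A2] : - t <= IA <= t.
  apply: sqr_small; first exact: ltW.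
  apply: le_trans A _; have -> : y * (1 / 2) ^+ 2 * (y - x) = 3 / 32 by rewrite /x /y; field.
  lra.
have /andP[B1 B2] : - t <= IB <= t.
  apply: sqr_small; first exact: ltW.
  apply: le_trans B _.
  have -> : (1 / 16) ^+ 2 / x * (y - x) = 1 / 128 by rewrite /x /y; field.
  lra.
rewrite T in L.
have z0 : u y * ((1 * y - x) * (-1 * y + y)) - u x * ((1 * x - x) * (-1 * x + y)) = 0 by ring.
rewrite z0 in L.
have : t ^+ 2 <= t / 2 by rewrite expr2 ler_pM2l// -[_^-1]mul1r.
move: L bI' ve' A1 B1 t0; clear; lra.
Qed.

(* Near a zero of [v] the bending energy keeps [v ^+ 2] well below [4 r ^+ 2], so the
   membrane terms see a forcing of order [r0 ^+ 2] on a length [k]. *)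
Lemma ebound_zero (k e : R) u p v b r0 : 0 < k -> 2 * k <= r0 -> r0 < 1 -> v r0 = 0 ->
  @ebound R (k ^+ 2) e u p v b -> r0 ^+ 3 * k ^+ 3 <= 100 * 100 * e.
Proof.
move=> k0 kr0 r01 vr0 H; rewrite leNgt; apply/negP => er0.
pose x := r0 - k.
have x0 : 0 < x by rewrite /x; lra.
have xr : x <= r0 by rewrite /x; lra.
have ga := bump_acon x r0; have wg := acon_within ga.
have wc := @within_ac_lin x r0 (- 2) (x + r0).
have gM r : x <= r <= r0 -> `|(1 * r - x) * (-1 * r + r0)| <= k ^+ 2 / 4.
  move=> rx; have h1 : 0 <= (1 * r - x) * (-1 * r + r0) by apply: mulr_ge0; lra.
  by rewrite ger0_norm//; have := sqr_ge0 (2 * r - x - r0); rewrite /x; nra.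
have cM r : x <= r <= r0 -> `|- 2 * r + (x + r0)| <= k.
  by rewrite /x => ?; rewrite ler_norml; lra.
have [Ti T] := ebound_test H x0 xr r01 ga wg.
have A := ebound_u H x0 xr r01 wc cM.
have [zi B] := ebound_z H x0 xr r01 wg gM.
have bI := bump_itg xr.
have r00 : 0 < r0 by lra.
(* [ebound_v] between r and the zero r0, with h = k^2: as r0 - r <= k and r >= r0 / 2, it bounds v^2
   by 2 e / (k^3 r0), which the assumed smallness of e puts below r0^2 / 2. *)
have v2 r : x <= r <= r0 -> v r ^+ 2 <= r0 ^+ 2 / 2.
  move=> rx; have k20 : 0 < k ^+ 2 by rewrite exprn_gt0.
  have := ebound_v H k20 (_ : 0 < r) (_ : r <= r0) r01; rewrite vr0 sub0r sqrrN => vr.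
  apply: le_trans (vr _ _) _; [lra|lra|].
  have : (((k ^+ 2) ^+ 2 * r)^-1 * (r0 - r)) <= 2 / (k ^+ 3 * r0).
    rewrite mulrC ler_pdivrMr; last by rewrite mulr_gt0 ?exprn_gt0//; rewrite /x in rx; lra.
    have -> : 2 / (k ^+ 3 * r0) * ((k ^+ 2) ^+ 2 * r) = k * (2 * r / r0) by field; rewrite !gt_eqF.
    have : 1 <= 2 * r / r0 by rewrite ler_pdivlMr//; rewrite /x in rx; lra.
    by rewrite /x in rx; nra.
  have [e0|e0] := leP e 0.
    move=> q; apply: (@le_trans _ _ 0); last by rewrite divr_ge0// sqr_ge0.
    rewrite mulr_le0_ge0// mulr_ge0 ?invr_ge0 ?mulr_ge0 ?sqr_ge0//; rewrite /x in rx; lra.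
  move=> q; apply: le_trans (ler_wpM2l (ltW e0) q) _.
  rewrite mulrA ler_pdivrMr ?mulr_gt0 ?exprn_gt0//.
  have -> : r0 ^+ 2 / 2 * (k ^+ 3 * r0) = (r0 ^+ 3 * k ^+ 3) / 2 by field.
  have : 0 < r0 ^+ 3 * k ^+ 3 by rewrite mulr_gt0 ?exprn_gt0.
  lra.
have L : r0 ^+ 2 / 2 * itg x r0 (fun r => (1 * r - x) * (-1 * r + r0)) <=
  itg x r0 (fun r => (4 * r ^+ 2 - v r ^+ 2) * ((1 * r - x) * (-1 * r + r0))).
  rewrite -itgZ; last exact: L1_cont.
  apply: itg_le => //; first by apply: L1Z; exact: L1_cont.
  move=> r rr; apply: ler_wpM2r; first by apply: mulr_ge0; lra.
  have := v2 r rr; rewrite /x in rr; nra.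
set IA := itg x r0 (fun r => u r * _) in A T; set IB := itg x r0 (fun r => (p r + _ - _) * _) in B T.
have xrk : r0 - x = k by rewrite /x; ring.
rewrite xrk in A B bI.
have q0 : 0 <= r0 ^+ 2 * k ^+ 3 by rewrite mulr_ge0 ?exprn_ge0// ltW.
(* The errors from u and from z are at most r0^2 k^3 / 100 each, against the 3/64 r0^2 k^3 produced
   by the bump. *)
have /andP[A1 A2] : - (r0 ^+ 2 * k ^+ 3 / 100) <= IA <= r0 ^+ 2 * k ^+ 3 / 100.
  apply: sqr_small; first by rewrite divr_ge0.
  apply: le_trans A _.
  have -> : (r0 ^+ 2 * k ^+ 3 / 100) ^+ 2 = (r0 ^+ 3 * k ^+ 3 / (100 * 100)) * (r0 * k ^+ 2 * k) by field.
  by apply: ler_wpM2r; [rewrite !mulr_ge0 ?exprn_ge0// ltW|lra].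
have /andP[B1 B2] : - (r0 ^+ 2 * k ^+ 3 / 100) <= IB <= r0 ^+ 2 * k ^+ 3 / 100.
  apply: sqr_small; first by rewrite divr_ge0.
  apply: le_trans B _.
  have -> : (r0 ^+ 2 * k ^+ 3 / 100) ^+ 2 = (r0 ^+ 3 * k ^+ 3 / (100 * 100)) * (r0 * k ^+ 2 * k) by field.
  apply: (@le_trans _ _ (r0 ^+ 3 * k ^+ 3 / (100 * 100) * ((k ^+ 2 / 4) ^+ 2 / x * k))).
    apply: ler_wpM2r; last lra.
    by rewrite mulr_ge0 ?divr_ge0 ?sqr_ge0// ltW.
  apply: ler_wpM2l; first by rewrite divr_ge0// mulr_ge0 ?exprn_ge0// ltW.
  apply: ler_wpM2r; first lra.
  rewrite ler_pdivrMr//.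
  have h1 : k ^+ 2 <= r0 * x by rewrite /x; nra.
  have h2 : 0 < k ^+ 2 by rewrite exprn_gt0.
  nra.
rewrite T in L.
have z0 : u r0 * ((1 * r0 - x) * (-1 * r0 + r0)) - u x * ((1 * x - x) * (-1 * x + r0)) = 0 by ring.
rewrite z0 in L.
have h3 : 0 < r0 ^+ 2 * k ^+ 3 by rewrite mulr_gt0 ?exprn_gt0.
have := ler_wpM2l (_ : 0 <= r0 ^+ 2 / 2) bI.
rewrite divr_ge0 ?sqr_ge0// => /(_ isT).
lra.
Qed.



End LowerBound2.

(** * Lower bound: the integral of w' in three zones *)

Section LowerBound3.
Context {R : realType}.
Notation mu := (@lebesgue_measure R).
Implicit Types (x y s t : R) (f g c : R -> R).

(** The regime left to exclude: k = h^(1/2), d = delta^(1/2), and an energy bound e far below d^3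
    k^3. The auxiliary t measures smallness; where u^2 <= 4 e, one has |u| <= 2 t d^6. [small_dataE]
    derives the inequalities, which are those consumed by the three zone estimates. *)
Definition small_data (k d e t : R) :=
  [/\ [/\ 0 < k, 0 < d, d <= 1 & 64 * k <= d ^+ 3],
      [/\ 0 < e, 0 < t, 512 * t <= 1 / 16 & e <= (t * d ^+ 6) ^+ 2]
    & [/\ e <= d ^+ 3 * k ^+ 3 / 256, e * d <= (8 * t * d ^+ 5) ^+ 2 * (2 * k)
        & 2 * e <= t * d ^+ 6 * k ^+ 2]].

Lemma small_abs (k d e t a : R) : small_data k d e t -> a ^+ 2 <= 4 * e ->
  `|a| <= 2 * t * d ^+ 6.
Proof.
move=> [[k0 d0 d1 kd] [e0 t0 t1 ed] [edk edk2 edk3]] ur.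
have td : 0 <= 2 * t * d ^+ 6 by rewrite !mulr_ge0 ?exprn_ge0// ltW.
rewrite ler_norml; apply: sqr_small => //; apply: le_trans ur _.
by move: ed; clear; lra.
Qed.

Lemma small_pow (d : R) m n : 0 < d -> d <= 1 -> (n <= m)%N -> d ^+ m <= d ^+ n.
Proof. by move=> d0 d1 nm; rewrite ler_wiXn2l// ltW. Qed.

(** Near 0 only the bending term v^2 / r is available. Young's inequality |v| <= (k / d) v^2 / r +
    (d / 4) (r / k), with r <= k, balances it against the length k of the zone. *)
Lemma pos_inner (k d e t : R) u p v b x a : small_data k d e t -> ebound (k ^+ 2) e u p v b ->
  0 < x -> x <= a -> a <= k -> itg x a (fun r => `|v r|) <= d ^+ 2 / 128.
Proof.
move=> [[k0 d0 d1 kd] [e0 t0 t1 ed] [edk edk2 edk3]] H x0 xa ak.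
have vb : ac v b by case: H.
have d3 := small_pow d0 d1 (isT : (0 <= 3)%N).
have a1 : a < 1 by move: ak kd d3 k0; rewrite expr0; clear; lra.
have [_ _ /(_ x a x0 a1)[_ _ _ [iv ve]]] := H.
have iR : L1 x a (fun r => k / d * (v r ^+ 2 / r) + d / 4) by apply: L1D; [exact: L1Z|exact: L1_cst].
apply: (@le_trans _ _ (itg x a (fun r => k / d * (v r ^+ 2 / r) + d / 4))).
  apply: itg_le => //; first by apply/L1_norm/L1_cont; exact: acon_within (vb _ _ x0 a1).
  move=> r /andP[xr ra]; have r0 : 0 < r by lra.
  have : 0 <= (2 * k * `|v r| - d * r) ^+ 2 / (4 * k * d * r).
    by rewrite divr_ge0 ?sqr_ge0// !mulr_ge0// ltW.
  have -> : (2 * k * `|v r| - d * r) ^+ 2 / (4 * k * d * r) =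
    k / d * (`|v r| ^+ 2 / r) + d / 4 * (r / k) - `|v r| by field; rewrite !gt_eqF.
  rewrite real_normK ?num_real//.
  have : d / 4 * (r / k) <= d / 4.
    by rewrite ler_piMr// ?ler_pdivrMr// ?mul1r; [rewrite divr_ge0// ltW|exact: le_trans ra ak].
  by clear; lra.
rewrite itgD; [|exact: L1Z|exact: L1_cst].
rewrite itgZ// itg_cst//.
have k4 : 0 < (k ^+ 2) ^+ 2 by rewrite !exprn_gt0.
have h1 : k / d * itg x a (fun r => v r ^+ 2 / r) <= d ^+ 2 / 256.
  have : itg x a (fun r => v r ^+ 2 / r) <= e / (k ^+ 2) ^+ 2.
    by rewrite ler_pdivlMr// mulrC.
  move=> /(ler_wpM2l (_ : 0 <= k / d)) h; apply: le_trans (h _) _; first by rewrite divr_ge0// ltW.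
  have -> : k / d * (e / (k ^+ 2) ^+ 2) = e / (d * k ^+ 3) by field; rewrite !gt_eqF.
  rewrite ler_pdivrMr ?mulr_gt0 ?exprn_gt0//; apply: le_trans edk _.
  by rewrite le_eqVlt; apply/orP; left; apply/eqP; field.
have h2 : d / 4 * (a - x) <= d ^+ 2 / 256.
  apply: (@le_trans _ _ (d / 4 * k)).
    apply: ler_wpM2l; first by rewrite divr_ge0// ltW.
    by move: x0 ak; clear; lra.
  have : d * (64 * k) <= d * d ^+ 3 by rewrite ler_pM2l.
  have : d * d ^+ 3 <= d ^+ 2.
    by rewrite -exprS ler_wiXn2l// ltW.
  by clear; lra.
by move: h1 h2; clear; lra.
Qed.

(** The membrane terms bound the integral of v^2 by that of 4 r^2 up to small errors, and |v| <= (2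
    / d) v^2 + d / 8 passes from v^2 to |v|. *)
Lemma pos_middle (k d e t : R) u p v b a y : small_data k d e t ->
  ebound (k ^+ 2) e u p v b ->
  k / 2 <= a -> a <= d / 8 -> d / 8 <= y -> y <= d / 4 ->
  u a ^+ 2 <= 4 * e -> u y ^+ 2 <= 4 * e ->
  itg a y (fun r => `|v r|) <= (5 / 32 + 24 * t) * d ^+ 2.
Proof.
move=> sd H ka ad dy yd ua uy.
have [[k0 d0 d1 kd] [e0 t0 t1 ed] [edk edk2 edk3]] := sd.
have [up vb _] := H.
have usq r := small_abs sd (a := u r).
have a0 : 0 < a by move: k0 ka; clear; lra.
have ay : a <= y by move: ad dy; clear; lra.
have y1 : y < 1 by move: yd d1 d0; clear; lra.
have wv := acon_within (vb _ _ a0 y1).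
have v2i : L1 a y (fun r => v r ^+ 2).
  by apply: L1_eq (L1M_cont wv (L1_cont wv)) => r _; rewrite expr2.
apply: (@le_trans _ _ (itg a y (fun r => 2 / d * v r ^+ 2 + d / 8))).
  apply: itg_le; first by apply: L1_norm; exact: L1_cont.
    by apply: L1D; [exact: L1Z|exact: L1_cst].
  move=> r _; have : 0 <= (4 * `|v r| - d) ^+ 2 / (8 * d).
    by rewrite divr_ge0 ?sqr_ge0// mulr_ge0// ltW.
  have -> : (4 * `|v r| - d) ^+ 2 / (8 * d) = 2 / d * `|v r| ^+ 2 + d / 8 - `|v r|.
    by field; rewrite !gt_eqF.
  by rewrite real_normK ?num_real//; clear; lra.
rewrite itgD; [|exact: L1Z|exact: L1_cst].
rewrite (itgZ _ v2i) itg_cst//.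
(* The constant test function 1: the integral of u disappears, and only z and the values of u at the
   two cut points remain. *)
have ga := acon_lin a y 0 1; have wg := acon_within ga.
have gM r : a <= r <= y -> `|0 * r + 1| <= 1 by move=> _; rewrite mul0r add0r normr1.
have [Ti T] := ebound_test H a0 ay y1 ga wg.
have [zi B] := ebound_z H a0 ay y1 wg gM.
have u0 : itg a y (fun r => u r * 0) = 0.
  by rewrite (itg_eq (g := fun=> 0)) ?itg_cst ?mul0r// => r _; rewrite mulr0.
rewrite u0 in T.
set Z := itg a y (fun r => (_ + _ - _) * _) in T B.
have hZ : `|Z| <= 8 * t * d ^+ 5.
  rewrite ler_norml; apply: sqr_small; first by rewrite !mulr_ge0 ?exprn_ge0// ltW.
  apply: le_trans B _; rewrite expr1n mul1r.
  apply: (@le_trans _ _ (e * (2 / k * (d / 4)))).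
    apply: ler_wpM2l; first exact: ltW.
    apply: ler_pM; first by rewrite invr_ge0 ltW.
    - by move: ay; clear; lra.
    - by rewrite -[leLHS]mul1r ler_pdivrMr// mulrAC ler_pdivlMr//; move: ka; clear; lra.
    - by move: yd a0; clear; lra.
  have -> : e * (2 / k * (d / 4)) = e * d / (2 * k) by field; rewrite gt_eqF.
  by rewrite ler_pdivrMr// mulr_gt0.
have L : itg a y (fun r => v r ^+ 2) = itg a y (fun r => 4 * r ^+ 2) -
    itg a y (fun r => (4 * r ^+ 2 - v r ^+ 2) * (0 * r + 1)).
  rewrite -itgB//; first by apply: itg_eq => r _; ring.
  have w := L1M_cont (@within_id R a y) (L1_cont (@within_id R a y)).
  by apply: L1_eq (L1Z 4 w) => r _; rewrite expr2.
have h4 : itg a y (fun r => 4 * r ^+ 2) <= d ^+ 3 / 16.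
  apply: (@le_trans _ _ (itg a y (fun r => d ^+ 2 / 4))).
    apply: itg_le; last 1 first.
    - move=> r /andP[ar ry]; have : r ^+ 2 <= (d / 4) ^+ 2.
        by rewrite lerXn2r ?nnegrE//; [move: ar a0|move: d0|move: ry yd]; clear; lra.
      by clear; lra.
    - have w := L1M_cont (@within_id R a y) (L1_cont (@within_id R a y)).
      by apply: L1_eq (L1Z 4 w) => r _; rewrite expr2.
    - exact: L1_cst.
  rewrite itg_cst//.
  have : d ^+ 2 / 4 * (y - a) <= d ^+ 2 / 4 * (d / 4).
    by apply: ler_wpM2l; [rewrite divr_ge0 ?sqr_ge0|move: yd a0; clear; lra].
  by move=> /le_trans; apply; rewrite le_eqVlt; apply/orP; left; apply/eqP; field.
have hv : itg a y (fun r => v r ^+ 2) <= (1 / 16 + 12 * t) * d ^+ 3.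
  rewrite L T.
  have := usq _ ua; have := usq _ uy; move: hZ; rewrite !ler_norml !mul0r !add0r !mulr1.
  have q1 : t * d ^+ 6 <= t * d ^+ 3 by rewrite ler_pM2l// small_pow.
  have q2 : t * d ^+ 5 <= t * d ^+ 3 by rewrite ler_pM2l// small_pow.
  by move: h4 q1 q2; clear; lra.
have -> : (5 / 32 + 24 * t) * d ^+ 2 = 2 / d * ((1 / 16 + 12 * t) * d ^+ 3) + d / 8 * (d / 4).
  by field; rewrite gt_eqF.
apply: lerD; first by rewrite ler_pM2l// divr_gt0.
by apply: ler_wpM2l; [rewrite divr_ge0// ltW|move: yd a0; clear; lra].
Qed.

(** Where v > 0 the test function 1 / (2 r + v) divides 4 r^2 - v^2 = (2 r - v) (2 r + v) exactly
    and gives 2 r - v itself. Its derivative contains v', so a product u v' appears, which the terms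
    u^2 / r and h^2 r v'^2 absorb. The constant is 304 = 32 + 192 + 16 + 64: the term with z, the
    term with u, and the two boundary terms. *)
Lemma pos_outer (k d e t : R) u p v b x y : small_data k d e t ->
  ebound (k ^+ 2) e u p v b -> (forall r, d / 16 <= r -> r < 1 -> 0 < v r) ->
  d / 16 <= x -> x <= d / 8 -> 1 / 2 <= y -> y < 1 ->
  u x ^+ 2 <= 4 * e -> u y ^+ 2 <= 64 * e / d ^+ 2 ->
  itg x y (fun r => 2 * r) - 304 * t * d ^+ 2 <= itg x y v.
Proof.
move=> sd H vpos dx xd y12 y1 ux uy.
have [[k0 d0 d1 kd] [e0 t0 t1 ed] [edk edk2 edk3]] := sd.
have [up vb _] := H.
have usq r := small_abs sd (a := u r).
have x0 : 0 < x by move: d0 dx; clear; lra.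
have xy : x <= y by move: d1 d0 xd y12; clear; lra.
have wv := acon_within (vb _ _ x0 y1).
have [bi _] := vb _ _ x0 y1; have wu := acon_within (up _ _ x0 y1).
pose f r := 2 * r + 0 + v r.
have fb : acon x y f (fun r => 2 + b r) := aconD (acon_lin x y 2 0) (vb _ _ x0 y1).
have fge r : x <= r <= y -> d / 8 <= f r.
  move=> /andP[xr ry]; have r1 : r < 1 by move: ry y1; clear; lra.
  have dr : d / 16 <= r by move: xr dx; clear; lra.
  by have := vpos _ dr r1; rewrite /f; move: dr; clear; lra.
have fpos r : x <= r <= y -> 0 < f r by move=> /fge; move: d0; clear; lra.
have ga := aconV fb fpos; have wg := acon_within ga.
have gM r : x <= r <= y -> `|(f r)^-1| <= 8 / d.
  move=> rxy; have f0 := fpos r rxy; have f0w := ltW f0; rewrite ger0_norm ?invr_ge0//.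
  rewrite -[leLHS]mul1r ler_pdivrMr// mulrAC ler_pdivlMr//.
  by have := fge r rxy; clear; lra.
have [Ti T] := ebound_test H x0 xy y1 ga wg.
have [zi B] := ebound_z H x0 xy y1 wg gM.
have E : itg x y (fun r => (4 * r ^+ 2 - v r ^+ 2) * (f r)^-1) = itg x y (fun r => 2 * r) - itg x y v.
  rewrite -itgB.
  - apply: itg_eq => r rxy; have := fpos r rxy; rewrite /f => f0.
    by field; rewrite gt_eqF//; move: f0; clear; lra.
  - by apply: L1Z; apply: L1_cont; exact: within_id.
  - exact: L1_cont.
rewrite E in T.
set Z := itg x y (fun r => (_ + _ - _) * _) in T B.
set U := itg x y (fun r => u r * _) in T.
have td n : 0 <= t * d ^+ n by rewrite mulr_ge0 ?exprn_ge0// ltW.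
have hZ : `|Z| <= 32 * t * d ^+ 4.
  rewrite ler_norml; apply: sqr_small; first by rewrite -mulrA mulr_ge0.
  apply: le_trans B _.
  apply: (@le_trans _ _ (e * (4 ^+ 5 / d ^+ 3))).
    apply: ler_wpM2l; first exact: ltW.
    have -> : 4 ^+ 5 / d ^+ 3 = (8 / d) ^+ 2 / (d / 16) * 1 by field; rewrite gt_eqF.
    apply: ler_pM => //.
    - by rewrite divr_ge0 ?sqr_ge0// ltW.
    - by move: xy; clear; lra.
    - by rewrite ler_wpM2l ?sqr_ge0// lef_pV2 ?posrE// divr_gt0.
    - by move: x0 y1; clear; lra.
  rewrite mulrA ler_pdivrMr ?exprn_gt0//.
  apply: (@le_trans _ _ ((t * d ^+ 6) ^+ 2 * 4 ^+ 5)); first by rewrite ler_wpM2r// exprn_ge0.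
  have -> : (t * d ^+ 6) ^+ 2 * 4 ^+ 5 = 4 ^+ 5 * (t ^+ 2 * d ^+ 12) by ring.
  have -> : (32 * t * d ^+ 4) ^+ 2 * d ^+ 3 = 4 ^+ 5 * (t ^+ 2 * d ^+ 11) by ring.
  by rewrite ler_wpM2l ?exprn_ge0// ler_wpM2l ?sqr_ge0// ler_wiXn2l// ltW.
have hU : `|U| <= 192 * t * d ^+ 3.
  have [_ _ /(_ x y x0 y1)[[iu ue] _ [ib be] _]] := H.
  have k20 : 0 < k ^+ 2 by rewrite exprn_gt0.
  have td5 : 0 < t * d ^+ 5 by rewrite mulr_gt0 ?exprn_gt0.
  (* Young's inequality applied to u (2 + b): weight t d^5 for the product with 2, weight k^2 for
     the product with b. The factor 64 / d^2 bounds the square of the test function. *)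
  pose M r := 64 / d ^+ 2 * (((t * d ^+ 5)^-1 + (2 * k ^+ 2)^-1) * (u r ^+ 2 / r) +
     (t * d ^+ 5 + k ^+ 2 / 2 * (r * b r ^+ 2))).
  have iM1 : L1 x y (fun r => ((t * d ^+ 5)^-1 + (2 * k ^+ 2)^-1) * (u r ^+ 2 / r)) by exact: L1Z.
  have iM2 : L1 x y (fun r => k ^+ 2 / 2 * (r * b r ^+ 2)) by exact: L1Z.
  have iM3 : L1 x y (fun=> t * d ^+ 5) by exact: L1_cst.
  have iM : L1 x y M by apply: L1Z; apply: L1D => //; exact: L1D.
  apply: (@le_trans _ _ (itg x y M)).
    apply: itg_norm_le => //.
      apply: L1_eq (L1M_cont wu (L1M_cont wg (L1M_cont wg (L1N (L1D (L1_cst x y 2) bi))))) => r _.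
      by ring.
    move=> r rxy; have r0 : 0 < r by move: rxy x0 => /andP[]; clear; lra.
    have -> : u r * (- (2 + b r) * (f r)^-1 ^+ 2) = - ((f r)^-1 ^+ 2) * (u r * (2 + b r)) by ring.
    rewrite normrM normrN normrX; apply: ler_pM => //.
      have -> : 64 / d ^+ 2 = (8 / d) ^+ 2 by field; rewrite gt_eqF.
      by rewrite lerXn2r ?nnegrE ?gM ?normr_ge0 ?divr_ge0 ?(ltW d0).
    have q1 : 0 <= (u r - t * d ^+ 5 * r) ^+ 2 / (t * d ^+ 5 * r).
      by rewrite divr_ge0 ?sqr_ge0// mulr_ge0// ltW.
    have q2 : 0 <= (u r + t * d ^+ 5 * r) ^+ 2 / (t * d ^+ 5 * r).
      by rewrite divr_ge0 ?sqr_ge0// mulr_ge0// ltW.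
    have q3 : 0 <= (u r - k ^+ 2 * r * b r) ^+ 2 / (2 * k ^+ 2 * r).
      by rewrite divr_ge0 ?sqr_ge0// !mulr_ge0// ltW.
    have q4 : 0 <= (u r + k ^+ 2 * r * b r) ^+ 2 / (2 * k ^+ 2 * r).
      by rewrite divr_ge0 ?sqr_ge0// !mulr_ge0// ltW.
    have n1 : t != 0 by rewrite gt_eqF.
    have n2 : d != 0 by rewrite gt_eqF.
    have n3 : k != 0 by rewrite gt_eqF.
    have n4 : r != 0 by rewrite gt_eqF.
    have q5 : t * d ^+ 5 * r <= t * d ^+ 5.
      by rewrite ler_piMr// ?ltW//; move: rxy y1 => /andP[]; clear; lra.
    have e1 : (u r - t * d ^+ 5 * r) ^+ 2 / (t * d ^+ 5 * r) =
       (t * d ^+ 5)^-1 * (u r ^+ 2 / r) - 2 * u r + t * d ^+ 5 * r.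
      by field; rewrite n1 n2 n4.
    have e2 : (u r + t * d ^+ 5 * r) ^+ 2 / (t * d ^+ 5 * r) =
       (t * d ^+ 5)^-1 * (u r ^+ 2 / r) + 2 * u r + t * d ^+ 5 * r.
      by field; rewrite n1 n2 n4.
    have e3 : (u r - k ^+ 2 * r * b r) ^+ 2 / (2 * k ^+ 2 * r) =
       (2 * k ^+ 2)^-1 * (u r ^+ 2 / r) - u r * b r + k ^+ 2 / 2 * (r * b r ^+ 2).
      by field; rewrite n3 n4.
    have e4 : (u r + k ^+ 2 * r * b r) ^+ 2 / (2 * k ^+ 2 * r) =
       (2 * k ^+ 2)^-1 * (u r ^+ 2 / r) + u r * b r + k ^+ 2 / 2 * (r * b r ^+ 2).
      by field; rewrite n3 n4.
    rewrite e1 in q1; rewrite e2 in q2; rewrite e3 in q3; rewrite e4 in q4.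
    by rewrite ler_norml mulrDr mulrDl; move: q1 q2 q3 q4 q5; clear; lra.
  rewrite /M itgZ; last by apply: L1D => //; exact: L1D.
  rewrite itgD//; last exact: L1D.
  rewrite (itgD iM3 iM2) (itgZ _ iu) (itgZ _ ib) itg_cst//.
  set IU := itg x y (fun r => u r ^+ 2 / r) in ue *; set IB := itg x y (fun r => r * b r ^+ 2) in be *.
  have s1 : (t * d ^+ 5)^-1 * IU <= t * d ^+ 5.
    rewrite mulrC ler_pdivrMr//; apply: le_trans ue (le_trans ed _).
    have -> : (t * d ^+ 6) ^+ 2 = t ^+ 2 * d ^+ 12 by ring.
    have -> : t * d ^+ 5 * (t * d ^+ 5) = t ^+ 2 * d ^+ 10 by ring.
    by rewrite ler_wpM2l ?sqr_ge0// ler_wiXn2l// ltW.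
  have s2 : (2 * k ^+ 2)^-1 * IU <= t * d ^+ 5 / 4.
    rewrite mulrC ler_pdivrMr ?mulr_gt0//; apply: le_trans ue _.
    have : t * d ^+ 6 * k ^+ 2 <= t * d ^+ 5 * k ^+ 2.
      by rewrite ler_pM2r// ler_pM2l// ler_wiXn2l// ltW.
    by move: edk3; clear; lra.
  have s3 : k ^+ 2 / 2 * IB <= t * d ^+ 5 / 4.
    have : k ^+ 2 * (k ^+ 2 * IB) <= k ^+ 2 * (t * d ^+ 5 / 2).
      apply: le_trans (_ : e <= _); first by move: be; rewrite mulrA -expr2.
      have : t * d ^+ 6 * k ^+ 2 <= t * d ^+ 5 * k ^+ 2.
        by rewrite ler_pM2r// ler_pM2l// ler_wiXn2l// ltW.
      by move: edk3; clear; lra.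
    by rewrite ler_pM2l//; clear; lra.
  have s4 : t * d ^+ 5 * (y - x) <= t * d ^+ 5.
    by rewrite ler_piMr// ?ltW//; move: y1 x0; clear; lra.
  have -> : 192 * t * d ^+ 3 = 64 / d ^+ 2 * (3 * (t * d ^+ 5)) by field; rewrite gt_eqF.
  apply: ler_wpM2l; first by rewrite divr_ge0 ?sqr_ge0.
  rewrite mulrDl; move: s1 s2 s3 s4 td5; clear; lra.
have hx : `|u x * (f x)^-1| <= 16 * t * d ^+ 5.
  have -> : 16 * t * d ^+ 5 = 2 * t * d ^+ 6 * (8 / d) by field; rewrite gt_eqF.
  by rewrite normrM; apply: ler_pM => //; [exact: usq _ ux|apply: gM; rewrite lexx].
have hy : `|u y * (f y)^-1| <= 64 * t * d ^+ 4.
  have -> : 64 * t * d ^+ 4 = 8 * t * d ^+ 5 * (8 / d) by field; rewrite gt_eqF.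
  rewrite normrM; apply: ler_pM => //; last by apply: gM; rewrite lexx andbT.
  rewrite ler_norml; apply: sqr_small; first by rewrite -mulrA mulr_ge0.
  apply: le_trans uy _; rewrite ler_pdivrMr ?exprn_gt0//.
  have -> : (8 * t * d ^+ 5) ^+ 2 * d ^+ 2 = 64 * (t * d ^+ 6) ^+ 2 by ring.
  by rewrite ler_pM2l.
have m n : t * d ^+ n.+2 <= t * d ^+ 2 by rewrite ler_pM2l// ler_wiXn2l// ltW.
move: hx hy hZ hU T (m 1%N) (m 2%N) (m 3%N); rewrite !ler_norml; clear; lra.
Qed.

End LowerBound3.

(** * Lower bound: existence of a zero and conclusion *)

Section LowerBound4.
Context {R : realType}.
Notation mu := (@lebesgue_measure R).
Implicit Types (x y s t : R) (f g c : R -> R).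

(** Without a sign change v stays close to 2 r, whose integral is 1. The inner and middle zones, the
    error of the outer zone and the two ends of the range lose together less than d^2 / 2, whereas
    the constraint demands a loss of d^2. *)
Lemma pos_total (k d e t : R) u p v b x y : small_data k d e t ->
  ebound (k ^+ 2) e u p v b -> (forall r, d / 16 <= r -> r < 1 -> 0 < v r) ->
  0 < x -> x <= k / 2 -> 1 - d ^+ 2 / 32 <= y -> y < 1 -> 1 - d ^+ 2 / 2 <= itg x y v.
Proof.
move=> sd H vpos x0 xk dy y1.
have [[k0 d0 d1 kd] [e0 t0 t1 ed] _] := sd.
have [up vb _] := H.
have d2 := small_pow d0 d1 (isT : (0 <= 2)%N); rewrite expr0 in d2.
have d3 := small_pow d0 d1 (isT : (1 <= 3)%N); rewrite expr1 in d3.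
have d20 : 0 < d ^+ 2 by rewrite exprn_gt0.
have [a /andP[ka ak] ua] : exists2 r, k / 2 <= r <= k & u r ^+ 2 <= 4 * e.
  apply: (ebound_pick H); first by rewrite divr_gt0.
  - by move: k0; clear; lra.
  - by move: kd d3 d1 k0 d0; clear; lra.
  - have : 0 < e * k by rewrite mulr_gt0.
    by clear; lra.
have [z /andP[dz zd] uz] : exists2 r, d / 8 <= r <= d / 4 & u r ^+ 2 <= 4 * e.
  apply: (ebound_pick H); first by rewrite divr_gt0.
  - by move: d0; clear; lra.
  - by move: d1 d0; clear; lra.
  - have : 0 < e * d by rewrite mulr_gt0.
    by clear; lra.
have [rho /andP[dr rd] ur] : exists2 r, d / 16 <= r <= d / 8 & u r ^+ 2 <= 4 * e.
  apply: (ebound_pick H); first by rewrite divr_gt0.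
  - by move: d0; clear; lra.
  - by move: d1 d0; clear; lra.
  - have : 0 < e * d by rewrite mulr_gt0.
    by clear; lra.
have [r1 /andP[dr1 rd1] ur1] : exists2 r, 1 - d ^+ 2 / 16 <= r <= 1 - d ^+ 2 / 32 & u r ^+ 2 <= 64 * e / d ^+ 2.
  apply: (ebound_pick H).
  - by move: d2; clear; lra.
  - by move: d20; clear; lra.
  - by move: d20; clear; lra.
  - have -> : 64 * e / d ^+ 2 * (1 - d ^+ 2 / 32 - (1 - d ^+ 2 / 16)) = 2 * e by field; rewrite gt_eqF.
    have : 0 < e * d ^+ 2 by rewrite mulr_gt0.
    by move: e0; clear; lra.
have r11 : r1 < 1 by move: rd1 d20; clear; lra.
have ad : a <= d / 16 by move: ak kd d3 k0; clear; lra.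
have ar : a <= rho by apply: le_trans dr.
have rz : rho <= z by apply: le_trans dz.
have a0 : 0 < a by move: ka k0; clear; lra.
have xa : x <= a by apply: le_trans ka.
have rho0 : 0 < rho by apply: lt_le_trans ar.
have rr1 : rho <= r1 by move: rd dr1 d2 d1 d0; clear; lra.
have r1y : r1 <= y by apply: le_trans dy.
have z1 : z < 1 by move: zd d1; clear; lra.
have vi : L1 x y v by apply: L1_cont; apply: acon_within; exact: vb.
have vi' x' y' : x <= x' -> y' <= y -> L1 x' y' v by move=> ? ?; exact: (L1_sub vi).
have xr : x <= rho := le_trans xa ar.
have ry : rho <= y := le_trans rr1 r1y.
have xr1 : x <= r1 := le_trans xr rr1.
have arho1 : rho < 1 := le_lt_trans rz z1.
rewrite (itg_split xa (le_trans ar ry) vi).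
rewrite (itg_split ar ry (vi' _ _ xa (lexx _))).
rewrite (itg_split rr1 r1y (vi' _ _ xr (lexx _))).
have s1 := pos_inner sd H x0 xa ak.
have n1 := itg_norm (vi' _ _ (lexx _) (le_trans ar ry)).
have s2 := pos_middle sd H ka (le_trans ad _) dz zd ua uz.
have {}s2 : itg a z (fun r => `|v r|) <= (5 / 32 + 24 * t) * d ^+ 2.
  by apply: s2; move: d0; clear; lra.
have n2 := itg_norm (vi' _ _ xa ry).
have vz : L1 a z (fun r => `|v r|).
  by apply: L1_norm; apply: L1_cont; apply: acon_within; exact: vb.
(* The middle estimate runs up to z, past the cut rho at which the outer one starts; the overlap
   costs nothing because |v| is integrated. *)
have s3 : itg a rho (fun r => `|v r|) <= itg a z (fun r => `|v r|).
  by apply: itg_sub_le.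
have s4 : 0 <= itg r1 y v.
  apply: itg_ge0 => r /andP[h1 h2]; apply/ltW/vpos; last exact: le_lt_trans y1.
  by apply: le_trans dr _; apply: le_trans rr1 h1.
have r12 : 1 / 2 <= r1 by move: dr1 d2; clear; lra.
have s5 := pos_outer sd H vpos dr rd r12 r11 ur ur1.
rewrite itg_2r// in s5.
have h1 : 1 - d ^+ 2 / 8 <= r1 ^+ 2.
  by have := sqr_ge0 (r1 - 1); move: dr1; clear; lra.
have h2 : rho ^+ 2 <= d ^+ 2 / 64.
  have -> : d ^+ 2 / 64 = (d / 8) ^+ 2 by field.
  by rewrite lerXn2r ?nnegrE// ?ltW// divr_gt0.
have td : 512 * (t * d ^+ 2) <= d ^+ 2 / 16 by have := ler_wpM2r (ltW d20) t1; clear; lra.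
move: n1 n2; rewrite ler_norml ler_norml => /andP[n1 _] /andP[n2 _].
have h3 : 0 <= t * d ^+ 2 by rewrite mulr_ge0// ltW.
move: n1 n2 h1 h2 s1 s2 s3 s4 s5 td h3 d20; clear; lra.
Qed.

(** The estimates live on compact subintervals of ]0, 1[; continuity of the integral in its
    endpoints carries them to [0, 1]. *)
Lemma itg01_ge (v : R -> R) (m al be : R) : 0 < al -> be < 1 -> L1 0 1 v ->
  (forall x y, 0 < x -> x <= al -> be <= y -> y < 1 -> m <= itg x y v) ->
  m <= itg 0 1 v.
Proof.
move=> al0 be1 vi H; apply/ler_addgt0Pr => e e0.
have [/= d1 d10 h1] : \forall c \near (0:R), 0 <= c -> `|itg 0 c v| < e / 2.
  by apply: (parameterized_integral_near_left ltr01 _ vi); rewrite divr_gt0.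
have := parameterized_integral_cvg_at_left ltr01 vi.
move=> /cvgrPdist_lt/(_ (e / 2)); rewrite divr_gt0// => /(_ isT)[/= d2 d20 h2].
pose x := Num.min al (Num.min (d1 / 2) (1 / 2)).
pose y := Num.max be (Num.max (1 - d2 / 2) (1 / 2)).
have x0 : 0 < x by rewrite !lt_min al0 !divr_gt0.
have y1 : y < 1 by rewrite !gt_max be1/=; lra.
have xal : x <= al by rewrite /x ge_min lexx.
have xd1 : x <= d1 / 2 by rewrite /x !ge_min lexx orbT.
have x12 : x <= 1 / 2 by rewrite /x !ge_min lexx !orbT.
have yb : be <= y by rewrite /y le_max lexx.
have yd2 : 1 - d2 / 2 <= y by rewrite /y !le_max lexx orbT.
have y12 : 1 / 2 <= y by rewrite /y !le_max lexx !orbT.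
have m1 := H x y x0 xal yb y1.
have a1 : `|itg 0 x v| < e / 2.
  by apply: h1 => /=; [rewrite sub0r normrN gtr0_norm//; lra|exact: ltW].
have a2 : `|itg 0 1 v - itg 0 y v| < e / 2.
  by apply: h2 => //=; rewrite gtr0_norm; lra.
have xy : x <= y by lra.
have : itg 0 y v = itg 0 x v + itg x y v.
  by apply: itg_split => //; [exact: ltW|apply: (L1_sub vi) => //; exact: ltW].
move: a1 a2 m1; rewrite !ltr_norml; clear; lra.
Qed.

(** Only v^2 and b^2 enter the energy, so a negative v can be replaced by - v. *)
Lemma ebound_opp h e u p (v b : R -> R) : ebound h e u p v b ->
  ebound h e u p (fun r => - v r) (fun r => - b r).
Proof.
move=> [up vb H]; split=> //.
  move=> x y x0 y1; have := aconZ (-1) (vb x y x0 y1).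
  under eq_fun do rewrite mulN1r.
  by under [X in acon _ _ _ X]eq_fun do rewrite mulN1r.
have E1 : (fun r => r * (p r + (- v r) ^+ 2 - 4 * r ^+ 2) ^+ 2) =
  (fun r => r * (p r + v r ^+ 2 - 4 * r ^+ 2) ^+ 2) by apply/funext => r; rewrite sqrrN.
have E2 : (fun r => r * (- b r) ^+ 2) = (fun r => r * b r ^+ 2).
  by apply/funext => r; rewrite sqrrN.
have E3 : (fun r => (- v r) ^+ 2 / r) = (fun r => v r ^+ 2 / r).
  by apply/funext => r; rewrite sqrrN.
by move=> x y x0 y1; rewrite E1 E2 E3; exact: H.
Qed.

(** The value of t is the one for which k <= d^3 / 64 and e <= d^3 k^3 / 256 give exactly e <= (t
    d^6)^2; it also makes 512 t equal to 1 / 16. *)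
Lemma small_dataE (k d e : R) : 0 < k -> 0 < d -> d <= 1 -> 64 * k <= d ^+ 3 -> 0 < e ->
  e <= d ^+ 3 * k ^+ 3 / 256 -> small_data k d e (64^-1 ^+ 2 / 2).
Proof.
move=> k0 d0 d1 kd e0 edk.
have := mulfV (_ : 64 != 0 :> R); rewrite pnatr_eq0 => /(_ isT).
have q256 : 256^-1 = 64^-1 / 4 :> R by field.
have edk0 := edk; rewrite q256 in edk.
have : 0 < 64^-1 :> R by rewrite invr_gt0 ltr0n.
move: edk; set q := 64^-1; move=> edk q0 q64.
have ked : k <= d ^+ 3 * q.
  have : q * (64 * k) <= q * d ^+ 3 by rewrite ler_pM2l.
  by rewrite mulrA (mulrC q) q64; clear; lra.
have q4 : 64 * (q * q) = q by rewrite mulrA q64 mul1r.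
have k0' : 0 <= k by exact: ltW.
have kp n : k ^+ n.+1 <= (d ^+ 3 * q) ^+ n.+1.
  by rewrite lerXn2r ?nnegrE ?(le_trans k0' ked).
have d3 : 0 < d ^+ 3 by rewrite exprn_gt0.
have q4' : 0 < q / 4 by rewrite divr_gt0.
clearbody q.
have p1 : d ^+ 3 * k ^+ 3 * (q / 4) <= d ^+ 3 * (d ^+ 3 * q) ^+ 3 * (q / 4).
  by rewrite ler_pM2r// ler_pM2l//; exact: (kp 2%N).
have p2 : (d ^+ 4 * k ^+ 2) * (k * (q / 4)) <= (d ^+ 4 * (d ^+ 3 * q) ^+ 2) * (k * (q / 4)).
  by rewrite ler_pM2r ?mulr_gt0// ler_pM2l ?exprn_gt0//; exact: (kp 1%N).
have p3 : d ^+ 3 * k ^+ 2 * (q / 2) * k <= d ^+ 3 * k ^+ 2 * (q / 2) * (d ^+ 3 * q).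
  by rewrite ler_pM2l// !mulr_gt0 ?exprn_gt0// invr_gt0.
have p4 : e * d <= d ^+ 3 * k ^+ 3 * (q / 4) * d by rewrite ler_pM2r.
have p5 : 0 <= d ^+ 4 * (d ^+ 3 * q) ^+ 2 * (k * (q / 4)).
  by rewrite !mulr_ge0 ?sqr_ge0 ?exprn_ge0// ltW.
split; split => //.
- by rewrite divr_gt0// exprn_gt0.
- by move: q4 q64; clear; lra.
- by apply: le_trans edk (le_trans p1 _); rewrite le_eqVlt; apply/orP; left; apply/eqP; field.
- have -> : (8 * (q ^+ 2 / 2) * d ^+ 5) ^+ 2 * (2 * k) =
    64 * (q * q) * (q ^+ 2 * d ^+ 10 * k / 2) by field.
  by rewrite q4; move: p4 p2 p5; clear; lra.
- have -> : q ^+ 2 / 2 * d ^+ 6 * k ^+ 2 = d ^+ 3 * k ^+ 2 * (q / 2) * (d ^+ 3 * q) by field.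
  by apply: le_trans p3; move: edk; clear; lra.
Qed.

Lemma ivt_zero (v : R -> R) x y : x <= y -> {within `[x, y], continuous v} ->
  0 < v x -> v y <= 0 -> exists2 r, x <= r <= y & v r = 0.
Proof.
move=> xy wv vx vy; have [|c cxy vc] := IVT (v := 0) xy wv.
  by rewrite ge_min vy orbT le_max ltW.
by exists c => //; move: cxy; rewrite in_itv.
Qed.

(** Without a zero v has one sign on [d / 16, 1[. If it is positive, [pos_total] makes its integral
    at least 1 - d^2 / 2, more than 1 - d^2; if it is negative, the same applied to - v makes the
    integral negative, although 1 - d^2 >= 0. *)
Lemma zero_exists (k d e : R) u p v b : 0 < k -> 0 < d -> d <= 1 -> 64 * k <= d ^+ 3 -> 0 < e ->
  e <= d ^+ 3 * k ^+ 3 / 256 -> ebound (k ^+ 2) e u p v b ->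
  L1 0 1 v -> itg 0 1 v = 1 - d ^+ 2 -> exists2 r, d / 16 <= r < 1 & v r = 0.
Proof.
move=> k0 d0 d1 kd e0 edk H vi vI.
have sd := small_dataE k0 d0 d1 kd e0 edk.
have d20 : 0 < d ^+ 2 by rewrite exprn_gt0.
have d21 : d ^+ 2 <= 1 by rewrite -(expr0 d) small_pow.
have [_ vb _] := H.
have main v' b' : ebound (k ^+ 2) e u p v' b' -> L1 0 1 v' -> 0 < v' (d / 16) ->
    (forall r, d / 16 <= r < 1 -> v' r <> 0) -> 1 - d ^+ 2 / 2 <= itg 0 1 v'.
  move=> H' v'i v'0 nz.
  have [_ v'b _] := H'.
  have v'pos r : d / 16 <= r -> r < 1 -> 0 < v' r.
    move=> dr r1; rewrite ltNge; apply/negP => v'r.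
    have wv : {within `[d / 16, r], continuous v'}.
      by apply: acon_within; apply: v'b => //; rewrite divr_gt0.
    have [s /andP[ds sr] vs] := ivt_zero dr wv v'0 v'r.
    by apply: (nz s) => //; rewrite ds (le_lt_trans sr).
  apply: (@itg01_ge _ _ (k / 2) (1 - d ^+ 2 / 32)) => //.
  - by rewrite divr_gt0.
  - by move: d20; clear; lra.
  - by move=> x y x0 xk dy y1; exact: (pos_total sd H').
apply: contrapT => /forall2NP nz.
have nz' r : d / 16 <= r < 1 -> v r <> 0 by move=> rr; case: (nz r).
have d16 : d / 16 <= d / 16 < 1 by rewrite lexx/=; move: d1; clear; lra.
have [v0|v0|v0] := ltrgtP 0 (v (d / 16)).
- by have := main v b H vi v0 nz'; rewrite vI; move: d20; clear; lra.
- have := main _ _ (ebound_opp H) (L1N vi).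
  rewrite oppr_gt0 => /(_ v0) h.
  have : 1 - d ^+ 2 / 2 <= itg 0 1 (fun t => - v t).
    by apply: h => r rr /eqP; rewrite oppr_eq0 => /eqP; exact: nz'.
  by rewrite itgN// vI; move: d20 d21; clear; lra.
- by have := nz' _ d16; rewrite -v0.
Qed.

(** The constant A serves for k^4. For the other term there are three cases: if d^3 <= 64 k it is at
    most 64 k^4; if e > d^3 k^3 / 256 the bound is immediate; otherwise v has a zero beyond d / 16,
    and [ebound_zero] applies there. *)
Lemma lower_bound : exists2 C : R, 0 < C & forall (k d e : R) u p v b,
  0 < k -> k ^+ 2 <= 1 / 2 -> 0 <= d -> d <= 1 -> 0 < e -> ebound (k ^+ 2) e u p v b ->
  L1 0 1 v -> itg 0 1 v = 1 - d ^+ 2 -> k ^+ 4 + d ^+ 3 * k ^+ 3 <= C * e.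
Proof.
pose A : R := (32 * 32) ^+ 2; pose B : R := 16 ^+ 3 * (100 * 100).
have A0 : 0 < A by rewrite /A exprn_gt0// mulr_gt0.
have B0 : 0 < B by rewrite /B !mulr_gt0// exprn_gt0.
have AE : A = (32 * 32) ^+ 2 by [].
have BE : B = 16 ^+ 3 * (100 * 100) by [].
clearbody A B.
exists (A + (64 * A + 256 + B)); first by move: A0 B0; clear; lra.
move=> k d e u p v b k0 k12 d0 d1 e0 H vi vI.
rewrite mulrDl; apply: lerD.
  have := ebound_h2 (_ : 0 < k ^+ 2) k12 H; rewrite exprn_gt0// => /(_ isT).
  by rewrite -exprM AE.
rewrite [(64 * A + 256 + B) * e]mulrDl [(64 * A + 256) * e]mulrDl.
have h2 : k ^+ 4 <= A * e.
  have := ebound_h2 (_ : 0 < k ^+ 2) k12 H; rewrite exprn_gt0// => /(_ isT).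
  by rewrite -exprM AE.
have Ae : 0 <= A * e by rewrite mulr_ge0// ltW.
have Be : 0 <= B * e by rewrite mulr_ge0// ltW.
have [kd|kd] := leP (d ^+ 3) (64 * k).
  have : d ^+ 3 * k ^+ 3 <= 64 * k * k ^+ 3 by rewrite ler_pM2r// exprn_gt0.
  have -> : 64 * k * k ^+ 3 = 64 * k ^+ 4 by ring.
  by move: Ae Be h2 e0; clear; lra.
have d00 : 0 < d.
  rewrite lt_neqAle d0 andbT eq_sym; apply/eqP => dE; move: kd; rewrite dE expr0n/=.
  by move: k0; clear; lra.
have [edk|edk] := leP e (d ^+ 3 * k ^+ 3 / 256); last by move: Ae Be edk e0; clear; lra.
have [r /andP[dr r1] vr] := zero_exists k0 d00 d1 (ltW kd) e0 edk H vi vI.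
have d3 := small_pow d00 d1 (isT : (1 <= 3)%N); rewrite expr1 in d3.
have kr : 2 * k <= r by move: dr kd d3 d00; clear; lra.
have := ebound_zero k0 kr r1 vr H.
have : (d / 16) ^+ 3 * k ^+ 3 <= r ^+ 3 * k ^+ 3.
  by rewrite ler_pM2r ?exprn_gt0// lerXn2r ?nnegrE// ?divr_ge0//; move: kr k0; clear; lra.
move=> /le_trans h /h{h}.
rewrite expr_div_n => h.
have : d ^+ 3 * k ^+ 3 <= B * e.
  rewrite BE; have -> : d ^+ 3 * k ^+ 3 = 16 ^+ 3 * (d ^+ 3 / 16 ^+ 3 * k ^+ 3) by field.
  by rewrite -[leRHS]mulrA ler_pM2l ?exprn_gt0.
by move: Ae e0; clear; lra.
Qed.

End LowerBound4.

(** * The one-dimensional energy with independent derivatives *)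

Section Energy1D.
Context {R : realType}.
Notation mu := (@lebesgue_measure R).
Notation I := (`]0%R, 1%R[%classic : set R).
Implicit Types (x y s t : R) (f g : R -> R).

Lemma mI : measurable (I : set (measurableTypeR R)).
Proof. exact: measurable_itv. Qed.

Lemma muI : mu I = 1%E.
Proof. by rewrite lebesgue_measure_itv/= lte_fin ltr01 oppr0 adde0. Qed.

Lemma invS_gt0 n : 0 < n.+2%:R^-1 :> R.
Proof. by rewrite invr_gt0 ltr0n. Qed.

Lemma near_invS (e : R) : 0 < e -> exists n, n.+2%:R^-1 < e.
Proof.
move=> e0; exists (Num.bound e^-1); rewrite invf_plt ?posrE ?ltr0n//.
apply: lt_trans (archi_boundP _) _; first by rewrite invr_ge0 ltW.
by rewrite ltr_nat.
Qed.

Lemma meas_oo f : (forall x y, 0 < x -> y < 1 -> measurable_fun `[x, y] f) ->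
  measurable_fun I f.
Proof.
move=> H; have -> : I = \bigcup_n `[n.+2%:R^-1, 1 - n.+2%:R^-1]%classic.
  rewrite eqEsubset; split=> [r|r [n _]] /=.
    rewrite in_itv/= => /andP[r0 r1].
    have m0 : 0 < Num.min r (1 - r) by rewrite lt_min r0 subr_gt0.
    have [n] := near_invS m0; rewrite lt_min => /andP[h1 h2].
    exists n => //=; rewrite in_itv/=; move: h1 h2; move: (n.+2%:R^-1) => q h1 h2.
    by apply/andP; split; lra.
  rewrite !in_itv/=; have := invS_gt0 n; move: (n.+2%:R^-1) => q; lra.
apply/measurable_fun_bigcup => [n|n]; first exact: measurable_itv.
by apply: H; [exact: invS_gt0|have := invS_gt0 n; move: (n.+2%:R^-1) => q; lra].
Qed.

Lemma integral_sub_le x y f g (e : R) : 0 < x -> y < 1 ->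
  measurable_fun I g -> measurable_fun `[x, y] f ->
  (forall r, x <= r <= y -> 0 <= f r <= g r) -> (forall r : R, 0 < r < 1 -> 0 <= g r) ->
  (\int[mu]_(r in I) (g r)%:E <= e%:E)%E -> L1 x y f /\ itg x y f <= e.
Proof.
move=> x0 y1 mg mf fg g0 ge.
have sub : `[x, y] `<=` I.
  by move=> r; rewrite /= !in_itv/= => /andP[? ?]; apply/andP; split; lra.
have fi : (\int[mu]_(r in `[x, y]) (f r)%:E <= e%:E)%E.
  apply: le_trans ge.
  apply: (@le_trans _ _ (\int[mu]_(r in `[x, y]) (g r)%:E)%E).
    apply: ge0_le_integral => //=.
    - by move=> r; rewrite in_itv/= lee_fin => /fg/andP[].
    - exact/measurable_EFinP.
    - by apply/measurable_EFinP; exact: measurable_funS mg.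
    - by move=> r; rewrite in_itv/= lee_fin => /fg/andP[].
  apply: ge0_subset_integral => //=.
  exact/measurable_EFinP.
have f0 : (0 <= \int[mu]_(r in `[x, y]) (f r)%:E)%E.
  by apply: integral_ge0 => r; rewrite /= in_itv/= lee_fin => /fg/andP[].
split.
  apply/integrableP; split; first exact/measurable_EFinP.
  apply: (le_lt_trans _ (ltry e)); apply: le_trans fi.
  apply: ge0_le_integral => //=.
  - by apply/measurable_EFinP; exact: measurableT_comp.
  - exact/measurable_EFinP.
  - by move=> r; rewrite in_itv/= lee_fin => /fg/andP[? _]; rewrite ger0_norm.
rewrite /itg /Rintegral -lee_fin fineK// ge0_fin_numE//.
exact: le_lt_trans fi (ltry _).
Qed.

(** The integrand of the energy with u', w', w'' as arguments p, v, b. The one-dimensional argument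
    can thus work with densities of absolutely continuous functions instead of the chosen
    [weak_deriv]. *)
Definition edens (h : R) (u p v b : R -> R) r :=
  u r ^+ 2 / r + r * (p r + v r ^+ 2 - 4 * r ^+ 2) ^+ 2 +
  h ^+ 2 * (r * b r ^+ 2 + v r ^+ 2 / r).

Definition E1 (h : R) (u p v b : R -> R) : \bar R := (\int[mu]_(r in I) (edens h u p v b r)%:E)%E.

Lemma ac_meas f (b : R -> R) : ac f b -> measurable_fun I f /\ measurable_fun I b.
Proof.
move=> fb; split; apply: meas_oo => x y x0 y1.
  by apply: within_meas; apply: acon_within; exact: fb.
by have [/L1_meas] := fb x y x0 y1.
Qed.

Lemma meas_inv (D : set R) : measurable (D : set (measurableTypeR R)) -> (forall r, D r -> 0 < r) -> measurable_fun D (fun r : R => r^-1).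
Proof.
move=> mD D0; suff : measurable_fun (`]0, +oo[%classic : set R) (fun r : R => r^-1).
  by apply: measurable_funS => // r /D0; rewrite /= in_itv/= andbT.
apply: open_continuous_measurable_fun; first exact: interval_open.
by move=> r; rewrite inE/= in_itv/= andbT => r0; apply: cvgV; [rewrite gt_eqF|exact: cvg_id].
Qed.

Lemma edens_ge0 (h : R) u p v b (r : R) : 0 < r < 1 -> 0 <= edens h u p v b r.
Proof.
move=> /andP[/ltW r0 _]; rewrite /edens; apply: addr_ge0.
  by apply: addr_ge0; [rewrite divr_ge0 ?sqr_ge0|rewrite mulr_ge0 ?sqr_ge0].
rewrite mulr_ge0 ?sqr_ge0//; apply: addr_ge0; last by rewrite divr_ge0 ?sqr_ge0.
by rewrite mulr_ge0 ?sqr_ge0.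
Qed.

Section Meas.
Context (u p v b : R -> R) (up : ac u p) (vb : ac v b).

Lemma meas_parts : [/\ measurable_fun I (fun r => u r ^+ 2 / r),
  measurable_fun I (fun r => r * (p r + v r ^+ 2 - 4 * r ^+ 2) ^+ 2),
  measurable_fun I (fun r => r * b r ^+ 2) & measurable_fun I (fun r => v r ^+ 2 / r)].
Proof.
have [mu' mp] := ac_meas up; have [mv mb] := ac_meas vb.
have mi : measurable_fun I (fun r : R => r^-1).
  by apply: meas_inv => // r; rewrite /= in_itv/= => /andP[].
split.
- by apply: measurable_funM => //; exact: measurable_funX.
- apply: measurable_funM; first exact: measurable_id.
  apply: measurable_funX; apply: measurable_funB; first apply: measurable_funD => //.
    exact: measurable_funX.
  apply: measurable_funM; first exact: measurable_cst.
  by apply: measurable_funX; exact: measurable_id.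
- by apply: measurable_funM; [exact: measurable_id|exact: measurable_funX].
- by apply: measurable_funM => //; exact: measurable_funX.
Qed.

Lemma meas_edens (h : R) : measurable_fun I (edens h u p v b).
Proof.
have [m1 m2 m3 m4] := meas_parts.
apply: measurable_funD; first exact: measurable_funD.
by apply: measurable_funM; [exact: measurable_cst|exact: measurable_funD].
Qed.

Lemma E1_ebound (h e : R) : 0 < h -> (E1 h u p v b <= e%:E)%E -> ebound h e u p v b.
Proof.
move=> h0 He; split=> // x y x0 y1.
have [m1 m2 m3 m4] := meas_parts.
have sub : `[x, y] `<=` I.
  by move=> r; rewrite /= !in_itv/= => /andP[? ?]; apply/andP; split; lra.
have part f : measurable_fun I f -> (forall r : R, 0 < r < 1 -> 0 <= f r <= edens h u p v b r) ->
    L1 x y f /\ itg x y f <= e.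
  move=> mf fg; apply: (integral_sub_le x0 y1 (meas_edens h)) He.
  - exact: measurable_funS mf.
  - by move=> r rxy; apply: fg; lra.
  - by move=> r; exact: edens_ge0.
have q1 r : 0 < r < 1 -> 0 <= u r ^+ 2 / r.
  by move=> ?; rewrite divr_ge0 ?sqr_ge0//; lra.
have q2 r : 0 < r < 1 -> 0 <= r * (p r + v r ^+ 2 - 4 * r ^+ 2) ^+ 2.
  by move=> ?; rewrite mulr_ge0 ?sqr_ge0//; lra.
have q3 r : 0 < r < 1 -> 0 <= r * b r ^+ 2.
  by move=> ?; rewrite mulr_ge0 ?sqr_ge0//; lra.
have q4 r : 0 < r < 1 -> 0 <= v r ^+ 2 / r.
  by move=> ?; rewrite divr_ge0 ?sqr_ge0//; lra.
have h20 : 0 < h ^+ 2 by rewrite exprn_gt0.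
have part2 f : measurable_fun I f -> (forall r : R, 0 < r < 1 -> 0 <= f r) ->
  (forall r : R, 0 < r < 1 -> h ^+ 2 * f r <= edens h u p v b r) -> L1 x y f /\ h ^+ 2 * itg x y f <= e.
  move=> mf f0 fg; have [||i1 i2] := part (fun r => h ^+ 2 * f r).
  - by apply: measurable_funM; [exact: measurable_cst|].
  - by move=> r rr; rewrite fg// mulr_ge0 ?f0// ltW.
  have fi : L1 x y f.
    by apply: L1_eq (L1Z (h ^+ 2)^-1 i1) => r _; rewrite mulrA mulVf ?mul1r// gt_eqF.
  by rewrite -itgZ.
have q5 r : 0 < r < 1 -> 0 <= h ^+ 2 * (r * b r ^+ 2).
  by move=> /q3 ?; rewrite mulr_ge0// ltW.
have q6 r : 0 < r < 1 -> 0 <= h ^+ 2 * (v r ^+ 2 / r).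
  by move=> /q4 ?; rewrite mulr_ge0// ltW.
have q r rr := (q1 r rr, q2 r rr, q5 r rr, q6 r rr).
split.
- apply: part => // r rr; rewrite q1//= /edens mulrDr; move: (q r rr) => [[[]]]; clear; lra.
- apply: part => // r rr; rewrite q2//= /edens mulrDr; move: (q r rr) => [[[]]]; clear; lra.
- apply: part2 => // r rr; rewrite /edens mulrDr; move: (q r rr) => [[[]]]; clear; lra.
- apply: part2 => // r rr; rewrite /edens mulrDr; move: (q r rr) => [[[]]]; clear; lra.
Qed.

End Meas.

(* The constraint is imposed on w' only: w is recovered as its primitive. *)
Definition adm1 (delta : R) (u p v b : R -> R) :=
  [/\ ac u p, ac v b, mu.-integrable I (EFin \o v) & \int[mu]_(r in I) v r = 1 - delta].

Lemma integrable_oo_cc x y f : mu.-integrable `]x, y[ (EFin \o f) <-> L1 x y f.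
Proof.
split=> [/integrableP[mf fi]|]; last first.
  by apply: integrableS => // r; rewrite /= !in_itv/= => /andP[? ?]; apply/andP; split; exact/ltW.
have mf' : measurable_fun (`[x, y]%classic : set R) f.
  apply/measurable_fun_itv_obnd_cbndP/measurable_fun_itv_bndo_bndcP.
  exact/measurable_EFinP.
apply/integrableP; split; first exact/measurable_EFinP.
have ma : measurable_fun (`[x, y]%classic : set R) (fun r => `|(f r)%:E|%E).
  by apply: measurableT_comp => //; exact/measurable_EFinP.
rewrite -integral_itv_obnd_cbnd; last first.
  by apply: measurable_funS ma => // r; rewrite /= !in_itv/= => /andP[/ltW -> ->].
rewrite -integral_itv_bndo_bndc//.
by apply: measurable_funS ma => // r; rewrite /= !in_itv/= => /andP[/ltW -> /ltW ->].
Qed.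

Lemma itg_oo_cc x y f : mu.-integrable `]x, y[ (EFin \o f) -> \int[mu]_(r in `]x, y[) f r = itg x y f.
Proof.
move=> fi; rewrite Rintegral_itv_bndo_bndc// Rintegral_itv_obnd_cbnd//.
have := (integrable_oo_cc _ _ f).1 fi; apply: integrableS => // r.
by rewrite /= !in_itv/= => /andP[/ltW -> ->].
Qed.

Lemma L1_eq_oo x y f g : (forall r, x < r < y -> f r = g r) -> L1 x y f -> L1 x y g.
Proof.
move=> fg /(integrable_oo_cc _ _ f).2 fi; apply: (integrable_oo_cc _ _ g).1.
apply: eq_integrable fi; first by [].
by move=> r; rewrite inE/= in_itv/= => /fg ->.
Qed.

Lemma itg_eq_oo x y f g : (forall r, x < r < y -> f r = g r) -> L1 x y f -> itg x y g = itg x y f.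
Proof.
move=> fg fi; have gi := L1_eq_oo fg fi.
rewrite -!itg_oo_cc; [|exact: (integrable_oo_cc _ _ f).2|exact: (integrable_oo_cc _ _ g).2].
by apply: eq_Rintegral => r; rewrite inE/= in_itv/= => /fg ->.
Qed.

End Energy1D.

Arguments integrable_oo_cc {R x y} f.

(** * Compactness of the derivatives w' and almost everywhere convergence *)

Section Compactness.
Context {R : realType}.
Notation mu := (@lebesgue_measure R).
Notation I := (`]0%R, 1%R[%classic : set R).
Implicit Types (x y s t : R).

(* A cluster point in the topology of pointwise convergence (Tychonoff). *)
Lemma pointwise_cluster (w : nat -> R -> R) (B : R) : (forall n r, `|w n r| <= B) ->
  exists V : R -> R, forall (F : seq R) (e : R) N, 0 < e ->
    exists2 n, (N <= n)%N & forall r, r \in F -> `|w n r - V r| < e.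
Proof.
move=> wB.
pose T := prod_topology (fun _ : R => R : topologicalType).
pose A := [set f : T | forall r, `[- B, B]%classic (f r)].
have cA : compact A := @tychonoff R (fun _ => R : topologicalType)
  (fun _ => `[- B, B]%classic) (fun _ => @segment_compact _ _ _).
pose G : set_system T := (w : nat -> T) @ \oo.
have FG : ProperFilter G by apply: fmap_proper_filter.
have GA : G A by exists 0%N => // n _ r /=; rewrite in_itv/= -ler_norml; exact: wB.
have [V [_ clV]] := cA G FG GA.
exists V => F e N e0.
have nV : nbhs (V : T) [set g : T | forall r, r \in F -> `|g r - V r| < e].
  elim: F => [|a F ih].
    by apply: filterS filterT => g _ r; rewrite in_nil.
  have : nbhs (V : T) [set g : T | `|g a - V a| < e].
    have /(_ V) := @proj_continuous R (fun _ => R : topologicalType) a.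
    move=> /(_ [set z | `|z - V a| < e]); apply.
    exists e => //= z /=; by rewrite distrC.
  apply: filterS2 ih => g h1 h2 r; rewrite in_cons => /orP[/eqP ->//|]; exact: h1.
have [g [[n /= Nn <-] h]] := clV [set g : T | exists2 n, (N <= n)%N & w n = g] _ (ltac:(exists N => // n /= Nn; exists n => //)) nV.
by exists n.
Qed.

(* Arzela-Ascoli on the half-open range: convergence is uniform away from 0. *)
Lemma equicontinuous_subseq (w : nat -> R -> R) (B : R) :
  (forall n r, 0 < r < 1 -> `|w n r| <= B) ->
  (forall a e : R, 0 < a -> 0 < e -> exists2 eta : R, 0 < eta & forall n x y,
     a <= x -> x <= y -> y < 1 -> y - x < eta -> `|w n y - w n x| <= e) ->
  exists (V : R -> R) (phi : nat -> nat), (forall k, (k <= phi k)%N) /\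
    forall k r, k.+2%:R^-1 <= r -> r < 1 -> `|w (phi k) r - V r| <= k.+2%:R^-1.
Proof.
move=> wB weq.
(* Tychonoff's theorem needs a bound at every real r; outside ]0, 1[ the values are set to 0. *)
pose w' n r := if 0 < r < 1 then w n r else 0.
have w'B n r : `|w' n r| <= `|B|.
  rewrite /w'; case: ifPn => [r01|_]; last by rewrite normr0.
  by apply: le_trans (wB n r r01) _; exact: ler_norm.
have [V hV] := pointwise_cluster w'B.
exists V.
(* For each k the cluster point supplies one index beyond k that is good on a finite grid, and
   equicontinuity extends this to all r >= 1 / (k + 2). The indices are chosen independently for
   different k. *)
suff /choice[phi hphi] : forall k, exists n, (k <= n)%N /\
    forall r, k.+2%:R^-1 <= r -> r < 1 -> `|w n r - V r| <= k.+2%:R^-1.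
  by exists phi; split=> k; have [] := hphi k.
move=> k; have := invS_gt0 (R := R) k; move: (k.+2%:R^-1) => a a0.
pose e := a / 5; have e0 : 0 < e by rewrite /e; lra.
have [eta eta0 heta] := weq a e a0 e0.
pose q := eta / 2; have q0 : 0 < q by rewrite /q; lra.
pose F := [seq a + i%:R * q | i <- iota 0 (Num.bound q^-1)].
have [n kn hn] := hV F e k e0.
exists n; split=> // r ar r1.
pose i := Num.truncn ((r - a) / q).
have ra0 : 0 <= (r - a) / q by rewrite divr_ge0 ?subr_ge0// ltW.
have /andP[i1 i2] := truncn_itv ra0; rewrite -/i in i1 i2.
pose g := a + i%:R * q.
have gr : g <= r by move: i1; rewrite ler_pdivlMr// /g; lra.
have rg : r - g < eta.
  by move: i2; rewrite ltr_pdivrMr// -natr1 mulrDl mul1r /g /q; lra.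
have ag : a <= g by rewrite /g lerDl mulr_ge0// ltW.
have gF : g \in F.
  apply/mapP; exists i => //; rewrite mem_iota add0n.
  suff : i%:R < (Num.bound q^-1)%:R :> R by rewrite ltr_nat.
  apply: le_lt_trans (archi_boundP _); last by rewrite invr_ge0 ltW.
  by apply: le_trans i1 _; rewrite ler_pdivrMr// mulVf ?gt_eqF//; lra.
have w'E m s : a <= s -> s < 1 -> w' m s = w m s.
  by move=> as_ s1; rewrite /w' s1 (lt_le_trans a0 as_).
(* Nothing is known yet about the continuity of V. A second index m, close to V at both g and r,
   transfers the common modulus to V; the triangle inequality then has five terms, whence e = a /
   5. *)
have [m _ hm] := hV [:: g; r] e 0%N e0.
have g1 : g < 1 := le_lt_trans gr r1.
have h1 := heta n g r ag gr r1 rg.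
have h2 := hn g gF; rewrite w'E// in h2.
have h3 := hm g; rewrite mem_head w'E// in h3; have {}h3 := h3 isT.
have h4 := heta m g r ag gr r1 rg.
have h5 := hm r; rewrite in_cons mem_head orbT w'E// in h5; have {}h5 := h5 isT.
move: h1 h2 h3 h4 h5; rewrite !ltr_norml !ler_norml /e; clear; lra.
Qed.

(** The series of the increments squared, weighted by 4^j, has integral at most the sum of 4^-j, so
    it is finite almost everywhere. There the increments are at most c 2^-j and the sequence is
    Cauchy. *)
Lemma ae_cvg_fast (f : nat -> R -> R) (om : R -> R) :
  (forall j, measurable_fun I (f j)) -> measurable_fun I om ->
  (forall r : R, 0 < r < 1 -> 0 < om r) ->
  (forall j, (\int[mu]_(r in I) (om r * (f j.+1 r - f j r) ^+ 2)%:E <= (16^-1 ^+ j)%:E)%E) ->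
  {ae mu, forall r, I r -> cvgn (fun j => f j r)}.
Proof.
move=> mf mo o0 Hf.
pose g j r := (4 ^+ j * (om r * (f j.+1 r - f j r) ^+ 2))%:E.
have md j : measurable_fun I (fun r => om r * (f j.+1 r - f j r) ^+ 2).
  by apply: measurable_funM => //; apply: measurable_funX; exact: measurable_funB.
have mg j : measurable_fun I (g j).
  by apply/measurable_EFinP; apply: measurable_funM; [exact: measurable_cst|exact: md].
have q0 j r : I r -> 0 <= om r * (f j.+1 r - f j r) ^+ 2.
  by rewrite /= in_itv/= => /o0/ltW h; rewrite mulr_ge0 ?sqr_ge0.
have g0 j r : I r -> (0 <= g j r)%E.
  by move=> rI; rewrite lee_fin mulr_ge0 ?exprn_ge0// q0.
have intg : (\int[mu]_(r in I) (\sum_(j <oo) g j r)%E < +oo)%E.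
  rewrite integral_nneseries//.
  apply: (@le_lt_trans _ _ (\sum_(j <oo) (geometric 1 4^-1 j)%:E)%E).
    apply: lee_nneseries => [j _ _|j _]; first by apply: integral_ge0; exact: g0.
    rewrite /g; under eq_integral do rewrite EFinM.
    rewrite ge0_integralZl_EFin ?exprn_ge0//.
    - apply: (@le_trans _ _ ((4 ^+ j)%:E * (16^-1 ^+ j)%:E)%E).
        by rewrite lee_pmul2l// lte_fin exprn_gt0.
      rewrite -EFinM lee_fin /geometric/= mul1r -exprMn.
      by have -> : 4 / 16 = 4^-1 :> R by field.
    - by move=> r rI; rewrite lee_fin q0.
    - by apply/measurable_EFinP; exact: md.
  apply: (@le_lt_trans _ _ (1 * (1 - 4^-1)^-1)%:E); last exact: ltry.
  apply: lime_le.
    by apply: is_cvg_nneseries => n _ _; rewrite lee_fin /geometric/= mul1r exprn_ge0.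
  apply: nearW => n; rewrite sumEFin lee_fin.
  have := @geometric_le_lim R n 1 4^-1; rewrite /series/=; apply => //.
  by rewrite ger0_norm// invf_lt1// ltr1n.
have mS : measurable_fun I (fun r => (\sum_(j <oo) g j r)%E).
  by apply: ge0_emeasurable_sum => // j r rI _; exact: g0.
have : mu.-integrable I (fun r => (\sum_(j <oo) g j r)%E).
  apply/integrableP; split => //.
  apply: le_lt_trans intg; rewrite le_eqVlt; apply/orP; left; apply/eqP.
  apply: eq_integral => r rI.
  rewrite gee0_abs//; apply: nneseries_ge0 => j _ _; apply: g0; exact/set_mem.
move=> /(integrable_ae mI); apply: filterS => r hr rI.
have {}hr := hr rI.
pose S := fine (\sum_(j <oo) g j r)%E.
have SE : (\sum_(j <oo) g j r)%E = S%:E by rewrite /S fineK.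
have gS j : 4 ^+ j * (om r * (f j.+1 r - f j r) ^+ 2) <= S.
  rewrite -lee_fin -SE; apply: le_trans (nneseries_lim_ge j.+1 _); last first.
    by move=> n _ _; exact: g0.
  rewrite big_nat_recr//= leeDr// sume_ge0// => i _; exact: g0.
have or : 0 < om r by apply: o0; move: rI; rewrite /= in_itv.
have S0 : 0 <= S by apply: le_trans (gS 0%N); rewrite mulr_ge0 ?exprn_ge0 ?q0.
pose c := Num.sqrt (S / om r).
have c2 : c ^+ 2 = S / om r by rewrite sqr_sqrtr// divr_ge0// ltW.
have c0 : 0 <= c by exact: sqrtr_ge0.
have dle j : `|f j.+1 r - f j r| <= geometric c 2^-1 j.
  rewrite /geometric/= -[leLHS]ger0_norm// -[leRHS]ger0_norm ?mulr_ge0 ?exprn_ge0//.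
  rewrite -ler_sqr ?nnegrE// !real_normK ?num_real//.
  have p4 : 0 < 4 ^+ j :> R by rewrite exprn_gt0.
  have -> : (c * 2^-1 ^+ j) ^+ 2 = S / om r * (4 ^+ j)^-1.
    rewrite exprMn c2 exprAC -exprVn; congr (_ * _ ^+ _); by field.
  rewrite -(ler_pM2l or) -(ler_pM2l p4).
  have -> : 4 ^+ j * (om r * (S / om r * (4 ^+ j)^-1)) = S by field; rewrite !gt_eqF.
  exact: gS.
have cs : cvgn (series (telescope (fun j => f j r))).
  apply: normed_cvg; apply: (@series_le_cvg _ _ (geometric c 2^-1)).
  - by move=> n; exact: normr_ge0.
  - by move=> n; rewrite /geometric/= mulr_ge0 ?exprn_ge0.
  - exact: dle.
  - by apply: is_cvg_geometric_series; rewrite ger0_norm// invf_lt1// ltr1n.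
have -> : (fun j => f j r) = (fun j => f 0%N r + series (telescope (fun j => f j r)) j).
  by apply/funext => j; rewrite -eq_sum_telescope.
by apply: is_cvgD => //; exact: is_cvg_cst.
Qed.

End Compactness.

(** * Limits in weighted L2 *)

Section Limits.
Context {R : realType}.
Notation mu := (@lebesgue_measure R).
Notation I := (`]0%R, 1%R[%classic : set R).
Implicit Types (x y s t : R).

Lemma ae_imp (P Q : R -> Prop) : (forall r, P r -> Q r) ->
  {ae mu, forall r, P r} -> {ae mu, forall r, Q r}.
Proof.
move=> PQ [N [mN N0 sub]]; exists N; split=> // r /= nQ; apply: sub => /= h.
exact/nQ/PQ.
Qed.

Lemma ae_and (P Q : R -> Prop) : {ae mu, forall r, P r} -> {ae mu, forall r, Q r} ->
  {ae mu, forall r, P r /\ Q r}.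
Proof. by move=> aP aQ; exact: (@filterI _ _ (ae_filter_ringOfSetsType mu) _ _ aP aQ). Qed.

Lemma fatou_le (F : nat -> R -> R) (G : R -> R) (c : nat -> R) (l : R) :
  (forall n, measurable_fun I (F n)) -> (forall n r, I r -> 0 <= F n r) ->
  measurable_fun I G -> (forall r, I r -> 0 <= G r) ->
  {ae mu, forall r, I r -> F n r @[n --> \oo] --> G r} ->
  (forall n, (\int[mu]_(r in I) (F n r)%:E <= (c n)%:E)%E) ->
  c n @[n --> \oo] --> l -> (\int[mu]_(r in I) (G r)%:E <= l%:E)%E.
Proof.
move=> mF F0 mG G0 FG Fc cl.
have mF' n : measurable_fun I (EFin \o F n) by exact/measurable_EFinP.
have F0' n r : I r -> (0 <= (EFin \o F n) r)%E by move=> /F0; rewrite lee_fin.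
have := @fatou _ _ _ mu I mI (fun n => EFin \o F n) mF' F0'.
have -> : (\int[mu]_(r in I) limn_einf (fun n => (EFin \o F n) r) = \int[mu]_(r in I) (G r)%:E)%E.
  apply: ae_eq_integral => //.
  - apply: measurableT_comp => //.
    apply: (@measurable_fun_limn_esup _ _ _ _ (fun n r => (- (EFin \o F n) r)%E)) => n.
    by apply: measurableT_comp => //; exact: mF'.
  - exact/measurable_EFinP.
  apply: ae_imp FG => r h rI.
  have : EFin (F n r) @[n --> \oo] --> (G r)%:E by apply: cvg_EFin; [exact: nearW|exact: h].
  by move/cvg_limn_einf_sup => [].
move=> /le_trans; apply.
rewrite limn_einf_lim; apply/lee_addgt0Pr => e e0.
apply: lime_le; first exact: is_cvg_einfs.
have : \forall n \near \oo, `|l - c n| < e.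
  by move: cl => /cvgrPdist_lt; apply.
apply: filterS => n hn.
apply: (@le_trans _ _ (c n)%:E); last first.
  by rewrite -EFinD lee_fin; move: hn; rewrite ltr_norml; clear; lra.
by apply: le_trans (Fc n); apply: ereal_inf_lbound; exists n => //=.
Qed.

Lemma ae_exists (P : R -> Prop) : {ae mu, forall r, I r -> P r} -> exists r, 0 < r < 1 /\ P r.
Proof.
move=> [N [mN N0 sub]]; apply: contrapT => nP.
have : (mu I <= mu N)%E.
  apply: le_measure; [by apply/mem_set; exact: mI|by apply/mem_set|].
  move=> r rI; apply: sub => /= h; apply: nP; exists r; split; last exact: h.
  by move: rI; rewrite /= in_itv.
by rewrite N0 muI leNgt lte_fin ltr01.
Qed.

Lemma cvg_geom2 (d : nat -> R) (C : R) : (forall i, d i ^+ 2 <= C * 16^-1 ^+ i) ->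
  d i @[i --> \oo] --> 0.
Proof.
move=> H.
have C0 : 0 <= C by have := H 0%N; rewrite expr0 mulr1; apply: le_trans; exact: sqr_ge0.
have h i : `|d i| <= (C + 1) * 4^-1 ^+ i.
  have q0 : 0 <= 4^-1 ^+ i :> R by rewrite exprn_ge0.
  rewrite ler_norml; apply: sqr_small; first by rewrite mulr_ge0// addr_ge0.
  apply: le_trans (H i) _.
  rewrite exprMn exprAC; have -> : 4^-1 ^+ 2 = 16^-1 :> R by field.
  rewrite ler_wpM2r ?exprn_ge0//.
  by move: C0; clear; nra.
apply/cvgr0Pnorm_le => e e0.
have : (C + 1) * 4^-1 ^+ i @[i --> \oo] --> 0.
  by apply: cvg_geometric; rewrite ger0_norm// invf_lt1// ltr1n.
move=> /cvgr0Pnorm_le/(_ e e0); apply: filterS => i; apply: le_trans.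
by apply: le_trans (h i) _; exact: ler_norm.
Qed.

(** Completeness of weighted L2, in a form that keeps the rate: the distance to the limit is bounded
    by Fatou's lemma applied to the distances between members of the sequence. *)
Lemma fast_limit (f : nat -> R -> R) (om : R -> R) :
  (forall j, measurable_fun I (f j)) -> measurable_fun I om ->
  (forall r : R, 0 < r < 1 -> 0 < om r) ->
  (forall i j, (i <= j)%N ->
    (\int[mu]_(r in I) (om r * (f j r - f i r) ^+ 2)%:E <= (16^-1 ^+ i)%:E)%E) ->
  exists g : R -> R, [/\ measurable_fun I g, {ae mu, forall r, I r -> f n r @[n --> \oo] --> g r} &
    forall i, (\int[mu]_(r in I) (om r * (f i r - g r) ^+ 2)%:E <= (16^-1 ^+ i)%:E)%E].
Proof.
move=> mf mo o0 Hf.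
have ae := ae_cvg_fast mf mo o0 (fun j => Hf j j.+1 (leqnSn j)).
(* The upper limit is measurable everywhere; its value on the null set without convergence does not
   matter. *)
pose g r := fine (limn_esup (fun n => (f n r)%:E)).
have mg : measurable_fun I g.
  apply: (measurableT_comp (f := fine)) => //.
  by apply: measurable_fun_limn_esup => n; exact/measurable_EFinP.
have fg : {ae mu, forall r, I r -> f n r @[n --> \oo] --> g r}.
  apply: ae_imp ae => r h rI; have /cvg_ex[l fl] := h rI.
  have : EFin (f n r) @[n --> \oo] --> l%:E by apply: cvg_EFin; [exact: nearW|exact: fl].
  by move=> /cvg_limn_einf_sup[_]; rewrite /g => ->.
have m2 (h k : R -> R) : measurable_fun I h -> measurable_fun I k -> measurable_fun I (fun r => om r * (h r - k r) ^+ 2).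
  by move=> mh mk; apply: measurable_funM => //; apply: measurable_funX; exact: measurable_funB.
have p2 (h k : R -> R) r : I r -> 0 <= om r * (h r - k r) ^+ 2.
  by rewrite /= in_itv/= => /o0/ltW ?; rewrite mulr_ge0 ?sqr_ge0.
exists g; split=> // i.
apply: (@fatou_le (fun n r => om r * (f i r - f (n + i)%N r) ^+ 2) _ (fun=> 16^-1 ^+ i)).
- by move=> n; exact: m2.
- by move=> n r; exact: p2.
- exact: m2.
- by move=> r; exact: p2.
- apply: ae_imp fg => r h rI; have {}h := h rI.
  apply: cvgM; first exact: cvg_cst.
  have h' : f i r - f (n + i)%N r @[n --> \oo] --> f i r - g r.
    apply: cvgB; first exact: cvg_cst.
    by have := h; rewrite -(cvg_shiftn i).
  rewrite expr2; under eq_fun do rewrite expr2.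
  exact: cvgM.
- move=> n; under eq_integral do rewrite -sqrrN opprB.
  by apply: Hf; exact: leq_addl.
- exact: cvg_cst.
Qed.

(** Cauchy-Schwarz against 1: since 1 / om is integrable on [x, y], weighted L2 convergence gives
    convergence of the integrals, hence of the increments of a primitive. *)
Lemma fast_limit_itg (f : nat -> R -> R) (g om : R -> R) x y : 0 < x -> y < 1 ->
  (forall j, measurable_fun I (f j)) -> measurable_fun I g -> measurable_fun I om ->
  (forall r : R, 0 < r < 1 -> 0 < om r) ->
  {within `[x, y], continuous (fun r => (om r)^-1)} ->
  (forall i, (\int[mu]_(r in I) (om r * (f i r - g r) ^+ 2)%:E <= (16^-1 ^+ i)%:E)%E) ->
  (forall i, L1 x y (f i)) -> L1 x y g /\ itg x y (f i) @[i --> \oo] --> itg x y g.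
Proof.
move=> x0 y1 mf mg mo o0 co Hf fi.
have sub : `[x, y] `<=` I.
  by move=> r; rewrite /= !in_itv/= => /andP[? ?]; apply/andP; split; lra.
have ms (h : R -> R) : measurable_fun I h -> measurable_fun `[x, y] h.
  by move=> mh; exact: measurable_funS mh.
have m2 i : measurable_fun I (fun r => om r * (f i r - g r) ^+ 2).
  by apply: measurable_funM => //; apply: measurable_funX; exact: measurable_funB.
have p2 i r : 0 < r < 1 -> 0 <= om r * (f i r - g r) ^+ 2.
  by move=> /o0/ltW ?; rewrite mulr_ge0 ?sqr_ge0.
have i2 : L1 x y (fun r => 1 ^+ 2 / om r).
  by apply: L1_eq (L1_cont co) => r _; rewrite expr1n mul1r.
have key i : L1 x y (fun r => f i r - g r) /\
    itg x y (fun r => f i r - g r) ^+ 2 <= itg x y (fun r => 1 ^+ 2 / om r) * 16^-1 ^+ i.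
  have [k1 k2] : L1 x y (fun r => om r * (f i r - g r) ^+ 2) /\
      itg x y (fun r => om r * (f i r - g r) ^+ 2) <= 16^-1 ^+ i.
    apply: (integral_sub_le x0 y1 (m2 i)) (Hf i); first exact: ms.
      by move=> r /andP[xr ry]; rewrite lexx andbT p2//; lra.
    by move=> r; exact: p2.
  have [] := itg_weighted_cs (om := om) (f := fun r => f i r - g r) (g := fun=> 1) _ _ _ _ k1 i2.
  - exact: ms.
  - by apply: ms; exact: measurable_funB.
  - exact: measurable_cst.
  - by move=> r /andP[xr ry]; apply: o0; lra.
  move=> k3 k4; split; first by apply: L1_eq k3 => r _; rewrite mulr1.
  move: k4; under [X in X ^+ 2]itg_eq do rewrite mulr1.
  move=> /le_trans; apply; rewrite mulrC ler_wpM2l//.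
  by apply: itg_ge0 => r /andP[xr ry]; rewrite divr_ge0 ?sqr_ge0// ltW// o0//; lra.
have gi : L1 x y g.
  have [k1 _] := key 0%N.
  by apply: L1_eq (L1B (fi 0%N) k1) => r _; ring.
split=> //.
have h : itg x y (f i) - itg x y g @[i --> \oo] --> 0.
  apply: (@cvg_geom2 _ (itg x y (fun r => 1 ^+ 2 / om r))) => i.
  by have [_] := key i; rewrite itgB.
have : itg x y (f i) - itg x y g + itg x y g @[i --> \oo] --> 0 + itg x y g.
  by apply: cvgD => //; exact: cvg_cst.
by rewrite add0r; under eq_fun do rewrite subrK.
Qed.
End Limits.

(** * Limit of a minimising sequence *)

Section LimitState.
Context {R : realType}.
Notation mu := (@lebesgue_measure R).
Notation I := (`]0%R, 1%R[%classic : set R).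
Implicit Types (x y s t : R).

Record state := State { su : R -> R; sp : R -> R; sv : R -> R; sb : R -> R }.

Definition sz (X : state) r := sp X r + sv X r ^+ 2 - 4 * r ^+ 2.

Definition adms (delta : R) X := adm1 delta (su X) (sp X) (sv X) (sb X).

Definition sE (h : R) X := E1 h (su X) (sp X) (sv X) (sb X).

(** The energy is the square of a norm in the variables (u, z, b, v), with z in place of u'; this is
    the density of the squared distance in that norm. *)
Definition qd (h : R) X Y r := (su X r - su Y r) ^+ 2 / r + r * (sz X r - sz Y r) ^+ 2 +
  h ^+ 2 * (r * (sb X r - sb Y r) ^+ 2 + (sv X r - sv Y r) ^+ 2 / r).

Lemma near_invS_le (e : R) : 0 < e -> \forall n \near \oo, n.+2%:R^-1 <= e.
Proof.
move=> e0; have [N hN] := near_invS e0; exists N => // n /= Nn.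
apply: le_trans (ltW hN); rewrite lef_pV2 ?posrE ?ltr0n//.
by rewrite ler_nat !ltnS.
Qed.

Lemma cvg_invS (d : nat -> R) (C : R) : (\forall n \near \oo, `|d n| <= C * n.+2%:R^-1) ->
  d n @[n --> \oo] --> 0.
Proof.
move=> H; apply/cvgr0Pnorm_le => e e0.
have C0 : 0 < `|C| + 1 by rewrite ltr_wpDl.
have : \forall n \near \oo, n.+2%:R^-1 <= e / (`|C| + 1).
  by apply: near_invS_le; rewrite divr_gt0.
apply: filterS2 H => n h1 h2; apply: le_trans h1 _.
move: h2; rewrite ler_pdivlMr// => h2; apply: le_trans h2.
rewrite mulrC ler_wpM2l ?invr_ge0//.
by apply: le_trans (ler_norm C) _; rewrite lerDl.
Qed.

Lemma cvg_of_diff0 (d : nat -> R) (l : R) : d n - l @[n --> \oo] --> 0 -> d n @[n --> \oo] --> l.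
Proof.
move=> h; have : d n - l + l @[n --> \oo] --> 0 + l by apply: cvgD => //; exact: cvg_cst.
by rewrite add0r; under eq_fun do rewrite subrK.
Qed.

Lemma qd_parts (h : R) X Z (r : R) : 0 < r < 1 ->
  [/\ r^-1 * (su X r - su Z r) ^+ 2 <= qd h X Z r, r * (sz X r - sz Z r) ^+ 2 <= qd h X Z r,
      (h ^+ 2 * r) * (sb X r - sb Z r) ^+ 2 <= qd h X Z r & 0 <= qd h X Z r].
Proof.
move=> /andP[/ltW r0 _]; have h20 : 0 <= h ^+ 2 by exact: sqr_ge0.
have ri0 : 0 <= r^-1 by rewrite invr_ge0.
have q1 : 0 <= r^-1 * (su X r - su Z r) ^+ 2 by apply: mulr_ge0 => //; exact: sqr_ge0.
have q2 : 0 <= r * (sz X r - sz Z r) ^+ 2 by apply: mulr_ge0 => //; exact: sqr_ge0.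
have q3 : 0 <= h ^+ 2 * r * (sb X r - sb Z r) ^+ 2.
  by apply: mulr_ge0; [apply: mulr_ge0|exact: sqr_ge0].
have q4 : 0 <= h ^+ 2 * ((sv X r - sv Z r) ^+ 2 / r).
  by apply: mulr_ge0 => //; apply: mulr_ge0 => //; exact: sqr_ge0.
have -> : qd h X Z r = r^-1 * (su X r - su Z r) ^+ 2 + r * (sz X r - sz Z r) ^+ 2 +
  h ^+ 2 * r * (sb X r - sb Z r) ^+ 2 + h ^+ 2 * ((sv X r - sv Z r) ^+ 2 / r).
  by rewrite /qd; ring.
by move: q1 q2 q3 q4; clear; split; lra.
Qed.

Lemma lim_eq (f g : nat -> R) (a b : R) : f n @[n --> \oo] --> a -> g n @[n --> \oo] --> b ->
  (forall n, f n = g n) -> a = b.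
Proof.
move=> fa gb fg; have E : f = g by apply/funext.
by move: fa; rewrite E => fa; exact: (cvg_unique (@Rhausdorff R) fa gb).
Qed.

Section Limit.
Context (h delta m B : R) (Y : nat -> state) (V : R -> R) (c : nat -> R).
Hypotheses (h0 : 0 < h) (Yadm : forall j, adms delta (Y j))
  (YE : forall j, (sE h (Y j) <= (c j)%:E)%E) (cm : c n @[n --> \oo] --> m)
  (YQ : forall i j, (i <= j)%N -> (\int[mu]_(r in I) (qd h (Y j) (Y i) r)%:E <= (16^-1 ^+ i)%:E)%E)
  (YB : forall j (r : R), 0 < r < 1 -> `|sv (Y j) r| <= B)
  (YV : forall j r, j.+2%:R^-1 <= r -> r < 1 -> `|sv (Y j) r - V r| <= j.+2%:R^-1).

Let up j : ac (su (Y j)) (sp (Y j)). Proof. by have [] := Yadm j. Qed.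
Let vb j : ac (sv (Y j)) (sb (Y j)). Proof. by have [] := Yadm j. Qed.

Let mY j : [/\ measurable_fun I (su (Y j)), measurable_fun I (sz (Y j)),
  measurable_fun I (sv (Y j)) & measurable_fun I (sb (Y j))].
Proof.
have [mu' mp] := ac_meas (up j); have [mv mb] := ac_meas (vb j); split => //.
apply: measurable_funB; first apply: measurable_funD => //.
  exact: measurable_funX.
apply: measurable_funM; first exact: measurable_cst.
by apply: measurable_funX; exact: measurable_id.
Qed.

Let mid : measurable_fun I (fun r : R => r). Proof. exact: measurable_id. Qed.

Let minv : measurable_fun I (fun r : R => r^-1).
Proof. by apply: meas_inv => // r; rewrite /= in_itv/= => /andP[]. Qed.

Lemma meas_qd i j : measurable_fun I (qd h (Y j) (Y i)).
Proof.
have [m1 m2 m3 m4] := mY i; have [n1 n2 n3 n4] := mY j.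
apply: measurable_funD; first apply: measurable_funD.
- by apply: measurable_funM => //; apply: measurable_funX; exact: measurable_funB.
- by apply: measurable_funM => //; apply: measurable_funX; exact: measurable_funB.
- apply: measurable_funM; first exact: measurable_cst.
  apply: measurable_funD; apply: measurable_funM => //.
    by apply: measurable_funX; exact: measurable_funB.
  by apply: measurable_funX; exact: measurable_funB.
Qed.

Let part (f : state -> R -> R) (om : R -> R) : (forall j, measurable_fun I (f (Y j))) ->
  measurable_fun I om -> (forall r : R, 0 < r < 1 -> 0 < om r) ->
  (forall X Z (r : R), 0 < r < 1 -> om r * (f X r - f Z r) ^+ 2 <= qd h X Z r) ->
  forall i j, (i <= j)%N ->
    (\int[mu]_(r in I) (om r * (f (Y j) r - f (Y i) r) ^+ 2)%:E <= (16^-1 ^+ i)%:E)%E.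
Proof.
move=> mf mo o0 le i j ij; apply: le_trans (YQ ij).
apply: ge0_le_integral.
- exact: mI.
- by move=> r; rewrite /= in_itv/= => /o0/ltW ?; rewrite lee_fin mulr_ge0 ?sqr_ge0.
- apply/measurable_EFinP; apply: measurable_funM => //; apply: measurable_funX.
  by apply: measurable_funB; exact: mf.
- by apply/measurable_EFinP; exact: meas_qd.
- by move=> r; rewrite /= in_itv/= lee_fin; exact: le.
Qed.

Let Vcvg (r : R) : 0 < r < 1 -> sv (Y n) r @[n --> \oo] --> V r.
Proof.
move=> /andP[r0 r1]; apply: cvg_of_diff0; apply: (@cvg_invS _ 1).
by apply: filterS (near_invS_le r0) => n hn; rewrite mul1r; exact: YV.
Qed.

Let V_le (r : R) : 0 < r < 1 -> `|V r| <= B + 1.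
Proof.
move=> /andP[r0 r1]; have [n hn] := near_invS r0.
have := YV (ltW hn) r1; have := @YB n r; rewrite r0 r1 => /(_ isT).
have : n.+2%:R^-1 <= 1 :> R by rewrite invf_le1 ?ltr0n// ler1n.
move: (n.+2%:R^-1) => q; rewrite !ler_norml; lra.
Qed.

Let itgv2 x y : 0 < x -> x <= y -> y < 1 -> {within `[x, y], continuous V} ->
  itg x y (fun r => sv (Y n) r ^+ 2) @[n --> \oo] --> itg x y (fun r => V r ^+ 2).
Proof.
move=> x0 xy y1 cV; apply: cvg_of_diff0.
have cvn n := acon_within (@vb n x y x0 y1).
have i1 n : L1 x y (fun r => sv (Y n) r ^+ 2).
  by apply: L1_eq (L1M_cont (cvn n) (L1_cont (cvn n))) => r _; rewrite expr2.
have i2 : L1 x y (fun r => V r ^+ 2).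
  by apply: L1_eq (L1M_cont cV (L1_cont cV)) => r _; rewrite expr2.
apply: (@cvg_invS _ (2 * B + 1)).
apply: filterS (near_invS_le x0) => n hn.
rewrite -itgB//.
have B0 : 0 <= 2 * B + 1.
  have x01 : 0 < x < 1 by rewrite x0 (le_lt_trans xy).
  have := YB n x01; have := normr_ge0 (sv (Y n) x); lra.
have q0 : 0 <= n.+2%:R^-1 :> R by rewrite invr_ge0.
apply: (@le_trans _ _ (itg x y (fun=> (2 * B + 1) * n.+2%:R^-1))).
  apply: itg_norm_le; [exact: L1B|exact: L1_cst|].
  move=> r /andP[xr ry]; have r01 : 0 < r < 1 by rewrite (lt_le_trans x0)//= (le_lt_trans ry).
  have := YB n r01; have := V_le r01; have := YV (le_trans hn xr) (le_lt_trans ry y1).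
  rewrite subr_sqr normrM mulrC => h1 h2 h3; apply: ler_pM => //.
  by apply: le_trans (ler_normD _ _) _; lra.
rewrite itg_cst// ler_piMr//; first exact: mulr_ge0.
by rewrite lerBlDr; move: x0 y1; lra.
Qed.

Lemma limit_state : exists X, adms delta X /\ (sE h X <= m%:E)%E.
Proof.
have h20 : 0 < h ^+ 2 by rewrite exprn_gt0.
have pu X Z (r : R) : 0 < r < 1 -> r^-1 * (su X r - su Z r) ^+ 2 <= qd h X Z r.
  by move=> /(qd_parts h X Z)[].
have pz X Z (r : R) : 0 < r < 1 -> r * (sz X r - sz Z r) ^+ 2 <= qd h X Z r.
  by move=> /(qd_parts h X Z)[].
have pb X Z (r : R) : 0 < r < 1 -> (h ^+ 2 * r) * (sb X r - sb Z r) ^+ 2 <= qd h X Z r.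
  by move=> /(qd_parts h X Z)[].
have ou (r : R) : 0 < r < 1 -> 0 < r^-1 by move=> /andP[? _]; rewrite invr_gt0.
have oz (r : R) : 0 < r < 1 -> 0 < r by move=> /andP[].
have ob (r : R) : 0 < r < 1 -> 0 < h ^+ 2 * r by move=> /andP[? _]; rewrite mulr_gt0.
have m1 j : measurable_fun I (su (Y j)) by have [] := mY j.
have m2 j : measurable_fun I (sz (Y j)) by have [] := mY j.
have m3 j : measurable_fun I (sv (Y j)) by have [] := mY j.
have m4 j : measurable_fun I (sb (Y j)) by have [] := mY j.
have mhr : measurable_fun I (fun r : R => h ^+ 2 * r).
  by apply: measurable_funM => //; exact: measurable_cst.
have [u0 [_ u0c _]] := fast_limit m1 minv ou (part m1 minv ou pu).
have [z [mz zc zL]] := fast_limit m2 mid oz (part m2 mid oz pz).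
have [b [mb bc bL]] := fast_limit m4 mhr ob (part m4 mhr ob pb).
have bi x y : 0 < x -> y < 1 -> L1 x y b /\ itg x y (sb (Y i)) @[i --> \oo] --> itg x y b.
  move=> x0 y1; apply: (fast_limit_itg x0 y1 m4 mb mhr ob _ bL).
    apply: continuous_in_subspaceT => r; rewrite inE/= in_itv/= => /andP[xr _].
    apply: cvgV; first by rewrite gt_eqF// mulr_gt0// (lt_le_trans x0 xr).
    by apply: cvgM; [exact: cvg_cst|exact: cvg_id].
  by move=> i; have [] := @vb i x y x0 y1.
have zi x y : 0 < x -> y < 1 -> L1 x y z /\ itg x y (sz (Y i)) @[i --> \oo] --> itg x y z.
  move=> x0 y1; apply: (fast_limit_itg x0 y1 m2 mz mid oz _ zL).
    exact: within_invr.
  move=> i; have [pi _] := @up i x y x0 y1; have cv := acon_within (@vb i x y x0 y1).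
  have w := L1M_cont (@within_id R x y) (L1_cont (@within_id R x y)).
  by apply: L1_eq (L1B (L1D pi (L1M_cont cv (L1_cont cv))) (L1Z 4 w)) => r _; rewrite /sz !expr2.
have Vb : ac V b.
  move=> x y x0 y1; have [bxy _] := bi x y x0 y1; split=> // s t xs st ty.
  have s0 : 0 < s := lt_le_trans x0 xs.
  have t1 : t < 1 := le_lt_trans ty y1.
  have [_ c1] := bi s t s0 t1.
  have c2 : sv (Y n) t - sv (Y n) s @[n --> \oo] --> V t - V s.
    by apply: cvgB; apply: Vcvg; rewrite ?s0 ?t1 ?(le_lt_trans st)// (lt_le_trans s0).
  by apply: (lim_eq c2 c1) => n; have [_ ->] := @vb n x y x0 y1.
(* The derivatives of u are not known to converge in L2, only the z do; the limit of u' is read off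
   from z and V. *)
pose p r := z r - V r ^+ 2 + 4 * r ^+ 2.
have pi x y : 0 < x -> y < 1 -> L1 x y p /\ (x <= y -> itg x y (sp (Y i)) @[i --> \oo] --> itg x y p).
  move=> x0 y1; have [z1 z2] := zi x y x0 y1.
  have cV := acon_within (Vb x y x0 y1).
  have w : L1 x y (fun r => 4 * r ^+ 2).
    have w := L1M_cont (@within_id R x y) (L1_cont (@within_id R x y)).
    by apply: L1_eq (L1Z 4 w) => r _; rewrite expr2.
  have V2 : L1 x y (fun r => V r ^+ 2).
    by apply: L1_eq (L1M_cont cV (L1_cont cV)) => r _; rewrite expr2.
  split; first by apply: L1D => //; exact: L1B.
  move=> xy; rewrite /p itgD ?itgB//; last exact: L1B.
  have E n : itg x y (sp (Y n)) = itg x y (sz (Y n)) - itg x y (fun r => sv (Y n) r ^+ 2) +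
      itg x y (fun r => 4 * r ^+ 2).
    have [pn _] := @up n x y x0 y1; have cv := acon_within (@vb n x y x0 y1).
    have v2 : L1 x y (fun r => sv (Y n) r ^+ 2).
      by apply: L1_eq (L1M_cont cv (L1_cont cv)) => r _; rewrite expr2.
    have zn : L1 x y (sz (Y n)) by apply: L1B => //; exact: L1D.
    rewrite -itgB// -itgD//; last exact: L1B.
    by apply: itg_eq => r _; rewrite /sz; ring.
  under eq_fun do rewrite E.
  by apply: cvgD; [apply: cvgB => //; exact: itgv2|exact: cvg_cst].
(* The functions u converge only almost everywhere. One point a of convergence fixes the constant,
   and u is redefined as a primitive of p; convergence then holds at every radius in ]0, 1[. *)
have [a [/andP[a0 a1] ac0]] := ae_exists u0c.
pose u r := u0 a + (if a <= r then itg a r p else - itg r a p).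
have uc (r : R) : 0 < r < 1 -> su (Y n) r @[n --> \oo] --> u r.
  move=> /andP[r0 r1]; rewrite /u; case: (leP a r) => ar.
    have [_ /(_ ar) c1] := pi a r a0 r1.
    have : su (Y n) a + itg a r (sp (Y n)) @[n --> \oo] --> u0 a + itg a r p by exact: cvgD.
    apply: cvg_trans; apply: near_eq_cvg; apply: nearW => n.
    have [_ /(_ a r (lexx _) ar (lexx _))] := @up n a r a0 r1; rewrite /=; lra.
  have [_ /(_ (ltW ar)) c1] := pi r a r0 a1.
  have : su (Y n) a - itg r a (sp (Y n)) @[n --> \oo] --> u0 a - itg r a p by exact: cvgB.
  apply: cvg_trans; apply: near_eq_cvg; apply: nearW => n.
  have [_ /(_ r a (lexx _) (ltW ar) (lexx _))] := @up n r a r0 a1; rewrite /=; lra.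
have upp : ac u p.
  move=> x y x0 y1; have [pxy _] := pi x y x0 y1; split=> // s t xs st ty.
  have s0 : 0 < s := lt_le_trans x0 xs.
  have t1 : t < 1 := le_lt_trans ty y1.
  have [_ /(_ st) c1] := pi s t s0 t1.
  have c2 : su (Y n) t - su (Y n) s @[n --> \oo] --> u t - u s.
    by apply: cvgB; apply: uc; rewrite ?s0 ?t1 ?(le_lt_trans st)// (lt_le_trans s0).
  by apply: (lim_eq c2 c1) => n; have [_ ->] := @up n x y x0 y1.
have [mu' mp] := ac_meas upp; have [mV _] := ac_meas Vb.
exists (State u p V b); split.
(* The constant B dominates all the v, so the constraint on the integral of w' passes to the
   limit. *)
- have [Vi Vc] : mu.-integrable I (EFin \o V) /\
      (fun n => \int[mu]_(r in I) (sv (Y n) r)%:E)%E @ \oo --> (\int[mu]_(r in I) (V r)%:E)%E.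
    have [] := @dominated_convergence _ _ _ mu I mI (fun n => EFin \o sv (Y n)) (EFin \o V) (fun=> B%:E).
    + by move=> n; apply/measurable_EFinP; exact: m3.
    + by apply/measurable_EFinP; exact: mV.
    + exists set0; split=> // r /= /not_implyP[]; rewrite in_itv/= => r01 []; apply: cvg_EFin; [exact: nearW|exact: Vcvg].
    + exact: (@integrable_oo_cc R 0 1 (fun=> B)).2 (L1_cst 0 1 B).
    + exists set0; split=> // r /= nh; apply: nh => n; rewrite in_itv/= => r01.
      by rewrite lee_fin; exact: YB.
    by [].
  split=> //.
  have : (fun=> (1 - delta)%:E) n @[n --> \oo] --> (\int[mu]_(r in I) (V r)%:E)%E.
    apply: cvg_trans Vc; apply: near_eq_cvg; apply: nearW => n.
    have [_ _ vi vI] := Yadm n; rewrite -vI /Rintegral fineK//.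
    exact: (integrable_fin_num mI vi).
  move=> /(cvg_unique _ (cvg_cst _)) => /(_ (@ereal_hausdorff R)) hV.
  by rewrite /= /Rintegral -hV.
- apply: (fatou_le _ _ _ _ _ YE cm).
  + by move=> n; exact: meas_edens.
  + by move=> n r; rewrite /= in_itv/=; exact: edens_ge0.
  + exact: meas_edens.
  + by move=> r; rewrite /= in_itv/=; exact: edens_ge0.
  apply: ae_imp (ae_and zc bc) => r [zr br] rI.
  have {}zr := zr rI; have {}br := br rI.
  have r01 : 0 < r < 1 by move: rI; rewrite /= in_itv.
  have sq (f : nat -> R) (l : R) : f n @[n --> \oo] --> l -> f n ^+ 2 @[n --> \oo] --> l ^+ 2.
    by move=> fl; rewrite expr2; under eq_fun do rewrite expr2; exact: cvgM.
  rewrite /edens /= /p.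
  have -> : z r - V r ^+ 2 + 4 * r ^+ 2 + V r ^+ 2 - 4 * r ^+ 2 = z r by ring.
  apply: cvgD; first apply: cvgD.
  * by apply: cvgM; [exact/sq/uc|exact: cvg_cst].
  * by apply: cvgM; [exact: cvg_cst|exact: sq].
  * apply: cvgM; first exact: cvg_cst.
    apply: cvgD; first by apply: cvgM; [exact: cvg_cst|exact: sq].
    by apply: cvgM; [exact/sq/Vcvg|exact: cvg_cst].
Qed.

End Limit.
End LimitState.

(** * Existence of a minimiser in one dimension *)

Section Minimizer.
Context {R : realType}.
Notation mu := (@lebesgue_measure R).
Notation I := (`]0%R, 1%R[%classic : set R).
Notation state := (@state R).
Implicit Types (x y s t h : R) (X Y Z : state).

(** The derivative 2 v v' of v^2 is dominated by v^2 / r + r v'^2, so v^2 varies by at most 2 K with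
    K = e / h^2. At some point of [1/2, 3/4] it is at most 8 K, by the bound on the integral of v^2
    / r. *)
Lemma ebound_v_sup h e u p v b : 0 < h -> 0 < e -> @ebound R h e u p v b ->
  forall r : R, 0 < r < 1 -> v r ^+ 2 <= 10 * e / h ^+ 2.
Proof.
move=> h0 e0 H r /andP[r0 r1]; have [_ vb H'] := H.
have h20 : 0 < h ^+ 2 by rewrite exprn_gt0.
pose K := e / h ^+ 2.
have K0 : 0 < K by rewrite divr_gt0.
have var x y : 0 < x -> x <= y -> y < 1 -> `|v y ^+ 2 - v x ^+ 2| <= 2 * K.
  move=> x0 xy y1; have [_ _ [ib be] [iv ve]] := H' x y x0 y1.
  have vxy := vb x y x0 y1; have wv := acon_within vxy.
  have [Li /(_ x y (lexx _) xy (lexx _))] := aconM vxy vxy.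
  rewrite !expr2 => ->.
  apply: (@le_trans _ _ (itg x y (fun r => v r ^+ 2 / r + r * b r ^+ 2))).
    apply: itg_norm_le => //; first exact: L1D.
    move=> q /andP[xq qy]; have q0 : 0 < q by exact: lt_le_trans xq.
    have e1 : 0 <= (v q - q * b q) ^+ 2 / q by rewrite divr_ge0 ?sqr_ge0// ltW.
    have e2 : 0 <= (v q + q * b q) ^+ 2 / q by rewrite divr_ge0 ?sqr_ge0// ltW.
    have n0 : q != 0 by rewrite gt_eqF.
    have e1' : (v q - q * b q) ^+ 2 / q = v q ^+ 2 / q + q * b q ^+ 2 - 2 * (v q * b q) by field.
    have e2' : (v q + q * b q) ^+ 2 / q = v q ^+ 2 / q + q * b q ^+ 2 + 2 * (v q * b q) by field.
    by rewrite ler_norml; move: e1 e2; rewrite e1' e2'; clear; lra.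
  rewrite itgD//.
  have : itg x y (fun r => v r ^+ 2 / r) <= K by rewrite ler_pdivlMr// mulrC.
  have : itg x y (fun r => r * b r ^+ 2) <= K by rewrite ler_pdivlMr// mulrC.
  by clear; lra.
have [x0 /andP[h1 h2] hx] : exists2 q : R, 1 / 2 <= q <= 3 / 4 & v q ^+ 2 <= 8 * K.
  apply: contrapT => /forall2NP nC.
  have h12 : 0 < 1 / 2 :> R by [].
  have h34 : 3 / 4 < 1 :> R by clear; lra.
  have le34 : 1 / 2 <= 3 / 4 :> R by clear; lra.
  have [_ _ _ [iv ve]] := H' (1 / 2) (3 / 4) h12 h34.
  have : itg (1 / 2) (3 / 4) (fun r => v r ^+ 2 / r) <= K by rewrite ler_pdivlMr// mulrC.
  have : itg (1 / 2) (3 / 4) (fun=> 8 * K) <= itg (1 / 2) (3 / 4) (fun r => v r ^+ 2 / r).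
    apply: itg_le => //; first exact: L1_cst.
    move=> q qq; have [//|/negP] := nC q; rewrite -ltNge => /ltW Cr.
    have q0 : 0 < q by move: qq; clear; lra.
    apply: le_trans Cr _; rewrite ler_peMr ?sqr_ge0//.
    by rewrite invf_ge1//; move: qq; clear; lra.
  by rewrite itg_cst//; move: K0; clear; lra.
rewrite -mulrA -/K.
have [rx|/ltW rx] := leP r x0.
  have := var r x0 r0 rx (_ : x0 < 1); rewrite ler_norml => vv.
  have /vv : x0 < 1 by move: h2; clear; lra.
  by move: hx; clear; lra.
have := var x0 r (_ : 0 < x0) rx r1; rewrite ler_norml => vv.
have /vv : 0 < x0 by move: h1; clear; lra.
by move: hx; clear; lra.
Qed.

Definition mid X Y := State (fun r => (su X r + su Y r) / 2) (fun r => (sp X r + sp Y r) / 2)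
  (fun r => (sv X r + sv Y r) / 2) (fun r => (sb X r + sb Y r) / 2).

Lemma mid_adm (delta : R) X Y : adms delta X -> adms delta Y -> adms delta (mid X Y).
Proof.
move=> [ux vx ix Ix] [uy vy iy Iy].
have half (f b g c : R -> R) : ac f b -> ac g c ->
    ac (fun r => (f r + g r) / 2) (fun r => (b r + c r) / 2).
  move=> fb gc; have := acZ 2^-1 (acD fb gc).
  under eq_fun do rewrite mulrC.
  by under [X in ac _ X]eq_fun do rewrite mulrC.
have Lx := (integrable_oo_cc _).1 ix; have Ly := (integrable_oo_cc _).1 iy.
have i2 : L1 0 1 (fun r => (sv X r + sv Y r) / 2).
  by apply: L1_eq (L1Z 2^-1 (L1D Lx Ly)) => r _; rewrite mulrC.
have i3 : mu.-integrable I (EFin \o (fun r => (sv X r + sv Y r) / 2)).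
  exact: (integrable_oo_cc _).2.
split; [exact: half|exact: half|exact: i3|].
rewrite itg_oo_cc//.
have -> : itg 0 1 (fun r => (sv X r + sv Y r) / 2) = 2^-1 * itg 0 1 (fun r => sv X r + sv Y r).
  by rewrite -itgZ; [apply: itg_eq => r _; rewrite mulrC|exact: L1D].
have Jx : itg 0 1 (sv X) = 1 - delta by rewrite -itg_oo_cc.
have Jy : itg 0 1 (sv Y) = 1 - delta by rewrite -itg_oo_cc.
by rewrite (itgD Lx Ly) Jx Jy; field.
Qed.

(** The parallelogram identity is exact in u, v, b. The z of the midpoint is the mean of the two z
    minus w = (v1 - v2)^2 / 4, and Young's inequality with parameter th separates this error: a
    factor 1 + th on the energies and the remainder (1 + 1 / th) tau / 16. *)
Lemma mid_pointwise h (th tau : R) X Y (r : R) : 0 < r < 1 -> 0 < th ->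
  r * (sv X r - sv Y r) ^+ 4 <= tau ->
  edens h (su (mid X Y)) (sp (mid X Y)) (sv (mid X Y)) (sb (mid X Y)) r + 4^-1 * qd h X Y r <=
  (1 + th) / 2 * edens h (su X) (sp X) (sv X) (sb X) r +
  (1 + th) / 2 * edens h (su Y) (sp Y) (sv Y) (sb Y) r + (1 + th^-1) * tau / 16.
Proof.
move=> /andP[r0 r1] th0 rt; rewrite /edens /qd /sz /=.
set u1 := su X r; set u2 := su Y r; set p1 := sp X r; set p2 := sp Y r.
set v1 := sv X r in rt *; set v2 := sv Y r in rt *; set b1 := sb X r; set b2 := sb Y r.
set z1 := p1 + v1 ^+ 2 - 4 * r ^+ 2; set z2 := p2 + v2 ^+ 2 - 4 * r ^+ 2.
pose D := v1 - v2; pose w := D ^+ 2 / 4.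
have -> : (p1 + p2) / 2 + ((v1 + v2) / 2) ^+ 2 - 4 * r ^+ 2 = (z1 + z2) / 2 - w.
  by rewrite /z1 /z2 /w /D; field.
have w2 : r * w ^+ 2 <= tau / 16.
  have -> : r * w ^+ 2 = r * D ^+ 4 / 16 by rewrite /w; field.
  by rewrite ler_pM2r ?invr_gt0.
clearbody w z1 z2.
have n0 : r != 0 by rewrite gt_eqF.
have E1 : ((u1 + u2) / 2) ^+ 2 / r + 4^-1 * ((u1 - u2) ^+ 2 / r) = 2^-1 * (u1 ^+ 2 / r) + 2^-1 * (u2 ^+ 2 / r) by field.
have E2 : r * ((b1 + b2) / 2) ^+ 2 + 4^-1 * (r * (b1 - b2) ^+ 2) = 2^-1 * (r * b1 ^+ 2) + 2^-1 * (r * b2 ^+ 2) by field.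
have E3 : ((v1 + v2) / 2) ^+ 2 / r + 4^-1 * ((v1 - v2) ^+ 2 / r) = 2^-1 * (v1 ^+ 2 / r) + 2^-1 * (v2 ^+ 2 / r) by field.
have q0 (a : R) : 0 <= a ^+ 2 / r by rewrite divr_ge0 ?sqr_ge0// ltW.
have q1 (a : R) : 0 <= r * a ^+ 2 by rewrite mulr_ge0 ?sqr_ge0// ltW.
have h2 : 0 <= h ^+ 2 by exact: sqr_ge0.
have Z : r * ((z1 + z2) / 2 - w) ^+ 2 + 4^-1 * (r * (z1 - z2) ^+ 2) <=
   (1 + th) / 2 * (r * z1 ^+ 2) + (1 + th) / 2 * (r * z2 ^+ 2) + (1 + th^-1) * tau / 16.
  have c1 : (1 + th^-1) * (r * w ^+ 2) <= (1 + th^-1) * (tau / 16).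
    by rewrite ler_wpM2l// addr_ge0// invr_ge0 ltW.
  have c2 : 0 <= r * (th * ((z1 + z2) / 2) + w) ^+ 2 / th.
    by rewrite divr_ge0 ?q1// ltW.
  have c3 : r * (th * ((z1 + z2) / 2) + w) ^+ 2 / th = th * (r * ((z1 + z2) / 2) ^+ 2) +
     2 * (r * ((z1 + z2) / 2) * w) + th^-1 * (r * w ^+ 2) by field; rewrite gt_eqF.
  have c4 : 0 <= th * (r * (z1 - z2) ^+ 2) by rewrite mulr_ge0// ltW.
  have c5 : r * ((z1 + z2) / 2) ^+ 2 = 2^-1 * (r * z1 ^+ 2) + 2^-1 * (r * z2 ^+ 2) - 4^-1 * (r * (z1 - z2) ^+ 2).
    by field.
  rewrite c3 in c2.
  have c6 : r * ((z1 + z2) / 2 - w) ^+ 2 = r * ((z1 + z2) / 2) ^+ 2 - 2 * (r * ((z1 + z2) / 2) * w) + r * w ^+ 2 by ring.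
  rewrite c6; move: c1 c2 c4; rewrite c5.
  move: (r * ((z1 + z2) / 2) * w) (r * w ^+ 2) (r * z1 ^+ 2) (r * z2 ^+ 2) (r * (z1 - z2) ^+ 2).
  move=> A0 A1 A2 A3 A4.
  by move: (th^-1) => th'; clear; lra.
have tq (a : R) : 0 <= a -> 0 <= th * a by move=> ?; rewrite mulr_ge0// ltW.
have E2h : h ^+ 2 * (r * ((b1 + b2) / 2) ^+ 2) + 4^-1 * (h ^+ 2 * (r * (b1 - b2) ^+ 2)) = 2^-1 * (h ^+ 2 * (r * b1 ^+ 2)) + 2^-1 * (h ^+ 2 * (r * b2 ^+ 2)) by field.
have E3h : h ^+ 2 * (((v1 + v2) / 2) ^+ 2 / r) + 4^-1 * (h ^+ 2 * ((v1 - v2) ^+ 2 / r)) = 2^-1 * (h ^+ 2 * (v1 ^+ 2 / r)) + 2^-1 * (h ^+ 2 * (v2 ^+ 2 / r)) by field.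
have p01 := tq _ (q0 u1); have p02 := tq _ (q0 u2).
have p03 := tq _ (mulr_ge0 h2 (q1 b1)); have p04 := tq _ (mulr_ge0 h2 (q1 b2)).
have p05 := tq _ (mulr_ge0 h2 (q0 v1)); have p06 := tq _ (mulr_ge0 h2 (q0 v2)).
move: Z E1 E2h E3h p01 p02 p03 p04 p05 p06.
move: ((1 + th^-1) * tau / 16) => T.
rewrite !(mulrDr (h ^+ 2)) !(mulrDr 4^-1).
move: (r * ((z1 + z2) / 2 - w) ^+ 2) (r * (z1 - z2) ^+ 2) (r * z1 ^+ 2) (r * z2 ^+ 2)
  (((u1 + u2) / 2) ^+ 2 / r) ((u1 - u2) ^+ 2 / r) (u1 ^+ 2 / r) (u2 ^+ 2 / r)
  (h ^+ 2 * (r * ((b1 + b2) / 2) ^+ 2)) (h ^+ 2 * (r * (b1 - b2) ^+ 2)) (h ^+ 2 * (r * b1 ^+ 2)) (h ^+ 2 * (r * b2 ^+ 2))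
  (h ^+ 2 * (((v1 + v2) / 2) ^+ 2 / r)) (h ^+ 2 * ((v1 - v2) ^+ 2 / r)) (h ^+ 2 * (v1 ^+ 2 / r)) (h ^+ 2 * (v2 ^+ 2 / r)).
clear; move=> A1 A2 A3 A4 B1 B2 B3 B4 C1 C2 C3 C4 D1 D2 D3 D4.
lra.
Qed.

Lemma integralZI (c : R) (f : R -> R) : measurable_fun I f -> (forall r, I r -> 0 <= f r) ->
  0 <= c -> (\int[mu]_(r in I) (c * f r)%:E = c%:E * \int[mu]_(r in I) (f r)%:E)%E.
Proof.
move=> mf f0 c0; rewrite -ge0_integralZl_EFin//.
exact/measurable_EFinP.
Qed.

Lemma integralDI (f g : R -> R) : measurable_fun I f -> measurable_fun I g ->
  (forall r, I r -> 0 <= f r) -> (forall r, I r -> 0 <= g r) ->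
  (\int[mu]_(r in I) (f r + g r)%:E = \int[mu]_(r in I) (f r)%:E + \int[mu]_(r in I) (g r)%:E)%E.
Proof.
move=> mf mg f0 g0; by rewrite -ge0_integralD//; exact/measurable_EFinP.
Qed.

(** The midpoint competes in the minimisation, so its energy is at least m; what the two energies
    exceed m by then bounds the squared distance. *)
Lemma mid_integral h (th tau e e' m delta : R) X Y : adms delta X -> adms delta Y ->
  0 < th -> 0 <= tau -> (forall r : R, 0 < r < 1 -> r * (sv X r - sv Y r) ^+ 4 <= tau) ->
  (sE h X <= e%:E)%E -> (sE h Y <= e'%:E)%E -> (m%:E <= sE h (mid X Y))%E ->
  (\int[mu]_(r in I) (qd h X Y r)%:E <=
    (4 * ((1 + th) / 2 * e + (1 + th) / 2 * e' + (1 + th^-1) * tau / 16 - m))%:E)%E.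
Proof.
move=> aX aY th0 tau0 Ht eX eY em.
have aM := mid_adm aX aY.
have q0 (r : R) : I r -> 0 <= qd h X Y r.
  by rewrite /= in_itv/= => /(qd_parts h X Y)[].
have mq : measurable_fun I (qd h X Y).
  have aXY (j : nat) : adms delta (if j is 0 then Y else X) by case: j.
  exact: (meas_qd h aXY 0%N 1%N).
have [uX vX _ _] := aX; have [uY vY _ _] := aY; have [uM vM _ _] := aM.
have mX := meas_edens uX vX h; have mY := meas_edens uY vY h; have mM := meas_edens uM vM h.
have pX (r : R) : I r -> 0 <= edens h (su X) (sp X) (sv X) (sb X) r.
  by rewrite /= in_itv/=; exact: edens_ge0.
have pY (r : R) : I r -> 0 <= edens h (su Y) (sp Y) (sv Y) (sb Y) r.
  by rewrite /= in_itv/=; exact: edens_ge0.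
have pM (r : R) : I r -> 0 <= edens h (su (mid X Y)) (sp (mid X Y)) (sv (mid X Y)) (sb (mid X Y)) r.
  by rewrite /= in_itv/=; exact: edens_ge0.
set fX := edens h (su X) _ _ _ in mX pX; set fY := edens h (su Y) _ _ _ in mY pY.
set fM := edens h (su (mid X Y)) _ _ _ in mM pM.
pose T := (1 + th^-1) * tau / 16; pose k := (1 + th) / 2.
have k0 : 0 <= k by rewrite divr_ge0// addr_ge0// ltW.
have T0 : 0 <= T by rewrite divr_ge0// mulr_ge0// addr_ge0// invr_ge0 ltW.
have mkX : measurable_fun I (fun r => k * fX r) by apply: measurable_funM => //; exact: measurable_cst.
have mkY : measurable_fun I (fun r => k * fY r) by apply: measurable_funM => //; exact: measurable_cst.
have mT : measurable_fun I (fun _ : R => T) by exact: measurable_cst.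
have m4q : measurable_fun I (fun r => 4^-1 * qd h X Y r) by apply: measurable_funM => //; exact: measurable_cst.
have q40 (r : R) : I r -> 0 <= 4^-1 * qd h X Y r by move=> rI; rewrite mulr_ge0 ?q0.
have kX0 (r : R) : I r -> 0 <= k * fX r by move=> rI; rewrite mulr_ge0 ?pX.
have kY0 (r : R) : I r -> 0 <= k * fY r by move=> rI; rewrite mulr_ge0 ?pY.
have le : (\int[mu]_(r in I) (fM r + 4^-1 * qd h X Y r)%:E <=
    \int[mu]_(r in I) (k * fX r + k * fY r + T)%:E)%E.
  apply: ge0_le_integral; first exact: mI.
  - by move=> r rI; rewrite lee_fin addr_ge0 ?pM// q40.
  - by apply/measurable_EFinP; apply: measurable_funD.
  - by apply/measurable_EFinP; apply: measurable_funD => //; exact: measurable_funD.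
  - move=> r; rewrite /= in_itv/= => r01; rewrite lee_fin.
    exact: mid_pointwise (Ht r r01).
have LE : (\int[mu]_(r in I) (fM r + 4^-1 * qd h X Y r)%:E =
    sE h (mid X Y) + 4^-1%:E * \int[mu]_(r in I) (qd h X Y r)%:E)%E.
  by rewrite integralDI ?integralZI.
have RE : (\int[mu]_(r in I) (k * fX r + k * fY r + T)%:E <= (k * e + k * e' + T)%:E)%E.
  rewrite integralDI//; last by move=> r rI; rewrite addr_ge0 ?kX0 ?kY0.
    rewrite integralDI// (integralZI mX pX k0) (integralZI mY pY k0).
    rewrite [X in (_ + X)%E](_ : _ = T%:E); last first.
      by rewrite integral_cst; [rewrite -[RHS]mule1 -muI|exact: mI].
    rewrite !EFinD !EFinM; apply: leeD => //.
    by apply: leeD; apply: lee_wpmul2l => //; rewrite lee_fin.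
  exact: measurable_funD.
have Q0 : (0 <= \int[mu]_(r in I) (qd h X Y r)%:E)%E.
  by apply: integral_ge0 => r rI; rewrite lee_fin q0.
have tot : (m%:E + 4^-1%:E * \int[mu]_(r in I) (qd h X Y r)%:E <= (k * e + k * e' + T)%:E)%E.
  by apply: le_trans RE; apply: le_trans le; rewrite LE leeD2r.
move: tot Q0; case: (\int[mu]_(r in I) (qd h X Y r)%:E)%E => [q| |].
- by rewrite -EFinM -EFinD !lee_fin /T /k => h1 _; move: h1; clear; lra.
- by rewrite gt0_muley ?lte_fin ?invr_gt0//.
- by [].
Qed.

Lemma exist_min h (delta : R) : 0 < h -> (exists X, adms delta X /\ (sE h X < +oo)%E) ->
  exists X (m : R), [/\ adms delta X, sE h X = m%:E & forall Z, adms delta Z -> (m%:E <= sE h Z)%E].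
Proof.
move=> h0 [X0 [aX0 X0y]].
have E0 X : (0 <= sE h X)%E.
  by apply: integral_ge0 => r; rewrite /= in_itv/= lee_fin; exact: edens_ge0.
have h20 : 0 < h ^+ 2 by rewrite exprn_gt0.
pose A := [set e : R | exists X, adms delta X /\ sE h X = e%:E].
have Al : lbound A 0 by move=> e [X [_ Xe]]; rewrite -lee_fin -Xe.
have hA : has_inf A.
  split; last by exists 0.
  by exists (fine (sE h X0)), X0; split => //; rewrite fineK// ge0_fin_numE.
pose m := inf A.
have m0 : 0 <= m by apply: lb_le_inf => //; have [] := hA.
have mle Z : adms delta Z -> (m%:E <= sE h Z)%E.
  move=> aZ; move: (E0 Z); case E: (sE h Z) => [q| |] // _; last by rewrite leey.
  by rewrite lee_fin; apply: ge_inf; [exists 0|exists Z].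
have /choice[X hX] : forall n : nat, exists X, adms delta X /\ (sE h X <= (m + n.+2%:R^-1)%:E)%E.
  move=> n; have [e [X [aX Xe]] em] := inf_adherent (invS_gt0 n : 0 < n.+2%:R^-1 :> R) hA.
  by exists X; rewrite Xe lee_fin ltW.
have inv1 n : n.+2%:R^-1 <= 1 :> R by rewrite invf_le1 ?ltr0n// ler1n.
have invle i j : (i <= j)%N -> j.+2%:R^-1 <= i.+2%:R^-1 :> R.
  by move=> ij; rewrite lef_pV2 ?posrE ?ltr0n// ler_nat !ltnS.
have m10 : 0 < m + 1 by rewrite ltr_wpDl.
have Xb n : ebound h (m + 1) (su (X n)) (sp (X n)) (sv (X n)) (sb (X n)).
  have [[up vb _ _] Xn] := hX n; apply: E1_ebound => //; apply: le_trans Xn _.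
  by rewrite lee_fin lerD2l.
pose B := 1 + 10 * (m + 1) / h ^+ 2.
have B0 : 0 <= B by rewrite addr_ge0// divr_ge0 ?mulr_ge0// ltW.
have XB n (r : R) : 0 < r < 1 -> `|sv (X n) r| <= B.
  move=> /(ebound_v_sup h0 m10 (Xb n)); rewrite -real_normK ?num_real// /B.
  by move: (`|_|) (10 * _ / _) => a C; clear; nra.
have Xeq (a e : R) : 0 < a -> 0 < e -> exists2 eta : R, 0 < eta & forall n x y,
    a <= x -> x <= y -> y < 1 -> y - x < eta -> `|sv (X n) y - sv (X n) x| <= e.
  move=> a0 e0; pose K := (m + 1) / (h ^+ 2 * a).
  have K0 : 0 < K by rewrite divr_gt0// mulr_gt0.
  exists (e ^+ 2 / K); first by rewrite divr_gt0// exprn_gt0.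
  move=> n x y ax xy y1; rewrite ltr_pdivlMr// => yx.
  have x0 : 0 < x := lt_le_trans a0 ax.
  rewrite ler_norml; apply: sqr_small; first exact: ltW.
  apply: le_trans (ebound_v (Xb n) h0 x0 xy y1) _.
  apply: le_trans (ltW yx).
  rewrite mulrA [leLHS]mulrC.
  rewrite ler_wpM2l ?subr_ge0// /K ler_pM2l// lef_pV2 ?posrE ?mulr_gt0//.
  by rewrite ler_pM2l.
have [V [phi [phik phiV]]] := equicontinuous_subseq XB Xeq.
pose W k := X (phi k).
have WE k j : (k <= j)%N -> (sE h (W j) <= (m + k.+2%:R^-1)%:E)%E.
  move=> kj; have [_ Xn] := hX (phi j); apply: le_trans Xn _.
  by rewrite lee_fin lerD2l invle// (leq_trans kj).
have Wa k : adms delta (W k) by have [] := hX (phi k).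
pose C := 16 * (1 + B ^+ 4).
have C0 : 0 < C by rewrite mulr_gt0// ltr_pwDl// exprn_ge0.
(* Two ranges of r. Beyond 1 / (k + 2) the uniform convergence makes the difference small; below it
   the weight r is small and the difference is at most 2 B. The factor 16 in C is 2^4. *)
have Wt k l (r : R) : (k <= l)%N -> 0 < r < 1 -> r * (sv (W l) r - sv (W k) r) ^+ 4 <= C * k.+2%:R^-1.
  move=> kl /andP[r0 r1].
  have d4 (d M : R) : `|d| <= M -> d ^+ 4 <= M ^+ 4.
    move=> dM; apply: le_trans (ler_norm _) _; rewrite normrX lerXn2r ?nnegrE//.
    exact: le_trans dM.
  have [rk|/ltW rk] := leP (k.+2%:R^-1) r.
    have h1 := phiV k r rk r1; have h2 := phiV l r (le_trans (invle _ _ kl) rk) r1.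
    have h3 : `|sv (W l) r - sv (W k) r| <= 2 * k.+2%:R^-1.
      apply: le_trans (ler_distD (V r) _ _) _; rewrite (distrC (V r)).
      have := le_trans h2 (invle _ _ kl); move: h1; rewrite -!/(W _).
      by move: (k.+2%:R^-1) (`|_ - _|) (`|_ - _|) => q q1 q2; clear; lra.
    have h4 := d4 _ _ h3.
    have a0 := invS_gt0 k : 0 < k.+2%:R^-1 :> R.
    have a1 := inv1 k; move: a0 a1 h4; move: (k.+2%:R^-1) => a a0 a1 h4.
    have h5 : a ^+ 4 <= a by rewrite -[leRHS]expr1 ler_wiXn2l// ltW.
    have h6 : r * (sv (W l) r - sv (W k) r) ^+ 4 <= (sv (W l) r - sv (W k) r) ^+ 4.
      by apply: ler_piMl; [exact: exprn_even_ge0|exact: ltW].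
    have h7 : 0 <= B ^+ 4 * a by rewrite mulr_ge0 ?exprn_ge0// ltW.
    rewrite /C; move: h4 h5 h6 h7; rewrite exprMn; have -> : 2 ^+ 4 = 16 :> R by ring.
    move: ((sv (W l) r - sv (W k) r) ^+ 4) (a ^+ 4) (B ^+ 4) => t2 t3 t4; clear; lra.
  have h3 : `|sv (W l) r - sv (W k) r| <= 2 * B.
    apply: le_trans (ler_normB _ _) _.
    have := XB (phi l) r; have := XB (phi k) r; rewrite r0 r1 => /(_ isT) + /(_ isT).
    by rewrite -!/(W _); clear; lra.
  have h4 := d4 _ _ h3.
  apply: (@le_trans _ _ (k.+2%:R^-1 * (2 * B) ^+ 4)).
    by apply: ler_pM => //; [exact: ltW|rewrite exprn_even_ge0].
  rewrite mulrC ler_wpM2r ?invr_ge0// exprMn /C; have -> : 2 ^+ 4 = 16 :> R by ring.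
  by rewrite ler_pM2l// lerDr.
have Q (eps : R) : 0 < eps -> exists K : nat, forall k l, (K <= k)%N -> (k <= l)%N ->
    (\int[mu]_(r in I) (qd h (W l) (W k) r)%:E <= eps%:E)%E.
  (* The bound of [mid_integral] becomes 4 th m + D / (k + 2). This th makes the first summand at
     most eps / 2, and then k is taken large. *)
  move=> eps0; pose th := eps / (8 * (m + 1)).
  have th0 : 0 < th by rewrite divr_gt0// mulr_gt0.
  pose D := 4 * ((1 + th) + (1 + th^-1) * C / 16).
  have D0 : 0 < D.
    have i0 : 0 < th^-1 by rewrite invr_gt0.
    have i1 : 0 < (1 + th^-1) * C / 16 by rewrite divr_gt0// mulr_gt0// addr_gt0.
    by rewrite /D; move: th0 i1; move: (_ / 16) => q; clear; lra.
  have e2 : 0 < eps / (2 * D) by rewrite divr_gt0// mulr_gt0.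
  have [K hK] := near_invS e2.
  exists K => k l Kk kl.
  have tau0 : 0 <= C * k.+2%:R^-1 by rewrite mulr_ge0 ?invr_ge0// ltW.
  have := mid_integral (h := h) (Wa l) (Wa k) th0 tau0 (fun r => Wt k l r kl) (WE k l kl) (WE k k (leqnn k)) (mle _ (mid_adm (Wa l) (Wa k))).
  move=> /le_trans; apply; rewrite lee_fin.
  have hk : k.+2%:R^-1 <= eps / (2 * D) := le_trans (invle _ _ Kk) (ltW hK).
  have {}hk : D * k.+2%:R^-1 <= eps / 2.
    have D20 : 0 < 2 * D by apply: mulr_gt0.
    move: hk; rewrite (ler_pdivlMr _ _ D20).
    by move: (k.+2%:R^-1) => q; generalize D; clear=> d; lra.
  have hth : 4 * (th * m) <= eps / 2.
    have -> : eps / 2 = 4 * (th * (m + 1)) by rewrite /th; field; rewrite gt_eqF.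
    by rewrite ler_pM2l// ler_pM2l// lerDl.
  move: hk hth; rewrite /D; move: (k.+2%:R^-1) (th^-1) => a th'; clear; lra.
have /choice[K hK] : forall j : nat, exists K : nat, forall k l, (K <= k)%N -> (k <= l)%N ->
    (\int[mu]_(r in I) (qd h (W l) (W k) r)%:E <= (16^-1 ^+ j)%:E)%E.
  by move=> j; apply: Q; rewrite exprn_gt0.
(* Partial sums make the indices monotone while keeping psi j above both K j and j. *)
pose psi j := (\sum_(i < j.+1) (K i).+1)%N.
have psiS j : psi j.+1 = (psi j + (K j.+1).+1)%N by rewrite /psi big_ord_recr.
have psiK j : (K j <= psi j)%N.
  by case: j => [|j]; [rewrite /psi big_ord1|rewrite psiS; apply: leq_trans (leq_addl _ _)].
have psij j : (j <= psi j)%N.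
  by elim: j => // j ih; rewrite psiS addnS ltnS; apply: leq_trans ih (leq_addr _ _).
have psim i j : (i <= j)%N -> (psi i <= psi j)%N.
  by apply: (homo_leq (r := leq)) => // [? ? ?|n]; [exact: leq_trans|rewrite psiS leq_addr].
have wE j := WE j (psi j) (psij j).
have cm : m + j.+2%:R^-1 @[j --> \oo] --> m.
  apply: cvg_of_diff0; apply: (@cvg_invS _ _ 1); apply: nearW => j.
  by rewrite addrAC subrr add0r mul1r ger0_norm// invr_ge0.
have YQ i j : (i <= j)%N ->
    (\int[mu]_(r in I) (qd h (W (psi j)) (W (psi i)) r)%:E <= (16^-1 ^+ i)%:E)%E.
  by move=> ij; apply: hK; [exact: psiK|exact: psim].
have YV j r : j.+2%:R^-1 <= r -> r < 1 -> `|sv (W (psi j)) r - V r| <= j.+2%:R^-1.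
  move=> jr r1; have jj := invle _ _ (psij j).
  exact: le_trans (phiV _ _ (le_trans jj jr) r1) jj.
have [Z [aZ Zm]] := limit_state h0 (fun j => Wa (psi j)) wE cm YQ (fun j => XB (phi (psi j))) YV.
exists Z, m; split=> //; apply/le_anti; rewrite Zm/=; exact: mle.
Qed.

End Minimizer.

(** * Upper bound: the competitor *)

Section Competitor.
Context {R : realType}.
Notation mu := (@lebesgue_measure R).
Notation I := (`]0%R, 1%R[%classic : set R).
Implicit Types (x y s t r : R).

Lemma acon_empty x y (f b : R -> R) : y < x -> acon x y f b.
Proof.
move=> yx; split; last by move=> s t *; exfalso; lra.
by apply: L1_eq (L1_cst x y 0) => r /andP[? ?]; exfalso; lra.
Qed.

Lemma acon_eq_oo x y (F B f b : R -> R) : (forall r, x <= r <= y -> f r = F r) ->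
  (forall r, x < r < y -> b r = B r) -> acon x y F B -> acon x y f b.
Proof.
move=> fF bB [Bi BE]; split; first by apply: L1_eq_oo Bi => r /bB ->.
move=> s t xs st ty; rewrite !fF; [|by apply/andP; split; lra..].
rewrite BE//; apply/esym/itg_eq_oo; last exact: L1_sub Bi _ _.
by move=> r /andP[? ?]; rewrite bB//; apply/andP; split; lra.
Qed.

Lemma acon_cat x m y (f b : R -> R) : x <= m -> m <= y -> acon x m f b -> acon m y f b -> acon x y f b.
Proof.
move=> xm my [b1 f1] [b2 f2].
have bi : L1 x y b.
  have b3 : mu.-integrable `]m, y] (EFin \o b).
    apply: integrableS b2 => //= r /=; rewrite !in_itv/= => /andP[/ltW -> ->]//.
  have k D mD := @integrable_mkcond _ (measurableTypeR R) R mu D (EFin \o b) mD.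
  have m3 : measurable (`]m, y]%classic : set (measurableTypeR R)) by exact: measurable_itv.
  have := integrableD measurableT ((k _ (mitv x m)).1 b1) ((k _ m3).1 b3).
  move=> H; apply/(k _ (mitv x y)).2; move: H; congr (mu.-integrable _ _).
  apply/funext => r; rewrite /= /patch !mem_setE !in_itv/=.
  case: (leP x r) => xr; case: (leP r m) => rm; case: (leP r y) => ry //=; rewrite ?adde0 ?add0e//; exfalso; lra.
split=> // s t xs st ty.
have [tm|mt] := leP t m; first exact: f1.
have [ms|sm] := leP m s; first exact: f2.
rewrite (@itg_split _ s m t); [|exact: ltW|exact: ltW|exact: L1_sub bi _ _].
rewrite -f1 ?(ltW sm)// -f2 ?(ltW mt)//; lra.
Qed.

Definition glue m (F G : R -> R) r := if r <= m then F r else G r.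

(** The position of m relative to [x, y] is free, so the gluing radii need not be compared with the
    interval considered. *)
Lemma acon_glue x y m (F B G D : R -> R) : F m = G m -> acon x y F B -> acon x y G D ->
  acon x y (glue m F G) (glue m B D).
Proof.
move=> FG aF aG; have [xy|] := leP x y; last exact: acon_empty.
have [mx|xm] := leP m x.
  apply: acon_eq_oo aG => r /andP[xr ry]; rewrite /glue; case: leP => // rm; last by lra.
  by have -> : r = m by lra.
have [ym|my] := leP y m.
  by apply: acon_eq_oo aF => r /andP[xr ry]; rewrite /glue; case: leP => // rm; lra.
apply: (acon_cat (ltW xm) (ltW my)).
  apply: acon_eq_oo (acon_sub aF (lexx _) (ltW my)) => r /andP[xr ry]; rewrite /glue; case: leP => // rm; lra.
apply: acon_eq_oo (acon_sub aG (ltW xm) (lexx _)) => r /andP[xr ry]; rewrite /glue; case: leP => // rm; last by lra.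
by have -> : r = m by lra.
Qed.

Lemma acon_ext x y (F B f b : R -> R) : (forall r, f r = F r) -> (forall r, b r = B r) ->
  acon x y F B -> acon x y f b.
Proof. by move=> /funext -> /funext ->. Qed.

Lemma aconX x y (F B : R -> R) n : acon x y F B ->
  acon x y (fun r => F r ^+ n.+1) (fun r => n.+1%:R * F r ^+ n * B r).
Proof.
move=> aF; elim: n => [|n ih].
  by apply: acon_ext aF => r; rewrite ?expr1// expr0 !mul1r.
apply: acon_ext (aconM aF ih) => r; first by rewrite -exprS.
by rewrite /= [in RHS]exprS [_ ^+ n.+1]exprS -[n.+2]addn1 natrD; ring.
Qed.

Lemma acon_cst x y (q : R) : acon x y (fun=> q) (fun=> 0).
Proof. by apply: acon_ext (acon_lin x y 0 q) => // r; rewrite mul0r add0r. Qed.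

Lemma acon_id x y : acon x y id (fun=> 1).
Proof. by apply: acon_ext (acon_lin x y 1 0) => // r; rewrite mul1r addr0. Qed.

(** An odd transition profile from -1 to 1. The parameter c lets it overshoot 1, so that 1 - phi^2
    can have mean zero on [-1, 1]. *)
Definition phi c t : R := (1 + c) * t + - c * t ^+ 3.

(** The odd primitive of 1 - phi^2, used to build u inside the layer. *)
Definition psi c t : R := 1 * t + - ((1 + c) ^+ 2 / 3) * t ^+ 3 +
  2 * c * (1 + c) / 5 * t ^+ 5 + - (c ^+ 2 / 7) * t ^+ 7.

(** The even primitive of phi; evenness is what makes the constraint on the integral of w' hold
    exactly. *)
Definition Iphi c t : R := (1 + c) / 2 * t ^+ 2 + - (c / 4) * t ^+ 4.

(** The equation is psi c 1 = 0 with denominators cleared; its positive root is c = (3 sqrt 21 - 7)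
    / 4. *)
Lemma profile_exists : exists c : R, 4 * c ^+ 2 + 14 * c = 35 /\ 0 <= c <= 2.
Proof.
pose q : R := Num.sqrt 21; have q2 : q ^+ 2 = 21 by rewrite sqr_sqrtr.
have q0 : 0 <= q by exact: sqrtr_ge0.
exists ((3 * q - 7) / 4); split; first by move: q2; clear; move: q => q q2; nra.
by move: q2 q0; clear; move: q => q q2 q0; apply/andP; split; nra.
Qed.

Lemma phi_bounds c t : 0 <= c <= 2 -> -1 <= t <= 1 ->
  [/\ phi c t ^+ 2 <= 9, ((1 + c) + - (3 * c) * t ^+ 2) ^+ 2 <= 25 & psi c t ^+ 2 <= 49].
Proof.
move=> /andP[c0 c2] /andP[t0 t1].
have t2 : 0 <= t ^+ 2 <= 1 by rewrite sqr_ge0/=; nra.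
have sq (a m : R) : 0 <= m -> - m <= a <= m -> a ^+ 2 <= m ^+ 2 by move=> ? /andP[? ?]; nra.
have e1 : phi c t = t * (1 + c * (1 - t ^+ 2)) by rewrite /phi; ring.
have e2 : psi c t = t * (1 - (1 + c) ^+ 2 / 3 * t ^+ 2 + 2 * c * (1 + c) / 5 * (t ^+ 2) ^+ 2 - c ^+ 2 / 7 * (t ^+ 2) ^+ 3).
  by rewrite /psi; ring.
have m1 (a b : R) : -1 <= a <= 1 -> forall m, -m <= b <= m -> -m <= a * b <= m.
  by move=> /andP[? ?] m /andP[? ?]; apply/andP; split; nra.
have t11 : -1 <= t <= 1 by rewrite t0.
move: t2; rewrite e1 e2; move: (t ^+ 2) => s /andP[s0 s1].
have -> : 9 = 3 ^+ 2 :> R by ring.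
have -> : 25 = 5 ^+ 2 :> R by ring.
have -> : 49 = 7 ^+ 2 :> R by ring.
have cs : 0 <= c * s <= 2 by apply/andP; split; nra.
have s2 : 0 <= s ^+ 2 <= 1 by apply/andP; split; nra.
have s3 : 0 <= s ^+ 3 <= 1 by move: s2; rewrite exprSr => /andP[? ?]; apply/andP; split; nra.
move: cs s2 s3 => /andP[cs0 cs1] /andP[s20 s21] /andP[s30 s31].
split; apply: sq => //.
- by apply: m1 => //; apply/andP; split; lra.
- by apply/andP; split; lra.
- apply: m1 => //.
  have a1 : 0 <= (1 + c) ^+ 2 / 3 <= 3 by apply/andP; split; nra.
  have a2 : 0 <= 2 * c * (1 + c) / 5 <= 12 / 5 by apply/andP; split; nra.
  have a3 : 0 <= c ^+ 2 / 7 <= 4 / 7 by apply/andP; split; nra.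
  have pr (a b m : R) : 0 <= a <= m -> 0 <= b -> b <= 1 -> 0 <= a * b <= m.
    by move=> /andP[? ?] ? ?; apply/andP; split; nra.
  move: (pr _ _ _ a1 s0 s1) (pr _ _ _ a2 s20 s21) (pr _ _ _ a3 s30 s31).
  move: (_ * s) (_ * s ^+ 2) (_ * s ^+ 3) => z1 z2 z3; clear.
  by move=> /andP[? ?] /andP[? ?] /andP[? ?]; apply/andP; split; lra.
Qed.

Lemma psi_end c : 4 * c ^+ 2 + 14 * c = 35 -> psi c 1 = 0 /\ psi c (-1) = 0.
Proof. by move=> h; rewrite /psi; split; nra. Qed.

Section Comp.
Context (k d c : R) (k0 : 0 < k) (kd : k <= d) (hc : 4 * c ^+ 2 + 14 * c = 35) (c2 : 0 <= c <= 2).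
(** The layer is described in the variable r^2, in which 2 r dr is Lebesgue measure. Its centre s0
    is delta / 2 and its half-width lam is of order k d, which means a width of order k = h^(1/2) at
    radius of order d. The hypothesis k <= d gives lam <= s0. *)
Let lam := k * d / 2.
Let s0 := d ^+ 2 / 2.
Let T r := (r ^+ 2 - s0) / lam.
Let r1 := Num.sqrt (s0 - lam).
Let r2 := Num.sqrt (s0 + lam).

Lemma comp_T x y : acon x y T (fun r => 2 * r / lam).
Proof.
apply: acon_ext (aconD (aconZ lam^-1 (aconX 1 (acon_id x y))) (acon_cst x y (- s0 / lam))) => r /=.
  by rewrite /T; ring.
by rewrite expr1; ring.
Qed.

Lemma comp_phi x y : acon x y (fun r => phi c (T r))
  (fun r => ((1 + c) + - (3 * c) * T r ^+ 2) * (2 * r / lam)).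
Proof.
apply: acon_ext (aconD (aconZ (1 + c) (comp_T x y)) (aconZ (- c) (aconX 2 (comp_T x y)))) => r //=.
by ring.
Qed.

Lemma comp_psi x y : acon x y (fun r => psi c (T r))
  (fun r => (1 - phi c (T r) ^+ 2) * (2 * r / lam)).
Proof.
apply: acon_ext (aconD (aconD (aconD (aconZ 1 (comp_T x y)) (aconZ _ (aconX 2 (comp_T x y))))
  (aconZ _ (aconX 4 (comp_T x y)))) (aconZ _ (aconX 6 (comp_T x y)))) => r //=.
by rewrite /phi; move: (2 * r / lam) (T r) => q t; field.
Qed.

Lemma comp_Iphi x y : acon x y (fun r => lam * Iphi c (T r)) (fun r => 2 * r * phi c (T r)).
Proof.
have l0 : lam != 0 by rewrite gt_eqF// divr_gt0// mulr_gt0// (lt_le_trans k0).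
apply: acon_ext (aconZ lam (aconD (aconZ _ (aconX 1 (comp_T x y))) (aconZ _ (aconX 3 (comp_T x y))))) => r //=.
by rewrite /phi; field.
Qed.

Definition cv := glue r2 (glue r1 (fun r => - 2 * r) (fun r => 2 * r * phi c (T r))) (fun r => 2 * r).

Definition cb := glue r2 (glue r1 (fun=> - 2)
  (fun r => 2 * phi c (T r) + 2 * r * (((1 + c) + - (3 * c) * T r ^+ 2) * (2 * r / lam)))) (fun=> 2).

(** In the layer u' = 2 lam psi + 4 r^2 (1 - phi^2), so z reduces to 2 lam psi(T), of order k d. As
    psi vanishes at 1 and -1, u joins the value 0 continuously. *)
Definition cu := glue r2 (glue r1 (fun=> 0) (fun r => 2 * lam * r * psi c (T r))) (fun=> 0).

Definition cp := glue r2 (glue r1 (fun=> 0)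
  (fun r => 2 * lam * psi c (T r) + 2 * lam * r * ((1 - phi c (T r) ^+ 2) * (2 * r / lam)))) (fun=> 0).

Let l0 : 0 < lam. Proof. by rewrite divr_gt0// mulr_gt0// (lt_le_trans k0). Qed.

Let ls : lam <= s0.
Proof. by rewrite ler_pM2r ?invr_gt0// expr2 ler_wpM2r// (le_trans (ltW k0)). Qed.

Let r1E : r1 ^+ 2 = s0 - lam. Proof. by rewrite sqr_sqrtr// subr_ge0. Qed.
Let r2E : r2 ^+ 2 = s0 + lam. Proof. by rewrite sqr_sqrtr// addr_ge0 ?ltW// (lt_le_trans l0). Qed.
Let r10 : 0 <= r1. Proof. exact: sqrtr_ge0. Qed.
Let r20 : 0 <= r2. Proof. exact: sqrtr_ge0. Qed.

Let r12 : r1 < r2.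
Proof. by rewrite -(ltr_pXn2r (_ : 0 < 2)%N) ?nnegrE// r1E r2E; move: l0; lra. Qed.

Let T1 : T r1 = -1.
Proof. by rewrite /T r1E addrAC subrr add0r mulNr divff// gt_eqF. Qed.

Let T2 : T r2 = 1.
Proof. by rewrite /T r2E addrAC subrr add0r divff// gt_eqF. Qed.

Let phi1 : phi c 1 = 1 /\ phi c (-1) = -1.
Proof. by rewrite /phi; split; ring. Qed.

Let glue1 (F G : R -> R) r : r1 = r -> glue r2 F G r = F r.
Proof. by move=> <-; rewrite /glue (ltW r12). Qed.

Let glue2 (F G : R -> R) : glue r1 F G r2 = G r2.
Proof. by rewrite /glue leNgt r12. Qed.

Lemma cv_ac x y : acon x y cv cb.
Proof.
have [p1 p2] := phi1; have [q1 q2] := psi_end hc.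
have lin m : acon x y (fun r => m * r) (fun=> m).
  by apply: acon_ext (acon_lin x y m 0) => r //; rewrite addr0.
apply: acon_glue (lin 2); first by rewrite glue2 T2 p1 mulr1.
apply: acon_glue (lin _) _; first by rewrite T1 p2; ring.
by apply: acon_ext (aconM (lin 2) (comp_phi x y)).
Qed.

Lemma cu_ac x y : acon x y cu cp.
Proof.
have [q1 q2] := psi_end hc.
have lin m : acon x y (fun r => m * r) (fun=> m).
  by apply: acon_ext (acon_lin x y m 0) => r //; rewrite addr0.
apply: acon_glue (acon_cst x y 0); first by rewrite glue2 T2 q1 mulr0.
apply: acon_glue (acon_cst x y 0) _; first by rewrite T1 q2 mulr0.
by apply: acon_ext (aconM (lin (2 * lam)) (comp_psi x y)).
Qed.

Let r2_le1 : d <= 1 -> r2 <= 1.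
Proof.
move=> d1; rewrite -(ler_pXn2r (_ : 0 < 2)%N) ?nnegrE// r2E expr1n.
by move: ls (exprn_ile1 2 (le_trans (ltW k0) kd) d1); rewrite /s0; move: lam (d ^+ 2) => l q; lra.
Qed.

(** The layer contributes nothing because [Iphi] is even; the two outer pieces give - r1^2 and 1 -
    r2^2, and r1^2 + r2^2 = 2 s0 = d^2. *)
Lemma cv_itg : d <= 1 -> L1 0 1 cv /\ itg 0 1 cv = 1 - d ^+ 2.
Proof.
move=> d1; pose m := - r1 ^+ 2 - lam * Iphi c (-1).
have e : Iphi c 1 = Iphi c (-1) by rewrite /Iphi; ring.
have [Vi VE] : acon 0 1 (glue r2 (glue r1 (fun r => - r ^+ 2) (fun r => lam * Iphi c (T r) + m))
   (fun r => r ^+ 2 + - (r1 ^+ 2 + r2 ^+ 2))) cv.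
  have sq : acon 0 1 (fun r => r ^+ 2) (fun r => 2 * r).
    by apply: acon_ext (aconX 1 (acon_id 0 1)) => r //=; rewrite expr1 mulr1.
  apply: acon_glue; first by rewrite glue2 T2 e /m; ring.
    apply: acon_glue; first by rewrite T1 /m; ring.
      by apply: acon_ext (aconZ (-1) sq) => r; ring.
    by apply: acon_ext (aconD (comp_Iphi 0 1) (acon_cst 0 1 m)) => r //; rewrite addr0.
  by apply: acon_ext (aconD sq (acon_cst 0 1 _)) => r //; rewrite addr0.
split=> //; rewrite -VE//; have [p1 p2] := phi1.
have r21 := r2_le1 d1.
have -> F G : glue r2 (glue r1 F G) (fun r => r ^+ 2 + - (r1 ^+ 2 + r2 ^+ 2)) 0 = F 0.
  by rewrite /glue r10 r20.
have [r2lt|] := ltP r2 1.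
  by rewrite {1}/glue leNgt r2lt/= r1E r2E /s0; field.
(* Equality occurs for k = d = 1; the endpoint 1 then falls in the layer branch of [glue]. *)
move=> r2ge; have r2e : r2 = 1 by apply/le_anti; rewrite r21.
rewrite -r2e {1}/glue lexx glue2 T2 e /m.
have := r2E; rewrite r2e expr1n r1E /s0; move: lam (d ^+ 2) => l q; lra.
Qed.

(** Outside the layer u and z vanish and bending costs 8 k^4 r. Inside, lam is k d / 2 and r <= d,
    so the membrane and the bending terms are both at most a constant times k^2 d^2 r. *)
Lemma cdens r : 0 < r -> r < 1 -> d <= 1 ->
  edens (k ^+ 2) cu cp cv cb r <= 8 * k ^+ 4 + glue r2 (glue r1 (fun=> 0) (fun r => 3600 * k ^+ 2 * d ^+ 2 * r)) (fun=> 0) r.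
Proof.
move=> r0 ri1 d1; have n0 : r != 0 by rewrite gt_eqF.
have d0 : 0 < d := lt_le_trans k0 kd.
have out : k ^+ 2 ^+ 2 * (4 * r + 4 * r) <= 8 * k ^+ 4.
  have := ler_piMr (exprn_ge0 4 (ltW k0)) (ltW ri1).
  by rewrite -exprM; move: (k ^+ 4) => q; lra.
rewrite /edens /cu /cp /cv /cb /glue; case: (leP r r2) => rr2; last first.
  by rewrite addr0 [leLHS](_ : _ = k ^+ 2 ^+ 2 * (4 * r + 4 * r)); [|by field].
case: (leP r r1) => rr1.
  by rewrite addr0 [leLHS](_ : _ = k ^+ 2 ^+ 2 * (4 * r + 4 * r)); [|by field].
have rs : r ^+ 2 <= s0 + lam by rewrite -r2E ler_pXn2r ?nnegrE// ltW.
have rs' : s0 - lam <= r ^+ 2 by rewrite -r1E ler_pXn2r ?nnegrE// ltW.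
have Tr : -1 <= T r <= 1.
  by rewrite /T ler_pdivlMr// ler_pdivrMr//; apply/andP; split; lra.
have [] := phi_bounds c2 Tr.
have rd : r ^+ 2 <= d ^+ 2 by move: ls rs; rewrite /s0; move: lam (d ^+ 2) => l q; lra.
move: (phi c (T r)) (psi c (T r)) (1 + c + - (3 * c) * T r ^+ 2) => f g df f9 df25 g49.
have -> : (2 * lam * r * g) ^+ 2 / r + r * (2 * lam * g + 2 * lam * r * ((1 - f ^+ 2) * (2 * r / lam)) +
   (2 * r * f) ^+ 2 - 4 * r ^+ 2) ^+ 2 + k ^+ 2 ^+ 2 * (r * (2 * f + 2 * r * (df * (2 * r / lam))) ^+ 2 +
   (2 * r * f) ^+ 2 / r) = r * (8 * lam ^+ 2 * g ^+ 2 + k ^+ 4 * ((2 * f + 4 * r ^+ 2 / lam * df) ^+ 2 + 4 * f ^+ 2)).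
  by field; rewrite n0 gt_eqF.
have m1 : (2 * f + 4 * r ^+ 2 / lam * df) ^+ 2 <= 2 * (4 * f ^+ 2) + 2 * ((4 * r ^+ 2 / lam) ^+ 2 * df ^+ 2).
  by move: (4 * r ^+ 2 / lam) => q; have := sqr_ge0 (2 * f - q * df); nra.
have m2 : k ^+ 4 * (4 * r ^+ 2 / lam) ^+ 2 <= 64 * k ^+ 2 * d ^+ 2.
  have -> : k ^+ 4 * (4 * r ^+ 2 / lam) ^+ 2 = 64 * k ^+ 2 * ((r ^+ 2) ^+ 2 / d ^+ 2).
    by rewrite /lam; field; rewrite !gt_eqF.
  have k2 : 0 < k ^+ 2 by rewrite exprn_gt0.
  rewrite ler_pM2l ?mulr_gt0// ler_pdivrMr ?exprn_gt0// -expr2.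
  by rewrite ler_pXn2r ?nnegrE ?sqr_ge0.
have m3 : k ^+ 4 <= k ^+ 2 * d ^+ 2.
  have -> : k ^+ 4 = k ^+ 2 * k ^+ 2 by ring.
  by rewrite ler_pM2l ?exprn_gt0// ler_pXn2r// nnegrE ltW.
have k4 : 0 <= 8 * k ^+ 4 by rewrite mulr_ge0// exprn_ge0// ltW.
(* The pieces are 98 from u and z, 72 + 3200 from w'' and 36 from w', in units of k^2 d^2 r; the sum
   3406 is rounded up. *)
apply: (@le_trans _ _ (3600 * k ^+ 2 * d ^+ 2 * r)); last by rewrite lerDr.
rewrite mulrC ler_pM2r//.
have l2 : lam ^+ 2 = k ^+ 2 * d ^+ 2 / 4 by rewrite /lam; field.
have m4 := ler_wpM2l (exprn_ge0 4 (ltW k0)) m1.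
have m5 : k ^+ 4 * (4 * r ^+ 2 / lam) ^+ 2 * df ^+ 2 <= 64 * k ^+ 2 * d ^+ 2 * 25.
  by apply: ler_pM => //; rewrite ?sqr_ge0// mulr_ge0 ?sqr_ge0// exprn_ge0// ltW.
have m6 : k ^+ 4 * f ^+ 2 <= k ^+ 2 * d ^+ 2 * 9.
  by apply: ler_pM => //; rewrite ?sqr_ge0// exprn_ge0// ltW.
have m7 : k ^+ 2 * d ^+ 2 * g ^+ 2 <= k ^+ 2 * d ^+ 2 * 49.
  by rewrite ler_wpM2l// mulr_ge0 ?sqr_ge0.
have m8 : 0 <= k ^+ 2 * d ^+ 2 by rewrite mulr_ge0 ?sqr_ge0.
rewrite l2; move: m4 m5 m6 m7 m8.
move: ((2 * f + 4 * r ^+ 2 / lam * df) ^+ 2) ((4 * r ^+ 2 / lam) ^+ 2) => q M.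
move: (df ^+ 2) (f ^+ 2) (g ^+ 2) (k ^+ 4) (k ^+ 2) (d ^+ 2) => D F G K P Q; lra.
Qed.

Lemma competitor : d <= 1 -> exists X, adms (d ^+ 2) X /\
  (sE (k ^+ 2) X <= (8 * k ^+ 4 + 1800 * k ^+ 3 * d ^+ 3)%:E)%E.
Proof.
move=> d1; have [Vi VE] := cv_itg d1.
have ua : ac cu cp by move=> x y _ _; exact: cu_ac.
have va : ac cv cb by move=> x y _ _; exact: cv_ac.
exists (State cu cp cv cb); split.
  split=> //=; first exact: (integrable_oo_cc _).2.
  by rewrite itg_oo_cc//; exact: (integrable_oo_cc _).2.
pose Q := 3600 * k ^+ 2 * d ^+ 2.
pose g r := 8 * k ^+ 4 + glue r2 (glue r1 (fun=> 0) (fun r => Q * r)) (fun=> 0) r.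
(* The primitive of the layer part: its increment is Q (r2^2 - r1^2) / 2 = Q lam = 1800 k^3 d^3. *)
pose G := glue r2 (glue r1 (fun=> 0) (fun r => Q / 2 * r ^+ 2 - Q / 2 * r1 ^+ 2)) (fun=> Q / 2 * r2 ^+ 2 - Q / 2 * r1 ^+ 2).
have [gi gE] : acon 0 1 (fun r => 8 * k ^+ 4 * r + 0 + G r) g.
  apply: aconD; first exact: acon_lin.
  apply: acon_glue (acon_cst _ _ _); first by rewrite glue2.
  apply: acon_glue (acon_cst _ _ _) _; first by rewrite subrr.
  apply: acon_ext (aconD (aconZ (Q / 2) (aconX 1 (acon_id 0 1))) (acon_cst 0 1 (- (Q / 2 * r1 ^+ 2)))) => r //=.
  by field.
have gi' := (integrable_oo_cc g).2 gi.
have gI : (\int[mu]_(r in I) (g r)%:E = (itg 0 1 g)%:E)%E.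
  rewrite -itg_oo_cc// /Rintegral fineK//.
  exact: (integrable_fin_num (@mI R) gi').
apply: (@le_trans _ _ (\int[mu]_(r in I) (g r)%:E)%E).
  apply: ge0_le_integral; first exact: mI.
  - by move=> r; rewrite /= in_itv/= lee_fin; exact: edens_ge0.
  - by apply/measurable_EFinP; exact: meas_edens.
  - by apply: measurable_int gi'.
  - by move=> r; rewrite /= in_itv/= => /andP[r0 ri1]; rewrite lee_fin; exact: cdens.
rewrite gI lee_fin -gE//.
have -> : G 0 = 0 by rewrite /G /glue r10 r20.
have -> : G 1 = Q * lam.
  have e : Q / 2 * r2 ^+ 2 - Q / 2 * r1 ^+ 2 = Q * lam by rewrite r1E r2E; field.
  rewrite -e /G {1}/glue; case: leP => // r2ge.
  have r2e : r2 = 1 by apply/le_anti; rewrite r2_le1.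
  by move: r2e => /esym ->; rewrite glue2.
by rewrite [leLHS](_ : _ = 8 * k ^+ 4 + 1800 * k ^+ 3 * d ^+ 3); [|rewrite /Q /lam; field].
Qed.

End Comp.
Lemma upper_bound (k d : R) : 0 < k -> 0 <= d <= 1 -> exists X, adms (d ^+ 2) X /\
  (sE (k ^+ 2) X <= (1800 * (k ^+ 4 + d ^+ 3 * k ^+ 3))%:E)%E.
Proof.
move=> k0 /andP[d0 d1]; have k4 : 0 <= k ^+ 4 by rewrite exprn_ge0// ltW.
have [kd|dk] := leP k d.
  have [c [hc c2]] := profile_exists.
  have [X [aX Xe]] := competitor k0 kd hc c2 d1.
  exists X; split=> //; apply: le_trans Xe _; rewrite lee_fin.
  by move: k4; move: (k ^+ 4) (k ^+ 3) (d ^+ 3) => A B D; clear; lra.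
pose m := 2 * (1 - d ^+ 2).
have lin x y : acon x y (fun r => m * r) (fun=> m).
  by apply: acon_ext (acon_lin x y m 0) => r //; rewrite addr0.
have v1 : L1 0 1 (fun r : R => m * r) by apply: L1Z; apply: L1_cont; exact: within_id.
have ua : ac (fun _ : R => 0 : R) (fun=> 0) by move=> x y _ _; exact: acon_cst.
have va : ac (fun r : R => m * r) (fun=> m) by move=> x y _ _; exact: lin.
exists (State (fun=> 0) (fun=> 0) (fun r => m * r) (fun=> m)); split.
  have i1 := (@integrable_oo_cc R 0 1 (fun r => m * r)).2 v1.
  split=> //=; rewrite itg_oo_cc//.
  rewrite (@itg_eq _ 0 1 _ (fun r => (1 - d ^+ 2) * (2 * r))); last by move=> r _; rewrite /m; ring.
  rewrite itgZ; last by apply: L1Z; apply: L1_cont; exact: within_id.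
  by rewrite itg_2r//; ring.
apply: (@le_trans _ _ (\int[mu]_(r in I) (72 * k ^+ 4)%:E)%E).
  apply: ge0_le_integral; first exact: mI.
  - by move=> r; rewrite /= in_itv/= lee_fin; exact: edens_ge0.
  - by apply/measurable_EFinP; exact: (meas_edens ua va).
  - by apply/measurable_EFinP; exact: measurable_cst.
  move=> r; rewrite /= in_itv/= => /andP[r0 r1]; rewrite lee_fin.
  have n0 : r != 0 by rewrite gt_eqF.
  rewrite /edens.
  have -> : 0 ^+ 2 / r + r * (0 + (m * r) ^+ 2 - 4 * r ^+ 2) ^+ 2 +
    k ^+ 2 ^+ 2 * (r * m ^+ 2 + (m * r) ^+ 2 / r) =
    r ^+ 5 * (16 * (d ^+ 4 * (2 - d ^+ 2) ^+ 2)) + r * (k ^+ 4 * (8 * (1 - d ^+ 2) ^+ 2)) by rewrite /m; field.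
  have r5 : r ^+ 5 <= 1 by rewrite exprn_ile1// ltW.
  have r50 : 0 <= r ^+ 5 by rewrite exprn_ge0// ltW.
  have dd : 0 <= d ^+ 2 <= 1 by rewrite sqr_ge0 exprn_ile1.
  have dk4 : d ^+ 4 <= k ^+ 4 by rewrite ler_pXn2r// ?nnegrE// ltW.
  have d40 : 0 <= d ^+ 4 by rewrite exprn_ge0.
  have a1 : 0 <= 16 * (d ^+ 4 * (2 - d ^+ 2) ^+ 2) <= 64 * k ^+ 4.
    move: dd dk4 d40; move: (d ^+ 4) (k ^+ 4) (d ^+ 2) => A B D; clear=> /andP[D0 D1] AB A0.
    have q : (2 - D) ^+ 2 <= 4 by nra.
    by have q0 := sqr_ge0 (2 - D); apply/andP; split; nra.
  have a2 : 0 <= k ^+ 4 * (8 * (1 - d ^+ 2) ^+ 2) <= 8 * k ^+ 4.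
    move: dd k4; move: (k ^+ 4) (d ^+ 2) => B D; clear=> /andP[D0 D1] B0.
    have q : (1 - D) ^+ 2 <= 1 by nra.
    by have q0 := sqr_ge0 (1 - D); apply/andP; split; nra.
  have le1 (a b M : R) : 0 <= a -> a <= 1 -> 0 <= b <= M -> a * b <= M.
    by move=> ? ? /andP[? ?]; nra.
  apply: le_trans (lerD (le1 _ _ _ r50 r5 a1) (le1 _ _ _ (ltW r0) (ltW r1) a2)) _.
  by move: (k ^+ 4) => z; clear; lra.
rewrite [leLHS](_ : _ = (72 * k ^+ 4)%:E); last first.
  by rewrite integral_cst; [rewrite -[RHS]mule1 -muI|exact: mI].
rewrite lee_fin; have : 0 <= d ^+ 3 * k ^+ 3 by rewrite mulr_ge0 ?exprn_ge0// ltW.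
by move: k4; move: (k ^+ 4) (_ * k ^+ 3) => z y; clear; lra.
Qed.

End Competitor.

(** * Calculus of smooth functions *)

Section CkCalculus.
Context {R : realType}.

Lemma Ck_cont (V : normedModType R) k (f : V -> R^o) : Ck k f -> continuous f.
Proof. by case: k => [|k] []. Qed.

Lemma Ck_pred (V : normedModType R) k (f : V -> R^o) : Ck k.+1 f -> Ck k f.
Proof.
elim: k f => [|k ih] f /= [cf df]; first by split.
by split=> // v; have [d1 d2] := df v; split => //; apply: ih.
Qed.

Lemma Ck_cst (V : normedModType R) k (c : R) : Ck k (fun _ : V => c : R^o).
Proof.
elim: k c => [|k ih] c; split=> //; try exact: cst_continuous.
move=> v; split; first by move=> x; exact: derivable_cst.
by rewrite (_ : 'D_v _ = fun=> 0) //; apply/funext => x; rewrite derive_cst.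
Qed.

Lemma Ck_add (V : normedModType R) k (f g : V -> R^o) : Ck k f -> Ck k g -> Ck k (f + g).
Proof.
elim: k f g => [|k ih] f g [cf df] [cg dg]; split=> //; try by move=> x; apply: cvgD; [exact: cf|exact: cg].
move=> v; have [f1 f2] := df v; have [g1 g2] := dg v; split; first by move=> x; exact: derivableD.
by rewrite (_ : 'D_v _ = 'D_v f + 'D_v g); [exact: ih|apply/funext => x; rewrite deriveD].
Qed.

Lemma Ck_mul (V : normedModType R) k (f g : V -> R^o) : Ck k f -> Ck k g -> Ck k (f * g).
Proof.
elim: k f g => [|k ih] f g Cf Cg; have cf := Ck_cont Cf; have cg := Ck_cont Cg.
  by split=> //; move=> x; apply: cvgM; [exact: cf|exact: cg].
split; first by move=> x; apply: cvgM; [exact: cf|exact: cg].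
move=> v; have [_ /(_ v)[f1 f2]] := Cf; have [_ /(_ v)[g1 g2]] := Cg.
split; first by move=> x; exact: derivableM.
rewrite (_ : 'D_v _ = f * 'D_v g + g * 'D_v f); last by apply/funext => x; rewrite deriveM.
by apply: Ck_add; apply: ih => //; exact: Ck_pred.
Qed.

Lemma Ck_scale (V : normedModType R) k (c : R) (f : V -> R^o) : Ck k f -> Ck k (fun x => c * f x : R^o).
Proof. by move=> /(Ck_mul (Ck_cst V k c)). Qed.

Section Affine.
Context (V W : normedModType R) (l : V -> W) (L : V -> W).
Hypotheses (cl : continuous l) (lE : forall h v x, l (h *: v + x) = h *: L v + l x).

Lemma derive_affine (f : W -> R^o) v x :
  ('D_v (f \o l) x = 'D_(L v) f (l x)) /\ (derivable f (l x) (L v) -> derivable (f \o l) x v).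
Proof.
have E : (fun h : R => h^-1 *: ((f \o l) (h *: v + x) - (f \o l) x)) =
    (fun h => h^-1 *: (f (h *: L v + l x) - f (l x))).
  by apply/funext => h /=; rewrite lE.
by split; [rewrite /derive E|rewrite /derivable E].
Qed.

Lemma Ck_affine k (f : W -> R^o) : Ck k f -> Ck k (f \o l).
Proof.
have cc (g : W -> R^o) : continuous g -> continuous (g \o l).
  by move=> cg x; apply: continuous_comp; [exact: cl|exact: cg].
elim: k f => [|k ih] f [cf df]; split=> //; try exact: cc.
move=> v; have [f1 f2] := df (L v); split.
  by move=> x; apply: (derive_affine f v x).2; exact: f1.
rewrite (_ : 'D_v _ = 'D_(L v) f \o l); first exact: ih.
by apply/funext => x; rewrite (derive_affine f v x).1.
Qed.

End Affine.

(** On the line every directional derivative is a multiple of the ordinary one, so a single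
    derivative feeds the recursion in [Ck]. *)
Lemma Ck_real k (f g : R^o -> R^o) : (forall x : R, is_derive (x : R^o) 1 f (g x)) -> Ck k g -> Ck k.+1 f.
Proof.
move=> fg Cg; have df (x : R) : differentiable f x by apply/derivable1_diffP.
split; first by move=> x; apply: differentiable_continuous; exact: df.
move=> v; split; first by move=> x; exact: diff_derivable.
rewrite (_ : 'D_v f = fun x => v * g x); first exact: Ck_scale.
apply/funext => x; rewrite deriveE// (_ : v = v *: (1 : R^o)); last by rewrite /GRing.scale/= mulr1.
rewrite linearZ -deriveE//; have [_ ->] := fg x.
by rewrite /GRing.scale/= mulr1.
Qed.

End CkCalculus.

(** * Smooth bumps *)

Section Bump.
Context {R : realType}.
Implicit Types (s x y : R) (m k n : nat).

(** The functions exp(- 1 / s) s^(-m), extended by 0. The family is taken for all m because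
    differentiation maps it into its own linear span. *)
Definition flat m s : R := if 0 < s then expR (- s^-1) * s^-1 ^+ m else 0.

Lemma flat_ge0 m s : 0 <= flat m s.
Proof.
by rewrite /flat; case: ifPn => // s0; rewrite mulr_ge0 ?expR_ge0// exprn_ge0// invr_ge0 ltW.
Qed.

Lemma exp_dominates n y : 0 <= y -> y ^+ n.+1 <= n.+1%:R ^+ n.+1 * expR y.
Proof.
move=> y0; have n0 : 0 < n.+1%:R :> R by rewrite ltr0n.
have -> : expR y = expR (y / n.+1%:R) ^+ n.+1 by rewrite -expRM_natl mulrC divfK// gt_eqF.
have -> : y ^+ n.+1 = n.+1%:R ^+ n.+1 * (y / n.+1%:R) ^+ n.+1.
  by rewrite -exprMn mulrC divfK// gt_eqF.
rewrite ler_pM2l ?exprn_gt0// ler_pXn2r ?nnegrE ?expR_ge0 ?divr_ge0//.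
by apply: le_trans (expR_ge1Dx _); rewrite lerDr.
Qed.

(** The difference quotient of [flat m] at 0 is [flat m.+1], so this linear bound, used for [m.+1],
    gives derivative 0 at the origin. *)
Lemma flat_le m s : `|flat m s| <= m.+1%:R ^+ m.+1 * `|s|.
Proof.
rewrite ger0_norm ?flat_ge0// /flat; case: ifPn => s0; last by rewrite mulr_ge0 ?exprn_ge0.
have i0 : 0 < s^-1 by rewrite invr_gt0.
have h := exp_dominates m (ltW i0).
rewrite gtr0_norm// expRN [leLHS]mulrC ler_pdivrMr ?expR_gt0//.
have -> : s^-1 ^+ m = s^-1 ^+ m.+1 * s by rewrite exprSr mulfVK ?gt_eqF.
by rewrite mulrAC ler_pM2r.
Qed.

Definition dflat m s : R := flat m.+2 s + - m%:R * flat m.+1 s.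

Lemma is_derive_flat m s : is_derive (s : R^o) 1 (flat m : R^o -> R^o) (dflat m s).
Proof.
have [s0|s0|->] := ltgtP s 0.
- have -> : dflat m s = 0 by rewrite /dflat /flat ltNge ltW//= mulr0 addr0.
  apply: (near_eq_is_derive (f := fun=> 0 : R^o)) => //.
  by near=> z; rewrite /flat ifF//; apply/negbTE; rewrite -leNgt ltW//; near: z; exact: lt_nbhsl.
- have n0 : s != 0 by rewrite gt_eqF.
  have d1 : is_derive (s : R^o) 1 ((fun z : R => z^-1) : R^o -> R^o) (- s ^- 2 *: 1).
    exact: is_deriveV.
  have d2 : is_derive (s : R^o) 1 ((fun z : R => expR (- z^-1)) : R^o -> R^o) (expR (- s^-1) * s ^- 2).
    have d3 := is_deriveN d1.
    apply: is_derive_eq (is_derive1_comp (is_derive_expR _) d3) _.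
    by rewrite scaleNr opprK /GRing.scale/= mulr1.
  have d4 := is_deriveX m d1.
  apply: (near_eq_is_derive (f := (fun z : R => expR (- z^-1)) * (fun z : R => z^-1) ^+ m)).
    near=> z; rewrite /flat ifT; last by near: z; exact: lt_nbhsr.
    by rewrite fctE; congr (_ * _); elim: m {d4} => [|m ih]; rewrite ?expr0// !exprS -ih.
  apply: is_derive_eq (is_deriveM d2 d4) _.
  rewrite /dflat /flat s0 !fctE /GRing.scale/=.
  case: m {d4} => [|m]; first by rewrite !expr0 exprVn; ring.
  by rewrite /= -exprVn !exprS; ring.
- have -> : dflat m 0 = 0 by rewrite /dflat /flat ltxx mulr0 addr0.
  suff : (fun h : R => h^-1 *: (flat m (h *: (1 : R^o) + 0) - flat m 0)) @ 0^' --> (0 : R^o).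
    move=> H; split; [by apply/cvg_ex; exists 0|exact: cvg_lim].
  apply/cvgr0Pnorm_le => e e0.
  have C0 : 0 < m.+2%:R ^+ m.+2 :> R by rewrite exprn_gt0// ltr0n.
  near=> h; have h0 : h != 0 by near: h; exact: nbhs_dnbhs_neq.
  rewrite /GRing.scale/= mulr1 addr0 {2}/flat ltxx subr0.
  have -> : h^-1 * flat m h = flat m.+1 h.
    by rewrite /flat; case: ifP => _; rewrite ?mulr0// exprS; ring.
  apply: le_trans (flat_le _ _) _; rewrite mulrC -ler_pdivlMr//.
  near: h; apply: dnbhs0_le; exact: divr_gt0.
Unshelve. all: by end_near. Qed.

Lemma Ck_flat k m : Ck k (flat m : R^o -> R^o).
Proof.
elim: k m => [|k ih] m; last first.
  apply: Ck_real (is_derive_flat m) _.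
  by apply: Ck_add; [exact: ih|apply: Ck_scale; exact: ih].
split=> //; move=> x; apply: differentiable_continuous.
by apply/derivable1_diffP; have [] := is_derive_flat m x.
Qed.

(** Smooth functions with values in [0, 1] that vanish outside [x, y] and converge to 1 on ]x, y[ as
    n grows. *)
Definition tbump x y n s : R := flat 0 (n%:R * (s - x)) * flat 0 (n%:R * (y - s)).

Lemma Ck_tbump k x y n : Ck k (tbump x y n : R^o -> R^o).
Proof.
have A (a b : R) : Ck k ((fun s => flat 0 (a * s + b)) : R^o -> R^o).
  apply: (@Ck_affine _ R^o R^o (fun s => a * s + b) (fun s => a * s)) (Ck_flat k 0).
    by move=> s; apply: cvgD; [apply: cvgM; [exact: cvg_cst|exact: cvg_id]|exact: cvg_cst].
  by move=> h v z; rewrite /GRing.scale/=; ring.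
rewrite (_ : tbump x y n = (fun s => flat 0 (n%:R * s + - (n%:R * x))) *
   (fun s => flat 0 (- n%:R * s + n%:R * y))); first exact: Ck_mul.
apply/funext => s; rewrite /tbump fctE; congr (flat 0 _ * flat 0 _); ring.
Qed.

Lemma tbump_eq0 x y n s : ~ x <= s <= y -> tbump x y n s = 0.
Proof.
move=> /negP; rewrite negb_and -!ltNge /tbump /flat => /orP[] h.
  by rewrite ifF ?mul0r//; apply/negbTE; rewrite -leNgt mulr_ge0_le0// subr_le0 ltW.
by rewrite [X in _ * X]ifF ?mulr0//; apply/negbTE; rewrite -leNgt mulr_ge0_le0// subr_le0 ltW.
Qed.

Lemma test_tbump (D : set R^o) x y n : `[x, y] `<=` D -> test_function D (tbump x y n : R^o -> R^o).
Proof.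
move=> xyD; split; first by move=> k; exact: Ck_tbump.
exists `[x, y]%classic; split=> //; first exact: segment_compact.
by move=> s /=; rewrite in_itv/=; exact: tbump_eq0.
Qed.

Lemma flat0_le1 s : flat 0 s <= 1.
Proof.
rewrite /flat expr0 mulr1; case: ifP => // s0.
by rewrite -expR0 ler_expR oppr_le0 invr_ge0 ltW.
Qed.

Lemma tbump_ge0_le1 x y n s : 0 <= tbump x y n s <= 1.
Proof. by rewrite mulr_ge0 ?flat_ge0//= mulr_ile1 ?flat_ge0 ?flat0_le1. Qed.

Lemma tbump_gt0 x y n s : x < s -> s < y -> 0 < tbump x y n.+1 s.
Proof.
move=> xs sy; have n0 : 0 < n.+1%:R :> R by rewrite ltr0n.
have a0 : 0 < n.+1%:R * (s - x) by rewrite mulr_gt0// subr_gt0.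
have b0 : 0 < n.+1%:R * (y - s) by rewrite mulr_gt0// subr_gt0.
by rewrite /tbump /flat a0 b0 !expr0 !mulr1 mulr_gt0 ?expR_gt0.
Qed.

Lemma tbump_cvg x y s : x < s -> s < y -> tbump x y n s @[n --> \oo] --> (1 : R).
Proof.
have F (a : R) : 0 < a -> flat 0 (n%:R * a) @[n --> \oo] --> (1 : R).
  (* The index is shifted because at n = 0 the argument of [flat] is 0, where it takes its default
     value. *)
  move=> a0; rewrite -(cvg_shiftS).
  rewrite (_ : (fun n => _) = (fun n => expR (- (a^-1 * n.+1%:R^-1)))); last first.
    by apply/funext => n; rewrite /flat pmulr_rgt0 ?ltr0n// a0 expr0 mulr1 invfM mulrC.
  have H : (fun n => - (a^-1 * n.+1%:R^-1)) @ \oo --> - (a^-1 * (0 : R)).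
    by apply: cvgN; apply: cvgM; [exact: cvg_cst|exact: (@cvg_harmonic R)].
  rewrite mulr0 oppr0 in H; have FF : Filter (\oo : set_system nat) by exact: eventually_filter.
  have K := @continuous_cvg _ _ _ _ _ _ (expR : R -> R) 0 (@continuous_expR R 0) H.
  by move: (K FF); rewrite expR0.
move=> xs sy; rewrite -(mulr1 (1 : R)).
by apply: cvgM; apply: F; rewrite subr_gt0.
Qed.

End Bump.

(** * Measures with an integrable density *)

Section Density.
Context {R : realType}.
Notation mu := (@lebesgue_measure R).
Context (f : R -> R) (f0 : forall x, 0 <= f x) (fi : mu.-integrable setT (EFin \o f)).

(** The two proofs are arguments of the definition so that the structures of measure and finite
    measure can be attached to it. *)
Definition density of (forall x, 0 <= f x) & mu.-integrable setT (EFin \o f) :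
    set (measurableTypeR R) -> \bar R :=
  fun A => (\int[mu]_(x in A) (f x)%:E)%E.

Let D0 : density f0 fi set0 = 0%E. Proof. exact: integral_set0. Qed.
Let Dge0 A : (0 <= density f0 fi A)%E.
Proof. by apply: integral_ge0 => x _; rewrite lee_fin. Qed.
Let Dsigma : semi_sigma_additive (density f0 fi).
Proof.
move=> /= A mA tA mUA; rewrite /density integral_bigcup//=; last first.
  exact: (integrableS _ _ (subsetT _)).
apply: is_cvg_ereal_nneg_natsum_cond => n _ _.
by apply: integral_ge0 => x _; rewrite lee_fin.
Qed.

HB.instance Definition _ := isMeasure.Build _ _ _ (density f0 fi) D0 Dge0 Dsigma.

Let Dfin : fin_num_fun (density f0 fi).
Proof.
move=> A mA; apply: integrable_fin_num => //; exact: (integrableS _ _ (subsetT _)).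
Qed.

HB.instance Definition _ := Measure_isFinite.Build _ _ _ (density f0 fi) Dfin.

(** The Radon-Nikodym derivative has the same integral as f over every measurable set, hence equals
    f almost everywhere; its change of variables formula then holds with f. *)
Lemma integral_density E (g : R -> R) : measurable E -> measurable_fun E g ->
  (forall x, 0 <= g x) ->
  (\int[density f0 fi]_(x in E) (g x)%:E = \int[mu]_(x in E) (g x * f x)%:E)%E.
Proof.
move=> mE mg g0.
have dom : density f0 fi `<< mu.
  apply/null_content_dominatesP => A mA A0.
  rewrite /density; apply: null_set_integral => //.
  by apply: measurable_funTS; exact: measurable_int fi.
set d := Radon_Nikodym_SigmaFinite.f (density f0 fi) mu.
have di : mu.-integrable setT d by exact: Radon_Nikodym_SigmaFinite.f_integrable.
have mf : measurable_fun E (EFin \o f).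
  by apply: measurable_funTS; exact: measurable_int fi.
have md : measurable_fun E d by apply: measurable_funTS; exact: measurable_int di.
have d0 x : (0 <= d x)%E by exact: Radon_Nikodym_SigmaFinite.f_ge0.
have fd : ae_eq mu E d (EFin \o f).
  have dE : mu.-integrable E d by apply: integrableS di.
  apply: integral_ae_eq => //.
  by move=> A AE mA; rewrite -(Radon_Nikodym_SigmaFinite.f_integral dom).
rewrite -(Radon_Nikodym_SigmaFinite.change_of_variables dom)//; last exact/measurable_EFinP.
rewrite -/d; apply: ge0_ae_eq_integral => //.
- by apply: emeasurable_funM => //; exact/measurable_EFinP.
- by apply/measurable_EFinP; apply: measurable_funM => //; exact/measurable_EFinP.
- by move=> x _; rewrite mule_ge0// lee_fin.
- by move=> x _; rewrite lee_fin mulr_ge0.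
- by apply: ae_imp fd => x; rewrite /= => H Ex; rewrite (H Ex).
Qed.

End Density.

(** * Change of variables by a monotone absolutely continuous map *)

Section Substitution.
Context {R : realType}.
Notation mu := (@lebesgue_measure R).
Implicit Types (s t r : R).

(** The image under X of the measure with density X1, completed by Lebesgue measure outside
    [X al, X be], gives every half-open interval its length. Uniqueness of Lebesgue measure
    identifies the two, and the formula is integration against an image measure. *)
Lemma substitution (al be : R) (X Y X1 : R -> R) : al <= be -> measurable_fun setT X ->
  (forall s t, al <= s -> s < t -> t <= be -> X s < X t) ->
  (forall r, X al <= r <= X be -> al <= Y r <= be /\ X (Y r) = r) ->
  acon al be X X1 -> (forall s, al <= s <= be -> 0 <= X1 s) ->
  forall g : R -> R, measurable_fun setT g -> (forall r, 0 <= g r) ->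
  (\int[mu]_(s in `[al, be]) (g (X s) * X1 s)%:E = \int[mu]_(r in `[X al, X be]) (g r)%:E)%E.
Proof.
move=> ab mX incX YP [Xi XE] X10 g mg g0.
have wX s t : al <= s -> s <= t -> t <= be -> X s <= X t.
  by move=> ? ; rewrite le_eqVlt => /predU1P[->//|] ? ?; apply/ltW/incX.
pose f := X1 \_ `[al, be].
have mI' := mitv al be.
have f0 x : 0 <= f x.
  by rewrite /f patchE; case: ifPn => //; rewrite inE/= in_itv/=; exact: X10.
have fi : mu.-integrable setT (EFin \o f).
  have := (@integrable_mkcond _ (measurableTypeR R) R mu _ (EFin \o X1) mI').1 Xi.
  congr (mu.-integrable _ _).
  by apply/funext => x; rewrite /f /= !patchE; case: ifP.
pose nu := density f0 fi.
have mD := mitv (X al) (X be).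
pose X' : measurableTypeR R -> measurableTypeR R := X.
(* The second summand restores Lebesgue measure off the range of X, so that the comparison can be
   made on the whole line. *)
pose m := measure_add (pushforward nu X') (mrestr mu (measurableC mD)).
have nuE (A : set R) : measurable A -> nu A = (\int[mu]_(s in `[al, be] `&` A) (X1 s)%:E)%E.
  move=> mA; rewrite /nu/= /density setIC integral_mkcondr; apply: eq_integral => s _.
  by rewrite /f /= !patchE; case: ifP.
have nu_seg s t : al <= s -> s <= t -> t <= be ->
   (\int[mu]_(s in `[s, t]) (X1 s)%:E = (X t - X s)%:E)%E.
  move=> als st tb; have Xi' := L1_sub Xi als tb.
  by rewrite XE// /itg /Rintegral fineK//; apply: integrable_fin_num.
have mE (A : set (measurableTypeR R)) : m (mX : measurable_fun setT X') A =
    (nu (X @^-1` A) + mu (A `&` ~` `[X al, X be]))%E by exact: measure_addE.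
have H (A : set (measurableTypeR R)) : measurable A -> mu A = m (mX : measurable_fun setT X') A.
  apply: lebesgue_measure_unique => _ [[a b] _ <-] /=.
  apply: etrans (esym (mE _)).
  set S := `]a, b]%classic.
  have mS : measurable (S : set (measurableTypeR R)) by exact: measurable_itv.
  have -> : mu S = (mu (S `&` `[X al, X be]) + mu (S `&` ~` `[X al, X be]))%E.
    by rewrite [LHS](measureDI mu mS mD) setDE addeC.
  congr (_ + _)%E.
  have mXS : measurable (X @^-1` S) by rewrite -[X in measurable X]setTI; exact (mX measurableT _ mS).
  rewrite nuE//; set T := _ `&` (X @^-1` S).
  have mT : measurable T by exact: measurableI.
  pose a' := Num.max a (X al); pose b' := Num.min b (X be).
  have S1 : S `&` `[X al, X be] `<=` `[a', b'].
    move=> r [] /=; rewrite /S /= !in_itv/= /a' /b' ge_max le_min.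
    by move=> /andP[/ltW -> ->] /andP[-> ->].
  have T1 s : T s -> a' <= X s <= b'.
    move=> [] /=; rewrite /S /= !in_itv/= /a' /b' ge_max le_min.
    by move=> /andP[als sbe] /andP[/ltW -> ->]; rewrite !wX.
  have [ba|ab'] := ltP b' a'.
    have -> : S `&` `[X al, X be] = set0.
      by rewrite -subset0; apply: subset_trans S1 _; rewrite set_itv_ge// bnd_simp -ltNge.
    have -> : T = set0.
      by rewrite -subset0 => s /T1/andP[/le_trans h /h]; rewrite leNgt ba.
    by rewrite measure0 integral_set0.
  have S2 : `]a', b'] `<=` S `&` `[X al, X be].
    move=> r /=; rewrite /S /= !in_itv/= /a' /b' gt_max le_min.
    by move=> /andP[/andP[-> /ltW ->] /andP[-> ->]].
  have a'r : X al <= a' <= X be.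
    by rewrite /a' le_max lexx orbT /= (le_trans ab')// /b' ge_min lexx orbT.
  have b'r : X al <= b' <= X be.
    by rewrite (le_trans _ ab') /a' ?le_max ?lexx ?orbT//= /b' ge_min lexx orbT.
  have [/andP[sa1 sa2] sa] := YP _ a'r; have [/andP[sb1 sb2] sb] := YP _ b'r.
  have sab : Y a' <= Y b'.
    by rewrite leNgt; apply/negP => /(incX _ _ sb1)/(_ sa2); rewrite sa sb ltNge ab'.
  (* Strict monotonicity squeezes the preimage T between a half-open and a closed interval with ends
     Y a' and Y b'; no exact description of its endpoints is required. *)
  have T2 : `]Y a', Y b'] `<=` T.
    move=> s /=; rewrite in_itv/= => /andP[as_ sb'].
    have als : al <= s by exact: le_trans (ltW as_).
    have sbe : s <= be by exact: le_trans sb2.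
    split; rewrite /= ?in_itv/= ?als//.
    have h1 := incX _ _ sa1 as_ sbe; have h2 := wX _ _ als sb' sb2.
    rewrite sa in h1; rewrite sb in h2.
    have : (S `&` `[X al, X be]) (X s) by apply: S2; rewrite /= in_itv/= h1.
    by case.
  have T3 : T `<=` `[Y a', Y b'].
    move=> s Ts; have /andP[h1 h2] := T1 _ Ts; have [] := Ts; rewrite /= !in_itv/= => /andP[als sbe] _.
    rewrite !leNgt; apply/andP; split; apply/negP.
      by move=> /(incX _ _ als)/(_ sa2); rewrite sa ltNge h1.
    by move=> /(incX _ _ sb1)/(_ sbe); rewrite sb ltNge h2.
  have mo p q : measurable (`]p, q]%classic : set (measurableTypeR R)) by exact: measurable_itv.
  have mc p q : measurable (`[p, q]%classic : set (measurableTypeR R)) by exact: measurable_itv.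
  have e1 : mu (S `&` `[X al, X be]) = (b' - a')%:E.
    apply/le_anti/andP; split.
      apply: (@le_trans _ _ (mu `[a', b'])); first by apply: le_measure => //; rewrite inE//; exact: measurableI.
      by rewrite lebesgue_measure_itv/= lte_fin; case: ltP => // ?; rewrite lee_fin subr_ge0.
    apply: (@le_trans _ _ (mu `]a', b'])); last by apply: le_measure => //; rewrite inE//; exact: measurableI.
    rewrite lebesgue_measure_itv/= lte_fin; case: ltP => // h; rewrite lee_fin subr_le0//.
  have mX1 p q : al <= p -> q <= be -> measurable_fun (`[p, q] : set (measurableTypeR R)) (fun s => (X1 s)%:E).
    by move=> h1 h2; apply/measurable_EFinP; exact: L1_meas (L1_sub Xi h1 h2).
  have g1 p q s : al <= p -> q <= be -> `[p, q]%classic s -> (0 <= (X1 s)%:E)%E.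
    by move=> h1 h2; rewrite /= in_itv/= => /andP[h3 h4]; rewrite lee_fin X10// (le_trans h1)//= (le_trans h4).
  have sub : T `<=` `[al, be] by move=> s [].
  have e2 : (\int[mu]_(s in T) (X1 s)%:E = (b' - a')%:E)%E.
    rewrite -sa -sb -nu_seg//; apply/le_anti/andP; split.
      apply: ge0_subset_integral => //; first exact: mX1.
      by move=> s; exact: g1.
    rewrite -integral_itv_obnd_cbnd; last first.
      by apply: measurable_funS (mX1 _ _ sa1 sb2) => // s; rewrite /= !in_itv/= => /andP[/ltW -> ->].
    apply: ge0_subset_integral => //.
      by apply: measurable_funS (mX1 _ _ (lexx al) (lexx be)).
    by move=> s /sub; exact: g1.
  by rewrite e1 e2.
have gX : measurable_fun setT (g \o X) by exact: measurableT_comp.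
have -> : (\int[mu]_(r in `[X al, X be]) (g r)%:E = \int[pushforward nu X']_(r in `[X al, X be]) (g r)%:E)%E.
  apply: eq_measure_integral => A mA AD; rewrite [LHS]H// mE.
  by rewrite (_ : A `&` ~` _ = set0) ?measure0 ?adde0// -setDE setD_eq0.
rewrite ge0_integral_pushforward//; last 2 first.
- by apply/measurable_EFinP; exact: measurable_funTS.
- by move=> r _; rewrite lee_fin.
have mXD : measurable (X @^-1` `[X al, X be]) by rewrite -[X in measurable X]setTI; exact (mX measurableT _ mD).
rewrite (_ : (fun x => ((EFin \o g) \o X') x) = (fun x => (g (X x))%:E))//.
have gX' : measurable_fun (X @^-1` `[X al, X be]) (g \o X) by exact: measurable_funTS gX.
rewrite (integral_density f0 fi mXD gX' (fun s => g0 (X s))).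
rewrite [RHS]integral_mkcond [LHS]integral_mkcond; apply: eq_integral => s _.
rewrite /= !patchE /f !patchE; case: ifPn => sI; last first.
  by rewrite /= mulr0; case: ifP.
rewrite ifT// inE /=; move: sI; rewrite inE/= !in_itv/= => /andP[? ?].
by rewrite !wX.
Qed.

End Substitution.

(** * Charts, chain rule and null sets *)

Section Charts.
Context {R : realType}.
Notation mu := (@lebesgue_measure R).
Implicit Types (x y s t r al be : R).

Lemma L1_mkcond x y (f : R -> R) : L1 x y f <-> mu.-integrable setT (EFin \o (f \_ `[x, y])).
Proof.
have := @integrable_mkcond _ (measurableTypeR R) R mu _ (EFin \o f) (mitv x y).
rewrite (_ : (EFin \o f) \_ `[x, y] = EFin \o (f \_ `[x, y]))//.
by apply/funext => r; rewrite /= !patchE; case: ifP.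
Qed.

(** Extended by 0, k has a primitive that vanishes identically, and Lebesgue differentiation
    recovers k from it almost everywhere. *)
Lemma itg0_ae x y (k : R -> R) : L1 x y k ->
  (forall s t, x <= s -> s <= t -> t <= y -> itg s t k = 0) ->
  {ae mu, forall r, x <= r <= y -> k r = 0}.
Proof.
move=> ki k0; have ki' := (L1_mkcond x y k).1 ki.
pose kk := k \_ `[x, y].
pose F r := \int[mu]_(t in `]-oo, r]) kk t.
have F0 r : F r = 0.
  rewrite /F /kk -Rintegral_mkcondr.
  have [rx|xr] := ltP r x.
    rewrite (_ : _ `&` _ = set0) ?Rintegral_set0// -subset0 => s /=; rewrite !in_itv/= => -[sr /andP[xs _]].
    by move: (le_lt_trans sr rx); rewrite ltNge xs.
  rewrite (_ : _ `&` _ = `[x, Num.min r y]%classic).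
    have [xy|yx] := leP x y.
      by apply: k0; rewrite ?lexx// ?le_min ?xr ?xy// ge_min lexx orbT.
    rewrite set_itv_ge ?Rintegral_set0// bnd_simp -ltNge gt_min yx orbT//.
  apply/seteqP; split=> s /=; rewrite !in_itv/= le_min; first by case=> -> /andP[-> ->].
  by move=> /andP[-> /andP[-> ->]].
have := @FTC1Ny R kk.
move=> /(_ _ (integrable_locally (mitv x y) ki)).
have Hi (z : R) : mu.-integrable `]-oo, z] (EFin \o kk).
  by apply: integrableS ki' => //; exact: measurable_itv.
move=> /(_ Hi) H.
apply: ae_imp H => r [_ +] xry; rewrite -/F.
rewrite (_ : F = fun=> 0); last exact/funext.
by rewrite derive1_cst /kk patchE ifT// inE/= in_itv.
Qed.

Lemma acon_uniq x y (F B B' : R -> R) : acon x y F B -> acon x y F B' ->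
  {ae mu, forall r, x <= r <= y -> B r = B' r}.
Proof.
move=> [b1 B1] [b2 B2].
have := @itg0_ae x y (fun r => B r - B' r) (L1B b1 b2).
have h s t : x <= s -> s <= t -> t <= y -> itg s t (fun r => B r - B' r) = 0.
  move=> xs st ty; rewrite itgB; [|exact: L1_sub b1 _ _|exact: L1_sub b2 _ _].
  by rewrite -B1// -B2// subrr.
move=> /(_ h); apply: ae_imp => r H /H; lra.
Qed.

(** The hypotheses of [substitution] in one bundle; Y is a right inverse that witnesses surjectivity
    onto [X al, X be]. *)
Definition chart al be (X Y X1 : R -> R) := [/\ measurable_fun setT X,
  (forall s t, al <= s -> s < t -> t <= be -> X s < X t),
  (forall r, X al <= r <= X be -> al <= Y r <= be /\ X (Y r) = r),
  acon al be X X1 & (forall s, al <= s <= be -> 0 <= X1 s)].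

Lemma chart_sub al be s t X Y X1 : chart al be X Y X1 -> al <= s -> s <= t -> t <= be -> chart s t X Y X1.
Proof.
move=> [mX iX YP aX X0] als st tb.
have wX p q : al <= p -> p <= q -> q <= be -> X p <= X q.
  by move=> ?; rewrite le_eqVlt => /predU1P[->//|] ? ?; apply/ltW/iX.
split=> //.
- by move=> p q sp pq qt; apply: iX => //; [exact: le_trans sp|exact: le_trans tb].
- move=> r /andP[r1 r2].
  have [] := YP r.
    by rewrite (le_trans _ r1) ?wX//= ?(le_trans r2) ?wX// ?(le_trans st)// (le_trans als).
  move=> /andP[h1 h2] E; split=> //; rewrite !leNgt; apply/andP; split; apply/negP => h.
    by have := iX _ _ h1 h (le_trans st tb); rewrite E ltNge r1.
  by have := iX _ _ (le_trans als st) h h2; rewrite E ltNge r2.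
- exact: acon_sub aX als tb.
- by move=> r /andP[sr rt]; apply: X0; rewrite (le_trans als)//= (le_trans rt).
Qed.

Lemma chart_homo al be s t X Y X1 : chart al be X Y X1 -> al <= s -> s <= t -> t <= be -> X s <= X t.
Proof. by move=> [mX iX _ _ _] ? + ?; rewrite le_eqVlt => /predU1P[->//|?]; apply/ltW/iX. Qed.

(** [substitution] is applied to the positive and the negative part of B, extended by 0 to have a
    function measurable on the whole line. *)
Lemma itg_subst al be X Y X1 (B : R -> R) : chart al be X Y X1 -> al <= be ->
  L1 (X al) (X be) B ->
  L1 al be (fun s => B (X s) * X1 s) /\ itg al be (fun s => B (X s) * X1 s) = itg (X al) (X be) B.
Proof.
move=> C ab Bi; have [mX iX YP aX X0] := C; have [X1i _] := aX.
pose b := B \_ `[X al, X be].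
have mb : measurable_fun setT b.
  by have := measurable_int _ ((L1_mkcond _ _ _).1 Bi); move/measurable_EFinP.
have S := substitution ab mX iX YP aX X0.
have bE r : X al <= r <= X be -> b r = B r.
  by move=> h; rewrite /b patchE ifT// inE/= in_itv.
have Xr s : al <= s <= be -> X al <= X s <= X be.
  by move=> /andP[? ?]; rewrite !(chart_homo C).
have bi : L1 (X al) (X be) b by apply: L1_eq Bi => r /bE.
have mbX : measurable_fun setT (b \o X) by exact: measurableT_comp.
have mX1 : measurable_fun `[al, be] X1 by exact: L1_meas.
have pos (g : R -> R) : measurable_fun setT g -> (forall r, 0 <= g r) -> L1 (X al) (X be) g ->
    L1 al be (fun s => g (X s) * X1 s) /\ itg al be (fun s => g (X s) * X1 s) = itg (X al) (X be) g.
  move=> mg g0 gi; have E := S g mg g0.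
  have li : L1 al be (fun s => g (X s) * X1 s).
    apply/integrableP; split.
      apply/measurable_EFinP; apply: measurable_funM => //.
      by apply: measurable_funTS; exact: measurableT_comp.
    have EE : (\int[mu]_(x in `[al, be]) `|(EFin \o (fun s => g (X s) * X1 s)%R) x| =
        \int[mu]_(s in `[al, be]) (g (X s) * X1 s)%:E)%E.
      by apply: eq_integral => s; rewrite inE/= in_itv/= => h; rewrite ger0_norm// mulr_ge0 ?X0.
    rewrite EE E; have /integrableP[_] := gi; apply: le_lt_trans; apply: ge0_le_integral => //.
    - by move=> r _; rewrite lee_fin.
    - by apply/measurable_EFinP; exact: measurable_funTS.
    - by apply/measurable_EFinP; apply: measurableT_comp => //; exact: measurable_funTS.
    - by move=> r _; rewrite lee_fin ler_norm.
  by split=> //; rewrite /itg /Rintegral E.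
pose p r := Num.max (b r) 0; pose m r := Num.max (- b r) 0.
have mp : measurable_fun setT p by apply: measurable_maxr => //; exact: measurable_cst.
have mm : measurable_fun setT m.
  by apply: measurable_maxr; [exact: measurableT_comp|exact: measurable_cst].
have p0 r : 0 <= p r by rewrite /p le_max lexx orbT.
have m0 r : 0 <= m r by rewrite /m le_max lexx orbT.
have pm r : b r = p r - m r by rewrite /p /m; case: (leP (b r) 0); case: (leP (- b r) 0) => ? ?; lra.
have pi : L1 (X al) (X be) p.
  apply: L1_le (L1_norm bi); first exact: measurable_funTS.
  by move=> r _; rewrite ger0_norm// /p ge_max ler_norm normr_ge0.
have mi : L1 (X al) (X be) m.
  apply: L1_le (L1_norm bi); first exact: measurable_funTS.
  by move=> r _; rewrite ger0_norm// /m ge_max -normrN ler_norm normr_ge0.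
have [p1 p2] := pos p mp p0 pi; have [m1 m2] := pos m mm m0 mi.
have E s : al <= s <= be -> p (X s) * X1 s - m (X s) * X1 s = B (X s) * X1 s.
  by move=> h; rewrite -mulrBl -pm bE// Xr.
split; first exact: L1_eq E (L1B p1 m1).
rewrite -(itg_eq E) itgB// p2 m2 -itgB//; apply: itg_eq => r h.
by rewrite -pm bE.
Qed.

Lemma acon_comp al be X Y X1 (F B : R -> R) : chart al be X Y X1 -> al <= be ->
  acon (X al) (X be) F B -> acon al be (F \o X) (fun s => B (X s) * X1 s).
Proof.
move=> C ab [Bi FB]; split; first by have [] := itg_subst C ab Bi.
move=> s t als st tb; have C' := chart_sub C als st tb.
have h1 := chart_homo C (lexx _) als (le_trans st tb); have h2 := chart_homo C als st tb.
have h3 := chart_homo C (le_trans als st) tb (lexx _).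
have [_ ->] := itg_subst C' st (L1_sub Bi h1 h3).
exact: FB.
Qed.

(** Substituting the indicator of a null set shows that the integral of X1 over its preimage
    vanishes, so the preimage is null where X1 > 0. *)
Lemma ae_comp al be X Y X1 (P : R -> Prop) : chart al be X Y X1 -> al <= be ->
  {ae mu, forall r, X al <= r <= X be -> P r} ->
  {ae mu, forall s, al <= s <= be -> 0 < X1 s -> P (X s)}.
Proof.
move=> C ab [N [mN N0 sub]]; have [mX iX YP aX X0] := C; have [X1i _] := aX.
have mg : measurable_fun setT (\1_N : R -> R) by exact: measurable_indic.
have S := substitution ab mX iX YP aX X0 mg (fun r => ltac:(by rewrite indicE ler0n)).
have S0 : (\int[mu]_(r in `[X al, X be]) (\1_N r : R)%:E = 0)%E.
  have mDD := mitv (X al) (X be); rewrite (integral_indic mu mDD mN).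
  exact: (subset_measure0 (measurableI _ _ mN mDD) mN (@subIsetl _ _ _) N0).
rewrite S0 in S.
have mf : measurable_fun (`[al, be] : set (measurableTypeR R)) (fun s => (\1_N (X s) * X1 s)%:E).
  apply/measurable_EFinP; apply: measurable_funM; last exact: L1_meas.
  by apply: measurable_funTS; exact: measurableT_comp mg mX.
have S' : (\int[mu]_(s in `[al, be]) `|(\1_N (X s) * X1 s)%:E| = 0)%E.
  rewrite -[RHS]S; apply: eq_integral => s; rewrite inE/= in_itv/= => h.
  by rewrite ger0_norm// mulr_ge0 ?X0// indicE ler0n.
have := (ae_eq_integral_abs mu (mitv al be) mf).1 S'.
apply: ae_imp => s H h X1s; have := H; rewrite /= in_itv/= => /(_ h) [].
move=> /eqP; rewrite mulf_eq0 (gt_eqF X1s) orbF => /eqP hN.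
apply: contrapT => nP; have : N (X s).
  by apply: sub => /= K; apply: nP; apply: K; have /andP[? ?] := h; rewrite !(chart_homo C).
by move: hN; rewrite indicE => + NX; rewrite mem_set// => /eqP; rewrite oner_eq0.
Qed.

(** With c = t^2 this is the radius along the line at height t; with c = - t^2 it is the abscissa as
    a function of the radius. Admitting al = 0 covers half a chord up to the axis when t is
    nonzero. *)
Lemma chart_sqrt (al be c : R) : 0 <= al -> al <= be -> 0 < al ^+ 2 + c ->
  chart al be (fun s => Num.sqrt (s ^+ 2 + c)) (fun r => Num.sqrt (r ^+ 2 - c))
    (fun s => s / Num.sqrt (s ^+ 2 + c)).
Proof.
move=> al0 ab h.
have pos s : al <= s -> 0 < s ^+ 2 + c.
  by move=> als; apply: lt_le_trans h _; rewrite lerD2r ler_pXn2r ?nnegrE// (le_trans al0).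
have dX s : al <= s -> is_derive s 1 (fun s => Num.sqrt (s ^+ 2 + c)) (s / Num.sqrt (s ^+ 2 + c)).
  move=> als; have p := pos _ als.
  have d1 : is_derive s 1 (fun s : R => s ^+ 2 + c) (2 * s).
    have d2 : is_derive s 1 ((id : R -> R) ^+ 2) (2 * s).
      by apply: is_derive_eq (is_deriveX 2 (is_derive_id s 1)) _; rewrite /= expr1 /GRing.scale/= mulr1.
    have := is_deriveD d2 (is_derive_cst c s 1); rewrite addr0.
    by apply: near_eq_is_derive; near=> z; rewrite !fctE.
  have d3 := @is_derive1_comp R Num.sqrt (fun s => s ^+ 2 + c) s _ _ (is_derive1_sqrt p) d1.
  have -> : s / Num.sqrt (s ^+ 2 + c) = (2 * Num.sqrt (s ^+ 2 + c))^-1 * (2 * s).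
    by field; rewrite gt_eqF// sqrtr_gt0.
  exact: d3.
have cX s : al <= s -> {for s, continuous (fun s : R => s / Num.sqrt (s ^+ 2 + c))}.
  move=> als; apply: cvgM; first exact: cvg_id.
  apply: cvgV; first by rewrite gt_eqF// sqrtr_gt0 pos.
  apply: (@continuous_comp R R R (fun x => x ^+ 2 + c) Num.sqrt); last exact: sqrt_continuous.
  by apply: cvgD; [exact: exprn_continuous|exact: cvg_cst].
split.
- apply: measurableT_comp; first by apply: continuous_measurable_fun; exact: sqrt_continuous.
  apply: measurable_funD => //; apply: measurable_funX; exact: measurable_id.
- move=> s t als st tb; rewrite ltr_sqrt ?pos ?(le_trans als (ltW st))// ltrD2r ltr_pXn2r// nnegrE.
    exact: le_trans als.
  exact: le_trans (le_trans als (ltW st)).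
- move=> r /andP[r1 r2]; have r0 : 0 <= r := le_trans (sqrtr_ge0 _) r1.
  have be2 : 0 <= be ^+ 2 + c by apply/ltW/pos.
  have q1 : al ^+ 2 <= r ^+ 2 - c.
    rewrite lerBrDr -(sqr_sqrtr (ltW h)) ler_pXn2r ?nnegrE ?sqrtr_ge0//.
  have q2 : r ^+ 2 - c <= be ^+ 2.
    by rewrite lerBlDr -(sqr_sqrtr be2) ler_pXn2r ?nnegrE ?sqrtr_ge0.
  have q0 : 0 <= r ^+ 2 - c by apply: le_trans q1; exact: sqr_ge0.
  split; last by rewrite sqr_sqrtr// subrK sqrtr_sqr ger0_norm.
  rewrite -(ler_pXn2r (_ : 0 < 2)%N) ?nnegrE ?sqrtr_ge0// sqr_sqrtr// q1/=.
  rewrite -(ler_pXn2r (_ : 0 < 2)%N) ?nnegrE ?sqrtr_ge0// ?sqr_sqrtr//.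
  exact: le_trans ab.
- apply: acon_derive => [s /andP[als _]|]; first exact: dX.
  by apply: continuous_in_subspaceT => s; rewrite inE/= in_itv/= => /andP[als _]; exact: cX.
- by move=> s /andP[als _]; rewrite divr_ge0 ?sqrtr_ge0// (le_trans al0).
Unshelve. all: by end_near. Qed.

End Charts.

(** * Weak derivatives on ]0, 1[ *)

Section WeakDerivative.
Context {R : realType}.
Notation mu := (@lebesgue_measure R).
Notation I := (`]0%R, 1%R[%classic : set R).
Implicit Types (x y s t r a b : R).

Lemma compact_lt (T : topologicalType) (K : set T) (f : T -> R) c : compact K -> continuous f ->
  (forall z, K z -> f z < c) -> exists2 rho, rho < c & forall z, K z -> f z <= rho.
Proof.
move=> cK cf Kc; have [K0|/set0P K0] := eqVneq K set0.
  by exists (c - 1); [lra|rewrite K0].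
have [z Kz fz] := compact_EVT_max K0 cK (continuous_subspaceT cf).
exists (f z); first by apply: Kc; move: Kz; rewrite inE.
by move=> z' Kz'; apply: fz; rewrite inE.
Qed.

Lemma compact_oo a b (K : set R) : compact K -> K `<=` `]a, b[ -> a < b ->
  exists x y, [/\ a < x, x <= y, y < b & K `<=` `[x, y]].
Proof.
move=> cK Kab ab.
have [z|y yb Ky] := @compact_lt _ K id b cK (fun z => cvg_id).
  by move=> /Kab; rewrite /= in_itv/= => /andP[].
have [z|x xa Kx] := @compact_lt _ K (fun z => - z) (- a) cK (fun z => cvgN cvg_id).
  by move=> /Kab; rewrite /= in_itv/= ltrN2 => /andP[].
pose m := (a + b) / 2.
exists (Num.min (- x) m), (Num.max y m); split.
- by rewrite lt_min /m; apply/andP; split; lra.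
- by apply: (@le_trans _ _ m); rewrite ?ge_min ?le_max lexx orbT.
- by rewrite gt_max yb /m; lra.
- move=> z Kz; rewrite /= in_itv/= ge_min le_max (Ky _ Kz)/= andbT.
  by have := Kx _ Kz; rewrite lerNl => ->.
Qed.

Lemma integral_supp (D : set R) x y (f : R -> R) : measurable (D : set (measurableTypeR R)) ->
  `[x, y] `<=` D -> (forall r, ~ x <= r <= y -> f r = 0) -> \int[mu]_(r in D) f r = itg x y f.
Proof.
move=> mD xyD f0; rewrite /itg [RHS]Rintegral_mkcond Rintegral_mkcond.
apply: eq_Rintegral => r _; rewrite !patchE.
case: ifPn => rD; case: ifPn => rxy //.
  by apply: f0; move: rxy; rewrite notin_setE/= in_itv/=.
by move: rD; rewrite notin_setE => -[]; apply: xyD; move: rxy; rewrite inE.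
Qed.

Lemma test_data (D : set R) (phi : R^o -> R^o) : test_function D phi ->
  [/\ continuous phi, continuous (derive1 phi) & forall r, is_derive (r : R^o) 1 phi (derive1 phi r)].
Proof.
move=> [Cphi _]; have [cphi /(_ 1)[d1 d2]] := Cphi 1%N.
have E : derive1 phi = 'D_1 phi by apply/funext => r; rewrite derive1E.
by split; [exact: cphi|rewrite E; exact: d2.1|move=> r; rewrite E; split; [exact: d1|]].
Qed.

Lemma test_derive_eq0 (phi : R^o -> R^o) x y r : (forall r, ~ x <= r <= y -> phi r = 0) ->
  ~ x <= r <= y -> derive1 phi r = 0.
Proof.
move=> p0 /negP; rewrite negb_and -!ltNge => /orP[] h; rewrite derive1E.
  rewrite (@near_eq_derive _ _ _ _ (fun=> 0 : R^o)) ?derive_cst//.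
  near=> z; apply: p0 => /andP[+ _]; apply/negP; rewrite -ltNge; near: z; exact: lt_nbhsl.
rewrite (@near_eq_derive _ _ _ _ (fun=> 0 : R^o)) ?derive_cst//.
near=> z; apply: p0 => /andP[_]; apply/negP; rewrite -ltNge; near: z; exact: lt_nbhsr.
Unshelve. all: by end_near. Qed.

Lemma acon_test (D : set R) (phi : R^o -> R^o) x y : test_function D phi ->
  acon x y (phi : R -> R) (derive1 phi : R -> R).
Proof.
move=> /test_data[c1 c2 d]; apply: acon_derive; exact: continuous_subspaceT.
Qed.

Lemma ae_I (P : R -> Prop) : (forall x y, 0 < x -> y < 1 -> {ae mu, forall r, x <= r <= y -> P r}) ->
  {ae mu, forall r, I r -> P r}.
Proof.
move=> H; have : {ae mu, forall r, forall n : nat, n.+2%:R^-1 <= r <= 1 - n.+2%:R^-1 -> P r}.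
  apply: ae_foralln => n; apply: H; first exact: invS_gt0.
  by have := invS_gt0 n : 0 < n.+2%:R^-1 :> R; move: (_ ^-1) => q; lra.
apply: ae_imp => r Hr; rewrite /= in_itv/= => /andP[r0 r1].
have m0 : 0 < Num.min r (1 - r) by rewrite lt_min r0 subr_gt0.
have [n] := near_invS m0; rewrite lt_min => /andP[h1 h2].
by apply: (Hr n); move: h1 h2; move: (n.+2%:R^-1) => q h1 h2; apply/andP; split; lra.
Qed.

Lemma ac_locally f g : ac f g -> locally_integrable I f /\ locally_integrable I g.
Proof.
move=> fg; have [mf mg] := ac_meas fg.
have loc (h : R -> R) : measurable_fun I h -> (forall x y, 0 < x -> y < 1 -> L1 x y h) -> locally_integrable I h.
  move=> mh hi; split => //.
  move=> K KI cK; have [x [y [x0 xy y1 Kxy]]] := compact_oo cK KI ltr01.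
  have /integrableP[m1 fin] := hi x y x0 y1; apply: le_lt_trans fin.
  apply: ge0_subset_integral => //; first exact: compact_measurable.
  by apply/measurable_EFinP; apply: measurableT_comp => //; exact/measurable_EFinP.
split; apply: loc => // x y x0 y1; last by have [] := fg x y x0 y1.
exact: L1_cont (acon_within (fg x y x0 y1)).
Qed.

Lemma ac_is_weak_deriv f g : ac f g -> @is_weak_deriv R f g.
Proof.
move=> fg; have [lf lg] := ac_locally fg; split=> // phi tphi.
have [_ [K [cK KI phi0]]] := tphi.
have [x [y [x0 xy y1 Kxy]]] := compact_oo cK KI ltr01.
(* The test function may be nonzero at x and y; on the slightly larger interval it vanishes at both
   ends, and no boundary term is left. *)
pose x' := x / 2; pose y' := (1 + y) / 2.
have x'0 : 0 < x' by rewrite /x'; lra.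
have y'1 : y' < 1 by rewrite /y'; lra.
have xy' : x' <= y' by rewrite /x' /y'; lra.
have p0 r : ~ x <= r <= y -> phi r = 0.
  by move=> h; apply: phi0 => /Kxy; rewrite /= in_itv.
have out r : ~ x' <= r <= y' -> ~ x <= r <= y.
  by move=> h /andP[? ?]; apply: h; rewrite /x' /y'; apply/andP; split; lra.
have xyI : `[x', y'] `<=` I.
  by move=> r; rewrite /= !in_itv/= => /andP[? ?]; apply/andP; split; lra.
have mI' : measurable (I : set (measurableTypeR R)) by exact: measurable_itv.
have E := acon_by_parts xy' (fg x' y' x'0 y'1) (acon_test x' y' tphi).
rewrite !p0 in E; [|by rewrite /x' => /andP[? ?]; lra|by rewrite /y' => /andP[? ?]; lra].
rewrite (integral_supp mI' xyI); last first.
  by move=> r /out h; rewrite (test_derive_eq0 p0 h) mulr0.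
rewrite (integral_supp mI' xyI); last by move=> r /out h; rewrite p0// mulr0.
by rewrite E !mulr0 subrr sub0r opprK.
Qed.

(** Dominated convergence: testing against the smooth bumps recovers the integral over [x, y], so
    identities against test functions become identities of interval integrals. *)
Lemma bump_limit x y k : L1 x y k ->
  itg x y (fun r => k r * tbump x y n r) @[n --> \oo] --> itg x y k.
Proof.
move=> ki; have mb n : measurable_fun `[x, y] (tbump x y n : R -> R).
  apply: within_meas; apply: continuous_subspaceT; exact: (Ck_cont (Ck_tbump 0 x y n)).
have mk := L1_meas ki.
have kb n : L1 x y (fun r => k r * tbump x y n r).
  apply: L1_eq (L1M_bounded (M := 1) (mb n) _ ki) => r _; first by rewrite mulrC.
  by have /andP[b0 b1] := tbump_ge0_le1 x y n r; rewrite ger0_norm.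
have koo : mu.-integrable `]x, y[ (EFin \o k) by exact/integrable_oo_cc.
have kboo n : mu.-integrable `]x, y[ (EFin \o (fun r => k r * tbump x y n r)) by exact/integrable_oo_cc.
have moo : measurable (`]x, y[%classic : set (measurableTypeR R)) by exact: measurable_itv.
have [_ _ C] := @dominated_convergence _ _ _ mu `]x, y[ moo (fun n => EFin \o (fun r => k r * tbump x y n r)) (EFin \o k)
  (fun r => `|k r|%:E) (fun n => measurable_int _ (kboo n)) (measurable_int _ koo)
  (ltac:(exists set0; split=> // r /= /not_implyP[]; rewrite in_itv/= => /andP[xr ry] []; apply: cvg_EFin;
    [exact: nearW|rewrite -[X in _ --> X]mulr1; apply: cvgM; [exact: cvg_cst|exact: tbump_cvg]]))
  (integrable_abse koo)
  (ltac:(exists set0; split=> // r /= nh; apply: nh => n _; rewrite lee_fin normrM ler_piMr//;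
    have /andP[b0 b1] := tbump_ge0_le1 x y n r; by rewrite ger0_norm)).
have F (h : R -> R) : mu.-integrable `]x, y[ (EFin \o h) ->
   (\int[mu]_(r in `]x, y[) (h r)%:E = (itg x y h)%:E)%E.
  by move=> hi; rewrite -itg_oo_cc// /Rintegral fineK//; exact: integrable_fin_num.
have : (itg x y (fun r => k r * tbump x y n r))%:E @[n --> \oo] --> (itg x y k)%:E.
  rewrite -F//; apply: cvg_trans C; apply: near_eq_cvg; apply: nearW => n /=.
  by rewrite -F.
by move/fine_cvg.
Qed.

Lemma weak_deriv_uniq f g g' : @is_weak_deriv R f g -> @is_weak_deriv R f g' ->
  {ae mu, forall r, I r -> g r = g' r}.
Proof.
move=> [_ lg Eg] [_ lg' Eg'].
have loc (h : R -> R) x y : locally_integrable I h -> 0 < x -> y < 1 -> L1 x y h.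
  move=> [mh _ fh] x0 y1; have xyI : `[x, y] `<=` I.
    by move=> r; rewrite /= !in_itv/= => /andP[? ?]; apply/andP; split; lra.
  apply/integrableP; split; first by apply/measurable_EFinP; exact: measurable_funS mh.
  by apply: fh => //; exact: segment_compact.
apply: ae_I => x y x0 y1.
have gi := loc g x y lg x0 y1; have gi' := loc g' x y lg' x0 y1.
apply: ae_imp (itg0_ae (L1B gi gi') _) => [r h /h|s t xs st ty]; first by lra.
have ki := L1_sub (L1B gi gi') xs ty.
have stI : `[s, t] `<=` I.
  by move=> r; rewrite /= !in_itv/= => /andP[? ?]; apply/andP; split; lra.
have mI' : measurable (I : set (measurableTypeR R)) by exact: measurable_itv.
have Z n : itg s t (fun r => (g r - g' r) * tbump s t n r) = 0.
  have tb : test_function I (tbump s t n : R^o -> R^o) := test_tbump n stI.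
  have := Eg _ tb; rewrite Eg' // => /oppr_inj.
  rewrite !(integral_supp mI' stI); [|by move=> r h; rewrite tbump_eq0// mulr0..].
  have cb : {within `[s, t], continuous (tbump s t n : R -> R)}.
    apply: continuous_subspaceT; exact: (Ck_cont (Ck_tbump 0 s t n)).
  have b1 : L1 s t (fun r => g r * tbump s t n r).
    by apply: L1_eq (L1M_cont cb (L1_sub gi xs ty)) => r _; rewrite mulrC.
  have b2 : L1 s t (fun r => g' r * tbump s t n r).
    by apply: L1_eq (L1M_cont cb (L1_sub gi' xs ty)) => r _; rewrite mulrC.
  move=> E; rewrite (@itg_eq _ s t _ (fun r => g r * tbump s t n r - g' r * tbump s t n r)); last first.
    by move=> r _; rewrite mulrBl.
  by rewrite itgB// E subrr.
have := bump_limit ki; under eq_fun do rewrite Z.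
by move/(cvg_unique _ (cvg_cst _)) => /(_ (@Rhausdorff R)) ->.
Qed.

(** The given profile only agrees almost everywhere with an absolutely continuous one; this lets it
    inherit the weak derivative once it is measurable. *)
Lemma weak_deriv_ae f f' (b : R -> R) : @is_weak_deriv R f b -> measurable_fun I f' ->
  {ae mu, forall r, I r -> f r = f' r} -> @is_weak_deriv R f' b.
Proof.
move=> [[mf oI lf] lb E] mf' ff'.
have pw (A : set R) (h h' : R -> \bar R) : measurable (A : set (measurableTypeR R)) -> A `<=` I ->
   measurable_fun A h -> measurable_fun A h' -> {ae mu, forall r, I r -> h r = h' r} ->
   (\int[mu]_(r in A) h r = \int[mu]_(r in A) h' r)%E.
  move=> mA AI mh mh' hh'; apply: ae_eq_integral => //.
  by apply: ae_imp hh' => r H /AI.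
split=> //.
  split=> // K KI cK; have mK := compact_measurable cK.
  rewrite -(pw K (fun r => `|f r|%:E))//; first exact: lf.
  - by apply/measurable_EFinP; apply: measurableT_comp => //; exact: measurable_funS mf.
  - by apply/measurable_EFinP; apply: measurableT_comp => //; exact: measurable_funS mf'.
  - by apply: ae_imp ff' => r H /H ->.
move=> phi tphi; rewrite -E//; have [_ cd _] := test_data tphi.
have md : measurable_fun I (derive1 phi : R -> R).
  by apply: measurable_funTS; exact: continuous_measurable_fun.
have mI' : measurable (I : set (measurableTypeR R)) by exact: measurable_itv.
congr fine; apply/esym; apply: pw => //.
- by apply/measurable_EFinP; apply: measurable_funM.
- by apply/measurable_EFinP; apply: measurable_funM.
- by apply: ae_imp ff' => r H /H ->.
Qed.

End WeakDerivative.

(** * The lemma of du Bois-Reymond with countably many test functions *)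

Section LineAC.
Context {R : realType}.
Notation mu := (@lebesgue_measure R).
Implicit Types (x y s t r a b : R).

Lemma itg_0 x y (f : R -> R) : (forall t, x <= t <= y -> f t = 0) -> itg x y f = 0.
Proof.
move=> f0; rewrite (@itg_eq _ x y f (fun=> 0 * 0)); last by move=> t /f0 ->; rewrite mulr0.
by rewrite (@itgZ _ x y 0 (fun=> 0)) ?mul0r//; exact: L1_cst.
Qed.

Lemma tbump_out x y n s : s <= x \/ y <= s -> tbump x y n s = 0.
Proof.
rewrite /tbump /flat => -[] h.
  by rewrite ifF ?mul0r//; apply/negbTE; rewrite -leNgt mulr_ge0_le0// subr_le0.
by rewrite [X in _ * X]ifF ?mulr0//; apply/negbTE; rewrite -leNgt mulr_ge0_le0// subr_le0.
Qed.

Lemma tbump_within x y s t n : {within `[s, t], continuous (tbump x y n : R -> R)}.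
Proof. apply: continuous_subspaceT; exact: (Ck_cont (Ck_tbump 0 x y n)). Qed.

Lemma tbump_L1 x y s t n : L1 s t (tbump x y n).
Proof. apply: L1_cont; exact: tbump_within. Qed.

Lemma tbump_itg_gt0 a b : a < b -> 0 < itg a b (tbump a b 1).
Proof.
move=> ab; pose x := a + (b - a) / 3; pose y := b - (b - a) / 3.
have xy : x < y by rewrite /x /y; lra.
have cb : continuous ((fun s => - tbump a b 1 s) : R -> R).
  by move=> s; apply: cvgN; exact: (Ck_cont (Ck_tbump 0 a b 1)).
have [z|rho rho0 K] := @compact_lt R R `[x, y]%classic _ 0 (@segment_compact R x y) cb.
  rewrite /= in_itv/= oppr_lt0 /x /y => /andP[? ?]; apply: tbump_gt0; lra.
have b0 t : 0 <= tbump a b 1 t by have /andP[] := tbump_ge0_le1 a b 1 t.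
apply: lt_le_trans (itg_sub_le (_ : a <= x) (ltW xy) (_ : y <= b) (tbump_L1 _ _ _ _ _) _); last 3 first.
- by rewrite /x; lra.
- by rewrite /y; lra.
- by move=> t _; exact: b0.
apply: lt_le_trans (itg_le (L1_cst x y (- rho)) (tbump_L1 _ _ _ _ _) _).
  by rewrite itg_cst ?ltW// mulr_gt0 ?subr_gt0// oppr_gt0.
by move=> t h; have := K t; rewrite /= in_itv/= h => /(_ isT); lra.
Qed.

Section AntiTest.
Context (a b q q' : R) (n : nat).

Definition kap := itg a b (tbump q q' n) / itg a b (tbump a b 1).

(** A bump corrected by a multiple of a fixed one to have mean zero, so that its primitive is again
    a test function. *)
Definition zet s := tbump q q' n s - kap * tbump a b 1 s.

(** The lower limit a - 1 instead of a leaves room to differentiate at the point a itself. *)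
Definition anti s := itg (a - 1) s zet.

Lemma Ck_zet k : Ck k (zet : R^o -> R^o).
Proof.
rewrite (_ : zet = (tbump q q' n : R^o -> R^o) + (fun s => - kap * tbump a b 1 s)).
  by apply: Ck_add; [exact: Ck_tbump|apply: Ck_scale; exact: Ck_tbump].
by apply/funext => s; rewrite fctE mulNr.
Qed.

Lemma zet_L1 s t : L1 s t zet.
Proof. apply: L1_cont; apply: continuous_subspaceT; exact: (Ck_cont (Ck_zet 0)). Qed.

Hypotheses (ab : a < b) (aq : a <= q) (qb : q' <= b).

Lemma zet_out s : s <= a \/ b <= s -> zet s = 0.
Proof.
move=> h; rewrite /zet !tbump_out ?mulr0 ?subrr//; case: h => h; [left|right]; rewrite ?(le_trans h aq) ?(le_trans qb h)//.
Qed.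

Lemma itg_zet : itg a b zet = 0.
Proof.
rewrite /zet itgB; [|exact: tbump_L1|apply: L1Z; exact: tbump_L1].
rewrite itgZ; last exact: tbump_L1.
by rewrite /kap divfK ?subrr// gt_eqF// tbump_itg_gt0.
Qed.

Lemma anti_out s : s <= a \/ b <= s -> anti s = 0.
Proof.
move=> [h|h]; first by apply: itg_0 => t /andP[_ ts]; apply: zet_out; left; exact: le_trans h.
rewrite /anti {1}/itg (integral_supp (mitv _ _) (x := a) (y := b)) ?itg_zet//.
  by move=> t; rewrite /= !in_itv/= => /andP[? ?]; apply/andP; split; lra.
move=> t; move/negP; rewrite negb_and -!ltNge => /orP[] /ltW ?; apply: zet_out; tauto.
Qed.

Lemma anti_derive s : is_derive (s : R^o) 1 (anti : R^o -> R^o) (zet s).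
Proof.
have [sa|as_] := ltP s a.
  rewrite zet_out; last by left; exact: ltW.
  apply: (near_eq_is_derive (f := fun=> 0 : R^o)) => //.
  by near=> z; rewrite anti_out//; left; apply: ltW; near: z; exact: lt_nbhsl.
have s1 : s < s + 1 by rewrite ltrDl.
have as1 : a - 1 < s by lra.
have cz : {for s, continuous (zet : R -> R)} by exact: (Ck_cont (Ck_zet 0)).
have [d1 d2] := continuous_FTC1_closed s1 (zet_L1 _ _) as1 cz.
by split; [exact: d1|rewrite -derive1E; exact: d2].
Unshelve. all: by end_near. Qed.

Lemma test_anti (D : set R^o) : `[a, b] `<=` D -> test_function D (anti : R^o -> R^o).
Proof.
move=> abD; split.
  by move=> k; apply: Ck_pred; apply: Ck_real anti_derive (Ck_zet k).
exists `[a, b]%classic; split=> //; first exact: segment_compact.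
move=> s /=; rewrite in_itv/= => /negP; rewrite negb_and -!ltNge => /orP[] /ltW ?; apply: anti_out; tauto.
Qed.

Lemma acon_anti x y : acon x y anti zet.
Proof.
apply: acon_derive; first by move=> t _; exact: anti_derive.
apply: continuous_subspaceT; exact: (Ck_cont (Ck_zet 0)).
Qed.

End AntiTest.

Lemma acon_itg a b (G : R -> R) : L1 a b G -> acon a b (fun s => itg a s G) G.
Proof.
move=> Gi; split=> // s t as_ st tb.
rewrite (@itg_split _ a s t)//; last exact: L1_sub Gi _ _.
by rewrite addrAC subrr add0r.
Qed.

(** Integrals depend continuously on their endpoints, so rational ones suffice. This keeps the
    family of test functions countable, as the union of exceptional sets over all lines requires. *)
Lemma itg0_rat a b (k : R -> R) : L1 a b k ->
  (forall q q' : rat, a < ratr q -> ratr q < ratr q' :> R -> ratr q' < b -> itg (ratr q) (ratr q') k = 0) ->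
  forall s t, a <= s -> s <= t -> t <= b -> itg s t k = 0.
Proof.
move=> ki k0 s t as_ st tb; apply: contrapT => /eqP; rewrite -normr_gt0 => e0.
have st' : s < t by rewrite lt_neqAle st andbT; apply: contraTneq e0 => ->; rewrite itg_pt normr0 ltxx.
have aP := acon_itg ki; have [eta eta0 H] := heine (acon_within aP) (divr_gt0 e0 (ltr0n _ 2)).
pose m := (s + t) / 2.
have sm : s < Num.min (s + eta) m by rewrite lt_min /m; apply/andP; split; lra.
have mt : Num.max (t - eta) m < t by rewrite gt_max /m; apply/andP; split; lra.
have [q] := rat_in_itvoo sm; rewrite in_itv/= lt_min => /and3P[sq q1 q2].
have [q'] := rat_in_itvoo mt; rewrite in_itv/= gt_max => /andP[/andP[q'1 q'2] q't].
have qq : ratr q < ratr q' :> R by exact: lt_trans q'2.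
have Z := k0 q q' (le_lt_trans as_ sq) qq (lt_le_trans q't tb).
have L u v : a <= u -> v <= b -> L1 u v k by move=> ? ?; exact: L1_sub ki _ _.
have E : itg s t k = itg s (ratr q) k + (itg (ratr q) (ratr q') k + itg (ratr q') t k).
  have aq : a <= ratr q := le_trans as_ (ltW sq).
  rewrite (itg_split (ltW sq) (ltW (lt_trans qq q't)) (L _ _ as_ tb)).
  by rewrite (itg_split (ltW qq) (ltW q't) (L _ _ aq tb)).
have [_ PE] := aP.
have aq : a <= ratr q := le_trans as_ (ltW sq).
have qb : ratr q <= b := le_trans (ltW (lt_trans qq q't)) tb.
have aq' : a <= ratr q' := le_trans aq (ltW qq).
have qb' : ratr q' <= b := le_trans (ltW q't) tb.
have n1 : `|itg s (ratr q) k| < `|itg s t k| / 2.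
  rewrite -(PE _ _ as_ (ltW sq) qb); apply: H; rewrite ?as_ ?aq ?qb ?(le_trans st tb)//.
  by rewrite gtr0_norm ?subr_gt0//; lra.
have n2 : `|itg (ratr q') t k| < `|itg s t k| / 2.
  rewrite -(PE _ _ aq' (ltW q't) tb); apply: H; rewrite ?(le_trans as_ st) ?tb ?aq' ?qb'//.
  by rewrite gtr0_norm ?subr_gt0//; lra.
have := ler_normD (itg s (ratr q) k) (itg (ratr q') t k).
rewrite Z add0r in E; rewrite -E; move: n1 n2.
by move: (`|itg s t k|) (`|itg s _ k|) (`|itg _ t k|) => A B C; clear; lra.
Qed.

(** The difference k of F and a primitive of G is orthogonal to every mean-zero [zet]. Hence it is
    almost everywhere equal to its average c against the fixed bump. *)
Lemma line_ac a b (F G : R -> R) : a < b -> L1 a b F -> L1 a b G ->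
  (forall (q q' : rat) n, a < ratr q -> ratr q < ratr q' :> R -> ratr q' < b ->
     itg a b (fun s => F s * zet a b (ratr q) (ratr q') n s) =
     - itg a b (fun s => G s * anti a b (ratr q) (ratr q') n s)) ->
  exists c, {ae mu, forall s, a <= s <= b -> F s = c + itg a s G}.
Proof.
move=> ab Fi Gi H; have aP := acon_itg Gi.
have Pi : L1 a b (fun s => itg a s G) by apply: L1_cont; exact: acon_within aP.
pose k s := F s - itg a s G; have ki : L1 a b k by exact: L1B.
pose eta := tbump a b 1; have e0 := tbump_itg_gt0 ab.
have Lc x y n (f : R -> R) : L1 a b f -> L1 a b (fun s => f s * tbump x y n s).
  move=> fi; have h := L1M_cont (@tbump_within x y a b n) fi.
  by apply: L1_eq h => s _; rewrite mulrC.
pose c := itg a b (fun s => k s * eta s) / itg a b eta.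
exists c; have k1 : L1 a b (fun s => k s - c) by apply: L1B => //; exact: L1_cst.
suff Z (q q' : rat) : a < ratr q -> ratr q < ratr q' :> R -> ratr q' < b -> itg (ratr q) (ratr q') (fun s => k s - c) = 0.
  apply: ae_imp (itg0_ae k1 (itg0_rat k1 Z)) => s h /h; rewrite /k; lra.
move=> aq qq qb.
have kq := L1_sub k1 (ltW aq) (ltW qb).
suff Zn n : itg (ratr q) (ratr q') (fun s => (k s - c) * tbump (ratr q) (ratr q') n s) = 0.
  have := bump_limit kq; under eq_fun do rewrite Zn.
  by move/(cvg_unique _ (cvg_cst _)) => /(_ (@Rhausdorff R)) ->.
have sub : `[ratr q, ratr q']%classic `<=` (`[a, b]%classic : set R).
  by move=> s; rewrite /= !in_itv/= => /andP[? ?]; apply/andP; split; lra.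
rewrite -(integral_supp (mitv a b) sub); last first.
  by move=> s /negP; rewrite negb_and -!ltNge => /orP[]/ltW ?; rewrite tbump_out ?mulr0//; tauto.
rewrite -/(itg a b _); have /= Hn := H q q' n aq qq qb.
set ps := tbump (ratr q) (ratr q') n in Hn *; set z := zet _ _ _ _ _ in Hn; set p := anti _ _ _ _ _ in Hn.
have z1 : L1 a b z by exact: zet_L1.
have cz : {within `[a, b], continuous z}.
  by apply: continuous_subspaceT; exact: (Ck_cont (Ck_zet a b (ratr q) (ratr q') n 0)).
have Fz : L1 a b (fun s => F s * z s) by apply: L1_eq (L1M_cont cz Fi) => s _; rewrite mulrC.
have Pz : L1 a b (fun s => itg a s G * z s) by apply: L1_eq (L1M_cont cz Pi) => s _; rewrite mulrC.
have := acon_by_parts (ltW ab) aP (acon_anti n ab (ltW aq) (ltW qb) a b).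
have pa : anti a b (ratr q) (ratr q') n a = 0 by apply: (anti_out n ab (ltW aq) (ltW qb)); left.
have pb : anti a b (ratr q) (ratr q') n b = 0 by apply: (anti_out n ab (ltW aq) (ltW qb)); right.
rewrite pa pb -/p -/z.
rewrite !mulr0 subrr sub0r => B; rewrite B opprK in Hn.
have kz : itg a b (fun s => k s * z s) = 0.
  rewrite (@itg_eq _ a b _ (fun s => F s * z s - itg a s G * z s)); last by move=> s _; rewrite -mulrBl.
  by rewrite itgB// Hn subrr.
have kE : itg a b (fun s => k s * z s) = itg a b (fun s => k s * ps s) - kap a b (ratr q) (ratr q') n * itg a b (fun s => k s * eta s).
  rewrite -(itgZ _ (Lc a b 1%N k ki)) -itgB; [|exact: Lc|by apply: L1Z; exact: Lc].
  by apply: itg_eq => s _; rewrite /z /zet -/ps; move: (k s) => ks; ring.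
rewrite (@itg_eq _ a b _ (fun s => k s * ps s - c * ps s)); last by move=> s _; rewrite mulrBl.
rewrite itgB; [|exact: Lc|by apply: L1Z; exact: tbump_L1].
rewrite itgZ; last exact: tbump_L1.
rewrite kE in kz; rewrite -[RHS]kz /kap -/ps -/eta /c; congr (_ - _).
by rewrite mulrAC [RHS]mulrAC; congr (_ / _); rewrite mulrC.
Qed.

End LineAC.

(** * Square integrable functions and product test functions in the plane *)

Section Planar.
Context {R : realType}.
Notation mu := (@lebesgue_measure R).
Notation lam := (@lebesgue2 R).
Notation RR := (measurableTypeR R * measurableTypeR R)%type.
Implicit Types (x y s t r a b c e : R).

Lemma Lfun2P (F : R * R -> R) : F \in Lfun lam 2%:E ->
  measurable_fun (setT : set RR) F /\ lam.-integrable setT (EFin \o (fun z => F z ^+ 2)).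
Proof.
move=> HF; split; last exact: Lfun2_integrable_sqr.
by have := sub_Lfun_mfun HF; rewrite inE.
Qed.

(** The product is dominated by M (1 + F^2) on Q and vanishes outside, where Q has finite
    measure. *)
Lemma Lfun2_mul (F w : R * R -> R) (Q : set RR) (M : R) : F \in Lfun lam 2%:E ->
  measurable Q -> (lam Q < +oo)%E -> measurable_fun (setT : set RR) w -> (forall z, `|w z| <= M) ->
  (forall z, ~ Q z -> w z = 0) -> lam.-integrable setT (EFin \o (fun z => F z * w z)).
Proof.
move=> /Lfun2P[mF F2] mQ Qfin mw wM w0.
have iQ : lam.-integrable setT (EFin \o (\1_Q : RR -> R)).
  apply/integrableP; split; first by apply/measurable_EFinP; exact: measurable_indic.
  have -> : (\int[lam]_(z in setT) `|(EFin \o (\1_Q : RR -> R)) z| = \int[lam]_(z in setT) (\1_Q z : R)%:E)%E.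
    by apply: eq_integral => z _; rewrite /= ger0_norm// indicE ler0n.
  by rewrite integral_indic// setIT.
have H : lam.-integrable setT (fun z => M%:E * ((EFin \o (\1_Q : RR -> R)) z + (EFin \o (fun z => (F z) ^+ 2)%R) z))%E.
  by apply: integrableZl => //; apply: integrableD.
apply: le_integrable H => //.
  by apply/measurable_EFinP; apply: measurable_funM.
move=> z _ /=; rewrite lee_fin; have M0 : 0 <= M by apply: le_trans (wM z); exact: normr_ge0.
rewrite normrM [leRHS]ger0_norm; last by rewrite mulr_ge0// addr_ge0 ?sqr_ge0// indicE ler0n.
have [Qz|nQ] := pselect (Q z); last by rewrite w0// normr0 mulr0 mulr_ge0// addr_ge0 ?sqr_ge0// indicE ler0n.
rewrite mulrC; apply: ler_pM => //; rewrite indicE mem_set//=.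
by rewrite -(real_normK (num_real (F z))); have := sqr_ge0 (`|F z| - 1); move: (`|F z|) => q; clear; nra.
Qed.

Lemma fst_meas : measurable_fun (setT : set RR) (fun z : R * R => z.1). Proof. exact: measurable_fst. Qed.
Lemma snd_meas : measurable_fun (setT : set RR) (fun z : R * R => z.2). Proof. exact: measurable_snd. Qed.

Lemma Ck_fst k (f : R^o -> R^o) : Ck k f -> Ck k ((fun z => f z.1) : R * R -> R^o).
Proof.
apply: (@Ck_affine R (R * R)%type R^o (fun z => z.1) (fun z => z.1)) => //.
by move=> z; exact: cvg_fst.
Qed.

Lemma Ck_snd k (f : R^o -> R^o) : Ck k f -> Ck k ((fun z => f z.2) : R * R -> R^o).
Proof.
apply: (@Ck_affine R (R * R)%type R^o (fun z => z.2) (fun z => z.2)) => //.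
by move=> z; exact: cvg_snd.
Qed.

Lemma tensor_test (D : set (R * R)) (f g : R^o -> R^o) a b c e :
  (forall k, Ck k f) -> (forall k, Ck k g) ->
  (forall s, ~ a <= s <= b -> f s = 0) -> (forall t, ~ c <= t <= e -> g t = 0) ->
  (forall s t, a <= s <= b -> c <= t <= e -> D (s, t)) ->
  test_function D ((fun z => f z.1 * g z.2) : R * R -> R^o).
Proof.
move=> Cf Cg f0 g0 sub; split.
  by move=> k; apply: (Ck_mul (Ck_fst (Cf k)) (Ck_snd (Cg k))).
exists (`[a, b]%classic `*` `[c, e]%classic); split.
- by apply: compact_setX; exact: segment_compact.
- by move=> [s t] [] /=; rewrite !in_itv/=; exact: sub.
- move=> [s t] /= h; have [h1|h1] := pselect (a <= s <= b); last by rewrite f0// mul0r.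
  by rewrite g0 ?mulr0// => h2; apply: h; split; rewrite /= in_itv.
Qed.

Lemma tensor_derive (f g : R^o -> R^o) z : Ck 1 f -> Ck 1 g ->
  'D_((1, 0) : R * R) ((fun z => f z.1 * g z.2) : R * R -> R^o) z = 'D_1 f z.1 * g z.2.
Proof.
move=> Cf Cg; have [_ df] := Cf; have [_ dg] := Cg.
have l1 h v (x : R * R) : (h *: v + x).1 = h *: v.1 + x.1 by [].
have l2 h v (x : R * R) : (h *: v + x).2 = h *: v.2 + x.2 by [].
have [d1 e1] := derive_affine l1 f (1, 0) z.
have [d2 e2] := derive_affine l2 g (1, 0) z.
have D1 : derivable ((fun z => f z.1) : R * R -> R^o) z (1, 0) by apply: e1; exact: (df 1).1.
have D2 : derivable ((fun z => g z.2) : R * R -> R^o) z (1, 0) by apply: e2; exact: (dg 0).1.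
rewrite (deriveM D1 D2); rewrite [X in _ *: X + _](_ : _ = 0); last first.
  apply: etrans d2 _; rewrite /= deriveE ?linear0//.
  by apply/derivable1_diffP; exact: (dg 1).1.
rewrite scaler0 add0r [X in _ *: X](_ : _ = 'D_1 f z.1); last exact: d1.
by rewrite /GRing.scale/= mulrC.
Qed.

Lemma within_bdd_supp (f : R -> R) a b : continuous f -> (forall s, ~ a <= s <= b -> f s = 0) ->
  exists M : R, forall s, `|f s| <= M.
Proof.
move=> cf f0; have [M HM] := within_bounded (continuous_subspaceT cf : {within `[a, b], continuous f}).
exists (Num.max M 0) => s; have [h|h] := pselect (a <= s <= b); first by rewrite le_max HM.
by rewrite f0// normr0 le_max lexx orbT.
Qed.

End Planar.

(** * Absolute continuity on almost every horizontal line *)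

Section Lines.
Context {R : realType}.
Notation mu := (@lebesgue_measure R).
Notation lam := (@lebesgue2 R).
Notation RR := (measurableTypeR R * measurableTypeR R)%type.
Implicit Types (x y s t r a b c e : R).

Lemma fubini_real (H : R * R -> R) : lam.-integrable setT (EFin \o H) ->
  [/\ {ae mu, forall t, mu.-integrable setT (EFin \o (fun s => H (s, t)))},
      mu.-integrable setT (EFin \o (fun t => \int[mu]_(s in setT) H (s, t)))
    & \int[lam]_(z in setT) H z = \int[mu]_(t in setT) \int[mu]_(s in setT) H (s, t)].
Proof.
move=> iH; have mH := measurable_int _ iH.
have ae2 : {ae mu, forall t, mu.-integrable setT (EFin \o (fun s => H (s, t)))}.
  exact: (ae_integrable2 iH).
pose G t := (\int[mu]_(s in setT) (H (s, t))%:E)%E.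
have mG : measurable_fun setT G by exact: (measurable_fubini_G iH).
have iG : mu.-integrable setT G.
  apply/integrableP; split=> //.
  have /(integrable21ltyP _ _ mH) := iH; apply: le_lt_trans.
  apply: ge0_le_integral => //.
  - exact: measurableT_comp.
  - apply: (@measurable_fun_fubini_tonelli_G _ _ _ _ _ mu (fun z => `|(EFin \o H) z|%E)) => //.
    exact: measurableT_comp.
  - move=> t _; apply: le_abse_integral => //.
    by move/measurable_EFinP : mH => mH; apply/measurable_EFinP; apply: (measurableT_comp mH); exact: measurable_pair2.
have aeG : {ae mu, forall t, G t = (fine (G t))%:E}.
  by apply: ae_imp ae2 => t it; rewrite fineK//; exact: (integrable_fin_num measurableT it).
have mf : measurable_fun setT (fun t => fine (G t)) by exact: measurableT_comp.
have iF : mu.-integrable setT (EFin \o (fun t => fine (G t))).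
  apply: le_integrable iG => //; first exact/measurable_EFinP.
  by move=> t _; rewrite /=; case: (G t) => [q| |] //=; rewrite ?normr0 ?leey.
split=> //; rewrite /Rintegral; congr fine.
rewrite -[LHS](integral21_prod_meas1 iH); apply: ae_eq_integral => //.
- exact/measurable_EFinP.
- by apply: ae_imp aeG => t E _; exact: E.
Qed.

Lemma mQ a b c e : measurable (`[a, b]%classic `*` `[c, e]%classic : set RR).
Proof. by apply: measurableX; exact: mitv. Qed.

Lemma Qfin a b c e : (lam (`[a, b]%classic `*` `[c, e]%classic) < +oo)%E.
Proof.
have -> : lam (`[a, b]%classic `*` `[c, e]%classic) = (mu `[a, b] * mu `[c, e])%E.
  by apply: product_measure1E; exact: mitv.
have F x y : (0 <= mu `[x, y] < +oo)%E.
  by rewrite measure_ge0/= lebesgue_measure_itv/=; case: ifP => // _; rewrite ?ltry -?EFinD ?ltry.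
have /andP[? ?] := F a b; have /andP[? ?] := F c e; apply: lte_mul_pinfty => //.
by rewrite ge0_fin_numE.
Qed.

(** The weak identity is tested against products A(s) chi(t), where A' = Z runs through the
    countable family of mean-zero bumps. For fixed A the freedom in chi gives the identity of
    [line_ac] for almost every t, and countability gives it for all A at once. *)
Lemma acl (f g : R * R -> R) a b c e : a < b ->
  (forall s t, a <= s <= b -> c <= t <= e -> (@B1 R) (s, t)) ->
  is_weak_partial B1 (1, 0) f g -> f \_ B1 \in Lfun lam 2%:E -> g \_ B1 \in Lfun lam 2%:E ->
  {ae mu, forall t, c <= t <= e -> [/\ L1 a b (fun s => f (s, t)), L1 a b (fun s => g (s, t)) &
    exists C, {ae mu, forall s, a <= s <= b -> f (s, t) = C + itg a s (fun s => g (s, t))}]}.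
Proof.
move=> ab sub wp Lf Lg; pose Q : set RR := `[a, b]%classic `*` `[c, e]%classic.
have QP s t : Q (s, t) <-> (a <= s <= b) /\ (c <= t <= e) by rewrite /Q /= !in_itv.
have sub' z : ~ (@B1 R) z -> ~ Q z by case: z => s t nB /QP[h1 h2]; exact/nB/sub.
pose w (p : R -> R) (q : R -> R) (z : R * R) : R := p z.1 * q z.2.
have key (F : R * R -> R) (p q : R -> R) : F \_ B1 \in Lfun lam 2%:E ->
    measurable_fun setT p -> measurable_fun setT q -> (exists M : R, forall s, `|p s| <= M) ->
    (exists M : R, forall s, `|q s| <= M) -> (forall s, ~ a <= s <= b -> p s = 0) ->
    (forall t, ~ c <= t <= e -> q t = 0) ->
    lam.-integrable setT (EFin \o (fun z => F z * w p q z)).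
  move=> LF mp mq [M pM] [N qN] p0 q0.
  have mw : measurable_fun (setT : set RR) (w p q).
    apply: measurable_funM; [exact: (measurableT_comp mp fst_meas)|exact: (measurableT_comp mq snd_meas)].
  have w0 z : ~ Q z -> w p q z = 0.
    case: z => s t /QP nQ; rewrite /w /=; have [h|h] := pselect (a <= s <= b); last by rewrite p0// mul0r.
    by rewrite q0 ?mulr0// => h'; apply: nQ.
  have := @Lfun2_mul R (F \_ B1) (w p q) Q (M * N) LF (mQ a b c e) (Qfin a b c e) mw _ w0.
  rewrite (_ : (fun z => (F \_ B1) z * w p q z) = (fun z => F z * w p q z)).
    by apply=> z; rewrite /w normrM ler_pM.
  apply/funext => z; rewrite patchE; case: ifPn => // nB.
  by rewrite [w _ _ _]w0 ?mulr0//; apply: sub'; move: nB; rewrite notin_setE.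
pose i1 := (\1_`[a, b] : R -> R); pose i2 := (\1_`[c, e] : R -> R).
have mi1 : measurable_fun setT i1 by apply: measurable_indic; exact: mitv.
have mi2 : measurable_fun setT i2 by apply: measurable_indic; exact: mitv.
have bi (A : set R) : exists M : R, forall s, `|(\1_A s : R)| <= M.
  by exists 1 => s; rewrite indicE ger0_norm ?ler0n// lern1 leq_b1.
have i10 s : ~ a <= s <= b -> i1 s = 0 by move=> h; rewrite /i1 indicE memNset//= in_itv.
have i20 s : ~ c <= s <= e -> i2 s = 0 by move=> h; rewrite /i2 indicE memNset//= in_itv.
have i11 s : a <= s <= b -> i1 s = 1 by move=> h; rewrite /i1 indicE mem_set//= in_itv.
have i21 s : c <= s <= e -> i2 s = 1 by move=> h; rewrite /i2 indicE mem_set//= in_itv.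
have lines (F : R * R -> R) : F \_ B1 \in Lfun lam 2%:E ->
    {ae mu, forall t, c <= t <= e -> L1 a b (fun s => F (s, t))}.
  move=> LF; have [H _ _] := fubini_real (key F i1 i2 LF mi1 mi2 (bi _) (bi _) i10 i20).
  apply: ae_imp H => t it ct; apply: L1_eq (_ : L1 a b (fun s => F (s, t) * w i1 i2 (s, t))).
    by move=> s h; rewrite /w /= i11// i21// !mulr1.
  by apply: integrableS it => //; exact: mitv.
have lf := lines f Lf; have lg := lines g Lg.
pose Z (j : rat * rat * nat) := zet a b (ratr j.1.1) (ratr j.1.2) j.2.
pose A (j : rat * rat * nat) := anti a b (ratr j.1.1) (ratr j.1.2) j.2.
pose ok (j : rat * rat * nat) := [/\ a < ratr j.1.1 :> R, ratr j.1.1 < ratr j.1.2 :> R & ratr j.1.2 < b :> R].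
(* The pairing of line t with the j-th test function; it vanishes exactly when the identity required
   by [line_ac] holds on that line. *)
pose k j t := itg a b (fun s => f (s, t) * Z j s + g (s, t) * A j s).
have Zout j s : ok j -> ~ a <= s <= b -> Z j s = 0.
  move=> [h1 _ h2] /negP; rewrite negb_and -!ltNge => /orP[] /ltW h; (apply: zet_out; [exact: (ltW h1)|exact: (ltW h2)|tauto]).
have Aout j s : ok j -> ~ a <= s <= b -> A j s = 0.
  move=> [h1 _ h2] /negP; rewrite negb_and -!ltNge => /orP[] /ltW h; (apply: anti_out; [exact: ab|exact: (ltW h1)|exact: (ltW h2)|tauto]).
have cZ j : continuous (Z j : R -> R) by exact: (Ck_cont (Ck_zet _ _ _ _ _ 0)).
have testA j : ok j -> test_function setT (A j : R^o -> R^o).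
  by move=> [h1 _ h2]; apply: test_anti; [exact: ab|exact: (ltW h1)|exact: (ltW h2)|].
have cA j : ok j -> continuous (A j : R -> R) by move=> /testA[C _]; exact: (Ck_cont (C 0%N)).
(* The indices j are enumerated by [pickle], and a countable union of null sets is null. *)
suff K j : ok j -> {ae mu, forall t, c <= t <= e -> k j t = 0}.
  have K' : {ae mu, forall t, forall n : nat, forall j, unpickle n = Some j -> ok j -> c <= t <= e -> k j t = 0}.
    apply: ae_foralln => n; case: (unpickle n) => [j|]; last by apply: aeW.
    have [okj|nok] := pselect (ok j); last by apply: aeW => t _ [<-] /nok.
    by apply: ae_imp (K j okj) => t H _ [<-] _.
  apply: ae_imp (ae_and K' (ae_and lf lg)) => t [Kt [ft gt]] ct.
  have fi := ft ct; have gi := gt ct; split=> //.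
  apply: line_ac => // q q' n h1 h2 h3.
  have := Kt (pickle (q, q', n)) (q, q', n) (pickleK _) (And3 h1 h2 h3) ct.
  have L1p (F p : R -> R) : continuous p -> L1 a b F -> L1 a b (fun s => F s * p s).
    move=> cp Fi; have h := L1M_cont (continuous_subspaceT cp : {within `[a, b], continuous p}) Fi.
    by apply: L1_eq h => s _; rewrite mulrC.
  rewrite /k itgD; [|exact: L1p|by apply: L1p => //; apply: cA].
  by move=> /eqP; rewrite addr_eq0 => /eqP.
move=> okj; have [aq qq qb] := okj.
have mZ : measurable_fun setT (Z j) by exact: continuous_measurable_fun.
have mA : measurable_fun setT (A j) by apply: continuous_measurable_fun; exact: cA.
have bZ := within_bdd_supp (cZ j) (Zout j ^~ okj).
have bA := within_bdd_supp (cA j okj) (Aout j ^~ okj).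
have inner (chi : R -> R) t : (forall s, f (s, t) * w (Z j) chi (s, t) + g (s, t) * w (A j) chi (s, t) =
    chi t * (f (s, t) * Z j s + g (s, t) * A j s)).
  by move=> s; rewrite /w /=; ring.
have supp (h : R -> R) : (forall s, ~ a <= s <= b -> h s = 0) -> \int[mu]_(s in setT) h s = itg a b h.
  by move=> h0; apply: integral_supp.
have iK : mu.-integrable setT (EFin \o (fun t => \int[mu]_(s in setT)
    (f (s, t) * w (Z j) i2 (s, t) + g (s, t) * w (A j) i2 (s, t)))).
  have h1 := key f (Z j) i2 Lf mZ mi2 bZ (bi _) (Zout j ^~ okj) i20.
  have h2 := key g (A j) i2 Lg mA mi2 bA (bi _) (Aout j ^~ okj) i20.
  by have [] := fubini_real (integrableD measurableT h1 h2).
have ki : L1 c e (k j).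
  apply: L1_eq (_ : L1 c e (fun t => \int[mu]_(s in setT)
    (f (s, t) * w (Z j) i2 (s, t) + g (s, t) * w (A j) i2 (s, t)))).
    move=> t ct; rewrite supp; last by move=> s h; rewrite /w /= Zout// Aout// !mul0r !mulr0 addr0.
    by apply: itg_eq => s _; rewrite inner i21// mul1r.
  by apply: integrableS iK => //; exact: mitv.
apply: ae_imp (itg0_ae ki _) => // s' t' cs st te.
have kst := L1_sub ki cs te.
suff Zn n : itg s' t' (fun t => k j t * tbump s' t' n t) = 0.
  have := bump_limit kst; under eq_fun do rewrite Zn.
  by move/(cvg_unique _ (cvg_cst _)) => /(_ (@Rhausdorff R)) ->.
pose chi : R -> R := tbump s' t' n.
have chi0 t : ~ c <= t <= e -> chi t = 0.
  by move=> h; apply: tbump_eq0 => /andP[? ?]; apply: h; rewrite (le_trans cs)//= (le_trans _ te).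
have cchi : continuous chi by exact: (Ck_cont (Ck_tbump 0 s' t' n)).
have mchi : measurable_fun setT chi by exact: continuous_measurable_fun.
have bchi := within_bdd_supp cchi chi0.
have h1 := key f (Z j) chi Lf mZ mchi bZ bchi (Zout j ^~ okj) chi0.
have h2 := key g (A j) chi Lg mA mchi bA bchi (Aout j ^~ okj) chi0.
have [ae1 iX EX] := fubini_real (integrableD measurableT h1 h2).
have tPhi : test_function B1 ((fun z => A j z.1 * chi z.2) : R * R -> R^o).
  apply: (@tensor_test R _ (A j : R^o -> R^o) (chi : R^o -> R^o) a b c e) => //.
  - by have [] := testA j okj.
  - by move=> m; exact: Ck_tbump.
  - by move=> s; exact: Aout.
have cB (F : R * R -> R) : (forall z, ~ (@B1 R) z -> F z = 0) -> \int[lam]_(z in B1) F z = \int[lam]_(z in setT) F z.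
  move=> F0; rewrite Rintegral_mkcond; apply: eq_Rintegral => z _; rewrite patchE; case: ifPn => // nB.
  by rewrite F0//; move: nB; rewrite notin_setE.
have w0 p z : (forall s, ~ a <= s <= b -> p s = 0) -> ~ (@B1 R) z -> w p chi z = 0.
  move=> p0 /sub'; case: z => s t /QP nQ; rewrite /w /=; have [h|h] := pselect (a <= s <= b); last by rewrite p0// mul0r.
  by rewrite chi0 ?mulr0// => h'; apply: nQ.
have Z0 : \int[lam]_(z in setT) (f z * w (Z j) chi z + g z * w (A j) chi z) = 0.
  rewrite RintegralD//.
  have := wp _ tPhi; rewrite !cB; last 2 first.
  - by move=> z nB; have := w0 (A j) z (Aout j ^~ okj) nB; rewrite /w => ->; rewrite mulr0.
  - move=> z nB; rewrite tensor_derive; [|exact: (testA j okj).1|exact: Ck_tbump].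
    have [_ ->] := anti_derive j.2 ab (ltW aq) (ltW qb) z.1.
    by have := w0 (Z j) z (Zout j ^~ okj) nB; rewrite /w /Z => ->; rewrite mulr0.
  move=> E; apply/eqP; rewrite addr_eq0; apply/eqP; rewrite -E.
  apply: eq_Rintegral => z _; rewrite tensor_derive; [|exact: (testA j okj).1|exact: Ck_tbump].
  by have [_ ->] := anti_derive j.2 ab (ltW aq) (ltW qb) z.1.
rewrite Z0 in EX; rewrite -(@integral_supp R setT) //; last first.
  by move=> t h; rewrite tbump_eq0 ?mulr0.
rewrite [RHS]EX /Rintegral; congr fine; apply: ae_eq_integral => //.
- have [mk _] := integrableP _ _ _ iK.
  apply/measurable_EFinP.
  rewrite (_ : (fun t => k j t * tbump s' t' n t) = (fun t => (\int[mu]_(s in setT)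
    (f (s, t) * w (Z j) i2 (s, t) + g (s, t) * w (A j) i2 (s, t))) * tbump s' t' n t)).
    by apply: measurable_funM => //; exact/measurable_EFinP.
  apply/funext => t; have [ct|nct] := pselect (c <= t <= e); last by rewrite -/chi chi0// !mulr0.
  rewrite supp; last by move=> s h; rewrite /w /= Zout// Aout// !mul0r !mulr0 addr0.
  by congr (_ * _); apply: itg_eq => s _; rewrite inner i21// mul1r.
- exact: measurable_int iX.
- apply: ae_imp (ae_and lf lg) => t [ft gt] _ /=; congr EFin.
  have hs := supp (fun s => f (s, t) * w (Z j) chi (s, t) + g (s, t) * w (A j) chi (s, t)) _.
  apply: etrans (esym (hs _)); last first.
    by move=> s h; rewrite /w /= Zout// Aout// !mul0r !mulr0 addr0.
  have [ct|nct] := pselect (c <= t <= e); last first.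
    rewrite -/chi chi0// mulr0; apply/esym; apply: itg_0 => s _.
    by rewrite inner chi0// mul0r.
  have L1p (F p : R -> R) : continuous p -> L1 a b F -> L1 a b (fun s => F s * p s).
    move=> cp Fi; have h := L1M_cont (continuous_subspaceT cp : {within `[a, b], continuous p}) Fi.
    by apply: L1_eq h => s _; rewrite mulrC.
  have li : L1 a b (fun s => f (s, t) * Z j s + g (s, t) * A j s).
    by apply: L1D; [apply: L1p; [exact: cZ|exact: ft]|apply: L1p; [exact: cA|exact: gt]].
  rewrite (itg_eq (fun s _ => inner chi t s)) (itgZ (chi t) li).
  exact: mulrC.
Qed.

End Lines.

(** * From lines to the radial variable *)

Section Radial.
Context {R : realType}.
Notation mu := (@lebesgue_measure R).
Notation lam := (@lebesgue2 R).
Notation I := (`]0%R, 1%R[%classic : set R).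
Implicit Types (x y s t r a b c e : R).

Lemma ae_pick c e (P : R -> Prop) : c < e -> {ae mu, forall t, c <= t <= e -> P t} ->
  exists2 t, c <= t <= e & P t.
Proof.
move=> ce [N [mN N0 sub]]; apply: contrapT => nP.
have : (mu `[c, e] <= mu N)%E.
  apply: le_measure; rewrite ?inE//.
  move=> t; rewrite /= in_itv/= => h; apply: sub => /= H; apply: nP; exists t => //; exact: H.
by rewrite N0 lebesgue_measure_itv/= lte_fin ce -EFinD lee_fin leNgt subr_gt0 ce.
Qed.

Lemma ae_cont_eq x y (f g : R -> R) : x < y -> {within `[x, y], continuous f} ->
  {within `[x, y], continuous g} -> {ae mu, forall r, x <= r <= y -> f r = g r} ->
  forall r, x <= r <= y -> f r = g r.
Proof.
move=> xy cf cg fg r /andP[xr ry]; apply/eqP; rewrite -subr_eq0; apply: contrapT => /negP.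
rewrite -normr_gt0 => e0; have ck : {within `[x, y], continuous (fun r => f r - g r)}.
  by move=> z; apply: cvgB; [exact: cf|exact: cg].
have [eta eta0 H] := heine ck e0.
pose p := Num.max x (r - eta / 2); pose q := Num.min y (r + eta / 2).
have pq : p < q by rewrite /p /q gt_max !lt_min xy /=; apply/andP; split; [lra|apply/andP; split; lra].
have xp : x <= p by rewrite /p le_max lexx.
have qy : q <= y by rewrite /q ge_min lexx.
have [z /andP[pz zq] zE] : exists2 z, p <= z <= q & f z = g z.
  apply: ae_pick pq _; apply: ae_imp fg => z E /andP[? ?]; apply: E.
  by rewrite (le_trans xp)//= (le_trans _ qy).
have zr : `|z - r| < eta.
  move: pz zq; rewrite /p /q ge_max le_min => /andP[_ ?] /andP[_ ?].
  by rewrite ltr_norml; apply/andP; split; lra.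
have := H r z; rewrite xr ry (le_trans xp pz) (le_trans zq qy) => /(_ isT isT zr).
by rewrite zE subrr sub0r normrN ltxx.
Qed.

(** The radius is inverted on the line at height t: composition with the chart r -> sqrt (r^2 - t^2)
    carries both the absolutely continuous function and the null set to the radial variable. *)
Lemma rad_ac (k H G : R -> R) a b t : 0 < a -> a <= b -> acon a b H G ->
  {ae mu, forall s, a <= s <= b -> k (Num.sqrt (s ^+ 2 + t ^+ 2)) = H s} ->
  let A := Num.sqrt (a ^+ 2 + t ^+ 2) in let B := Num.sqrt (b ^+ 2 + t ^+ 2) in
  exists F D, acon A B F D /\ {ae mu, forall r, A <= r <= B -> k r = F r}.
Proof.
move=> a0 ab aH kH A B; have b0 : 0 < b := lt_le_trans a0 ab.
have p s : 0 < s -> 0 < s ^+ 2 + t ^+ 2 by move=> s0; rewrite ltr_pwDl ?sqr_ge0// exprn_gt0.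
have A2 : A ^+ 2 = a ^+ 2 + t ^+ 2 by rewrite sqr_sqrtr// ltW// p.
have B2 : B ^+ 2 = b ^+ 2 + t ^+ 2 by rewrite sqr_sqrtr// ltW// p.
have A0 : 0 < A by rewrite sqrtr_gt0 p.
have AB : A <= B by apply: ler_wsqrtr; rewrite lerD2r ler_pXn2r// nnegrE ltW.
have h : 0 < A ^+ 2 + - t ^+ 2 by rewrite A2 addrK exprn_gt0.
have C := chart_sqrt (ltW A0) AB h.
have XA : Num.sqrt (A ^+ 2 + - t ^+ 2) = a by rewrite A2 addrK sqrtr_sqr gtr0_norm.
have XB : Num.sqrt (B ^+ 2 + - t ^+ 2) = b by rewrite B2 addrK sqrtr_sqr gtr0_norm.
have aF := acon_comp C AB; rewrite XA XB in aF.
have := ae_comp C AB; rewrite XA XB => K.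
eexists; eexists; split; first exact: aF aH.
apply: ae_imp (K _ kH) => r E /andP[Ar rB].
have r0 : 0 < r := lt_le_trans A0 Ar.
have q0 : 0 < r ^+ 2 + - t ^+ 2.
  by apply: lt_le_trans h _; rewrite lerD2r ler_pXn2r// nnegrE ltW.
have := E _ _; rewrite Ar rB divr_gt0 ?sqrtr_gt0// => /(_ isT isT) /= <-.
by rewrite sqr_sqrtr ?(ltW q0)// subrK sqrtr_sqr gtr0_norm.
Qed.

(** A thin rectangle in the first quadrant on which every horizontal line sweeps all radii in [x, y]
    and stays inside the disc. Its height is at most x / 2, for the left end, and at most (1 - y) /
    2, for the right end. *)
Lemma rect x y : 0 < x -> x <= y -> y < 1 -> exists a b c e, [/\ 0 < a, a < b, 0 < c, c < e &
  forall t, c <= t <= e -> [/\ Num.sqrt (a ^+ 2 + t ^+ 2) <= x, y <= Num.sqrt (b ^+ 2 + t ^+ 2),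
    Num.sqrt (b ^+ 2 + t ^+ 2) < 1 & forall s, a <= s <= b -> (@B1 R) (s, t)]].
Proof.
move=> x0 xy y1; pose e := x * (1 - y) / 2.
have e0 : 0 < e by rewrite divr_gt0// mulr_gt0// subr_gt0.
have ex : e <= x / 2 by rewrite /e ler_pM2r ?invr_gt0// ler_piMr ?ltW//; lra.
have ey : e <= (1 - y) / 2.
  by rewrite /e ler_pM2r ?invr_gt0// ler_piMl ?subr_ge0 ?ltW// (le_lt_trans xy).
have y0 : 0 < y := lt_le_trans x0 xy.
exists (x / 2), y, (e / 2), e; split; [lra|lra|lra|lra|].
move=> t /andP[t1 t2]; have t0 : 0 < t by lra.
have lt1 s : 0 < s -> s <= y -> Num.sqrt (s ^+ 2 + t ^+ 2) < 1.
  move=> s0 sy; rewrite -sqrtr1 ltr_sqrt//.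
  have h1 : s ^+ 2 <= y ^+ 2 by rewrite ler_pXn2r// nnegrE ltW.
  have h2 : t ^+ 2 <= ((1 - y) / 2) ^+ 2 by rewrite ler_pXn2r// ?nnegrE; lra.
  by apply: le_lt_trans (lerD h1 h2) _; move: y0 y1; clear; nra.
split.
- rewrite -[leRHS]gtr0_norm// -sqrtr_sqr; apply: ler_wsqrtr.
  have : t ^+ 2 <= (x / 2) ^+ 2 by rewrite ler_pXn2r// ?nnegrE; lra.
  by move: x0; clear; nra.
- by rewrite -[leLHS]gtr0_norm// -sqrtr_sqr ler_wsqrtr// lerDl sqr_ge0.
- exact: lt1.
- move=> s /andP[s1 s2]; have s0 : 0 < s by lra.
  exact: lt1 s0 s2.
Qed.

(** An exhaustion of ]0, 1[; the shift by 3 makes already the first interval nondegenerate. *)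
Let X n : R := n.+3%:R^-1.
Let Y n : R := 1 - n.+3%:R^-1.

Let X0 n : 0 < X n. Proof. by rewrite invr_gt0. Qed.
Let XY n : X n < Y n.
Proof.
rewrite /X /Y; have : n.+3%:R^-1 <= 3^-1 :> R by rewrite lef_pV2 ?posrE ?ltr0n// ler_nat.
by move: (n.+3%:R^-1) => q; lra.
Qed.
Let Y1 n : Y n < 1. Proof. by rewrite /Y ltrBlDr ltrDl; exact: X0. Qed.
Let Xle i j : (i <= j)%N -> X j <= X i.
Proof. by move=> ij; rewrite lef_pV2 ?posrE ?ltr0n// ler_nat !ltnS. Qed.
Let Yle i j : (i <= j)%N -> Y i <= Y j.
Proof. by move=> /Xle; rewrite /X /Y => ?; rewrite lerD2l lerN2. Qed.
Let cover x y : 0 < x -> y < 1 -> exists n, X n <= x /\ y <= Y n.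
Proof.
move=> x0 y1; have m0 : 0 < Num.min x (1 - y) by rewrite lt_min x0 subr_gt0.
have [n] := near_invS m0; rewrite lt_min => /andP[h1 h2].
have h3 : X n <= n.+2%:R^-1 by rewrite lef_pV2 ?posrE ?ltr0n// ler_nat.
exists n; split; first exact: le_trans h3 (ltW h1).
by rewrite /Y -/(X n); move: h2 h3; move: (X n) (n.+2%:R^-1) => p q ? ?; lra.
Qed.

(** Continuous representatives on nested intervals coincide where both are defined, but their
    densities agree only almost everywhere. A density with consistent values is therefore built by
    successive extension. *)
Lemma glue_ac (k : R -> R) : (forall x y, 0 < x -> x <= y -> y < 1 ->
    exists F D, acon x y F D /\ {ae mu, forall r, x <= r <= y -> k r = F r}) ->
  exists F D, ac F D /\ {ae mu, forall r, I r -> k r = F r}.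
Proof.
move=> H; have /choice[FD hFD] : forall n, exists FD : (R -> R) * (R -> R),
    acon (X n) (Y n) FD.1 FD.2 /\ {ae mu, forall r, X n <= r <= Y n -> k r = FD.1 r}.
  by move=> n; have [F [D [a1 a2]]] := H _ _ (X0 n) (ltW (XY n)) (Y1 n); exists (F, D).
pose F n := (FD n).1.
have FS i j : (i <= j)%N -> forall r, X i <= r <= Y i -> F i r = F j r.
  move=> ij; have [ai ki] := hFD i; have [aj kj] := hFD j.
  apply: (ae_cont_eq (XY i) (acon_within ai)).
    exact: acon_within (acon_sub aj (Xle ij) (Yle ij)).
  apply: ae_imp (ae_and ki kj) => r [h1 h2] /andP[r1 r2]; rewrite /F -h1 ?r1// -h2//.
  by rewrite (le_trans (Xle ij))//= (le_trans r2)// Yle.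
(* Each new density keeps the previous one on the previous interval and is taken from [FD] only
   outside it, so the value at r no longer depends on n. *)
pose D := fix D n := if n is m.+1 then (fun r => if X m <= r <= Y m then D m r else (FD n).2 r) else (FD 0).2.
have aD n : acon (X n) (Y n) (F n) (D n).
  elim: n => [|n ih]; first by have [] := hFD 0%N.
  have [aS _] := hFD n.+1; have x1 := Xle (leqnSn n); have y1 := Yle (leqnSn n).
  apply: (acon_cat x1 (le_trans (ltW (XY n)) y1)).
    apply: acon_eq_oo (acon_sub aS (lexx _) (le_trans (ltW (XY n)) y1)) => // r /andP[_ h] /=.
    by rewrite leNgt h.
  apply: (acon_cat (ltW (XY n)) y1).
    apply: acon_eq_oo ih => r h; first by rewrite (FS n n.+1).
    by rewrite /= !ltW//; case/andP: h.
  apply: acon_eq_oo (acon_sub aS (le_trans x1 (ltW (XY n))) (lexx _)) => // r /andP[h _] /=.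
  by rewrite [r <= _]leNgt h andbF.
have DS i j : (i <= j)%N -> forall r, X i <= r <= Y i -> D i r = D j r.
  move=> /subnK <-; elim: (j - i)%N => // n ih r h; rewrite addSn /= ifT; first exact: ih.
  have /andP[h1 h2] := h; have le := leq_addl n i.
  by rewrite (le_trans (Xle le))//= (le_trans h2)// Yle.
have /choice[N hN] : forall r, exists n, 0 < r < 1 -> X n <= r <= Y n.
  move=> r; have [/andP[r0 r1]|h] := pselect (0 < r < 1); last by exists 0%N.
  by have [n [h1 h2]] := cover r0 r1; exists n => _; rewrite h1 h2.
have E n r : X n <= r <= Y n -> F (N r) r = F n r /\ D (N r) r = D n r.
  move=> h; have hr : 0 < r < 1.
    by have /andP[h1 h2] := h; rewrite (lt_le_trans (X0 n) h1) (le_lt_trans h2 (Y1 n)).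
  have hn := hN r hr; have [le|/ltnW le] := leqP n (N r).
    by rewrite -(FS _ _ le) // -(DS _ _ le).
  by rewrite (FS _ _ le) // (DS _ _ le).
exists (fun r => F (N r) r), (fun r => D (N r) r); split.
  move=> x y x0 y1; have [n [h1 h2]] := cover x0 y1.
  apply: acon_eq_oo (acon_sub (aD n) h1 h2) => r /andP[? ?].
    by have [] := E n r; rewrite ?(le_trans h1)//= (le_trans _ h2).
  by have [] := E n r; rewrite ?(le_trans h1)//= ?(le_trans _ h2)// ltW.
have A : {ae mu, forall r, forall n, X n <= r <= Y n -> k r = F n r}.
  by apply: ae_foralln => n; have [] := hFD n.
apply: ae_imp A => r h; rewrite /= in_itv/= => hr.
exact: h (hN r hr).
Qed.

End Radial.

(** * From planar Sobolev functions to radial profiles *)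

Section Necessity.
Context {R : realType}.
Notation mu := (@lebesgue_measure R).
Notation lam := (@lebesgue2 R).
Notation RR := (measurableTypeR R * measurableTypeR R)%type.
Notation I := (`]0%R, 1%R[%classic : set R).
Implicit Types (x y s t r a b c e : R).

(** The multiplier M turns a planar function on the line at height t into a radial profile: 2 |z| /
    s for the first component of U, 1 for W, and |z| / s for the first partial derivative of W. One
    good line covers the whole of [x, y]. *)
Lemma rad_rep (k : R -> R) (f g : R * R -> R) (M M' : R -> R -> R) :
  is_weak_partial B1 (1, 0) f g -> f \_ B1 \in Lfun lam 2%:E -> g \_ B1 \in Lfun lam 2%:E ->
  (forall a b t, 0 < a -> a <= b -> acon a b (M t) (M' t)) ->
  (forall a b c e, 0 < a -> a < b -> 0 < c ->
    (forall t, c <= t <= e -> Num.sqrt (b ^+ 2 + t ^+ 2) < 1) ->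
    (forall s t, a <= s <= b -> c <= t <= e -> (@B1 R) (s, t)) ->
    {ae mu, forall t, c <= t <= e -> {ae mu, forall s, a <= s <= b ->
       k (Num.sqrt (s ^+ 2 + t ^+ 2)) = M t s * f (s, t)}}) ->
  exists F D, ac F D /\ {ae mu, forall r, I r -> k r = F r}.
Proof.
move=> wp Lf Lg aM kf; apply: glue_ac => x y x0 xy y1.
have [a [b [c [e [a0 ab c0 ce H]]]]] := rect x0 xy y1.
have sub s t : a <= s <= b -> c <= t <= e -> (@B1 R) (s, t).
  by move=> hs /H[_ _ _]; apply.
have b1 t : c <= t <= e -> Num.sqrt (b ^+ 2 + t ^+ 2) < 1 by move=> /H[].
have [t ct [Kt At]] := ae_pick ce (ae_imp (fun t (h : (c <= t <= e -> _) /\ (c <= t <= e -> _)) ct =>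
  conj (h.1 ct) (h.2 ct)) (ae_and (kf a b c e a0 ab c0 b1 sub) (acl ab sub wp Lf Lg))).
have [fi gi [C fE]] := At.
have aH : acon a b (fun s => C + itg a s (fun s => g (s, t))) (fun s => g (s, t)).
  by apply: acon_ext (aconD (acon_cst a b C) (acon_itg gi)) => r //; rewrite add0r.
have [|F [D [aF kF]]] := rad_ac (k := k) (t := t) a0 (ltW ab) (aconM (aM a b t a0 (ltW ab)) aH).
  by apply: ae_imp (ae_and Kt fE) => s [h1 h2] hs; rewrite h1// h2.
have [h1 h2 _ _] := H t ct; exists F, D; split; first exact: acon_sub aF h1 h2.
by apply: ae_imp kF => r h /andP[xr ry]; apply: h; rewrite (le_trans h1)//= (le_trans ry).
Qed.

Lemma acon_radius a b t : 0 < a -> a <= b ->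
  acon a b (fun s => Num.sqrt (s ^+ 2 + t ^+ 2)) (fun s => s / Num.sqrt (s ^+ 2 + t ^+ 2)).
Proof.
move=> a0 ab; have h : 0 < a ^+ 2 + t ^+ 2 by rewrite ltr_pwDl ?sqr_ge0// exprn_gt0.
by have [_ _ _] := chart_sqrt (ltW a0) ab h.
Qed.

Lemma acon_ratio (al : R) : exists M', forall a b t, 0 < a -> a <= b ->
  acon a b (fun s => al * (Num.sqrt (s ^+ 2 + t ^+ 2) * s^-1)) (M' t).
Proof.
eexists => a b t a0 ab.
have ai : acon a b (fun s => s^-1) _ := aconV (acon_id a b) (fun s h => lt_le_trans a0 (andP h).1).
exact: (aconZ al (aconM (acon_radius t a0 ab) ai)).
Qed.

Lemma xget_weak (f g : R -> R) : @is_weak_deriv R f g ->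
  @is_weak_deriv R f (weak_deriv f) /\ {ae mu, forall r, I r -> weak_deriv f r = g r}.
Proof.
move=> fg; have H : @is_weak_deriv R f (weak_deriv f).
  by rewrite /weak_deriv; apply: (@xgetPex _ (fun=> 0) [set g | @is_weak_deriv R f g]); exists g.
by split=> //; exact: weak_deriv_uniq H fg.
Qed.

Lemma enormE s t : enorm (s, t) = Num.sqrt (s ^+ 2 + t ^+ 2) :> R. Proof. by []. Qed.

Lemma meas_density (h : R) (u p v b : R -> R) : measurable_fun I u -> measurable_fun I p ->
  measurable_fun I v -> measurable_fun I b -> measurable_fun I (edens h u p v b).
Proof.
move=> mu' mp mv mb.
have mi : measurable_fun I (fun r : R => r^-1).
  by apply: meas_inv; [exact: mI|move=> r; rewrite /= in_itv/= => /andP[]].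
have mr : measurable_fun I (fun r : R => r) by exact: measurable_id.
apply: measurable_funD; first apply: measurable_funD.
- by apply: measurable_funM => //; exact: measurable_funX.
- apply: measurable_funM => //; apply: measurable_funX; apply: measurable_funB.
    by apply: measurable_funD => //; exact: measurable_funX.
  by apply: measurable_funM; [exact: measurable_cst|exact: measurable_funX].
- apply: measurable_funM; first exact: measurable_cst.
  by apply: measurable_funD; apply: measurable_funM => //; exact: measurable_funX.
Qed.

Lemma energy_edens h uw : energy h uw =
  E1 h uw.1 (weak_deriv uw.1) (weak_deriv uw.2) (weak_deriv (weak_deriv uw.2)) :> \bar R.
Proof. by []. Qed.

Lemma E1_ae (h : R) (u p v b u' p' v' b' : R -> R) :
  measurable_fun I (edens h u p v b) -> measurable_fun I (edens h u' p' v' b') ->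
  {ae mu, forall r, I r -> u r = u' r} -> {ae mu, forall r, I r -> p r = p' r} ->
  {ae mu, forall r, I r -> v r = v' r} -> {ae mu, forall r, I r -> b r = b' r} ->
  E1 h u p v b = E1 h u' p' v' b'.
Proof.
move=> m1 m2 eu ep ev eb; apply: ae_eq_integral => //; [exact/measurable_EFinP|exact/measurable_EFinP|].
apply: ae_imp (ae_and (ae_and eu ep) (ae_and ev eb)) => r [[h1 h2] [h3 h4]] rI.
by rewrite /edens h1// h2// h3// h4.
Qed.

(** The chosen weak derivatives agree almost everywhere with the densities found on lines, so
    replacing them leaves the energy unchanged. *)
Lemma admissible_state (h delta : R) uw : admissible delta uw ->
  exists X, [/\ ac (su X) (sp X), ac (sv X) (sb X), energy h uw = sE h X &
    forall x y, 0 < x -> x <= y -> y < 1 -> itg x y (sv X) = uw.2 y - uw.2 x].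
Proof.
case: uw => u w [/= [LU1 [[g [wpU [Lg _]]] _]] _ [Lw [[G1 [wpw [LG1 [[G11 [wpG [LG11 _]]] _]]]] _]] cw [w0 w1]].
have pos a t s : 0 < a -> a <= s -> 0 < s ^+ 2 + t ^+ 2.
  by move=> a0 as_; rewrite ltr_pwDl ?sqr_ge0// exprn_gt0// (lt_le_trans a0).
have [M2 aM2] := acon_ratio 2; have [M1 aM1] := acon_ratio 1.
have [F [p [Fp uF]]] : exists F D, ac F D /\ {ae mu, forall r, I r -> u r = F r}.
  apply: (rad_rep wpU LU1 Lg aM2) => a b c e a0 ab c0 _ _.
  apply: aeW => t _; apply: aeW => s /andP[as_ sb]; have s0 := lt_le_trans a0 as_.
  rewrite /radial_vector /= enormE; have := pos a t s a0 as_; rewrite -sqrtr_gt0 => q0.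
  by field; rewrite !gt_eqF.
have [W [v0 [Wv wW]]] : exists F D, ac F D /\ {ae mu, forall r, I r -> w r = F r}.
  apply: (rad_rep wpw Lw LG1 (M := fun _ _ => 1) (M' := fun _ _ => 0)).
    by move=> a b t _ _; exact: acon_cst.
  move=> a b c e a0 ab c0 _ _; apply: aeW => t _; apply: aeW => s _.
  by rewrite mul1r.
have wE r : 0 < r < 1 -> w r = W r.
  move=> /andP[r0 r1]; have h1 : r / 2 < (1 + r) / 2 by lra.
  apply: (ae_cont_eq h1) => [|||]; last by apply/andP; split; lra.
  - apply: continuous_subspaceW cw => z; rewrite /= !in_itv/= => /andP[? ?]; apply/andP; split; lra.
  - by apply: acon_within; apply: Wv; lra.
  - by apply: ae_imp wW => z H /andP[? ?]; apply: H; rewrite /= in_itv/=; apply/andP; split; lra.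
(* On a line W has two densities: the weak partial derivative G1, and v0 times s / |z| from the
   chain rule. [acon_uniq] identifies them, so w' is |z| / s times the Sobolev function G1. *)
have [V [b [Vb vV]]] : exists F D, ac F D /\ {ae mu, forall r, I r -> v0 r = F r}.
  apply: (rad_rep wpG LG1 LG11 aM1) => a b c e a0 ab c0 b1 sub.
  apply: ae_imp (acl ab sub wpw Lw LG1) => t H ct; have [fi gi [C fE]] := H ct.
  have bt := b1 t ct; have A0 : 0 < Num.sqrt (a ^+ 2 + t ^+ 2) by rewrite sqrtr_gt0 (pos a).
  have h2 : 0 < a ^+ 2 + t ^+ 2 by apply: (pos a).
  have ch := chart_sqrt (ltW a0) (ltW ab) h2.
  have aW := acon_comp ch (ltW ab) (Wv _ _ A0 bt).
  have aH : acon a b (fun s => C + itg a s (fun s => G1 (s, t))) (fun s => G1 (s, t)).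
    by apply: acon_ext (aconD (acon_cst a b C) (acon_itg gi)) => r //; rewrite add0r.
  have rI s : a <= s <= b -> 0 < Num.sqrt (s ^+ 2 + t ^+ 2) < 1.
    move=> /andP[as_ sb]; rewrite sqrtr_gt0 (pos a)//=; apply: le_lt_trans bt.
    by apply: ler_wsqrtr; rewrite lerD2r ler_pXn2r// nnegrE; [exact: ltW (lt_le_trans a0 as_)|exact: ltW (lt_trans a0 ab)].
  have WH s : a <= s <= b -> (W \o (fun s => Num.sqrt (s ^+ 2 + t ^+ 2))) s = C + itg a s (fun s => G1 (s, t)).
    apply: (ae_cont_eq ab (acon_within aW) (acon_within aH)) => //.
    apply: ae_imp fE => z E hz; rewrite -E//= /radial_scalar enormE wE//; exact: rI.
  have aW' : acon a b (fun s => C + itg a s (fun s => G1 (s, t)))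
      (fun s => v0 (Num.sqrt (s ^+ 2 + t ^+ 2)) * (s / Num.sqrt (s ^+ 2 + t ^+ 2))).
    by apply: acon_eq_oo aW => s hs //; rewrite WH.
  apply: ae_imp (acon_uniq aH aW') => s E hs; rewrite E//.
  have /andP[as_ _] := hs; have s0 := lt_le_trans a0 as_; have /andP[q0 _] := rI s hs.
  by move: (v0 _) => z; field; rewrite !gt_eqF.
(* Equality almost everywhere with F does not make u measurable; its measurability is read off from
   U on the ray t = 0, where u(s) is twice the first component. *)
have mu' : measurable_fun I u.
  have [mU _] := Lfun2P LU1.
  have mp : measurable_fun (setT : set (measurableTypeR R)) (fun s : R => (s, 0) : RR).
    by apply: measurable_fun_pair; [exact: measurable_id|exact: measurable_cst].
  have mc : measurable_fun setT (((fst \o radial_vector u) \_ B1) \o (fun s : R => (s, 0))).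
    exact: measurableT_comp mU mp.
  have m2 : measurable_fun I (fun s => 2 * (((fst \o radial_vector u) \_ B1) \o (fun s : R => (s, 0))) s).
    by apply: measurable_funM; [exact: measurable_cst|exact: measurable_funTS].
  apply: eq_measurable_fun m2 => s; rewrite inE/= in_itv/= => /andP[s0 s1].
  have es : enorm (s, 0) = s by rewrite enormE expr0n addr0 sqrtr_sqr gtr0_norm.
  rewrite patchE ifT; last by rewrite inE /B1 /= es.
  by rewrite /radial_vector /= es; field; rewrite gt_eqF.
have [mF mp] := ac_meas Fp; have [mV mb] := ac_meas Vb.
have mw : measurable_fun I w by apply: eq_measurable_fun (ac_meas Wv).1 => r; rewrite inE/= in_itv/= => /wE ->.
have aeC (f f' : R -> R) : {ae mu, forall r, I r -> f r = f' r} -> {ae mu, forall r, I r -> f' r = f r}.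
  by apply: ae_imp => r H /H ->.
have [wu pu] := xget_weak (weak_deriv_ae (ac_is_weak_deriv Fp) mu' (aeC _ _ uF)).
have [ww vw] := xget_weak (weak_deriv_ae (ac_is_weak_deriv Wv) mw (aeC _ _ wW)).
have mwd f f' : @is_weak_deriv R f f' -> measurable_fun I f' by move=> [_ [mf' _ _] _].
have mp' := mwd _ _ wu.
have mv' := mwd _ _ ww.
have vV' : {ae mu, forall r, I r -> weak_deriv w r = V r}.
  by apply: ae_imp (ae_and vw vV) => r [h1 h2] rI; rewrite h1// h2.
have [wv bv] := xget_weak (weak_deriv_ae (ac_is_weak_deriv Vb) mv' (aeC _ _ vV')).
have mb' := mwd _ _ wv.
exists (State F p V b); split=> //=.
  rewrite energy_edens /sE /=; apply: E1_ae => //; exact: meas_density.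
move=> x y x0 xy y1; have [v1 vE] := Wv x y x0 y1.
have V1 : L1 x y V by apply: L1_cont; apply: acon_within; exact: Vb.
rewrite !wE ?x0 ?y1 ?(le_lt_trans xy)// ?(lt_le_trans x0)//= vE//.
congr fine; apply: ae_eq_integral => //; [exact: measurable_int V1|exact: measurable_int v1|].
apply: ae_imp vV => r H; rewrite /= in_itv/= => /andP[xr ry]; rewrite H//= in_itv/=.
by rewrite (lt_le_trans x0)//= (le_lt_trans ry).
Qed.

End Necessity.

(** * A polar coordinate estimate and square integrability of radial bounds *)

Section Polar.
Context {R : realType}.
Notation mu := (@lebesgue_measure R).
Notation lam := (@lebesgue2 R).
Notation RR := (measurableTypeR R * measurableTypeR R)%type.
Notation I := (`]0%R, 1%R[%classic : set R).
Implicit Types (x y s t r a b c e : R).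

(** An open set is a countable union of boxes with rational corners, hence belongs to the product
    sigma-algebra. *)
Lemma open2_measurable (U : set (R * R)) : open U -> measurable (U : set RR).
Proof.
move=> oU; pose J := (rat * rat * (rat * rat))%type.
pose bx (j : J) : set (R * R) := `]ratr j.1.1, ratr j.1.2[%classic `*` `]ratr j.2.1, ratr j.2.2[%classic.
have mbx j : measurable (bx j : set RR) by apply: measurableX; exact: measurable_itv.
pose V n : set (R * R) := if unpickle n is Some j then (if pselect (bx j `<=` U) then bx j else set0) else set0.
have -> : U = \bigcup_n V n.
  apply/seteqP; split => [[s t] Ust|z [n _]]; last first.
    by rewrite /V; case: (unpickle n) => // j; case: pselect => // sub /sub.
  have [e /= e0 be] := (nbhs_ballP _ _).1 (open_nbhs_nbhs (conj oU Ust)).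
  have h r : r - e < r /\ r < r + e by split; lra.
  have [/rat_in_itvoo[q1 Q1] /rat_in_itvoo[q2 Q2]] := h s.
  have [/rat_in_itvoo[q3 Q3] /rat_in_itvoo[q4 Q4]] := h t.
  move: Q1 Q2 Q3 Q4; rewrite !in_itv/= => /andP[? ?] /andP[? ?] /andP[? ?] /andP[? ?].
  have := pickleK (((q1, q2), (q3, q4)) : J); move: (pickle _) => n nE.
  exists n; first exact: Logic.I.
  rewrite /V nE; case: pselect => [sub|nsub]; first by rewrite /bx; split; rewrite /= in_itv/=; apply/andP; split.
  exfalso; apply: nsub => -[s' t'] [] /=; rewrite !in_itv/= => /andP[? ?] /andP[? ?].
  by apply: be; split; rewrite /ball/= ltr_norml; apply/andP; split; lra.
apply: bigcupT_measurable => n; rewrite /V; case: (unpickle n) => [j|]; last exact: measurable0.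
by case: pselect => h; [exact: mbx|exact: measurable0].
Qed.

Lemma cont2_meas (f : R * R -> R) : continuous f -> measurable_fun (setT : set RR) f.
Proof.
move=> /continuousP cf; apply: (measurability _ (RGenOpens.measurableE R)).
move=> _ [_ [a [b ->] <-]]; rewrite setTI; apply: open2_measurable.
exact/cf/interval_open.
Qed.

Lemma enorm_cont : continuous (@enorm R).
Proof.
move=> z; apply: (@continuous_comp _ R R (fun z : R * R => z.1 ^+ 2 + z.2 ^+ 2) Num.sqrt); last exact: sqrt_continuous.
apply: cvgD.
  by apply: (@continuous_comp _ R R fst (fun r => r ^+ 2)); [exact: cvg_fst|exact: exprn_continuous].
by apply: (@continuous_comp _ R R snd (fun r => r ^+ 2)); [exact: cvg_snd|exact: exprn_continuous].
Qed.

Lemma enorm_meas : measurable_fun (setT : set RR) (@enorm R).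
Proof. exact: cont2_meas enorm_cont. Qed.

Section Annuli.
Context (g : R -> R).
Hypotheses (mg : measurable_fun setT g) (g0 : forall r, 0 <= g r) (gI : forall r, ~ 0 < r < 1 -> g r = 0).

(** The function is cut to the cone |t| <= |s|. There the radius is at most 2 |s|, so passing from
    ds to dr along a half line costs at most a factor 2. *)
Let f t s := g (Num.sqrt (s ^+ 2 + t ^+ 2)) * (`|t| <= `|s|)%R%:R.

Let mle2 : measurable_fun (setT : set RR) (fun z : R * R => (`|z.2| <= `|z.1|)%R%:R : R).
Proof.
rewrite (_ : (fun z => _) = \1_([set z : R * R | `|z.2| <= `|z.1|]) :> (R * R -> R)).
  have mh : measurable_fun (setT : set RR) (fun z : R * R => `|z.1| - `|z.2|).
    by apply: measurable_funB; apply: measurableT_comp.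
  have := mh measurableT _ (measurable_itv `[0, +oo[); rewrite setTI => H.
  apply: measurable_indic; move: H; congr measurable.
  by apply/seteqP; split=> z; rewrite /= in_itv/= andbT subr_ge0.
by apply/funext => z; rewrite indicE; case: (boolP (_ <= _)) => h; [rewrite mem_set|rewrite memNset//; exact/negP].
Qed.

Let mf2 : measurable_fun (setT : set RR) (fun z : R * R => f z.2 z.1).
Proof.
apply: measurable_funM mle2; apply: (measurableT_comp mg).
by rewrite (_ : (fun z => _) = @enorm R)//; exact: enorm_meas.
Qed.

Let mf t : measurable_fun setT (f t).
Proof. by have := measurableT_comp mf2 (measurable_pair2 t : measurable_fun setT (fun s => (s, t))). Qed.

Let f0 t s : 0 <= f t s. Proof. by rewrite mulr_ge0. Qed.

Let half t : (\int[mu]_(s in `[(`|t|)%R, 1%R]) (f t s)%:E <= \int[mu]_r (2 * (g r * (`|t| <= r)%R%:R))%:E)%E.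
Proof.
have mgr : measurable_fun setT (fun r => 2 * (g r * (`|t| <= r)%R%:R)).
  apply: measurable_funM; first exact: measurable_cst.
  apply: measurable_funM => //.
  rewrite (_ : (fun r => _) = \1_(`[`|t|, +oo[)); first by apply: measurable_indic; exact: measurable_itv.
  apply/funext => r; rewrite indicE; case: (boolP (_ <= _)) => h.
    by rewrite mem_set//= in_itv/= h.
  by rewrite memNset//= in_itv/= andbT; exact/negP.
have gr0 r : 0 <= 2 * (g r * (`|t| <= r)%R%:R) by rewrite mulr_ge0// mulr_ge0.
have res a b : `|t| <= a -> (\int[mu]_(r in `[a, b]) (2 * g r)%:E <= \int[mu]_r (2 * (g r * (`|t| <= r)%R%:R))%:E)%E.
  move=> ta; apply: (@le_trans _ _ (\int[mu]_(r in `[a, b]) (2 * (g r * (`|t| <= r)%R%:R))%:E)%E).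
    rewrite le_eqVlt; apply/orP; left; apply/eqP; apply: eq_integral => r; rewrite inE/= in_itv/= => /andP[ar _].
    by rewrite (le_trans ta ar) mulr1.
  apply: ge0_subset_integral => //; [exact/measurable_EFinP|by move=> r _; rewrite lee_fin].
have [t1|t1] := leP `|t| 1; last first.
  rewrite set_itv_ge ?bnd_simp -?ltNge// integral_set0; apply: integral_ge0 => r _.
  by rewrite lee_fin.
(* On the line t = 0 the chart degenerates at s = 0, but the radius is s itself. *)
have [t0|t0] := eqVneq t 0.
  apply: le_trans (res `|t| 1 (lexx _)); apply: ge0_le_integral => //; [by move=> s _; rewrite lee_fin| | | ].
  - by apply/measurable_EFinP; exact: (measurable_funTS (mf t)).
  - by apply/measurable_EFinP; apply: measurable_funTS; apply: measurable_funM => //; exact: measurable_cst.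
  - move=> s; rewrite /= in_itv/= t0 normr0 => /andP[s0 _]; rewrite lee_fin /f expr0n addr0 sqrtr_sqr normr0 normr_ge0 mulr1.
    by rewrite ger0_norm//; have := g0 s; lra.
have a0 : 0 < `|t| by rewrite normr_gt0.
have h2 : 0 < `|t| ^+ 2 + t ^+ 2 by rewrite ltr_pwDl ?sqr_ge0// exprn_gt0.
have C := chart_sqrt (normr_ge0 t) t1 h2; have [mX iX YP aX X1] := C; have [X1i _] := aX.
have mg2 : measurable_fun setT (fun r => 2 * g r) by apply: measurable_funM => //; exact: measurable_cst.
have g20 r : 0 <= 2 * g r by rewrite mulr_ge0.
apply: (@le_trans _ _ (\int[mu]_(s in `[(`|t|)%R, 1%R]) (2 * g (Num.sqrt (s ^+ 2 + t ^+ 2)) * (s / Num.sqrt (s ^+ 2 + t ^+ 2)))%:E)%E).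
  apply: ge0_le_integral => //; [by move=> s _; rewrite lee_fin| | | ].
  - by apply/measurable_EFinP; exact: (measurable_funTS (mf t)).
  - apply/measurable_EFinP; apply: measurable_funM; last exact: L1_meas X1i.
    by apply: measurable_funTS; exact: (measurableT_comp mg2 mX).
  - move=> s; rewrite /= in_itv/= => /andP[ts _]; rewrite lee_fin /f.
    have s0 : 0 < s := lt_le_trans a0 ts.
    have st : t ^+ 2 <= s ^+ 2 by rewrite -(real_normK (num_real t)) ler_pXn2r// nnegrE ltW.
    have q0 : 0 < Num.sqrt (s ^+ 2 + t ^+ 2) by rewrite sqrtr_gt0 ltr_pwDl ?sqr_ge0// exprn_gt0.
    have q2 : Num.sqrt (s ^+ 2 + t ^+ 2) <= 2 * s.
      rewrite -[leRHS]ger0_norm ?mulr_ge0// ?(ltW s0)// -sqrtr_sqr; apply: ler_wsqrtr.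
      by move: st (sqr_ge0 s); rewrite exprMn; move: (s ^+ 2) (t ^+ 2) => A B; lra.
    have k1 : 1 <= 2 * (s / Num.sqrt (s ^+ 2 + t ^+ 2)) by rewrite mulrA ler_pdivlMr// mul1r.
    apply: (@le_trans _ _ (g (Num.sqrt (s ^+ 2 + t ^+ 2)))); first by rewrite ler_piMr// lern1 leq_b1.
    by rewrite mulrAC ler_peMl.
rewrite (substitution t1 mX iX YP aX X1 mg2 g20); apply: res.
by rewrite -[leLHS]normr_id -sqrtr_sqr; apply: ler_wsqrtr; rewrite lerDl sqr_ge0.
Qed.

Lemma line_le t : (\int[mu]_s (f t s)%:E <= \int[mu]_r (4 * (g r * (`|t| <= r)%R%:R))%:E)%E.
Proof.
have mEf : measurable_fun setT (EFin \o f t) by exact/measurable_EFinP.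
have feven s : f t (- s) = f t s by rewrite /f sqrrN normrN.
have pos : (\int[mu]_(s in `[0%R, +oo[) (f t s)%:E = \int[mu]_(s in `[(`|t|)%R, 1%R]) (f t s)%:E)%E.
  rewrite integral_mkcond [RHS]integral_mkcond; apply: eq_integral => s _; rewrite !patchE.
  have [s0|s0] := leP 0 s; last first.
    rewrite !memNset//= in_itv/= ?andbT; [|by apply/negP; rewrite -ltNge].
    by move=> /andP[h _]; have := le_trans (normr_ge0 t) h; rewrite leNgt s0.
  rewrite mem_set/=; last by rewrite in_itv/= s0.
  have [h|h] := boolP (s \in `[`|t|, 1]); first by rewrite mem_set.
  rewrite memNset; last exact/negP.
  move: h; rewrite in_itv/= negb_and -!ltNge /f (ger0_norm s0) => /orP[h|h].
    by rewrite leNgt h mulr0.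
  rewrite gI ?mul0r// => /andP[_]; apply/negP; rewrite -leNgt -[leLHS]sqrtr1; apply: ler_wsqrtr.
  by apply: (le_trans (exprn_ege1 2 (ltW h))); rewrite lerDl sqr_ge0.
have neg : (\int[mu]_(s in `]-oo, 0%R]) (f t s)%:E = \int[mu]_(s in `[0%R, +oo[) (f t s)%:E)%E.
  rewrite (ge0_integration_by_substitution0 mEf); last by move=> r; rewrite lee_fin.
  by apply: eq_integral => s _; rewrite /= feven.
have -> : (\int[mu]_s (f t s)%:E = \int[mu]_(s in `]-oo, 0%R]) (f t s)%:E + \int[mu]_(s in `]0%R, +oo[) (f t s)%:E)%E.
  rewrite -ge0_integral_setU//=.
  - by congr integral; apply/seteqP; split=> // s _; rewrite /= !in_itv/= andbT; case: (leP s 0); [left|right].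
  - exact: (measurable_funTS mEf).
  - by move=> s _; rewrite lee_fin.
  - by rewrite disj_set2E; apply/eqP; rewrite -subset0 => s [] /=; rewrite !in_itv/= andbT leNgt => /negP.
have pos' : (\int[mu]_(s in `]0%R, +oo[) (f t s)%:E <= \int[mu]_(s in `[0%R, +oo[) (f t s)%:E)%E.
  apply: ge0_subset_integral => //; first exact: (measurable_funTS mEf).
    by move=> s _; rewrite lee_fin.
  by move=> s; rewrite /= !in_itv/= !andbT => /ltW.
have E : (\int[mu]_r (4 * (g r * (`|t| <= r)%R%:R))%:E = \int[mu]_r (2 * (g r * (`|t| <= r)%R%:R))%:E + \int[mu]_r (2 * (g r * (`|t| <= r)%R%:R))%:E)%E.
  have mgr : measurable_fun setT (fun r => (2 * (g r * (`|t| <= r)%R%:R))%:E).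
    apply/measurable_EFinP; apply: measurable_funM; first exact: measurable_cst.
    apply: measurable_funM => //.
    rewrite (_ : (fun r => _) = \1_(`[`|t|, +oo[)); first by apply: measurable_indic; exact: measurable_itv.
    apply/funext => r; rewrite indicE; case: (boolP (_ <= _)) => h.
      by rewrite mem_set//= in_itv/= h.
    by rewrite memNset//= in_itv/= andbT; exact/negP.
  have gr0 r : (0 <= (2 * (g r * (`|t| <= r)%R%:R))%:E)%E by rewrite lee_fin mulr_ge0// mulr_ge0.
  rewrite -ge0_integralD//; apply: eq_integral => r _; rewrite -EFinD; congr EFin; lra.
by rewrite E neg; apply: leeD; [rewrite pos; exact: half|apply: le_trans pos' _; rewrite pos; exact: half].
Qed.

(** The plane is covered by the cone and its mirror image, each contributing 8: [line_le] gives 4,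
    and integrating the indicator of |t| <= r over t gives 2 r. Only finiteness is at stake, so the
    constant need not be 2 pi. *)
Lemma polar_le : (\int[lam]_z (g (enorm z))%:E <= \int[mu]_r (16 * (g r * r))%:E)%E.
Proof.
pose p (z : R * R) : R := f z.2 z.1; pose q (z : R * R) : R := f z.1 z.2.
have mq : measurable_fun (setT : set RR) q.
  exact: (measurableT_comp mf2 (measurable_fun_pair snd_meas fst_meas)).
have p0 z : 0 <= p z by exact: f0.
have q0 z : 0 <= q z by exact: f0.
have mpE : measurable_fun (setT : set RR) (fun z => (p z)%:E) by exact/measurable_EFinP.
have mqE : measurable_fun (setT : set RR) (fun z => (q z)%:E) by exact/measurable_EFinP.
have p0E z : (0 <= (p z)%:E)%E by rewrite lee_fin.
have q0E z : (0 <= (q z)%:E)%E by rewrite lee_fin.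
have mE : measurable_fun (setT : set RR) (fun z => g (enorm z)) by exact: measurableT_comp mg enorm_meas.
have le1 : (\int[lam]_z (g (enorm z))%:E <= \int[lam]_z (p z + q z)%:E)%E.
  apply: ge0_le_integral => //.
  - by move=> z _; rewrite lee_fin.
  - exact/measurable_EFinP.
  - by apply/measurable_EFinP; apply: measurable_funD.
  - move=> -[s t] _; rewrite lee_fin /p /q /f /= enormE [t ^+ 2 + s ^+ 2]addrC.
    have [h|/ltW h] := leP `|t| `|s|; first by rewrite mulr1 lerDl mulr_ge0.
    by rewrite h mulr1 lerDr mulr_ge0.
apply: (le_trans le1).
have -> : (\int[lam]_z (p z + q z)%:E = \int[lam]_z (p z)%:E + \int[lam]_z (q z)%:E)%E.
  by rewrite -ge0_integralD//; first [exact/measurable_EFinP | by move=> z _; rewrite lee_fin].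
pose k (z : R * R) : R := 4 * (g z.1 * (`|z.2| <= z.1)%R%:R).
have k0 z : (0 <= (k z)%:E)%E by rewrite lee_fin mulr_ge0// mulr_ge0.
have mk : measurable_fun (setT : set RR) (fun z => (k z)%:E).
  apply/measurable_EFinP; apply: measurable_funM; first exact: measurable_cst.
  apply: measurable_funM; first exact: (measurableT_comp mg fst_meas).
  rewrite (_ : (fun z => _) = \1_([set z : R * R | `|z.2| <= z.1]) :> (R * R -> R)).
    have mh : measurable_fun (setT : set RR) (fun z : R * R => z.1 - `|z.2|).
      by apply: measurable_funB => //; apply: measurableT_comp.
    have := mh measurableT _ (measurable_itv `[0, +oo[); rewrite setTI => H.
    apply: measurable_indic; move: H; congr measurable.
    by apply/seteqP; split=> z; rewrite /= in_itv/= andbT subr_ge0.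
  by apply/funext => z; rewrite indicE; case: (boolP (_ <= _)) => h; [rewrite mem_set|rewrite memNset//; exact/negP].
have K : (\int[mu]_t \int[mu]_r (4 * (g r * (`|t| <= r)%R%:R))%:E <= \int[mu]_r (8 * (g r * r))%:E)%E.
  have -> : (\int[mu]_t \int[mu]_r (4 * (g r * (`|t| <= r)%R%:R))%:E = \int[mu]_r \int[mu]_t (k (r, t))%:E)%E.
    have := @fubini_tonelli _ _ _ _ R mu mu (fun z => (k z)%:E) mk k0.
    by move=> ->.
  rewrite le_eqVlt; apply/orP; left; apply/eqP; apply: eq_integral => r _.
  have [/andP[r0 r1]|nr] := pselect (0 < r < 1); last first.
    rewrite gI// mul0r mulr0; apply: integral0_eq => t _.
    by rewrite /k /= gI// mul0r mulr0.
  have -> : (\int[mu]_t (k (r, t))%:E = \int[mu]_(t in `[(- r)%R, r]) (4 * g r)%:E)%E.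
    rewrite [RHS]integral_mkcond; apply: eq_integral => t _; rewrite patchE /k /=.
    case: (boolP (`|t| <= r)) => h.
      by rewrite mulr1 mem_set//= in_itv/= -ler_norml.
    by rewrite !mulr0 memNset//= in_itv/= -ler_norml; exact/negP.
  rewrite integral_cst; last exact: mitv.
  have mr : mu `[(- r)%R, r] = (2 * r)%:E.
    rewrite lebesgue_measure_itv/= lte_fin ifT; last by move: r0; lra.
    by rewrite -EFinD; congr EFin; rewrite opprK mulr2n mulrDl mul1r.
  apply: etrans (congr1 (fun z => (4 * g r)%:E * z)%E mr) _.
  by rewrite -EFinM; congr EFin; ring.
have mL : measurable_fun setT (fun t => \int[mu]_s (f t s)%:E)%E.
  exact: (@measurable_fun_fubini_tonelli_G _ _ _ _ _ mu (fun z => (p z)%:E) mpE p0E).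
have mK : measurable_fun setT (fun t => \int[mu]_r (4 * (g r * (`|t| <= r)%R%:R))%:E)%E.
  exact: (@measurable_fun_fubini_tonelli_G _ _ _ _ _ mu (fun z => (k z)%:E) mk k0).
have le2 : (\int[mu]_t \int[mu]_s (f t s)%:E <= \int[mu]_r (8 * (g r * r))%:E)%E.
  apply: le_trans K; apply: ge0_le_integral => //.
  - by move=> t _; apply: integral_ge0 => s _; rewrite lee_fin.
  - by move=> t _; exact: line_le.
have E1 : (\int[lam]_z (p z)%:E = \int[mu]_t \int[mu]_s (f t s)%:E)%E.
  exact: (@fubini_tonelli2 _ _ _ _ R mu mu (fun z => (p z)%:E) mpE p0E).
have E2 : (\int[lam]_z (q z)%:E = \int[mu]_t \int[mu]_s (f t s)%:E)%E.
  exact: (@fubini_tonelli1 _ _ _ _ R mu mu (fun z => (q z)%:E) mqE q0E).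
have gr0 r : 0 <= g r * r.
  by have [/andP[r0 _]|nr] := pselect (0 < r < 1); [exact: (mulr_ge0 (g0 r) (ltW r0))|rewrite gI// mul0r].
have -> : (\int[mu]_r (16 * (g r * r))%:E = \int[mu]_r (8 * (g r * r))%:E + \int[mu]_r (8 * (g r * r))%:E)%E.
  have m8 : measurable_fun setT (fun r => (8 * (g r * r))%:E).
    by apply/measurable_EFinP; apply: measurable_funM; [exact: measurable_cst|exact: measurable_funM].
  have h8 r : (0 <= (8 * (g r * r))%:E)%E by rewrite lee_fin mulr_ge0.
  rewrite -ge0_integralD//; apply: eq_integral => r _; rewrite -EFinD; congr EFin.
  by move: (g r * r) => z; lra.
by rewrite E1 E2; exact: leeD.
Qed.

End Annuli.

(** A pointwise radial bound psi with psi^2 r integrable on ]0, 1[ gives square integrability on the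
    disc through [polar_le]. *)
Lemma L2_radial (F : R * R -> R) (psi : R -> R) : measurable_fun (setT : set RR) (F \_ B1) ->
  measurable_fun I psi -> (\int[mu]_(r in I) (psi r ^+ 2 * r)%:E < +oo)%E ->
  (forall z, (@B1 R) z -> 0 < enorm z -> `|F z| <= `|psi (enorm z)|) -> F \_ B1 \in Lfun lam 2%:E.
Proof.
move=> mF mp fin Fp; pose g r := (psi \_ I) r ^+ 2.
have mI' := @mI R.
have mpI : measurable_fun setT (psi \_ I) := (measurable_restrictT _ mI').1 mp.
have mg : measurable_fun setT g by exact: measurable_funX.
have g0 r : 0 <= g r by exact: sqr_ge0.
have gI r : ~ 0 < r < 1 -> g r = 0.
  by move=> h; rewrite /g patchE memNset ?expr0n//= in_itv.
pose Q : set RR := `[-1, 1]%classic `*` `[-1, 1]%classic.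
(* The bound by psi excludes the origin; c times the indicator of the square Q covers that point, so
   domination holds everywhere. *)
pose c := F (0, 0) ^+ 2.
have BQ z : (@B1 R) z -> Q z.
  have sq1 (p q : R) : Num.sqrt (p ^+ 2 + q ^+ 2) < 1 -> -1 <= p <= 1.
    move=> h; rewrite -ler_norml; apply: ltW; apply: le_lt_trans h.
    by rewrite -sqrtr_sqr; apply: ler_wsqrtr; rewrite lerDl sqr_ge0.
  by case: z => s t h; split; rewrite /= in_itv/=; [apply: (sq1 s t)|apply: (sq1 t s); rewrite addrC].
have ptw z : (F \_ B1) z ^+ 2 <= g (enorm z) + c * \1_Q z.
  have c0 : 0 <= c * \1_Q z by rewrite mulr_ge0 ?sqr_ge0// indicE ler0n.
  rewrite patchE; case: ifPn => [|_]; last by rewrite expr0n addr_ge0.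
  rewrite inE => Bz; have [e0|e0] := ltP 0 (enorm z).
    apply: le_trans (_ : g (enorm z) <= _); last by rewrite lerDl.
    rewrite /g patchE mem_set/=; last by rewrite in_itv/= e0.
    by rewrite -(real_normK (num_real (F z))) -(real_normK (num_real (psi _))) ler_pXn2r ?nnegrE// Fp.
  have z0 : z = (0, 0).
    have : Num.sqrt (z.1 ^+ 2 + z.2 ^+ 2) = 0 by apply/le_anti; rewrite e0 sqrtr_ge0.
    move/eqP; rewrite sqrtr_eq0 => h; have h1 := sqr_ge0 z.1; have h2 := sqr_ge0 z.2.
    have /eqP : z.1 ^+ 2 = 0 by apply/le_anti; rewrite h1 andbT; move: h h1 h2; move: (z.1 ^+ 2) (z.2 ^+ 2) => A B; clear; lra.
    have /eqP : z.2 ^+ 2 = 0 by apply/le_anti; rewrite h2 andbT; move: h h1 h2; move: (z.1 ^+ 2) (z.2 ^+ 2) => A B; clear; lra.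
    by rewrite !expf_eq0/= => /eqP e2 /eqP e1; rewrite [z]surjective_pairing e1 e2.
  by rewrite indicE mem_set ?mulr1 ?z0 ?lerDr//; apply: BQ; rewrite -z0.
have mQ' : measurable Q by exact: mQ.
have Qf : (lam Q < +oo)%E by exact: Qfin.
have m1Q : measurable_fun (setT : set RR) (fun z => c * \1_Q z : R).
  by apply: measurable_funM; [exact: measurable_cst|exact: measurable_indic].
have m1 : measurable_fun (setT : set RR) (fun z => g (enorm z)) by exact: measurableT_comp mg enorm_meas.
have c10 z : 0 <= c * \1_Q z :> R by rewrite mulr_ge0 ?sqr_ge0// indicE ler0n.
have F2 : (\int[lam]_z ((F \_ B1) z ^+ 2)%:E < +oo)%E.
  apply: (@le_lt_trans _ _ (\int[lam]_z (g (enorm z) + c * \1_Q z)%:E)%E).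
    apply: ge0_le_integral => //.
    - by move=> z _; rewrite lee_fin sqr_ge0.
    - by apply/measurable_EFinP; exact: measurable_funX.
    - by apply/measurable_EFinP; exact: measurable_funD.
    - by move=> z _; rewrite lee_fin.
  have -> : (\int[lam]_z (g (enorm z) + c * \1_Q z)%:E = \int[lam]_z (g (enorm z))%:E + \int[lam]_z (c * \1_Q z)%:E)%E.
    by rewrite -ge0_integralD//; first [exact/measurable_EFinP | by move=> z _; rewrite lee_fin].
  apply: lte_add_pinfty.
    apply: le_lt_trans (polar_le mg g0 gI) _.
    have -> : (\int[mu]_r (16 * (g r * r))%:E = \int[mu]_(r in I) (16%:E * (psi r ^+ 2 * r)%:E))%E.
      rewrite [RHS]integral_mkcond; apply: eq_integral => r _; rewrite /g !patchE.
      by case: ifP => _; rewrite ?expr0n ?mul0r ?mulr0// -EFinM.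
    rewrite ge0_integralZl_EFin//.
    - by apply: lte_mul_pinfty => //; rewrite lee_fin.
    - by move=> r; rewrite /= in_itv/= => /andP[r0 _]; rewrite lee_fin mulr_ge0 ?sqr_ge0// ltW.
    - by apply/measurable_EFinP; apply: measurable_funM; [exact: measurable_funX|exact: measurable_id].
  have -> : (\int[lam]_z (c * \1_Q z)%:E = c%:E * lam Q)%E.
    have -> : (\int[lam]_z (c * \1_Q z)%:E = \int[lam]_z (c%:E * (\1_Q z)%:E))%E by apply: eq_integral => z _; rewrite EFinM.
    rewrite ge0_integralZl_EFin//; [|by apply/measurable_EFinP; exact: measurable_indic|exact: sqr_ge0].
    by rewrite integral_indic// setIT.
  by apply: lte_mul_pinfty => //; rewrite lee_fin sqr_ge0.
rewrite inE/=; apply/andP; split; rewrite inE//=.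
rewrite /finite_norm unlock/=; apply: poweR_lty.
move: F2; congr (_ < _)%E; apply: eq_integral => z _ /=.
by rewrite powR_mulrn ?normr_ge0// real_normK// num_real.
Qed.
End Polar.

(** * Reflection and integration by parts on a chord *)

Section S.
Context {R : realType}.
Notation mu := (@lebesgue_measure R).
Notation lam := (@lebesgue2 R).
Notation RR := (measurableTypeR R * measurableTypeR R)%type.
Notation I := (`]0%R, 1%R[%classic : set R).
Implicit Types (x y s t r a b c e : R).

Lemma ge0_integral_opp (f : R -> \bar R) : measurable_fun (setT : set (measurableTypeR R)) f ->
  (forall r, 0 <= f r)%E -> (\int[mu]_r f (- r)%R = \int[mu]_r f r)%E.
Proof.
move=> mf f0; transitivity (\int[pushforward mu (-%R : _ -> measurableTypeR R)]_(r in setT) f r)%E.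
  by rewrite ge0_integral_pushforward.
by apply: eq_measure_integral => A mA _; exact: lebesgue_measureN.
Qed.

Lemma integral_opp (f : R -> \bar R) : measurable_fun (setT : set (measurableTypeR R)) f ->
  (\int[mu]_r f (- r)%R = \int[mu]_r f r)%E.
Proof.
move=> mf; rewrite [LHS]integralE [RHS]integralE; congr (_ - _)%E.
  have h := ge0_integral_opp (measurable_funepos mf) (fun r => funepos_ge0 f r).
  apply: etrans h; apply: eq_integral => x _; first [by [] | by rewrite !funeposE | by rewrite !funenegE | by rewrite /funepos /funeneg].
have h := ge0_integral_opp (measurable_funeneg mf) (fun r => funeneg_ge0 f r).
apply: etrans h; apply: eq_integral => x _; first [by [] | by rewrite !funeposE | by rewrite !funenegE | by rewrite /funepos /funeneg].
Qed.

Lemma patch_opp a b (f : R -> R) s : (f \_ `[a, b]) (- s) = ((fun s => f (- s)) \_ `[- b, - a]) s.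
Proof.
rewrite !patchE; have -> : (- s \in `[a, b]%classic) = (s \in `[- b, - a]%classic).
  by apply/idP/idP; rewrite !inE/= !in_itv/= => /andP[? ?]; apply/andP; split; lra.
by [].
Qed.

Lemma L1_opp a b (f : R -> R) : L1 a b f -> L1 (- b) (- a) (fun s => f (- s)).
Proof.
move=> /L1_mkcond/integrableP[mf fi]; apply/L1_mkcond/integrableP; split.
  apply: eq_measurable_fun (measurableT_comp mf (@oppr_measurable R setT)) => s _ /=.
  by rewrite patch_opp.
move: fi; rewrite -integral_opp; last exact: measurableT_comp.
by congr (_ < _)%E; apply: eq_integral => s _ /=; rewrite patch_opp.
Qed.

Lemma itg_opp a b (f : R -> R) : L1 a b f -> itg (- b) (- a) (fun s => f (- s)) = itg a b f.
Proof.
move=> /L1_mkcond fi; rewrite /itg Rintegral_mkcond [RHS]Rintegral_mkcond /Rintegral.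
rewrite -[in RHS]integral_opp; last exact: measurable_int fi.
by congr fine; apply: eq_integral => s _; rewrite -patch_opp.
Qed.

Lemma acon_opp a b (F B : R -> R) : acon a b F B ->
  acon (- b) (- a) (fun s => F (- s)) (fun s => - B (- s)).
Proof.
move=> [Bi FB]; split; first exact/L1N/L1_opp.
move=> s t bs st ta; have i : L1 (- t) (- s) B by apply: L1_sub Bi _ _; lra.
rewrite itgN; last by have := L1_opp i; rewrite !opprK.
have := itg_opp i; rewrite !opprK => ->.
by rewrite -FB; [ring|lra..].
Qed.

(** The integrand is the density of q(X) (c0 + c1 s) psi, which vanishes at both ends of a chord of
    the disc of radius rho. As t is nonzero, the radius X stays away from 0, where q is not
    controlled. *)
Lemma slice0 (q be psi psi1 : R -> R) t rho c0 c1 : ac q be -> t != 0 -> rho < 1 ->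
  (forall x y, acon x y psi psi1) ->
  (forall s, rho <= Num.sqrt (s ^+ 2 + t ^+ 2) -> psi s = 0 /\ psi1 s = 0) ->
  (\int[mu]_s (q (Num.sqrt (s ^+ 2 + t ^+ 2)) * (c0 + c1 * s) * psi1 s +
     (be (Num.sqrt (s ^+ 2 + t ^+ 2)) * (s / Num.sqrt (s ^+ 2 + t ^+ 2)) * (c0 + c1 * s) +
      q (Num.sqrt (s ^+ 2 + t ^+ 2)) * c1) * psi s)%:E = 0)%E.
Proof.
move=> qb t0 r1 ap z0.
pose X s := Num.sqrt (s ^+ 2 + t ^+ 2).
have t20 : 0 < t ^+ 2 by rewrite exprn_even_gt0.
have [rt|tr] := ltP rho `|t|.
  apply: integral0_eq => s _; have [|-> ->] := z0 s; last by rewrite !mulr0 addr0.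
  by apply: (le_trans (ltW rt)); rewrite -sqrtr_sqr; apply: ler_wsqrtr; rewrite lerDr sqr_ge0.
have rho0 : 0 <= rho := le_trans (normr_ge0 t) tr.
have t2r : t ^+ 2 <= rho ^+ 2 by rewrite -(real_normK (num_real t)) ler_pXn2r ?nnegrE.
(* Half the length of the chord at height t of the disc of radius rho. *)
pose L := Num.sqrt (rho ^+ 2 - t ^+ 2).
have L0 : 0 <= L := sqrtr_ge0 _.
have L2 : L ^+ 2 = rho ^+ 2 - t ^+ 2 by rewrite sqr_sqrtr// subr_ge0.
have XL : X L = rho by rewrite /X L2 subrK sqrtr_sqr ger0_norm.
have X0 : 0 < X 0 by rewrite /X expr0n/= add0r sqrtr_gt0.
have XN s : X (- s) = X s by rewrite /X sqrrN.
have h0 : 0 < 0 ^+ 2 + t ^+ 2 by rewrite expr0n/= add0r.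
have XL1 : X L < 1 by rewrite XL.
have aq : acon 0 L (q \o X) (fun s => be (X s) * (s / X s)) :=
  acon_comp (chart_sqrt (lexx 0) L0 h0) L0 (qb _ _ X0 XL1).
(* The radius increases with s only for s >= 0; the other half of the chord is obtained by
   reflection. *)
have aqN : acon (- L) 0 (q \o X) (fun s => be (X s) * (s / X s)).
  have := acon_opp aq; rewrite oppr0; apply: acon_ext => s /=; first by rewrite XN.
  by rewrite XN mulNr mulrN opprK.
have NL : - L <= 0 by rewrite oppr_le0.
have al : acon (- L) L (fun s => c0 + c1 * s) (fun=> 0 + c1 * 1) :=
  aconD (acon_cst _ _ c0) (aconZ c1 (acon_id _ _)).
have [Hi HE] := aconM (aconM (acon_cat NL L0 aqN aq) al) (ap (- L) L).
set H := (fun s => q (X s) * (c0 + c1 * s) * psi1 s +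
     (be (X s) * (s / X s) * (c0 + c1 * s) + q (X s) * c1) * psi s).
have HH s : (be (X s) * (s / X s) * (c0 + c1 * s) + (q \o X) s * (0 + c1 * 1)) * psi s +
    (q \o X) s * (c0 + c1 * s) * psi1 s = H s by rewrite /H /= add0r mulr1 addrC.
have Hi' : L1 (- L) L H by apply: L1_eq Hi => s _; exact: HH.
have off s : ~ - L <= s <= L -> H s = 0.
  move=> ns; have [|p0 p1] := z0 s; last by rewrite /H p0 p1 !mulr0 addr0.
  rewrite -/(X s) -XL; apply: ler_wsqrtr; rewrite lerD2r.
  rewrite -[leRHS](real_normK (num_real s)) ler_pXn2r ?nnegrE//.
  by rewrite leNgt; apply/negP => h; apply: ns; rewrite -ler_norml ltW.
have -> : (\int[mu]_s (H s)%:E = \int[mu]_(s in `[(- L)%R, L]) (H s)%:E)%E.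
  rewrite [RHS]integral_mkcond; apply: eq_integral => s _; rewrite patchE.
  by case: ifPn => // /negP h; rewrite off// => h'; apply: h; rewrite inE/= in_itv.
rewrite -[LHS]fineK; last exact: (integrable_fin_num _ Hi').
congr EFin; have := HE (- L) L (lexx _) (le_trans NL L0) (lexx _).
have [|pL _] := z0 L; first by rewrite -/(X L) XL.
have [|pN _] := z0 (- L); first by rewrite -/(X (- L)) XN XL.
rewrite pL pN !mulr0 subrr => /esym; rewrite (@itg_eq _ _ _ _ H)//.
Qed.
End S.

(** * Weak partial derivatives of radial functions times affine forms *)

Section S.
Context {R : realType}.
Notation mu := (@lebesgue_measure R).
Notation lam := (@lebesgue2 R).
Notation RR := (measurableTypeR R * measurableTypeR R)%type.
Notation I := (`]0%R, 1%R[%classic : set R).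
Implicit Types (x y s t r a b c e : R).

Lemma enorm_ge (z : R * R) : `|z.1| <= enorm z /\ `|z.2| <= enorm z.
Proof.
split; rewrite /enorm -sqrtr_sqr; apply: ler_wsqrtr; by rewrite ?lerDl ?lerDr sqr_ge0.
Qed.

Lemma supp_bounded (f : R * R -> R) : continuous f -> (forall z, 1 <= enorm z -> f z = 0) ->
  exists M : R, forall z, `|f z| <= M.
Proof.
move=> cf f0; pose Q : set (R * R) := `[-1, 1]%classic `*` `[-1, 1]%classic.
have cQ : compact Q by apply: compact_setX; exact: segment_compact.
have Q0 : Q !=set0 by exists (0, 0); split; rewrite /= in_itv/=; apply/andP; split; lra.
have cg : continuous (fun z => `|f z|) by move=> z; apply: cvg_norm; exact: cf.
have [z _ fz] := compact_EVT_max Q0 cQ (continuous_subspaceT cg).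
exists `|f z| => z'; have [h|h] := leP 1 (enorm z'); first by rewrite f0// normr0.
apply: fz; rewrite inE; have [h1 h2] := enorm_ge z'.
by split; rewrite /= in_itv/= -ler_norml; [apply: (le_trans h1)|apply: (le_trans h2)]; exact: ltW.
Qed.

Lemma test2_supp (phi : R * R -> R^o) : test_function B1 phi -> exists2 rho : R, rho < 1 &
  forall v z, rho <= enorm z -> phi z = 0 /\ 'D_v phi z = 0.
Proof.
move=> [_ [K [cK KB p0]]].
have [r r1 Kr] := compact_lt cK (@enorm_cont R) KB.
exists ((r + 1) / 2); first by lra.
move=> v z hz; have rz : r < enorm z by move: hz r1; lra.
have off (y : R * R) : r < enorm y -> phi y = 0.
  by move=> h; apply: p0 => /Kr; rewrite leNgt h.
split; first exact: off.
rewrite (@near_eq_derive _ _ _ phi (cst 0)); first by rewrite derive_cst.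
have /(_ (nbhs_filter z)) := cvgr_gt _ (@enorm_cont R z) _ rz.
by apply: filterS => y; exact: off.
Qed.

Definition wk (v : R * R) (F G : R * R -> R) (phi : R * R -> R^o) (z : R * R) : R :=
  (F \_ B1) z * 'D_v phi z + (G \_ B1) z * phi z.

(** Extending F and G by 0 turns the weak identity into the vanishing of one integral over the
    plane, whose integrability is provided by the L2 assumptions and the bounded support of phi. *)
Lemma weak_partial_of (v : R * R) (F G : R * R -> R) :
  F \_ B1 \in Lfun lam 2%:E -> G \_ B1 \in Lfun lam 2%:E ->
  (forall phi rho, Ck 1 phi -> rho < 1 ->
    (forall z, rho <= enorm z -> phi z = 0 /\ 'D_v phi z = 0) ->
    lam.-integrable setT (EFin \o wk v F G phi) -> \int[lam]_(z in setT) wk v F G phi z = 0) ->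
  is_weak_partial B1 v F G.
Proof.
move=> LF LG H phi tphi; have [rho r1 hr] := test2_supp tphi.
have [C1 _] := tphi; have {}C1 := C1 1%N.
have [cp /(_ v)[_ [cD _]]] := C1.
have hv z : 1 <= enorm z -> phi z = 0 /\ 'D_v phi z = 0.
  by move=> h; apply: hr; apply: le_trans h; exact: ltW.
have [M1 b1] := supp_bounded cp (fun z h => (hv z h).1).
have [M2 b2] := supp_bounded cD (fun z h => (hv z h).2).
have Q0 (f : R * R -> R) : (forall z, 1 <= enorm z -> f z = 0) ->
    forall z, ~ (`[-1, 1]%classic `*` `[-1, 1]%classic) z -> f z = 0.
  move=> f0 z nQ; apply: f0; rewrite leNgt; apply/negP => h; apply: nQ.
  have [h1 h2] := enorm_ge z.
  by split; rewrite /= in_itv/= -ler_norml; [apply: (le_trans h1)|apply: (le_trans h2)]; exact: ltW.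
have i1 : lam.-integrable setT (EFin \o (fun z => (F \_ B1) z * 'D_v phi z)).
  exact: (Lfun2_mul LF (mQ (-1) 1 (-1) 1) (Qfin (-1) 1 (-1) 1) (cont2_meas cD) b2 (Q0 _ (fun z h => (hv z h).2))).
have i2 : lam.-integrable setT (EFin \o (fun z => (G \_ B1) z * phi z)).
  exact: (Lfun2_mul LG (mQ (-1) 1 (-1) 1) (Qfin (-1) 1 (-1) 1) (cont2_meas cp) b1 (Q0 _ (fun z h => (hv z h).1))).
have E : \int[lam]_(z in setT) wk v F G phi z =
    \int[lam]_(z in setT) ((F \_ B1) z * 'D_v phi z) + \int[lam]_(z in setT) ((G \_ B1) z * phi z).
  exact: RintegralD.
have i3 : lam.-integrable setT (EFin \o wk v F G phi).
  have := integrableD measurableT i1 i2; apply: eq_integrable => //.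
have := H phi rho C1 r1 (hr v) i3; rewrite E => /eqP; rewrite addr_eq0 => /eqP E2.
have P (f g : R * R -> R) : \int[lam]_(z in B1) (f z * g z) = \int[lam]_(z in setT) ((f \_ B1) z * g z).
  rewrite Rintegral_mkcond; apply: eq_Rintegral => z _; rewrite !patchE.
  by case: ifP => // _; rewrite mul0r.
by rewrite !P.
Qed.

(** The one line through the origin is left out, being null. The two orders of integration serve the
    two partial derivatives. *)
Lemma fubini_slices (H : R * R -> R) : lam.-integrable setT (EFin \o H) ->
  (forall t, t != 0 -> (\int[mu]_s (H (s, t))%:E = 0)%E) \/
  (forall s, s != 0 -> (\int[mu]_t (H (s, t))%:E = 0)%E) -> \int[lam]_(z in setT) H z = 0.
Proof.
move=> iH h; have S (g : R -> \bar R) : (forall t, t != 0 -> g t = 0%E) -> (\int[mu]_t g t = 0)%E.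
  move=> g0; rewrite -[RHS](integral_set1 g 0) [RHS]integral_mkcond; apply: eq_integral => t _.
  rewrite patchE; case: ifPn => // /negP t0; apply: g0; apply/eqP => tE; apply: t0.
  by rewrite inE.
rewrite /Rintegral; have -> : (\int[lam]_z (H z)%:E = 0)%E; last by [].
case: h => h.
  by rewrite -[LHS](integral21_prod_meas1 iH); exact: S.
by rewrite -[LHS](integral12_prod_meas1 iH); exact: S.
Qed.

Lemma acon_slice1 (phi : R * R -> R^o) t x y : Ck 1 phi ->
  acon x y (fun s => phi (s, t)) (fun s => 'D_((1, 0) : R * R) phi (s, t)).
Proof.
move=> C1; have [cp /(_ (1, 0))[d [cD _]]] := C1.
pose l (s : R^o) : R * R := (s, t); pose L (s : R^o) : R * R := (s, 0).
have lE (h : R) (v z : R^o) : l (h *: v + z) = h *: L v + l z.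
  by apply/pair_equal_spec; split => //=; rewrite scaler0 add0r.
apply: acon_derive => [s _|].
  have [E dI] := derive_affine lE phi 1 s; rewrite -[X in is_derive _ _ _ X]E.
  by apply: derivableP; apply: dI; exact: d.
apply: continuous_subspaceT => s.
have cl : l z @[z --> (s : R^o)] --> l s.
  move=> A HA; have [[P Q] /= [hP hQ] sub] := HA.
  first [apply: (filterS _ hP) => z Pz; apply: (sub (z, t)); split => //=; exact: nbhs_singleton hQ | apply: (filterS _ hQ) => z Pz; apply: (sub (t, z)); split => //=; exact: nbhs_singleton hP].
first [exact: (cvg_comp _ _ cl (cD (l s))) | exact: (cvg_comp cl (cD (l s)))].
Qed.

Lemma acon_slice2 (phi : R * R -> R^o) t x y : Ck 1 phi ->
  acon x y (fun s => phi (t, s)) (fun s => 'D_((0, 1) : R * R) phi (t, s)).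
Proof.
move=> C1; have [cp /(_ (0, 1))[d [cD _]]] := C1.
pose l (s : R^o) : R * R := (t, s); pose L (s : R^o) : R * R := (0, s).
have lE (h : R) (v z : R^o) : l (h *: v + z) = h *: L v + l z.
  by apply/pair_equal_spec; split => //=; rewrite scaler0 add0r.
apply: acon_derive => [s _|].
  have [E dI] := derive_affine lE phi 1 s; rewrite -[X in is_derive _ _ _ X]E.
  by apply: derivableP; apply: dI; exact: d.
apply: continuous_subspaceT => s.
have cl : l z @[z --> (s : R^o)] --> l s.
  move=> A HA; have [[P Q] /= [hP hQ] sub] := HA.
  first [apply: (filterS _ hP) => z Pz; apply: (sub (z, t)); split => //=; exact: nbhs_singleton hQ | apply: (filterS _ hQ) => z Pz; apply: (sub (t, z)); split => //=; exact: nbhs_singleton hP].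
first [exact: (cvg_comp _ _ cl (cD (l s))) | exact: (cvg_comp cl (cD (l s)))].
Qed.

(** A common form for everything to be differentiated: W itself (q = w and the form 1), the
    components of U (q = u / (2 r) and a coordinate), and the first partial derivatives of W (q = w'
    / r and a coordinate). *)
Definition rlin (q : R -> R) k0 k1 k2 (z : R * R) := q (enorm z) * (k0 + k1 * z.1 + k2 * z.2).

(** The partial derivative of [rlin] along one axis: be is the density of q, c the coordinate along
    that axis and k its coefficient in the affine form. *)
Definition drlin (q be : R -> R) k0 k1 k2 (z : R * R) c k :=
  be (enorm z) * (c / enorm z) * (k0 + k1 * z.1 + k2 * z.2) + q (enorm z) * k.

Lemma patch_wk (v : R * R) (F G : R * R -> R) (phi : R * R -> R^o) rho z : rho < 1 ->
  (forall z, rho <= enorm z -> phi z = 0 /\ 'D_v phi z = 0) ->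
  wk v F G phi z = F z * 'D_v phi z + G z * phi z.
Proof.
move=> r1 h; rewrite /wk !patchE; case: ifPn => // /negP nB.
have [|-> ->] := h z; last by rewrite !mulr0.
apply: (le_trans (ltW r1)); rewrite leNgt; apply/negP => hz; apply: nB; rewrite inE; exact: hz.
Qed.

Lemma rlin_partial1 (q be : R -> R) k0 k1 k2 : ac q be -> rlin q k0 k1 k2 \_ B1 \in Lfun lam 2%:E ->
  (fun z => drlin q be k0 k1 k2 z z.1 k1) \_ B1 \in Lfun lam 2%:E ->
  is_weak_partial B1 (1, 0) (rlin q k0 k1 k2) (fun z => drlin q be k0 k1 k2 z z.1 k1).
Proof.
move=> qb LF LG; apply: weak_partial_of LF LG _ => phi rho C1 r1 h iH.
apply: fubini_slices iH _; left => t t0.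
have := slice0 (k0 + k2 * t) k1 qb t0 r1 (fun x y => acon_slice1 t x y C1) (fun s => h (s, t)).
move=> <-; apply: eq_integral => s _; congr EFin; rewrite (patch_wk _ _ _ r1 h).
by rewrite /rlin /drlin /enorm /=; ring.
Qed.

Lemma rlin_partial2 (q be : R -> R) k0 k1 k2 : ac q be -> rlin q k0 k1 k2 \_ B1 \in Lfun lam 2%:E ->
  (fun z => drlin q be k0 k1 k2 z z.2 k2) \_ B1 \in Lfun lam 2%:E ->
  is_weak_partial B1 (0, 1) (rlin q k0 k1 k2) (fun z => drlin q be k0 k1 k2 z z.2 k2).
Proof.
move=> qb LF LG; apply: weak_partial_of LF LG _ => phi rho C1 r1 h iH.
apply: fubini_slices iH _; right => s s0.
have h' t : rho <= Num.sqrt (t ^+ 2 + s ^+ 2) -> phi (s, t) = 0 /\ 'D_((0, 1) : R * R) phi (s, t) = 0.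
  by rewrite addrC; exact: (h (s, t)).
have := slice0 (k0 + k1 * s) k2 qb s0 r1 (fun x y => acon_slice2 s x y C1) h'.
move=> <-; apply: eq_integral => t _; congr EFin; rewrite (patch_wk _ _ _ r1 h).
by rewrite /rlin /drlin /enorm /= [t ^+ 2 + _]addrC; ring.
Qed.
End S.

(** * Sobolev regularity from finite energy *)

Section S.
Context {R : realType}.
Notation mu := (@lebesgue_measure R).
Notation lam := (@lebesgue2 R).
Notation RR := (measurableTypeR R * measurableTypeR R)%type.
Notation I := (`]0%R, 1%R[%classic : set R).
Implicit Types (x y s t r a b c e : R).

Section Dominated.
Variable ed : R -> R.
Hypotheses (med : measurable_fun I ed) (ed0 : forall r, I r -> 0 <= ed r)
  (edf : (\int[mu]_(r in I) (ed r)%:E < +oo)%E).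

(** Finiteness of integrals is inherited from the energy density [ed]; the added 1 absorbs bounded
    functions. *)
Definition dom (f : R -> R) := exists2 A : R, 0 <= A & forall r, 0 < r < 1 -> f r <= A * (ed r + 1).

Lemma fin_dom (f : R -> R) : measurable_fun I f -> (forall r, I r -> 0 <= f r) -> dom f ->
  (\int[mu]_(r in I) (f r)%:E < +oo)%E.
Proof.
move=> mf f0 [A A0 h]; have mI' := @mI R.
have m1 : measurable_fun I (fun r => ed r + 1) by exact: measurable_funD.
have p1 r : I r -> 0 <= ed r + 1 by move=> /ed0 ?; rewrite addr_ge0.
apply: (@le_lt_trans _ _ (\int[mu]_(r in I) (A * (ed r + 1))%:E)%E).
  apply: ge0_le_integral => //.
  - by apply/measurable_EFinP.
  - by apply/measurable_EFinP; apply: measurable_funM => //; exact: measurable_cst.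
rewrite integralZI// integralDI//.
apply: lte_mul_pinfty => //; apply: lte_add_pinfty => //.
rewrite integral_cst//; apply: lte_mul_pinfty => //.
exact: (eq_ind_r (fun z => (z < +oo)%E) (ltry 1) (@muI R)).
Qed.

Lemma rad_meas (q : R -> R) : measurable_fun I q ->
  measurable_fun (setT : set RR) ((fun z => q (enorm z)) \_ B1).
Proof.
move=> mq; have m0 : measurable (`[0, 1[%classic : set (measurableTypeR R)) by exact: measurable_itv.
have mq' : measurable_fun (`[0, 1[%classic : set (measurableTypeR R)) q.
  have -> : `[0, 1[%classic = [set 0] `|` I.
    apply/seteqP; split=> r; rewrite /= !in_itv/=.
      by move=> /andP[]; rewrite le_eqVlt => /predU1P[<- _|-> ->]; [left|right].
    by move=> [->|/andP[/ltW -> ->]//]; rewrite lexx ltr01.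
  apply/measurable_funU; [exact: measurable_set1|exact: mI|split=> //; exact: measurable_fun_set1].
have m1 := (measurable_restrictT _ m0).1 mq'.
rewrite (_ : _ \_ _ = (q \_ `[0, 1[) \o enorm); first exact: measurableT_comp m1 enorm_meas.
apply/funext => z; rewrite /= !patchE.
have -> // : (z \in B1) = (enorm z \in `[0, 1[%classic).
by apply/idP/idP; rewrite !inE/= in_itv/= ?sqrtr_ge0.
Qed.

Lemma patch_mul_meas (f g : R * R -> R) : measurable_fun (setT : set RR) (f \_ B1) ->
  measurable_fun (setT : set RR) g -> measurable_fun (setT : set RR) ((fun z => f z * g z) \_ B1).
Proof.
move=> mf mg; rewrite (_ : _ \_ _ = (fun z => (f \_ B1) z * g z)); first exact: measurable_funM.
by apply/funext => z; rewrite !patchE; case: ifP => // _; rewrite mul0r.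
Qed.

Lemma patch_add_meas (f g : R * R -> R) : measurable_fun (setT : set RR) (f \_ B1) ->
  measurable_fun (setT : set RR) (g \_ B1) -> measurable_fun (setT : set RR) ((fun z => f z + g z) \_ B1).
Proof.
move=> mf mg; rewrite (_ : _ \_ _ = (fun z => (f \_ B1) z + (g \_ B1) z)); first exact: measurable_funD.
by apply/funext => z; rewrite !patchE; case: ifP => // _; rewrite addr0.
Qed.

Lemma rlin_meas (q : R -> R) k0 k1 k2 : measurable_fun I q ->
  measurable_fun (setT : set RR) (rlin q k0 k1 k2 \_ B1).
Proof.
move=> mq; apply: patch_mul_meas; first exact: rad_meas.
apply: measurable_funD; last by apply: measurable_funM; [exact: measurable_cst|exact: snd_meas].
apply: measurable_funD; first exact: measurable_cst.
by apply: measurable_funM; [exact: measurable_cst|exact: fst_meas].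
Qed.

Lemma drlin_meas (q be : R -> R) k0 k1 k2 (c : R * R -> R) k : measurable_fun I q -> measurable_fun I be ->
  measurable_fun (setT : set RR) c ->
  measurable_fun (setT : set RR) ((fun z => drlin q be k0 k1 k2 z (c z) k) \_ B1).
Proof.
move=> mq mb mc; have mV : measurable_fun I (fun r : R => r^-1).
  by apply: meas_inv => [|r]; [exact: mI|rewrite /= in_itv/= => /andP[]].
apply: patch_add_meas.
  have -> : (fun z : R * R => be (enorm z) * (c z / enorm z) * (k0 + k1 * z.1 + k2 * z.2)) =
      (fun z => rlin (fun r => be r * r^-1) k0 k1 k2 z * c z).
    by apply/funext => z; rewrite /rlin; ring.
  by apply: patch_mul_meas mc; apply: rlin_meas; exact: measurable_funM.
have -> : (fun z : R * R => q (enorm z) * k) = rlin q k 0 0; last exact: rlin_meas.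
by apply/funext => z; rewrite /rlin !mul0r !addr0.
Qed.

Section VectorField.
Variables (Q P : R -> R) (k1 k2 : R).
Hypotheses (QP : ac Q P) (dP : dom (fun r => P r ^+ 2 * r)) (dQ : dom (fun r => Q r ^+ 2 / r))
  (k12 : `|k1| + `|k2| <= 1).
Let q r := Q r * r^-1.
Let be r := P r * r^-1 + Q r * (- 1 * r^-1 ^+ 2).

Lemma ac_quot : ac q be.
Proof.
move=> x y x0 y1; apply: aconM (QP x0 y1) (aconV (acon_id x y) _) => t /andP[xt _].
exact: lt_le_trans xt.
Qed.

Lemma ell_le (z : R * R) : `|0 + k1 * z.1 + k2 * z.2| <= enorm z.
Proof.
have [h1 h2] := enorm_ge z; rewrite add0r; apply: (le_trans (ler_normD _ _)); rewrite !normrM.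
apply: (@le_trans _ _ ((`|k1| + `|k2|) * enorm z)).
  by rewrite mulrDl; apply: lerD; apply: ler_wpM2l.
by rewrite ler_piMl// sqrtr_ge0.
Qed.

Lemma rlin_L2 : rlin q 0 k1 k2 \_ B1 \in Lfun lam 2%:E.
Proof.
have [mQ' mP] := ac_meas QP; have [mq _] := ac_meas ac_quot.
have [A A0 hA] := dQ.
apply: (L2_radial (psi := Q)) => //; first exact: rlin_meas.
  apply: fin_dom.
  - by apply: measurable_funM => //; exact: measurable_funX.
  - by move=> r; rewrite /= in_itv/= => /andP[/ltW r0 _]; rewrite mulr_ge0// sqr_ge0.
  exists A => // r /[dup] r01 /andP[r0 r1]; apply: le_trans (hA r r01).
  apply: ler_wpM2l; first exact: sqr_ge0.
  by apply: (le_trans (ltW r1)); rewrite invf_ge1// ltW.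
move=> z _ e0; rewrite /rlin /q normrM normrM (gtr0_norm (_ : 0 < (enorm z)^-1)) ?invr_gt0//.
by rewrite -mulrA ler_piMr// mulrC ler_pdivrMr// mul1r ell_le.
Qed.

(** The coordinate and the linear form are at most |z|, so the derivative is at most |P| + 2 |Q| /
    r. Its square times r is bounded by 2 P^2 r + 8 Q^2 / r. *)
Lemma drlin_L2 (c : R * R -> R) k : measurable_fun (setT : set RR) c -> (forall z, `|c z| <= enorm z) ->
  `|k| <= 1 -> (fun z => drlin q be 0 k1 k2 z (c z) k) \_ B1 \in Lfun lam 2%:E.
Proof.
move=> mc cz k1'; have [mQ' mP] := ac_meas QP; have [mq mb] := ac_meas ac_quot.
have mV : measurable_fun I (fun r : R => r^-1).
  by apply: meas_inv => [|r]; [exact: mI|rewrite /= in_itv/= => /andP[]].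
have [A A0 hA] := dQ; have [B B0 hB] := dP.
pose psi r := `|P r| + 2 * `|Q r| * r^-1.
have mpsi : measurable_fun I psi.
  apply: measurable_funD; first exact: measurableT_comp.
  apply: measurable_funM => //; apply: measurable_funM; first exact: measurable_cst.
  exact: measurableT_comp.
apply: (L2_radial (psi := psi)) => //; first exact: drlin_meas.
  apply: fin_dom.
  - by apply: measurable_funM => //; exact: measurable_funX.
  - by move=> r; rewrite /= in_itv/= => /andP[/ltW r0 _]; rewrite mulr_ge0// sqr_ge0.
  exists (2 * B + 8 * A); first by rewrite addr_ge0// mulr_ge0.
  move=> r /[dup] r01 /andP[r0 r1].
  apply: (@le_trans _ _ (2 * (P r ^+ 2 * r) + 8 * (Q r ^+ 2 / r))); last first.
    have := hA r r01; have := hB r r01.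
    by move: (P r ^+ 2 * r) (Q r ^+ 2 / r) (ed r + 1) => X1 X2 X3 h2 h1; rewrite (_ : (2 * B + 8 * A) * X3 = 2 * (B * X3) + 8 * (A * X3)); [move: h1 h2; lra|ring].
  rewrite -(real_normK (num_real (P r))) -(real_normK (num_real (Q r))) /psi.
  have ir : r^-1 * r = 1 by rewrite mulVf// gt_eqF.
  have i0 : 0 < r^-1 by rewrite invr_gt0.
  move: `|P r| `|Q r| (r^-1) ir i0 => X1 X2 i ir i0.
  have -> : 8 * (X2 ^+ 2 * i) = 8 * (X2 * i) ^+ 2 * r.
    by rewrite (_ : 8 * (X2 * i) ^+ 2 * r = 8 * (X2 ^+ 2 * i) * (i * r)); [rewrite ir mulr1|ring].
  rewrite mulrA -mulrDl; apply: ler_wpM2r; first exact: ltW.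
  rewrite -[2 * X2 * i]mulrA; move: (X2 * i) => X3.
  by rewrite -subr_ge0 (_ : _ - _ = (X1 - 2 * X3) ^+ 2) ?sqr_ge0//; ring.
move=> z _ e0; have ie : (enorm z)^-1 * enorm z = 1 by rewrite mulVf// gt_eqF.
have i0 : 0 < (enorm z)^-1 by rewrite invr_gt0.
apply: le_trans (ler_norm _); rewrite /drlin /psi /q /be.
have l0 := ell_le z; have c0 := cz z.
move: (enorm z) ((enorm z)^-1) ie i0 e0 l0 c0 => w i ie i0 w0 l0 c0.
set l := 0 + _ + _ in l0 *.
apply: (le_trans (ler_normD _ _)); rewrite !normrM.
have h1 : `|c z| * `|i| <= 1.
  by rewrite (gtr0_norm i0) -ie mulrC; apply: ler_wpM2l => //; exact: ltW.
have h2 : `|P w * i + Q w * (-1 * i ^+ 2)| <= `|P w| * i + `|Q w| * (i * i).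
  apply: (le_trans (ler_normD _ _)); rewrite !normrM normrN normr1 mul1r (gtr0_norm i0).
  by rewrite ?lexx// normrX (gtr0_norm i0) expr2.
have h3 : `|P w * i + Q w * (-1 * i ^+ 2)| * (`|c z| * `|i|) * `|l| <= (`|P w| * i + `|Q w| * (i * i)) * w.
  apply: ler_pM => //.
  by apply: le_trans h2; rewrite ler_piMr.
have h4 : `|Q w| * `|i| * `|k| <= `|Q w| * i.
  by rewrite (gtr0_norm i0) ler_piMr// mulr_ge0// ltW.
apply: (le_trans (lerD h3 h4)).
have -> : (`|P w| * i + `|Q w| * (i * i)) * w = `|P w| * (i * w) + `|Q w| * i * (i * w) by ring.
by rewrite ie !mulr1; move: (`|Q w| * i) (`|P w|) (2 * `|Q w| * i) (mulrA 2 `|Q w| i) => X1 X2 X3 <-; lra.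
Qed.

Lemma sobolev_vector : sobolev2 1 B1 (rlin q 0 k1 k2).
Proof.
have hk1 : `|k1| <= 1 by have := normr_ge0 k2; move: k12; lra.
have hk2 : `|k2| <= 1 by have := normr_ge0 k1; move: k12; lra.
have L1' := drlin_L2 fst_meas (fun z => (enorm_ge z).1) hk1.
have L2' := drlin_L2 snd_meas (fun z => (enorm_ge z).2) hk2.
split; first exact: rlin_L2.
split; eexists; split.
- exact: rlin_partial1 ac_quot rlin_L2 L1'.
- by split.
- exact: rlin_partial2 ac_quot rlin_L2 L2'.
- by split.
Qed.

End VectorField.

(** The first partial derivatives of w(|z|) are the components of the radial field with profile v,
    so the second order part is [sobolev_vector] with Q = v and P = b. *)
Lemma sobolev_scalar (w v b : R -> R) M : ac w v -> (forall r, 0 < r < 1 -> `|w r| <= M) -> ac v b ->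
  dom (fun r => b r ^+ 2 * r) -> dom (fun r => v r ^+ 2 / r) -> sobolev2 2 B1 (radial_scalar w).
Proof.
move=> wv wM vb db dv; have [mw mv] := ac_meas wv.
have wE : radial_scalar w = rlin w 1 0 0 by apply/funext => z; rewrite /rlin !mul0r !addr0 mulr1.
have LW : rlin w 1 0 0 \_ B1 \in Lfun lam 2%:E.
  apply: (L2_radial (psi := w)) => //; first exact: rlin_meas.
    apply: fin_dom.
    - by apply: measurable_funM => //; exact: measurable_funX.
    - by move=> r; rewrite /= in_itv/= => /andP[/ltW r0 _]; rewrite mulr_ge0// sqr_ge0.
    exists (M ^+ 2); first exact: sqr_ge0.
    move=> r /[dup] r01 /andP[r0 r1]; have e0 : 0 <= ed r by apply: ed0; rewrite /= in_itv.
    have M0 : 0 <= M := le_trans (normr_ge0 _) (wM r r01).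
    have h : w r ^+ 2 <= M ^+ 2 by rewrite -(real_normK (num_real (w r))) ler_pXn2r ?nnegrE// wM.
    apply: (@le_trans _ _ (w r ^+ 2 * 1)); first by apply: ler_wpM2l; [exact: sqr_ge0|exact: ltW].
    by apply: ler_pM => //; [exact: sqr_ge0|rewrite lerDr].
  by move=> z _ _; rewrite -wE.
have hk (k k' : R) : (k == 1) && (k' == 0) || (k == 0) && (k' == 1) -> `|k| + `|k'| <= 1.
  by move=> /orP[] /andP[/eqP-> /eqP->]; rewrite normr0 normr1 ?addr0 ?add0r.
have S1 := @sobolev_vector v b 1 0 vb db dv (hk 1 0 ltac:(by rewrite !eqxx)).
have S2 := @sobolev_vector v b 0 1 vb db dv (hk 0 1 ltac:(by rewrite !eqxx orbT)).
have G1 : (fun z => drlin w v 1 0 0 z z.1 0) = rlin (fun r => v r * r^-1) 0 1 0.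
  by apply/funext => z; rewrite /rlin /drlin; ring.
have G2 : (fun z => drlin w v 1 0 0 z z.2 0) = rlin (fun r => v r * r^-1) 0 0 1.
  by apply/funext => z; rewrite /rlin /drlin; ring.
rewrite wE; split=> //; split.
  exists (rlin (fun r => v r * r^-1) 0 1 0); split=> //; rewrite -G1.
  by apply: rlin_partial1 => //; rewrite G1; case: S1.
exists (rlin (fun r => v r * r^-1) 0 0 1); split=> //; rewrite -G2.
by apply: rlin_partial2 => //; rewrite G2; case: S2.
Qed.

End Dominated.
End S.

(** * Equivalence with the planar problem and conclusion *)

Section S.
Context {R : realType}.
Notation mu := (@lebesgue_measure R).
Notation lam := (@lebesgue2 R).
Notation RR := (measurableTypeR R * measurableTypeR R)%type.
Notation I := (`]0%R, 1%R[%classic : set R).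
Implicit Types (x y s t r a b c e : R).

Lemma edens_parts (h : R) (u p v b : R -> R) r : 0 < h -> 0 < r < 1 ->
  [/\ u r ^+ 2 / r <= edens h u p v b r,
      r * (p r + v r ^+ 2 - 4 * r ^+ 2) ^+ 2 <= edens h u p v b r,
      b r ^+ 2 * r <= edens h u p v b r / h ^+ 2 & v r ^+ 2 / r <= edens h u p v b r / h ^+ 2].
Proof.
move=> h0 /andP[r0 _]; have h2 : 0 < h ^+ 2 by rewrite exprn_gt0.
have a1 : 0 <= u r ^+ 2 / r by rewrite divr_ge0 ?sqr_ge0// ltW.
have a2 : 0 <= r * (p r + v r ^+ 2 - 4 * r ^+ 2) ^+ 2 by rewrite mulr_ge0 ?sqr_ge0// ltW.
have a3 : 0 <= r * b r ^+ 2 by rewrite mulr_ge0 ?sqr_ge0// ltW.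
have a4 : 0 <= v r ^+ 2 / r by rewrite divr_ge0 ?sqr_ge0// ltW.
have a3' := mulr_ge0 (ltW h2) a3; have a4' := mulr_ge0 (ltW h2) a4.
rewrite /edens [b r ^+ 2 * r]mulrC mulrDr; split.
- by move: a1 a2 a3' a4'; lra.
- by move: a1 a2 a3' a4'; lra.
- by rewrite ler_pdivlMr// mulrC; move: a1 a2 a3' a4'; lra.
- by rewrite ler_pdivlMr// mulrC; move: a1 a2 a3' a4'; lra.
Qed.

(** The function w is recovered as the primitive of v from 0. Finite energy makes all the profiles
    and their derivatives dominated by the energy density, as the planar regularity lemmas
    require. *)
Lemma state_admissible (h delta m : R) X : 0 < h -> adms delta X -> sE h X = m%:E ->
  exists2 uw, admissible delta uw & energy h uw = m%:E.
Proof.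
move=> h0 [up vb vi vI] Em; have h2 : 0 < h ^+ 2 by rewrite exprn_gt0.
pose u := su X; pose p := sp X; pose v := sv X; pose b := sb X.
pose ed := edens h u p v b.
have med : measurable_fun I ed by exact: meas_edens up vb h.
have ed0' r : 0 < r < 1 -> 0 <= ed r by exact: edens_ge0.
have ed0 r : I r -> 0 <= ed r by rewrite /= in_itv/=; exact: ed0'.
have edE : (\int[mu]_(r in I) (ed r)%:E = m%:E)%E by exact: Em.
have edf : (\int[mu]_(r in I) (ed r)%:E < +oo)%E by rewrite edE ltry.
have m0 : 0 <= m by rewrite -lee_fin -edE; apply: integral_ge0 => r rI; rewrite lee_fin ed0.
have m10 : 0 < m + 1 by rewrite ltr_wpDl.
have eb : ebound h (m + 1) u p v b.
  by apply: (E1_ebound up vb h0); move: Em; rewrite /sE => ->; rewrite lee_fin lerDl.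
have vK := ebound_v_sup h0 m10 eb.
set K := 10 * (m + 1) / h ^+ 2 in vK.
have K0 : 0 <= K by rewrite divr_ge0 ?mulr_ge0// ltW.
have h2V : 0 <= (h ^+ 2)^-1 by rewrite invr_ge0 ltW.
have db : dom ed (fun r => b r ^+ 2 * r).
  exists (h ^+ 2)^-1 => // r r01; have [_ _ H _] := edens_parts u p v b h0 r01.
  by apply: (le_trans H); rewrite mulrC; apply: ler_wpM2l => //; rewrite lerDl.
have dv : dom ed (fun r => v r ^+ 2 / r).
  exists (h ^+ 2)^-1 => // r r01; have [_ _ _ H] := edens_parts u p v b h0 r01.
  by apply: (le_trans H); rewrite mulrC; apply: ler_wpM2l => //; rewrite lerDl.
have q4 (x : R) : (2^-1 * x) ^+ 2 = x ^+ 2 / 4 by field.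
have dQ : dom ed (fun r => (2^-1 * u r) ^+ 2 / r).
  exists 1 => // r r01; have [H _ _ _] := edens_parts u p v b h0 r01.
  have r0 : 0 < r by case/andP: r01.
  have a1 : 0 <= u r ^+ 2 / r by rewrite divr_ge0 ?sqr_ge0// ltW.
  have -> : (2^-1 * u r) ^+ 2 / r = (u r ^+ 2 / r) / 4.
    by rewrite q4 mulrAC.
  rewrite -/(ed r) in H; move: H a1.
  by move: (u r ^+ 2 / r) (ed r) => z e; lra.
(* The energy controls z and not u'; from u' = z - v^2 + 4 r^2 and the bound v^2 <= K follows p^2 <=
   3 z^2 + 3 K^2 + 48. *)
have dP : dom ed (fun r => (2^-1 * p r) ^+ 2 * r).
  exists (3 + 3 * K ^+ 2 + 48); first by rewrite !addr_ge0// mulr_ge0// sqr_ge0.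
  move=> r /[dup] r01 /andP[r0 r1]; have [_ H _ _] := edens_parts u p v b h0 r01.
  have e0 := ed0' r r01; have v2 := vK r r01.
  have v4 : (v r ^+ 2) ^+ 2 <= K ^+ 2 by rewrite ler_pXn2r ?nnegrE// sqr_ge0.
  have r4 : (r ^+ 2) ^+ 2 <= 1 by rewrite -exprM exprn_ile1// ltW.
  pose z := p r + v r ^+ 2 - 4 * r ^+ 2.
  have pE : p r = z - v r ^+ 2 + 4 * r ^+ 2 by rewrite /z; ring.
  have sq3 (x1 x2 x3 : R) : (x1 - x2 + 4 * x3) ^+ 2 <= 3 * x1 ^+ 2 + 3 * x2 ^+ 2 + 48 * x3 ^+ 2.
    rewrite -subr_ge0 (_ : _ - _ = (x1 + x2) ^+ 2 + (x1 - 4 * x3) ^+ 2 + (x2 + 4 * x3) ^+ 2); last by ring.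
    by rewrite !addr_ge0// sqr_ge0.
  have h3 : p r ^+ 2 <= 3 * z ^+ 2 + (3 * K ^+ 2 + 48).
    by rewrite pE; apply: (le_trans (sq3 _ _ _)); move: v4 r4; move: ((v r ^+ 2) ^+ 2) ((r ^+ 2) ^+ 2) (K ^+ 2) (z ^+ 2) => x1 x2 x3 x4; lra.
  have K2 : 0 <= 3 * K ^+ 2 + 48 by rewrite addr_ge0// mulr_ge0// sqr_ge0.
  have h4 : (2^-1 * p r) ^+ 2 * r <= p r ^+ 2 * r.
    rewrite (_ : (2^-1 * p r) ^+ 2 = p r ^+ 2 / 4); last exact: q4.
    apply: ler_wpM2r; first exact: ltW.
    by have := sqr_ge0 (p r); move: (p r ^+ 2) => x1; lra.
  have h5 : p r ^+ 2 * r <= (3 * z ^+ 2 + (3 * K ^+ 2 + 48)) * r by apply: ler_wpM2r; [exact: ltW|].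
  have h6 : (3 * K ^+ 2 + 48) * r <= 3 * K ^+ 2 + 48 by rewrite ler_piMr// ltW.
  have h7 : 0 <= (3 * K ^+ 2 + 48) * ed r by rewrite mulr_ge0.
  have h8 : r * z ^+ 2 <= ed r by exact: H.
  move: h4 h5 h6 h7 h8 e0; rewrite -/(ed r) -addrA [_ * r <= (_ + _) * r](_ : _ = (p r ^+ 2 * r <= 3 * (r * z ^+ 2) + (3 * K ^+ 2 + 48) * r)); last by congr (_ <= _); ring.
  by move: ((2^-1 * p r) ^+ 2 * r) (p r ^+ 2 * r) (3 * K ^+ 2 + 48) (ed r) (r * z ^+ 2) => x1 x2 x3 x4 x5; rewrite (_ : (3 + x3) * (x4 + 1) = 3 * x4 + 3 + x3 * x4 + x3); [lra|ring].
have vL : L1 0 1 v := (integrable_oo_cc v).1 vi.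
pose w r := itg 0 r v.
have aw : acon 0 1 w v := acon_itg vL.
have wv : ac w v by move=> x y x0 y1; apply: acon_sub aw _ _; exact: ltW.
have cw := acon_within aw.
have [M wM] := within_bounded cw.
have uh : ac (fun r => 2^-1 * u r) (fun r => 2^-1 * p r) by move=> x y x0 y1; exact: aconZ (up x y x0 y1).
exists (u, w).
  split=> /=.
  - rewrite (_ : _ \o _ = rlin (fun r => 2^-1 * u r * r^-1) 0 1 0).
      by apply: (sobolev_vector med ed0 edf uh dP dQ); rewrite normr1 normr0 addr0.
    by apply/funext => z; rewrite /rlin /=; ring.
  - rewrite (_ : _ \o _ = rlin (fun r => 2^-1 * u r * r^-1) 0 0 1).
      by apply: (sobolev_vector med ed0 edf uh dP dQ); rewrite normr1 normr0 add0r.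
    by apply/funext => z; rewrite /rlin /=; ring.
  - apply: (sobolev_scalar med ed0 edf wv _ vb db dv (M := M)) => r /andP[r0 r1].
    by apply: wM; rewrite !ltW.
  - exact: cw.
  - split; first exact: itg_pt.
    by rewrite /w -(itg_oo_cc vi).
rewrite energy_edens /= -edE.
have wu := ac_is_weak_deriv up; have ww := ac_is_weak_deriv wv; have wb := ac_is_weak_deriv vb.
have [_ au] := xget_weak wu; have [[_ lw _] aw'] := xget_weak ww.
have mI' := @mI R.
have mwd (f g : R -> R) : @is_weak_deriv R f g -> measurable_fun I (weak_deriv f).
  by move=> /xget_weak[[_ [l _ _] _] _].
have wb' : @is_weak_deriv R (weak_deriv w) b.
  apply: (weak_deriv_ae wb (mwd _ _ ww)); apply: ae_imp aw' => r H rI; by rewrite H.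
have [_ ab] := xget_weak wb'.
have [mu' mp] := ac_meas up; have [mv mb] := ac_meas vb.
have mV : measurable_fun I (fun r : R => r^-1).
  by apply: meas_inv => [|r]; [exact: mI|rewrite /= in_itv/= => /andP[]].
apply: E1_ae => //; last by apply: aeW.
have mu1 := mwd _ _ wu; have mw1 := mwd _ _ ww; have mw2 := mwd _ _ wb'.
rewrite /edens; apply: measurable_funD.
  apply: measurable_funD; first by apply: measurable_funM => //; exact: measurable_funX.
  apply: measurable_funM => //; apply: measurable_funX; apply: measurable_funB.
    by apply: measurable_funD => //; exact: measurable_funX.
  by apply: measurable_funM; [exact: measurable_cst|exact: measurable_funX].
apply: measurable_funM; first exact: measurable_cst.
apply: measurable_funD; apply: measurable_funM => //; exact: measurable_funX.
Qed.

Lemma ae_ne (a : R) : {ae mu, forall r, r <> a}.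
Proof.
exists [set a]; split; [exact: measurable_set1|exact: lebesgue_measure_set1|].
by move=> r /= h; apply: contrapT.
Qed.

(** Finite energy makes v bounded, hence integrable up to both ends of ]0, 1[, and the boundary
    values of w become the constraint on the integral of v. *)
Lemma admissible_adms (h delta : R) uw : 0 < h -> admissible delta uw -> (energy h uw < +oo)%E ->
  exists2 X, adms delta X & energy h uw = sE h X.
Proof.
move=> h0 aduw efin; have [X [up vb EX vw]] := admissible_state h aduw.
have [_ _ _ cw [w0 w1]] := aduw.
have e0 : (0 <= sE h X)%E.
  by apply: integral_ge0 => r; rewrite /= in_itv/= => rI; rewrite lee_fin edens_ge0.
have fE : sE h X \is a fin_num by rewrite ge0_fin_numE// -EX.
pose m := fine (sE h X); have mE : sE h X = m%:E by rewrite fineK.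
have m0 : 0 <= m by rewrite -lee_fin -mE.
have m10 : 0 < m + 1 by rewrite ltr_wpDl.
have eb : ebound h (m + 1) (su X) (sp X) (sv X) (sb X).
  by apply: (E1_ebound up vb h0); move: mE; rewrite /sE => ->; rewrite lee_fin lerDl.
have vK := ebound_v_sup h0 m10 eb.
set K := 10 * (m + 1) / h ^+ 2 in vK.
have [mv _] := ac_meas vb.
have vi : mu.-integrable I (EFin \o sv X).
  have i1 : mu.-integrable I (EFin \o (fun=> K + 1 : R)) by apply: (integrable_oo_cc _).2; exact: L1_cst.
  have mI' := @mI R; apply: le_integrable i1 => //; first exact/measurable_EFinP.
  move=> r; rewrite /= in_itv/= => /vK; rewrite lee_fin => h1; apply: le_trans (ler_norm _).
  rewrite -(real_normK (num_real (sv X r))) in h1.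
  by move: h1 (normr_ge0 (sv X r)); move: `|sv X r| => z; nra.
have vL : L1 0 1 (sv X) := (integrable_oo_cc (sv X)).1 vi.
have aw := acon_itg vL.
exists X => //; split=> //; rewrite (itg_oo_cc vi).
pose c := uw.2 (1 / 2) - itg 0 (1 / 2) (sv X).
have cf : {within `[0, 1], continuous (fun r => itg 0 r (sv X) + c)}.
  by apply: (@acon_within _ _ _ _ (fun r => sv X r + 0)); exact: aconD aw (acon_cst _ _ _).
(* The increments of w are known only between interior points; both sides are continuous on [0, 1],
   so the identity extends to the endpoints. *)
have EQ : forall r, 0 <= r <= 1 -> itg 0 r (sv X) + c = uw.2 r.
  apply: (ae_cont_eq ltr01 cf cw); apply: ae_imp (ae_and (ae_ne 0) (ae_ne 1)) => r [n0 n1] /andP[r0 r1].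
  have {}r0 : 0 < r by rewrite lt_neqAle r0 andbT eq_sym; apply/eqP.
  have {}r1 : r < 1 by rewrite lt_neqAle r1 andbT; apply/eqP.
  have [_ aE] := aw; rewrite /c; have [hr|hr] := leP r (1 / 2).
    have V := vw r (1 / 2) r0 hr ltac:(lra); have A := aE r (1 / 2) (ltW r0) hr ltac:(lra).
    by move: V A; lra.
  have V := vw (1 / 2) r ltac:(lra) (ltW hr) r1; have A := aE (1 / 2) r ltac:(lra) (ltW hr) (ltW r1).
  by move: V A; lra.
have E0 := EQ 0 ltac:(lra); have E1' := EQ 1 ltac:(lra).
rewrite itg_pt w0 in E0; rewrite w1 in E1'; by move: E0 E1'; lra.
Qed.

Lemma powR_sqr32 (d : R) : 0 <= d -> (d ^+ 2) `^ (3 / 2) = d ^+ 3.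
Proof.
move=> d0; rewrite -(powR_mulrn 2 d0) -powRrM.
by rewrite (_ : 2%:R * (3 / 2) = 3%:R) ?powR_mulrn//; field.
Qed.

Lemma scaling_bounds : exists2 C : R, 0 < C & forall h delta m : R, 0 < h <= 1 / 2 -> 0 <= delta <= 1 ->
  is_min_value h delta m -> h ^+ 2 + delta `^ (3 / 2) * h `^ (3 / 2) <= C * m.
Proof.
have [C C0 H] := @lower_bound R; exists C => // h delta m /andP[h0 hh] /andP[d0 d1] [[uw ad eE] _].
have [X [up vb vi vI] EX] := admissible_adms h0 ad ltac:(by rewrite eE ltry).
pose k := Num.sqrt h; pose d := Num.sqrt delta.
have k2 : k ^+ 2 = h by rewrite sqr_sqrtr// ltW.
have d2 : d ^+ 2 = delta by rewrite sqr_sqrtr.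
have k0 : 0 < k by rewrite sqrtr_gt0.
have d0' : 0 <= d := sqrtr_ge0 _.
have d1' : d <= 1 by rewrite -(@ler_pXn2r _ 2) ?nnegrE// d2 expr1n.
rewrite -k2 -d2 !powR_sqr32//; last exact: ltW.
(* [lower_bound] requires a positive energy bound, and m is only known to be nonnegative; the slack
   e / C is removed by letting e tend to 0. *)
rewrite -exprM; apply/ler_addgt0Pr => e e0.
have e1 : 0 < e / C by rewrite divr_gt0.
have mE : sE h X = m%:E by rewrite -EX.
have m0 : 0 <= m.
  rewrite -lee_fin -mE; apply: integral_ge0 => r; rewrite /= in_itv/= => rI.
  by rewrite lee_fin edens_ge0.
have eb : ebound h (m + e / C) (su X) (sp X) (sv X) (sb X).
  by apply: (E1_ebound up vb h0); move: mE; rewrite /sE => ->; rewrite lee_fin lerDl ltW.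
have vL : L1 0 1 (sv X) := (integrable_oo_cc (sv X)).1 vi.
have := H k d (m + e / C) (su X) (sp X) (sv X) (sb X) k0; rewrite k2 d2.
move=> /(_ hh d0' d1' ltac:(by rewrite ltr_wpDl) eb vL ltac:(by rewrite -(itg_oo_cc vi))).
by rewrite mulrDr [C * (e / C)]mulrC divfK// gt_eqF.
Qed.

Lemma min_exists : exists2 C : R, 0 < C & forall h delta : R, 0 < h -> 0 <= delta <= 1 ->
  exists2 m, is_min_value h delta m & m <= C * (h ^+ 2 + delta `^ (3 / 2) * h `^ (3 / 2)).
Proof.
exists 1800 => [|h delta h0 /andP[d0 d1]]; first by rewrite ltr0n.
pose k := Num.sqrt h; pose d := Num.sqrt delta.
have k2 : k ^+ 2 = h by rewrite sqr_sqrtr// ltW.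
have d2 : d ^+ 2 = delta by rewrite sqr_sqrtr.
have k0 : 0 < k by rewrite sqrtr_gt0.
have d0' : 0 <= d := sqrtr_ge0 _.
have d1' : d <= 1 by rewrite -(@ler_pXn2r _ 2) ?nnegrE// d2 expr1n.
have d01 : 0 <= d <= 1 by rewrite d0'.
have [X0 [a0]] := upper_bound k0 d01; rewrite k2 d2 in a0 * => E0.
have [|X [m [aX Xm mmin]]] := exist_min (delta := delta) h0.
  by exists X0; split=> //; apply: le_lt_trans E0 _; rewrite ltry.
exists m; last first.
  rewrite -[in X in _ <= X]k2 -[in X in _ <= X]d2 !powR_sqr32//; last exact: ltW.
  by rewrite -exprM -lee_fin; apply: le_trans (mmin X0 a0) E0.
split; first exact: state_admissible h0 aX Xm.
(* A planar competitor of infinite energy satisfies the inequality trivially; only the others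
   correspond to one-dimensional states. *)
move=> uw ad; have [->|fin] := eqVneq (energy h uw) +oo%E; first exact: leey.
have [Y aY ->] := admissible_adms h0 ad ltac:(by rewrite ltey).
exact: mmin.
Qed.
End S.

Theorem theorem3p1 (R : realType) :
  exists C : R, 0 < C /\
    forall h delta : R, 0 < h <= 1 / 2 -> 0 <= delta <= 1 ->
      exists m : R, is_min_value h delta m /\
        C^-1 * (h ^+ 2 + delta `^ (3 / 2) * h `^ (3 / 2)) <= m
          <= C * (h ^+ 2 + delta `^ (3 / 2) * h `^ (3 / 2)).
Proof.
have [c c0 lo] := @scaling_bounds R; have [c' c'0 hi] := @min_exists R.
have C0 : 0 < c' + c := addr_gt0 c'0 c0.
exists (c' + c); split=> // h delta h01 d01; have /andP[h0 _] := h01.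
have [m mv up] := hi h delta h0 d01; exists m; split=> //.
have := lo h delta m h01 d01 mv.
have S0 : 0 < h ^+ 2 + delta `^ (3 / 2) * h `^ (3 / 2).
  by apply: ltr_pwDl; [rewrite exprn_gt0|rewrite mulr_ge0 ?powR_ge0].
move: up S0; move: (_ + _ * _) => s up S0 lo'.
have m0 : 0 <= m by rewrite -(pmulr_rge0 _ c0) (le_trans (ltW S0)).
apply/andP; split.
  by rewrite mulrC ler_pdivrMr// mulrC mulrDl (le_trans lo')// lerDr mulr_ge0// ltW.
by rewrite mulrDl (le_trans up)// lerDl mulr_ge0// ltW.
Qed.
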